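(* As $U_q\mathrm D_{2|1;\alpha}$-modules, $$\big(\tilde L_{(1,1,1)}\big)^{\otimes2}\cong\big(L_{(1,1,1)}\oplus L_{(0,0,0)}\big)^{\otimes2}\cong W_a\oplus L_{(3,1,1)}\oplus L_{(1,3,1)}\oplus L_{(1,1,3)}\oplus 2L_{(1,1,1)}\oplus2L_{(0,0,0)},$$ where $\dim L_{(1,1,1)}=17$, $\dim L_{(0,0,0)}=1$, $\dim L_{(3,1,1)}=\dim L_{(1,3,1)}=\dim L_{(1,1,3)}=48$, and $W_a$ is an indecomposable module of dimension $144=17+110+17$ with composition factors $L_{(1,1,1)},L_{(2,2,2)},L_{(1,1,1)}$, $\dim L_{(2,2,2)}=110$, such that $$\operatorname{Soc}(W_a)\cong L_{(1,1,1)},\qquad \operatorname{Soc}\big(W_a/\operatorname{Soc}(W_a)\big)\cong L_{(2,2,2)}.$$ Moreover, $$\dim\operatorname{End}_{U_q\mathrm D_{2|1;\alpha}}\Big(\big(\tilde L_{(1,1,1)}\big)^{\otimes2}\Big)=4+2^2+2^2+3+2=17.$$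
   Context: $\alpha_1,\alpha_2,\alpha_3\in\mathbb C$, $\alpha_i\neq0,-1$, $\alpha_1+\alpha_2+\alpha_3=0$. $q\in\mathbb C^\times$ is not a root of unity, a value of $\log q$ is fixed and $q^a=e^{a\log q}$ for $a\in\mathbb C$. $U_q\mathrm D_{2|1;\alpha}$ (all-fermionic Dynkin diagram) is the unital associative superalgebra over $\mathbb C$ with even generators $K_i^{\pm1/2}$ and odd generators $E_i,F_i$, $i=1,2,3$, and relations: the $K$'s commute, $K_iE_jK_i^{-1}=q^{B_{ij}}E_j$, $K_iF_jK_i^{-1}=q^{-B_{ij}}F_j$, $E_iF_j+F_jE_i=\delta_{ij}\frac{K_i-K_i^{-1}}{q-q^{-1}}$, $E_i^2=F_i^2=0$, and the standard higher-order quantum Serre relations, where $B_{ii}=0$, $B_{12}=B_{21}=\alpha_3$, $B_{13}=B_{31}=\alpha_2$, $B_{23}=B_{32}=\alpha_1$ (the $K_i^{1/2}$ satisfying the corresponding relations with $q^{\pm B_{ij}/2}$). Coproduct: $\Delta(K_i^{\pm 1/2})=K_i^{\pm 1/2}\otimes K_i^{\pm 1/2}$, $\Delta(X)=X\otimes K_i^{1/2}+K_i^{-1/2}\otimes X$ for $X=E_i,F_i$, with the sign rule $(A\otimes B)(v\otimes w)=(-1)^{p_Bp_v}Av\otimes Bw$ ($p$ denotes parity). $L_{(a,b,c)}$ is the irreducible module with highest weight vector $v$ ($E_iv=0$) satisfying $K_iv=q^{\lambda_i}v$, $K_i^{1/2}v=q^{\lambda_i/2}v$, where $\lambda=a\omega_1+b\omega_2+c\omega_3$,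 $\omega_1=\frac12(-\alpha_1,\alpha_1,\alpha_1)$, $\omega_2=\frac12(\alpha_2,-\alpha_2,\alpha_2)$, $\omega_3=\frac12(\alpha_3,\alpha_3,-\alpha_3)$. $\tilde L_{(1,1,1)}$ is an $18$-dimensional module over the quantum affine superalgebra $U_q\tilde{\mathrm D}_{2|1;\alpha}$ whose restriction to $U_q\mathrm D_{2|1;\alpha}$ is $L_{(1,1,1)}\oplus L_{(0,0,0)}$, where the highest weight vector of $L_{(1,1,1)}$ is odd and $L_{(0,0,0)}$ is even. $\operatorname{Soc}(W)$ denotes the sum of all irreducible submodules of $W$.
   Formalization: Two assumptions are added: no q^{α_i} is a root of unity (otherwise the irreducible module L_{(a,b,c)} is not determined by its highest weight), and q^{2(α_i−α_j)}≠1 for i≠j (e.g. if α_1=α_2, then dim L_{(3,1,1)} is less than 48). *)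

(* Defs.v *)
From HB Require Import structures.
From mathcomp Require Import all_boot all_order all_algebra perm.
From mathcomp Require Import complex.
From mathcomp Require Import reals sequences exp trigo.

Set Implicit Arguments.
Unset Strict Implicit.
Unset Printing Implicit Defensive.

Import Order.TTheory GRing.Theory Num.Theory.
Import VectorInternalTheory.

Local Open Scope ring_scope.

Definition cexp (R : realType) (z : R[i]) : R[i] :=
  (expR (complex.Re z))%:C%C *
  (cos (complex.Im z) +i* sin (complex.Im z))%C.

(* The indices 1, 2, 3 are the elements 0, 1, 2 of 'I_3. [Kh i] and [Khi i]
   stand for K_i^{1/2} and K_i^{-1/2}. *)
Inductive gen := Kh of 'I_3 | Khi of 'I_3 | E of 'I_3 | F of 'I_3.

Section Representations.
Variable K : fieldType.
Implicit Types V W : vectType K.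

(* A finite-dimensional superspace with an action of the generators. The
   Z/2-grading is given by its parity operator (-1)^p, whose eigenspaces for
   1 and -1 are the even and the odd part. The relations are not part of the
   record: see [is_module]. *)
Record rep := Rep {
  car :> vectType K;
  par : 'End(car);
  act : gen -> 'End(car) }.

Implicit Types M N : rep.

Definition rep_dim M : nat := \dim {:car M}.

Definition hom M N (f : 'Hom(car M, car N)) : Prop :=
  forall g, (f \o act M g)%VF = (act N g \o f)%VF.

(* Isomorphisms preserve parity. *)
Definition iso M N : Prop :=
  exists f : 'Hom(car M, car N),
    [/\ hom f, (f \o par M)%VF = (par N \o f)%VF,
        lker f = 0%VS & limg f = fullv].

(* All linear maps commuting with the action, whatever their parity. *)
Definition dim_End M (n : nat) : Prop :=
  exists A : {vspace 'End(car M)},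
    (forall f : 'End(car M), f \in A <-> hom f) /\ \dim A = n.

(* Submodules are Z/2-graded. *)
Definition submodule M (U : {vspace car M}) : Prop :=
  (par M @: U <= U)%VS /\ forall g, (act M g @: U <= U)%VS.

Definition irreducible_sub M (U : {vspace car M}) : Prop :=
  [/\ submodule U, U <> 0%VS &
      forall U' : {vspace car M}, submodule U' -> (U' <= U)%VS ->
        U' = 0%VS \/ U' = U].

Definition irreducible M : Prop := irreducible_sub (fullv : {vspace car M}).

Definition indecomposable M : Prop :=
  (fullv : {vspace car M}) <> 0%VS /\
  forall U1 U2 : {vspace car M}, submodule U1 -> submodule U2 ->
    (U1 + U2)%VS = fullv -> (U1 :&: U2)%VS = 0%VS -> U1 = 0%VS \/ U2 = 0%VS.

(* [S] is the sum of all irreducible submodules; as the space is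
   finite-dimensional, this sum is a sum of finitely many of them. *)
Definition is_socle M (S : {vspace car M}) : Prop :=
  (forall U, irreducible_sub U -> (U <= S)%VS) /\
  exists Us : seq {vspace car M},
    (forall U, U \in Us -> irreducible_sub U) /\ S = (\sum_(U <- Us) U)%VS.

(** Submodules and quotients as modules *)

Definition sub_lfun V (U : {vspace V}) (f : 'End(V)) : 'End(subvs_of U) :=
  linfun (vsproj U \o f \o vsval).

Definition submod M (U : {vspace car M}) : rep :=
  Rep (sub_lfun U (par M)) (fun g => sub_lfun U (act M g)).

(* V / U is realised on the complement U^C of U, the canonical surjection
   being the projection onto U^C along U (see [lker_quo_proj]). *)
Definition quo_proj V (U : {vspace V}) : 'Hom(V, subvs_of U^C) :=
  linfun (vsproj U^C \o daddv_pi U^C U).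

Definition quo_lfun V (U : {vspace V}) (f : 'End(V)) : 'End(subvs_of U^C) :=
  linfun (quo_proj U \o f \o vsval).

Definition quomod M (U : {vspace car M}) : rep :=
  Rep (quo_lfun U (par M)) (fun g => quo_lfun U (act M g)).

(* M has a composition series whose factors, from the bottom up, are
   isomorphic to the members of Ls. *)
Fixpoint composition_series (Ls : seq rep) M : Prop :=
  if Ls is L :: Ls' then
    irreducible L /\
    exists U : {vspace car M},
      [/\ submodule U, iso (submod U) L & composition_series Ls' (quomod U)]
  else rep_dim M = 0%N.

(** Direct sums *)

Definition dsum_lfun V W (f : 'End(V)) (g : 'End(W)) : 'End((V * W)%type) :=
  linfun (fun x => (f x.1, g x.2)).

Definition dsum M N : rep :=
  Rep (dsum_lfun (par M) (par N)) (fun g => dsum_lfun (act M g) (act N g)).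

(** Tensor products *)

(* In coordinates, V (x) W is the space of matrices and v (x) w is the product
   of the column of v by the row of w. *)
Definition tens V W (v : V) (w : W) : 'M[K]_(dim V, dim W) :=
  (v2r v)^T *m v2r w.

Definition tens_lfun V W (f : 'End(V)) (g : 'End(W)) :
    'End('M[K]_(dim V, dim W)) :=
  linfun (fun X => (f2mx f)^T *m X *m f2mx g).

(* The sign rule (A (x) B)(v (x) w) = (-1)^(p_B p_v) Av (x) Bw turns A (x) B,
   for B odd, into (A \o par) (x) B. *)
Definition tensor M N : rep :=
  Rep (tens_lfun (par M) (par N))
      (fun g => match g with
       | Kh i  => tens_lfun (act M (Kh i)) (act N (Kh i))
       | Khi i => tens_lfun (act M (Khi i)) (act N (Khi i))
       | E i => tens_lfun (act M (E i)) (act N (Kh i))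
                + tens_lfun (act M (Khi i) \o par M)%VF (act N (E i))
       | F i => tens_lfun (act M (F i)) (act N (Kh i))
                + tens_lfun (act M (Khi i) \o par M)%VF (act N (F i))
       end).

(** Characterisations of the constructions above *)

Lemma sub_lfunE V (U : {vspace V}) (f : 'End(V)) (x : subvs_of U) :
  (f @: U <= U)%VS -> vsval (sub_lfun U f x) = f (vsval x).
Proof.
move=> fU; rewrite /sub_lfun lfunE /= vsprojK //.
by apply: (subvP fU); rewrite memv_img ?subvsP.
Qed.

Lemma quo_projE V (U : {vspace V}) (v : V) :
  vsval (quo_proj U v) = daddv_pi U^C U v.
Proof. by rewrite /quo_proj lfunE /= vsprojK // memv_pi. Qed.

Lemma lker_quo_proj V (U : {vspace V}) : lker (quo_proj U) = U.
Proof.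
have capU : (U^C :&: U = 0)%VS by rewrite capvC capv_compl.
have capU' : (U :&: U^C = 0)%VS by rewrite capv_compl.
apply/vspaceP => v; rewrite memv_ker.
have -> : (quo_proj U v == 0) = (daddv_pi U^C U v == 0).
  by rewrite -quo_projE -[0 in RHS](@GRing.raddf0 _ _ (@vsval _ _ U^C)) (inj_eq val_inj).
have vD : daddv_pi U^C U v + daddv_pi U U^C v = v.
  by apply: daddv_pi_add => //; rewrite addvC addv_complf memvf.
apply/eqP/idP => [v0 | vU].
  by move: vD; rewrite v0 add0r => <-; apply: memv_pi.
by move: vD; rewrite (daddv_pi_id capU' vU) => /eqP; rewrite -subr_eq0 addrK => /eqP.
Qed.

Lemma limg_quo_proj V (U : {vspace V}) : limg (quo_proj U) = fullv.
Proof.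
apply/vspaceP => x; rewrite memvf.
have -> : x = quo_proj U (vsval x).
  apply: val_inj; rewrite /= quo_projE daddv_pi_id ?subvsP //.
  by rewrite capvC capv_compl.
by rewrite memv_img ?memvf.
Qed.

Lemma quo_lfunE V (U : {vspace V}) (f : 'End(V)) (v : V) :
  (f @: U <= U)%VS -> quo_lfun U f (quo_proj U v) = quo_proj U (f v).
Proof.
move=> fU; rewrite /quo_lfun lfunE /=.
set w := vsval _; have : w - v \in lker (quo_proj U).
  rewrite memv_ker linearB /= subr_eq0; apply/eqP/val_inj => /=.
  rewrite !quo_projE /w quo_projE daddv_pi_id ?memv_pi //.
  by rewrite capvC capv_compl.
rewrite lker_quo_proj => wvU; apply/eqP; rewrite -subr_eq0 -!linearB /=.
by rewrite -memv_ker lker_quo_proj (subvP fU) ?memv_img.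
Qed.

Lemma dsum_lfunE V W (f : 'End(V)) (g : 'End(W)) (x : V * W) :
  dsum_lfun f g x = (f x.1, g x.2).
Proof.
have lin : linear (fun x : V * W => (f x.1, g x.2)).
  by move=> a [x1 x2] [y1 y2] /=; rewrite !linearP.
pose h : {linear (V * W)%type -> (V * W)%type} :=
  HB.pack (fun x : V * W => (f x.1, g x.2))
    (GRing.isLinear.Build _ _ _ _ _ lin).
exact: (lfunE h).
Qed.

Lemma tens_lfunE V W (f : 'End(V)) (g : 'End(W)) (v : V) (w : W) :
  tens_lfun f g (tens v w) = tens (f v) (g w).
Proof.
have lin : linear (fun X : 'M[K]_(dim V, dim W) => (f2mx f)^T *m X *m f2mx g).
  by move=> a X Y; rewrite mulmxDr mulmxDl -scalemxAr -scalemxAl.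
pose h : {linear 'M[K]_(dim V, dim W) -> 'M[K]_(dim V, dim W)} :=
  HB.pack (fun X : 'M[K]_(dim V, dim W) => (f2mx f)^T *m X *m f2mx g)
    (GRing.isLinear.Build _ _ _ _ _ lin).
rewrite /tens_lfun (lfunE h) /= /tens !unlock /= !r2vK.
by rewrite trmx_mul !mulmxA.
Qed.

End Representations.

Declare Scope rep_scope.
Delimit Scope rep_scope with rep.
Notation "M ⊕ N" := (dsum M N) (at level 50, left associativity) : rep_scope.
Notation "M ⊗ N" := (tensor M N) (at level 40, left associativity) : rep_scope.
Notation "M ≅ N" := (iso M N) (at level 70, no associativity) : rep_scope.

Section QuantumD21alpha.
Variables (R : realType) (alpha : 'I_3 -> R[i]) (logq : R[i]).

Definition qpow (a : R[i]) : R[i] := cexp (a * logq).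

Definition qnum (a : R[i]) : R[i] :=
  (qpow a - qpow (- a)) / (qpow 1 - qpow (- 1)).

(* In 'I_3 = Z/3, for i != j, the third index is - (i + j). *)
Definition B (i j : 'I_3) : R[i] :=
  if i == j then 0 else alpha (- (i + j)).

(* [2] (X1 X2 X3 - X3 X2 X1) + [3] (X2 X3 X1 - X1 X3 X2)
   + [1] (X3 X1 X2 - X2 X1 X3), with [i] = [alpha_i]_q. In terms of the
   q-supercommutators [[X_b, X_c]] = X_b X_c - (-1)^(p_b p_c) q^(b,c) X_c X_b
   this is [2] [[[[X1, X2]], X3]] - [3] [[[[X1, X3]], X2]], and it does not
   change when q is replaced with q^-1. *)
Definition serre (V : vectType R[i]) (X : 'I_3 -> 'End(V)) : 'End(V) :=
  \sum_(s : 'S_3) ((-1) ^+ s * qnum (alpha (s 1))) *: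
    (X (s 0) \o X (s 1) \o X (s 2))%VF.

(* The relations between K_i and E_j, F_j are implied by [Kh_E] and [Kh_F]. *)
Record is_module (M : rep R[i]) : Prop := IsModule {
  par_par : (par M \o par M)%VF = \1%VF;
  par_Kh : forall i, (par M \o act M (Kh i) = act M (Kh i) \o par M)%VF;
  par_Khi : forall i, (par M \o act M (Khi i) = act M (Khi i) \o par M)%VF;
  par_E : forall i, (par M \o act M (E i) = - (act M (E i) \o par M))%VF;
  par_F : forall i, (par M \o act M (F i) = - (act M (F i) \o par M))%VF;
  Kh_Khi : forall i, (act M (Kh i) \o act M (Khi i) = \1)%VF;
  Khi_Kh : forall i, (act M (Khi i) \o act M (Kh i) = \1)%VF;
  Kh_Kh : forall i j,
    (act M (Kh i) \o act M (Kh j) = act M (Kh j) \o act M (Kh i))%VF;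
  Kh_E : forall i j, (act M (Kh i) \o act M (E j) \o act M (Khi i))%VF
                     = qpow (B i j / 2) *: act M (E j);
  Kh_F : forall i j, (act M (Kh i) \o act M (F j) \o act M (Khi i))%VF
                     = qpow (- (B i j / 2)) *: act M (F j);
  E_F : forall i j,
    (act M (E i) \o act M (F j))%VF + (act M (F j) \o act M (E i))%VF
    = if i == j then
        (qpow 1 - qpow (- 1))^-1 *:
          ((act M (Kh i) \o act M (Kh i))%VF
           - (act M (Khi i) \o act M (Khi i))%VF)
      else 0;
  E_E : forall i, (act M (E i) \o act M (E i))%VF = 0;
  F_F : forall i, (act M (F i) \o act M (F i))%VF = 0;
  serre_E : serre (fun i => act M (E i)) = 0;
  serre_F : serre (fun i => act M (F i)) = 0 }.

(* [omega j i] is the i-th coordinate of omega_j. *)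
Definition omega (j i : 'I_3) : R[i] :=
  (if i == j then - alpha j else alpha j) / 2.

Definition weight (a b c : nat) (i : 'I_3) : R[i] :=
  a%:R * omega 0 i + b%:R * omega 1 i + c%:R * omega 2 i.

(* M is L_{(a,b,c)}, the highest weight vector having the parity of a + b + c.
   In particular it is odd for (1,1,1) and even for (0,0,0); as alpha_i has
   coordinates (-1,1,1), (1,-1,1), (1,1,-1) in the basis omega, this is the
   choice for which, in the tensor square, a vector of weight (a,b,c) always
   has the parity of a + b + c. *)
Definition is_L (a b c : nat) (M : rep R[i]) : Prop :=
  [/\ is_module M, irreducible M &
      exists v : car M,
        [/\ v != 0, par M v = (-1) ^+ (a + b + c) *: v,
            forall i, act M (E i) v = 0 &
            forall i, act M (Kh i) v = qpow (weight a b c i / 2) *: v]].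

End QuantumD21alpha.

(* Main.v *)
(* Over a field with parameters x_i = q^(alpha_i / 2), L_(1,1,1) is an explicit
   17-dimensional module V with a contravariant form. For l = (2,2,2), (3,1,1),
   (1,3,1), (1,1,3), (0,0,0), the tensor square T of V contains a highest weight
   vector s_l of nonzero norm; let X_l be the submodule that it generates. The
   Gram determinants of suitable words in the F_i factor into t_i - 1, t_i + 1,
   t_i^2 + 1, t_i - t_j, t_i + t_j and 2, where t_i = q^alpha_i, so that X_l has
   at least 110, 48, 48, 48, 1 dimensions modulo its radical. A further highest
   weight vector z of weight (1,1,1) lies in X_(2,2,2) and is isotropic; it
   generates Z, of dimension at least 17, orthogonal to all the X_l. Comparing
   dimensions, 255 + dim Z <= 289 - dim Z, so dim Z = 17 and the X_l for
   l <> (2,2,2) are irreducible. The orthogonal W_a of their sum has dimension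
   144, and its only nonzero proper submodules are Z and X_(2,2,2): a submodule
   avoiding s_(2,2,2) and not contained in Z would contain a vector t of weight
   (1,1,1) killed by all the E_i with (t, z) <> 0, whereas z is a combination of
   vectors F_i u. *)

From Stdlib Require Import BinInt.
Require Import Defs.
From HB Require Import structures.
From mathcomp Require Import all_boot all_order all_algebra perm.
From mathcomp Require Import complex.
From mathcomp Require Import ssrZ zify ring.
From mathcomp Require Import boolp reals sequences exp trigo.

Set Implicit Arguments.
Unset Strict Implicit.
Unset Printing Implicit Defensive.

Import Order.TTheory GRing.Theory Num.Theory.
Import VectorInternalTheory.

Local Open Scope ring_scope.
Local Open Scope rep_scope.

(** The parameters are given complex numbers, so a determinant that is nonzero as a Laurent
    polynomial might still vanish at them. This is why every Gram determinant is needed in factored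
    form: besides 2 and h being nonzero, what passes from the complex numbers to the algebra is that
    the listed factors do not vanish and that words of different content lower a weight differently.
    Everything in between is done over a field with invertible x_0, x_1, where x_2 = 1 / (x_0 x_1)
    encodes the vanishing sum of the alpha_i; q occurs only through h = q - 1/q, which is cleared by
    working with h E_i. Gram entries are computed on formal words, from weights, the relations
    between E_i and F_j, and F_i^2 = 0. One certificate therefore serves for a highest weight vector
    in any module, modulo any submodule that avoids this vector. The classification of the
    submodules of W_a uses self-duality: taking orthogonals in W_a exchanges the submodules that
    contain s_(2,2,2) with those that do not, so only the latter are treated directly. *)

Section Spaces.
Variable K : fieldType.
Implicit Types V W : vectType K.

Lemma vspace_of_pred V (P : V -> Prop) :
    P 0 -> (forall a u v, P u -> P v -> P (a *: u + v)) ->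
  exists U : {vspace V}, forall u, u \in U <-> P u.
Proof.
move=> P0 PL.
suff main n (U : {vspace V}) : (forall u, u \in U -> P u) ->
    (dim V - \dim U <= n)%N -> exists U : {vspace V}, forall u, u \in U <-> P u.
  apply: (main (dim V) 0%VS); last by rewrite dimv0 subn0.
  by move=> u; rewrite memv0 => /eqP->.
elim: n U => [|n IHn] U UP dU.
  exists U => u; split=> [/UP //|_]; suff -> : U = fullv by rewrite memvf.
  by apply/eqP; rewrite eqEdim subvf dimvf -subn_eq0 -leqn0.
have [[u Pu uU]|noU] := pselect (exists2 u, P u & u \notin U); last first.
  exists U => u; split=> [/UP //|Pu]; apply: contrapT => /negP uU.
  by apply: noU; exists u.
apply: (IHn (<[u]> + U)%VS) => [w /memv_addP[w1 /vlineP[k ->] [w2 w2U ->]]|].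
  by apply: PL => //; apply: UP.
have -> : \dim (<[u]> + U)%VS = (\dim U).+1.
  rewrite dimv_disjoint_sum ?dim_vline; last first.
    apply/eqP; rewrite -subv0; apply/subvP => w.
    rewrite memv_cap memv0 => /andP[/vlineP[k ->]] kuU.
    have [->|k0] := eqVneq k 0; first by rewrite scale0r.
    by rewrite -(scale1r u) -(mulVf k0) -scalerA memvZ in uU.
  by case: eqP uU => [->|_ _]; rewrite ?mem0v // add1n.
by rewrite subnS; case: (dim V - _)%N dU.
Qed.

Lemma inj_lker V W (f : 'Hom(V, W)) :
  (forall u, f u = 0 -> u = 0) <-> lker f = 0%VS.
Proof.
split=> [f0|f0 u fu]; last by apply/eqP; rewrite -memv0 -f0 memv_ker fu.
by apply/eqP; rewrite -subv0; apply/subvP => u; rewrite memv_ker memv0 => /eqP/f0->.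
Qed.

Lemma surj_limg V W (f : 'Hom(V, W)) :
  (forall w, exists u, f u = w) <-> limg f = fullv.
Proof.
split=> [fS|fS w]; last first.
  have : w \in limg f by rewrite fS memvf.
  by case/memv_imgP => u _ ->; exists u.
apply/vspaceP => w; rewrite memvf; case: (fS w) => u <-.
by rewrite memv_img ?memvf.
Qed.

Lemma bij_lfun V W (f : 'Hom(V, W)) : lker f = 0%VS -> limg f = fullv ->
  (f \o f^-1 = \1)%VF /\ (f^-1 \o f = \1)%VF.
Proof.
move=> f0 fS; split; last by apply: lker0_compVf; apply/eqP.
by apply/lfunP => w; rewrite comp_lfunE id_lfunE limg_lfunVK // fS memvf.
Qed.

Lemma limg_lker0 V W (f : 'Hom(V, W)) :
  dim V = dim W -> limg f = fullv -> lker f = 0%VS.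
Proof.
move=> dVW fS; have := limg_ker_dim f fullv.
rewrite fS capfv !dimvf dVW -[RHS]add0n => /addIn/eqP.
by rewrite dimv_eq0 => /eqP.
Qed.

Lemma linfunE V W (f : V -> W) (lf : linear f) : linfun f =1 f.
Proof.
pose h : {linear V -> W} := HB.pack f (GRing.isLinear.Build _ _ _ _ _ lf).
exact: (lfunE h).
Qed.

Lemma fullvP V (U : {vspace V}) : (forall u, u \in U) -> U = fullv.
Proof. by move=> h; apply/vspaceP => u; rewrite memvf h. Qed.

Lemma zerovP V (U : {vspace V}) : (forall u, u \in U -> u = 0) -> U = 0%VS.
Proof.
by move=> h; apply/eqP; rewrite -subv0; apply/subvP => u /h->; rewrite mem0v.
Qed.

End Spaces.

(** * Even morphisms and isomorphisms of representations *)

Section Reps.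
Variable K : fieldType.
Implicit Types M N L : rep K.

(* The parity operator is treated as one more generator. *)
Definition op M (o : option gen) : 'End(car M) :=
  if o is Some g then act M g else par M.

Definition mor M N (f : 'Hom(car M, car N)) := forall o u, f (op M o u) = op N o (f u).

Lemma morP M N (f : 'Hom(car M, car N)) :
  mor f <-> Defs.hom f /\ (f \o par M = par N \o f)%VF.
Proof.
split=> [fm|[fh fp] [g|] u].
- by split=> [g|]; apply/lfunP => u; rewrite !comp_lfunE ?(fm (Some g)) ?(fm None).
- by have /lfunP/(_ u) := fh g; rewrite !comp_lfunE.
by have /lfunP/(_ u) := fp; rewrite !comp_lfunE.
Qed.

Lemma isoP M N : iso M N <->
  exists f : 'Hom(car M, car N), [/\ mor f, lker f = 0%VS & limg f = fullv].
Proof.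
split=> [[f [fh fp f0 fS]]|[f [/morP[fh fp] f0 fS]]].
  by exists f; split=> //; apply/morP.
by exists f.
Qed.

Lemma mor_comp M N L (f : 'Hom(car M, car N)) (g : 'Hom(car N, car L)) :
  mor f -> mor g -> mor (g \o f)%VF.
Proof. by move=> fm gm o u; rewrite !comp_lfunE fm gm. Qed.

Lemma mor1 M : mor (\1%VF : 'End(car M)).
Proof. by move=> o u; rewrite !id_lfunE. Qed.

Lemma mor_inv M N (f : 'Hom(car M, car N)) :
  mor f -> lker f = 0%VS -> limg f = fullv -> mor f^-1%VF.
Proof.
move=> fm f0 fS o u; have [fV Vf] := bij_lfun f0 fS.
have fVE w : f (f^-1%VF w) = w by rewrite -comp_lfunE fV id_lfunE.
by rewrite -{1}(fVE u) -fm -comp_lfunE Vf id_lfunE.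
Qed.

Lemma iso_sym M N : M ≅ N -> N ≅ M.
Proof.
case/isoP => f [fm f0 fS]; apply/isoP; exists f^-1%VF.
have [fV Vf] := bij_lfun f0 fS; split; first exact: mor_inv.
  by apply/inj_lker => u fu; rewrite -(id_lfunE u) -fV comp_lfunE fu linear0.
by apply/surj_limg => u; exists (f u); rewrite -comp_lfunE Vf id_lfunE.
Qed.

Lemma iso_trans M N L : M ≅ N -> N ≅ L -> M ≅ L.
Proof.
case/isoP => f [fm /inj_lker f0 /surj_limg fS] /isoP[g [gm /inj_lker g0 /surj_limg gS]].
apply/isoP; exists (g \o f)%VF; split; first exact: mor_comp.
  by apply/inj_lker => u; rewrite comp_lfunE => /g0/f0.
apply/surj_limg => w; have [v <-] := gS w; have [u <-] := fS v.
by exists u; rewrite comp_lfunE.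
Qed.

Lemma iso_dim M N : M ≅ N -> dim (car M) = dim (car N).
Proof.
case=> f [_ _ f0 fS]; have := limg_ker_dim f fullv.
by rewrite f0 capv0 dimv0 fS !dimvf.
Qed.

(** The final decomposition is obtained in this way: a map out of the direct sum is shown to be
    onto, and the dimensions agree. *)
Lemma mor_surj_iso M N (f : 'Hom(car M, car N)) :
  mor f -> limg f = fullv -> dim (car M) = dim (car N) -> M ≅ N.
Proof.
move=> fm fS dMN; apply/isoP; exists f; split=> //; exact: limg_lker0.
Qed.

(** * Submodules and quotients *)

Lemma submoduleP M (U : {vspace car M}) :
  submodule U <-> forall o u, u \in U -> op M o u \in U.
Proof.
split=> [[pU aU] [g|] u uU|h].
- by apply: (subvP (aU g)); rewrite memv_img.
- by apply: (subvP pU); rewrite memv_img.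
by split=> [|g]; apply/subvP => w /memv_imgP[u uU ->];
  [apply: (h None)|apply: (h (Some g))].
Qed.

Lemma submodule0 M : submodule (0%VS : {vspace car M}).
Proof. by apply/submoduleP => o u; rewrite !memv0 => /eqP->; rewrite linear0. Qed.

Lemma submodulef M : submodule (fullv : {vspace car M}).
Proof. by apply/submoduleP => o u _; rewrite memvf. Qed.

Lemma submoduleI M (U W : {vspace car M}) :
  submodule U -> submodule W -> submodule (U :&: W)%VS.
Proof.
move=> /submoduleP hU /submoduleP hW; apply/submoduleP => o u.
by rewrite !memv_cap => /andP[/hU-> /hW->].
Qed.

Lemma submoduleD M (U W : {vspace car M}) :
  submodule U -> submodule W -> submodule (U + W)%VS.
Proof.
move=> /submoduleP hU /submoduleP hW; apply/submoduleP => o u.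
case/memv_addP => u1 u1U [u2 u2W ->]; rewrite linearD memv_add //.
  exact: hU.
exact: hW.
Qed.

Lemma submodule_img M N (f : 'Hom(car M, car N)) (U : {vspace car M}) :
  mor f -> submodule U -> submodule (f @: U)%VS.
Proof.
move=> fm /submoduleP hU; apply/submoduleP => o w /memv_imgP[u uU ->].
by rewrite -fm memv_img ?hU.
Qed.

Lemma submodule_preim M N (f : 'Hom(car M, car N)) (U : {vspace car N}) :
  mor f -> submodule U -> submodule (f @^-1: U)%VS.
Proof.
move=> fm /submoduleP hU; apply/submoduleP => o w.
by rewrite -!memv_preim fm => /hU.
Qed.

Definition incl M (U : {vspace car M}) : 'Hom(car (submod U), car M) :=
  linfun (@vsval _ _ U).

Lemma inclE M (U : {vspace car M}) (u : subvs_of U) : incl U u = vsval u.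
Proof. exact: lfunE. Qed.

Lemma op_submod M (U : {vspace car M}) o :
  op (submod U) o = sub_lfun U (op M o) :> 'End(subvs_of U).
Proof. by case: o. Qed.

Lemma op_quomod M (U : {vspace car M}) o :
  op (quomod U) o = quo_lfun U (op M o) :> 'End(subvs_of U^C).
Proof. by case: o. Qed.

Lemma submodule_op M (U : {vspace car M}) o :
  submodule U -> (op M o @: U <= U)%VS.
Proof. by move=> [pU aU]; case: o => [g|] /=; [apply: aU|]. Qed.

Lemma mor_incl M (U : {vspace car M}) : submodule U -> mor (incl U).
Proof.
move=> hU o u; rewrite !inclE op_submod /=.
by rewrite sub_lfunE //; apply: submodule_op.
Qed.

Lemma lker_incl M (U : {vspace car M}) : lker (incl U) = 0%VS.
Proof. by apply/inj_lker => u; rewrite inclE => u0; apply: val_inj. Qed.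

Lemma limg_incl M (U : {vspace car M}) : limg (incl U) = U.
Proof.
apply/vspaceP => w; apply/memv_imgP/idP => [[u _ ->]|wU].
  by rewrite inclE subvsP.
by exists (vsproj U w); rewrite ?memvf // inclE vsprojK.
Qed.

Definition quo M (U : {vspace car M}) : 'Hom(car M, car (quomod U)) :=
  quo_proj U.

Lemma mor_quo M (U : {vspace car M}) : submodule U -> mor (quo U).
Proof.
move=> hU o u; rewrite op_quomod /= quo_lfunE //; exact: submodule_op.
Qed.

Lemma lker_quo M (U : {vspace car M}) : lker (quo U) = U.
Proof. exact: lker_quo_proj. Qed.

Lemma limg_quo M (U : {vspace car M}) : limg (quo U) = fullv.
Proof. exact: limg_quo_proj. Qed.

Lemma dim_submod M (U : {vspace car M}) : dim (car (submod U)) = \dim U.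
Proof. by []. Qed.

Lemma iso_submod M N (f : 'Hom(car M, car N)) (U : {vspace car N}) :
  mor f -> lker f = 0%VS -> limg f = U -> submodule U -> submod U ≅ M.
Proof.
move=> fm f0 fU hU; apply: iso_sym.
have fE u : vsval (vsproj U (f u)) = f u.
  by rewrite vsprojK // -fU memv_img ?memvf.
have lin : linear (fun u => vsproj U (f u)) by move=> a u v; rewrite !linearP.
pose g : 'Hom(car M, car (submod U)) := linfun (fun u => vsproj U (f u)).
have gE u : incl U (g u) = f u by rewrite inclE /g linfunE.
have iinj := (inj_lker (incl U)).2 (lker_incl U).
apply/isoP; exists g; split=> [o u||].
- apply/eqP; rewrite -subr_eq0; apply/eqP/iinj; rewrite linearB /= gE.
  by rewrite (mor_incl hU) gE fm subrr.
- apply/inj_lker => u gu; apply: (inj_lker f).2 => //.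
  by rewrite -gE gu linear0.
apply/surj_limg => w; have : vsval w \in limg f by rewrite fU subvsP.
case/memv_imgP => u _ wE; exists u; apply/eqP; rewrite -subr_eq0.
by apply/eqP/iinj; rewrite linearB /= gE inclE wE subrr.
Qed.

(** * Direct sums *)

Lemma op_dsum M N o (u : car (M ⊕ N)) :
  op (M ⊕ N) o u = (op M o u.1, op N o u.2) :> car M * car N.
Proof. by case: o => [g|]; rewrite /= dsum_lfunE. Qed.

Definition copair M N L (f : 'Hom(car M, car L)) (g : 'Hom(car N, car L)) :
    'Hom(car (M ⊕ N), car L) :=
  linfun (fun u : car M * car N => f u.1 + g u.2).

Lemma copairE M N L (f : 'Hom(car M, car L)) (g : 'Hom(car N, car L)) u :
  copair f g u = f u.1 + g u.2.
Proof.
by apply: linfunE => a [u1 u2] [v1 v2] /=; rewrite !linearP scalerDr addrACA.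
Qed.

Lemma mor_copair M N L (f : 'Hom(car M, car L)) (g : 'Hom(car N, car L)) :
  mor f -> mor g -> mor (copair f g).
Proof. by move=> fm gm o u; rewrite !copairE op_dsum fm gm linearD. Qed.

Lemma limg_copair M N L (f : 'Hom(car M, car L)) (g : 'Hom(car N, car L)) :
  limg (copair f g) = (limg f + limg g)%VS.
Proof.
apply/vspaceP => w; apply/memv_imgP/memv_addP => [[u _ ->]|].
  by rewrite copairE; exists (f u.1); rewrite ?memv_img ?memvf //;
    exists (g u.2); rewrite ?memv_img ?memvf.
case=> w1 /memv_imgP[u1 _ ->] [w2 /memv_imgP[u2 _ ->] ->].
by exists (u1, u2); rewrite ?memvf // copairE.
Qed.

Definition inL M N : 'Hom(car M, car (M ⊕ N)) :=
  linfun (fun u : car M => (u, 0) : car M * car N).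
Definition inR M N : 'Hom(car N, car (M ⊕ N)) :=
  linfun (fun u : car N => (0, u) : car M * car N).
Definition prL M N : 'Hom(car (M ⊕ N), car M) :=
  linfun (fun u : car M * car N => u.1).
Definition prR M N : 'Hom(car (M ⊕ N), car N) :=
  linfun (fun u : car M * car N => u.2).

Lemma inLE M N u : inL M N u = (u, 0).
Proof. by apply: linfunE => a v w; rewrite /GRing.scale /= /GRing.add /= /add_pair /= /scale_pair /= scaler0 add0r. Qed.

Lemma inRE M N u : inR M N u = (0, u).
Proof. by apply: linfunE => a v w; rewrite /GRing.scale /= /GRing.add /= /add_pair /= /scale_pair /= scaler0 add0r. Qed.

Lemma prLE M N u : prL M N u = u.1.
Proof. exact: linfunE. Qed.

Lemma prRE M N u : prR M N u = u.2.
Proof. exact: linfunE. Qed.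

Lemma mor_inL M N : mor (inL M N).
Proof. by move=> o u; rewrite op_dsum !inLE /= linear0. Qed.

Lemma mor_inR M N : mor (inR M N).
Proof. by move=> o u; rewrite op_dsum !inRE /= linear0. Qed.

Lemma mor_prL M N : mor (prL M N).
Proof. by move=> o u; rewrite !prLE op_dsum. Qed.

Lemma mor_prR M N : mor (prR M N).
Proof. by move=> o u; rewrite !prRE op_dsum. Qed.

Lemma dim_dsum M N : dim (car (M ⊕ N)) = (dim (car M) + dim (car N))%N.
Proof. by []. Qed.

(** * Tensor products *)

Section Tens.
Variables V W V' W' : vectType K.

Lemma tensDl (v1 v2 : V) (w : W) : tens (v1 + v2) w = tens v1 w + tens v2 w.
Proof. by rewrite /tens linearD linearD mulmxDl. Qed.

Lemma tensDr (v : V) (w1 w2 : W) : tens v (w1 + w2) = tens v w1 + tens v w2.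
Proof. by rewrite /tens linearD mulmxDr. Qed.

Lemma tensZl a (v : V) (w : W) : tens (a *: v) w = a *: tens v w.
Proof. by rewrite /tens linearZ linearZ scalemxAl. Qed.

Lemma tensZr a (v : V) (w : W) : tens v (a *: w) = a *: tens v w.
Proof. by rewrite /tens linearZ scalemxAr. Qed.

Lemma tens0l (w : W) : tens (0 : V) w = 0.
Proof. by rewrite -(scale0r 0) tensZl scale0r. Qed.

Lemma tens0r (v : V) : tens v (0 : W) = 0.
Proof. by rewrite -(scale0r 0) tensZr scale0r. Qed.

Lemma tens_sumr I (r : seq I) (P : pred I) (v : V) (f : I -> W) :
  tens v (\sum_(i <- r | P i) f i) = \sum_(i <- r | P i) tens v (f i).
Proof. by elim/big_rec2: _ => [|i y1 y2 _ <-]; rewrite ?tens0r ?tensDr. Qed.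

Lemma tens_suml I (r : seq I) (P : pred I) (w : W) (f : I -> V) :
  tens (\sum_(i <- r | P i) f i) w = \sum_(i <- r | P i) tens (f i) w.
Proof. by elim/big_rec2: _ => [|i y1 y2 _ <-]; rewrite ?tens0l ?tensDl. Qed.

Lemma tens_deltaE (X : 'M[K]_(dim V, dim W)) :
  X = \sum_i \sum_j X i j *: tens (r2v (delta_mx 0 i) : V) (r2v (delta_mx 0 j) : W).
Proof.
rewrite {1}(matrix_sum_delta X); apply: eq_bigr => i _; apply: eq_bigr => j _.
by rewrite /tens !r2vK trmx_delta mul_delta_mx.
Qed.

Lemma tens_full (U : {vspace 'M[K]_(dim V, dim W)}) :
  (forall v w, tens v w \in U) -> U = fullv.
Proof.
move=> h; apply: fullvP => X; rewrite (tens_deltaE X).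
by do 2![apply: memv_suml => ? _]; apply: memvZ.
Qed.

(** The arguments are functions with a proof of linearity rather than elements of ['Hom], so that
    the lemma also applies to a bilinear form with one variable fixed. *)
Lemma tens_ext (A : lmodType K) (f g : 'M[K]_(dim V, dim W) -> A) :
  linear f -> linear g -> (forall v w, f (tens v w) = g (tens v w)) -> f =1 g.
Proof.
move=> lf lg h X.
pose f' : {linear 'M[K]_(dim V, dim W) -> A} :=
  HB.pack f (GRing.isLinear.Build _ _ _ _ _ lf).
pose g' : {linear 'M[K]_(dim V, dim W) -> A} :=
  HB.pack g (GRing.isLinear.Build _ _ _ _ _ lg).
rewrite -[f X]/(f' X) -[g X]/(g' X) (tens_deltaE X) !linear_sum.
apply: eq_bigr => i _; rewrite !linear_sum; apply: eq_bigr => j _.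
by rewrite !linearZ /= h.
Qed.

Definition tens_hom (f : 'Hom(V, V')) (g : 'Hom(W, W')) :
    'Hom('M[K]_(dim V, dim W), 'M[K]_(dim V', dim W')) :=
  linfun (fun X => (f2mx f)^T *m X *m f2mx g).

Lemma tens_homE (f : 'Hom(V, V')) (g : 'Hom(W, W')) v w :
  tens_hom f g (tens v w) = tens (f v) (g w).
Proof.
rewrite /tens_hom linfunE => [|a X Y]; last first.
  by rewrite mulmxDr mulmxDl -scalemxAr -scalemxAl.
by rewrite /tens !unlock /= !r2vK trmx_mul !mulmxA.
Qed.

End Tens.

Lemma lfun_linear (V W : vectType K) (f : 'Hom(V, W)) : linear f.
Proof. by move=> a u v; rewrite linearP. Qed.

Lemma tens_lfun_ext (V W A : vectType K) (f g : 'Hom('M[K]_(dim V, dim W), A)) :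
  (forall v w, f (tens v w) = g (tens v w)) -> f =1 g.
Proof. move=> h; apply: tens_ext h; exact: lfun_linear. Qed.

Lemma op_tensor_tens M N o (v : car M) (w : car N) :
  op (M ⊗ N) o (tens v w) =
  match o with
  | Some (E i) => tens (act M (E i) v) (act N (Kh i) w)
                  + tens (act M (Khi i) (par M v)) (act N (E i) w)
  | Some (F i) => tens (act M (F i) v) (act N (Kh i) w)
                  + tens (act M (Khi i) (par M v)) (act N (F i) w)
  | _ => tens (op M o v) (op N o w)
  end.
Proof.
by case: o => [[i|i|i|i]|] /=; rewrite ?add_lfunE !tens_lfunE ?comp_lfunE.
Qed.

Lemma mor_tens_hom M N M' N' (f : 'Hom(car M, car M')) (g : 'Hom(car N, car N')) :
  mor f -> mor g ->
  mor (tens_hom f g : 'Hom(car (M ⊗ N), car (M' ⊗ N'))).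
Proof.
move=> fm gm o u.
have [fp gp] : (forall v, f (par M v) = par M' (f v)) /\
    (forall g0 v, f (act M g0 v) = act M' g0 (f v)).
  by split=> [|g0]; [exact: (fm None)|exact: (fm (Some g0))].
have gg g0 v : g (act N g0 v) = act N' g0 (g v) by exact: (gm (Some g0)).
have gp' v : g (par N v) = par N' (g v) by exact: (gm None).
rewrite -!comp_lfunE; apply: tens_lfun_ext => v w {u}.
rewrite !comp_lfunE op_tensor_tens tens_homE op_tensor_tens.
by case: o => [[i|i|i|i]|] /=; rewrite ?linearD /= !tens_homE ?gg ?gp ?fp ?gp'.
Qed.

Lemma iso_tensor M N M' N' : M ≅ M' -> N ≅ N' -> M ⊗ N ≅ M' ⊗ N'.
Proof.
move=> iM iN; have dM := iso_dim iM; have dN := iso_dim iN.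
case/isoP: iM => f [fm f0 /surj_limg fS]; case/isoP: iN => g [gm g0 /surj_limg gS].
apply: (@mor_surj_iso _ _ (tens_hom f g : 'Hom(car (M ⊗ N), car (M' ⊗ N')))).
- exact: mor_tens_hom.
- apply: tens_full => v w; have [v' <-] := fS v; have [w' <-] := gS w.
  by rewrite -tens_homE memv_img ?memvf.
by rewrite /= !dim_matrix dM dN.
Qed.

End Reps.

(** * Dimensions of spaces of homomorphisms *)

Section HomDim.
Variable K : fieldType.
Implicit Types M N L : rep K.

Lemma homE M N (f : 'Hom(car M, car N)) :
  Defs.hom f <-> forall g u, f (act M g u) = act N g (f u).
Proof.
split=> [h g u|h g]; last by apply/lfunP => u; rewrite !comp_lfunE.
by have /lfunP/(_ u) := h g; rewrite !comp_lfunE.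
Qed.

Lemma mor_hom M N (f : 'Hom(car M, car N)) : mor f -> Defs.hom f.
Proof. by case/morP. Qed.

Lemma hom_comp M N L (f : 'Hom(car M, car N)) (g : 'Hom(car N, car L)) :
  Defs.hom f -> Defs.hom g -> Defs.hom (g \o f)%VF.
Proof.
by move=> /homE fm /homE gm; apply/homE => o u; rewrite !comp_lfunE fm gm.
Qed.

Lemma hom0 M N : Defs.hom (0 : 'Hom(car M, car N)).
Proof. by apply/homE => g u; rewrite !zero_lfunE linear0. Qed.

Lemma homPL M N a (f g : 'Hom(car M, car N)) :
  Defs.hom f -> Defs.hom g -> Defs.hom (a *: f + g).
Proof.
move=> /homE hf /homE hg; apply/homE => o u.
by rewrite !add_lfunE !scale_lfunE hf hg linearP.
Qed.

Lemma homD M N (f g : 'Hom(car M, car N)) :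
  Defs.hom f -> Defs.hom g -> Defs.hom (f + g).
Proof. by move=> hf hg; rewrite -[f]scale1r; apply: homPL. Qed.

Definition hom_space M N : {vspace 'Hom(car M, car N)} :=
  projT1 (cid (vspace_of_pred (hom0 M N) (@homPL M N))).

Lemma hom_spaceP M N f : f \in hom_space M N <-> Defs.hom f.
Proof. by rewrite /hom_space; case: cid. Qed.

Definition hom_dim M N := \dim (hom_space M N).

Lemma dim_EndP M n : dim_End M n <-> hom_dim M M = n.
Proof.
split=> [[A [hA <-]]|<-]; last by exists (hom_space M M); split=> // f; apply: hom_spaceP.
congr (\dim _); apply/vspaceP => f; apply/idP/idP.
  by move/hom_spaceP => /hA.
by move/hA => /hom_spaceP.
Qed.

Lemma hom_dim_transfer M N M' N'
    (phi : 'Hom('Hom(car M, car N), 'Hom(car M', car N')))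
    (psi : 'Hom(car M', car N') -> 'Hom(car M, car N)) :
  (forall f, Defs.hom f -> Defs.hom (phi f)) ->
  (forall f, Defs.hom f -> Defs.hom (psi f)) ->
  (forall f, Defs.hom f -> psi (phi f) = f) ->
  (forall f, Defs.hom f -> phi (psi f) = f) ->
  hom_dim M N = hom_dim M' N'.
Proof.
move=> hphi hpsi phiK psiK; rewrite /hom_dim.
have <- : (phi @: hom_space M N)%VS = hom_space M' N'.
  apply/vspaceP => f; apply/memv_imgP/idP => [[g /hom_spaceP hg ->]|/hom_spaceP hf].
    by apply/hom_spaceP/hphi.
  by exists (psi f); [apply/hom_spaceP/hpsi|rewrite psiK].
(* Injectivity of [phi] on homomorphisms: as [psi] is just a function, [psi 0 = 0] is obtained from
   [phiK] at 0. *)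
apply/esym/limg_dim_eq/zerovP => f; rewrite memv_cap memv_ker.
move=> /andP[/hom_spaceP hf /eqP f0]; have [g h0 _] : exists2 g, psi 0 = g & True by exists (psi 0).
rewrite -(phiK f hf) f0 -(phiK 0); last exact: hom0.
by rewrite linear0.
Qed.

Definition precomp (V W U : vectType K) (p : 'Hom(V, W)) : 'Hom('Hom(W, U), 'Hom(V, U)) :=
  linfun (fun f : 'Hom(W, U) => (f \o p)%VF).

Definition postcomp (V W U : vectType K) (p : 'Hom(W, U)) : 'Hom('Hom(V, W), 'Hom(V, U)) :=
  linfun (fun f : 'Hom(V, W) => (p \o f)%VF).

Lemma precompE (V W U : vectType K) (p : 'Hom(V, W)) (f : 'Hom(W, U)) :
  precomp U p f = (f \o p)%VF.
Proof. by apply: linfunE => a g h; rewrite comp_lfunDl comp_lfunZl. Qed.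

Lemma postcompE (V W U : vectType K) (p : 'Hom(W, U)) (f : 'Hom(V, W)) :
  postcomp V p f = (p \o f)%VF.
Proof. by apply: linfunE => a g h; rewrite comp_lfunDr comp_lfunZr. Qed.

Lemma hom_dim_isol M M' N : M ≅ M' -> hom_dim M N = hom_dim M' N.
Proof.
move=> /isoP[f [fm f0 fS]]; have [fV Vf] := bij_lfun f0 fS.
apply: (hom_dim_transfer (phi := precomp _ f^-1%VF) (psi := fun g => (g \o f)%VF)).
- move=> g hg; rewrite precompE; apply: hom_comp => //.
  by apply: mor_hom; apply: mor_inv.
- by move=> g hg; apply: hom_comp => //; apply: mor_hom.
- by move=> g hg; rewrite precompE -comp_lfunA Vf comp_lfun1r.
- by move=> g hg; rewrite precompE -comp_lfunA fV comp_lfun1r.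
Qed.

Lemma hom_dim_isor M N N' : N ≅ N' -> hom_dim M N = hom_dim M N'.
Proof.
move=> /isoP[f [fm f0 fS]]; have [fV Vf] := bij_lfun f0 fS.
apply: (hom_dim_transfer (phi := postcomp _ f) (psi := fun g => (f^-1 \o g)%VF)).
- by move=> g hg; rewrite postcompE; apply: hom_comp => //; apply: mor_hom.
- move=> g hg; apply: hom_comp => //; apply: mor_hom; exact: mor_inv.
- by move=> g hg; rewrite postcompE comp_lfunA Vf comp_lfun1l.
- by move=> g hg; rewrite postcompE comp_lfunA fV comp_lfun1l.
Qed.

Lemma hom_inL M N : Defs.hom (inL M N). Proof. exact/mor_hom/mor_inL. Qed.
Lemma hom_inR M N : Defs.hom (inR M N). Proof. exact/mor_hom/mor_inR. Qed.
Lemma hom_prL M N : Defs.hom (prL M N). Proof. exact/mor_hom/mor_prL. Qed.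
Lemma hom_prR M N : Defs.hom (prR M N). Proof. exact/mor_hom/mor_prR. Qed.

Lemma prL_inL M N : (prL M N \o inL M N = \1)%VF.
Proof. by apply/lfunP => u; rewrite !(comp_lfunE, id_lfunE) prLE inLE. Qed.
Lemma prR_inR M N : (prR M N \o inR M N = \1)%VF.
Proof. by apply/lfunP => u; rewrite !(comp_lfunE, id_lfunE) prRE inRE. Qed.
Lemma prL_inR M N : (prL M N \o inR M N = 0)%VF.
Proof. by apply/lfunP => u; rewrite !(comp_lfunE, zero_lfunE) prLE inRE. Qed.
Lemma prR_inL M N : (prR M N \o inL M N = 0)%VF.
Proof. by apply/lfunP => u; rewrite !(comp_lfunE, zero_lfunE) prRE inLE. Qed.
Lemma in_pr_sum M N : ((inL M N \o prL M N) + (inR M N \o prR M N) = \1)%VF.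
Proof.
apply/lfunP => -[u1 u2]; rewrite !(add_lfunE, comp_lfunE, id_lfunE) inLE inRE prLE prRE.
by rewrite /GRing.add /= /add_pair /= addr0 add0r.
Qed.

(* Both additivity lemmas: a Hom space out of (into) a direct sum is the direct
   sum of the images of two injective maps, with the (co)projections as
   retractions. *)
Lemma hom_dim_biproduct M N M1 N1 M2 N2
    (a : 'Hom('Hom(car M1, car N1), 'Hom(car M, car N)))
    (b : 'Hom('Hom(car M2, car N2), 'Hom(car M, car N)))
    (a' : 'Hom('Hom(car M, car N), 'Hom(car M1, car N1)))
    (b' : 'Hom('Hom(car M, car N), 'Hom(car M2, car N2))) :
  (forall f, Defs.hom f -> Defs.hom (a f)) ->
  (forall f, Defs.hom f -> Defs.hom (b f)) ->
  (forall f, Defs.hom f -> Defs.hom (a' f)) ->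
  (forall f, Defs.hom f -> Defs.hom (b' f)) ->
  (forall f, a' (a f) = f) -> (forall f, b' (b f) = f) ->
  (forall f, b' (a f) = 0) -> (forall f, a (a' f) + b (b' f) = f) ->
  hom_dim M N = (hom_dim M1 N1 + hom_dim M2 N2)%N.
Proof.
move=> ha hb ha' hb' aK bK ab0 sumK; rewrite /hom_dim.
have -> : hom_space M N = (a @: hom_space M1 N1 + b @: hom_space M2 N2)%VS.
  apply/vspaceP => f; apply/idP/memv_addP => [/hom_spaceP hf|].
    exists (a (a' f)); first by apply/memv_img/hom_spaceP/ha'.
    exists (b (b' f)); first by apply/memv_img/hom_spaceP/hb'.
    by rewrite sumK.
  move=> [_ /memv_imgP[g /hom_spaceP hg ->] [_ /memv_imgP[h /hom_spaceP hh ->] ->]].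
  by apply/hom_spaceP/homD; [apply: ha|apply: hb].
rewrite dimv_disjoint_sum ?limg_dim_eq //.
- by apply: zerovP => f; rewrite memv_cap memv_ker => /andP[_ /eqP f0];
    rewrite -(bK f) f0 linear0.
- by apply: zerovP => f; rewrite memv_cap memv_ker => /andP[_ /eqP f0];
    rewrite -(aK f) f0 linear0.
apply: zerovP => f; rewrite memv_cap => /andP[/memv_imgP[g _ ->] /memv_imgP[h _ e]].
by rewrite e -(bK h) -e ab0 linear0.
Qed.

Lemma hom_dim_dsuml M1 M2 N :
  hom_dim (M1 ⊕ M2) N = (hom_dim M1 N + hom_dim M2 N)%N.
Proof.
apply: (@hom_dim_biproduct _ _ _ _ _ _ (precomp _ (prL M1 M2)) (precomp _ (prR M1 M2))
   (precomp _ (inL M1 M2)) (precomp _ (inR M1 M2))) => f; rewrite ?precompE.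
- by move=> hf; apply: hom_comp => //; apply: hom_prL.
- by move=> hf; apply: hom_comp => //; apply: hom_prR.
- by move=> hf; apply: hom_comp => //; apply: hom_inL.
- by move=> hf; apply: hom_comp => //; apply: hom_inR.
- by rewrite -comp_lfunA prL_inL comp_lfun1r.
- by rewrite -comp_lfunA prR_inR comp_lfun1r.
- by rewrite -comp_lfunA prL_inR comp_lfun0r.
- by rewrite -!comp_lfunA -comp_lfunDr in_pr_sum comp_lfun1r.
Qed.

Lemma hom_dim_dsumr M N1 N2 :
  hom_dim M (N1 ⊕ N2) = (hom_dim M N1 + hom_dim M N2)%N.
Proof.
apply: (@hom_dim_biproduct _ _ _ _ _ _ (postcomp _ (inL N1 N2)) (postcomp _ (inR N1 N2))
   (postcomp _ (prL N1 N2)) (postcomp _ (prR N1 N2))) => f; rewrite ?postcompE.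
- by move=> hf; apply: hom_comp => //; apply: hom_inL.
- by move=> hf; apply: hom_comp => //; apply: hom_inR.
- by move=> hf; apply: hom_comp => //; apply: hom_prL.
- by move=> hf; apply: hom_comp => //; apply: hom_prR.
- by rewrite comp_lfunA prL_inL comp_lfun1l.
- by rewrite comp_lfunA prR_inR comp_lfun1l.
- by rewrite comp_lfunA prR_inL comp_lfun0l.
- by rewrite !comp_lfunA -comp_lfunDl in_pr_sum comp_lfun1l.
Qed.

Lemma hom_dim0 M N :
  (forall f : 'Hom(car M, car N), Defs.hom f -> f = 0) -> hom_dim M N = 0%N.
Proof.
move=> h; apply/eqP; rewrite dimv_eq0; apply/eqP/zerovP => f.
by move/hom_spaceP/h.
Qed.

Lemma hom_dim1 M N (g : 'Hom(car M, car N)) : Defs.hom g -> g <> 0 ->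
  (forall f : 'Hom(car M, car N), Defs.hom f -> exists a, f = a *: g) ->
  hom_dim M N = 1%N.
Proof.
move=> hg g0 h; rewrite /hom_dim; have -> : hom_space M N = <[g]>%VS.
  apply/vspaceP => f; apply/idP/vlineP => [/hom_spaceP/h //|[a ->]].
  by apply/memvZ/hom_spaceP.
by rewrite dim_vline; case: eqP g0.
Qed.

Lemma hom_dim2 M N (g h : 'Hom(car M, car N)) : Defs.hom g -> Defs.hom h ->
  g <> 0 -> (forall a, h <> a *: g) ->
  (forall f : 'Hom(car M, car N), Defs.hom f -> exists a b, f = a *: g + b *: h) ->
  hom_dim M N = 2%N.
Proof.
move=> hg hh g0 hN H; rewrite /hom_dim.
have -> : hom_space M N = <<[:: h; g]>>%VS.
  rewrite span_cons span_seq1; apply/vspaceP => f; apply/idP/memv_addP.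
    move=> /hom_spaceP/H[a [b ->]]; exists (b *: h); first by rewrite memvZ ?memv_line.
    by exists (a *: g); rewrite ?memvZ ?memv_line // addrC.
  move=> [_ /vlineP[b ->] [_ /vlineP[a ->] ->]].
  by apply: memvD; apply/memvZ/hom_spaceP.
have : free [:: h; g].
  rewrite free_cons seq1_free span_seq1; apply/andP; split; last exact/eqP.
  by apply/negP => /vlineP[a /hN].
by rewrite /free => /eqP->.
Qed.

End HomDim.

(** * The relations of the quantum group, vector by vector *)

Section QModules.
Variables (K : fieldType) (x : 'I_3 -> K) (h : K).

(* [bx i j] stands for q^(B_ij / 2), where [x i] is q^(alpha_i / 2). *)
Definition bx (i j : 'I_3) : K := if i == j then 1 else x (- (i + j)).

(** The relations of [is_module] over an arbitrary field, with [h] in the role of q - 1/q. The Serre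
    coefficients are h times the q-numbers of [serre], so that they are polynomials in the [x i] and
    their inverses. *)
Record qmodule (M : rep K) : Prop := QModule {
  pt_par : forall u, par M (par M u) = u;
  pt_parKh : forall i u, par M (act M (Kh i) u) = act M (Kh i) (par M u);
  pt_parKhi : forall i u, par M (act M (Khi i) u) = act M (Khi i) (par M u);
  pt_parE : forall i u, par M (act M (E i) u) = - act M (E i) (par M u);
  pt_parF : forall i u, par M (act M (F i) u) = - act M (F i) (par M u);
  pt_KhKhi : forall i u, act M (Kh i) (act M (Khi i) u) = u;
  pt_KhiKh : forall i u, act M (Khi i) (act M (Kh i) u) = u;
  pt_KhKh : forall i j u,
    act M (Kh i) (act M (Kh j) u) = act M (Kh j) (act M (Kh i) u);
  pt_KhE : forall i j u,
    act M (Kh i) (act M (E j) u) = bx i j *: act M (E j) (act M (Kh i) u);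
  pt_KhF : forall i j u,
    act M (Kh i) (act M (F j) u) = (bx i j)^-1 *: act M (F j) (act M (Kh i) u);
  pt_EF : forall i j u,
    act M (E i) (act M (F j) u) + act M (F j) (act M (E i) u) =
    if i == j then
      h^-1 *: (act M (Kh i) (act M (Kh i) u) - act M (Khi i) (act M (Khi i) u))
    else 0;
  pt_EE : forall i u, act M (E i) (act M (E i) u) = 0;
  pt_FF : forall i u, act M (F i) (act M (F i) u) = 0;
  pt_serreE : forall u, \sum_(s : 'S_3) ((-1) ^+ s * (x (s 1) ^+ 2 - x (s 1) ^- 2)) *:
    act M (E (s 0)) (act M (E (s 1)) (act M (E (s 2)) u)) = 0;
  pt_serreF : forall u, \sum_(s : 'S_3) ((-1) ^+ s * (x (s 1) ^+ 2 - x (s 1) ^- 2)) *: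
    act M (F (s 0)) (act M (F (s 1)) (act M (F (s 2)) u)) = 0 }.

Section Transport.
Variables (M N : rep K) (f : 'Hom(car M, car N)).
Hypothesis fm : mor f.

Lemma mor_act g u : f (act M g u) = act N g (f u).
Proof. exact: (fm (Some g)). Qed.

Lemma mor_par u : f (par M u) = par N (f u).
Proof. exact: (fm None). Qed.

Let fE := (mor_act, mor_par).

Lemma serre_mor (e : 'I_3 -> gen) u :
  f (\sum_(s : 'S_3) ((-1) ^+ s * (x (s 1) ^+ 2 - x (s 1) ^- 2)) *:
    act M (e (s 0)) (act M (e (s 1)) (act M (e (s 2)) u))) =
  \sum_(s : 'S_3) ((-1) ^+ s * (x (s 1) ^+ 2 - x (s 1) ^- 2)) *:
    act N (e (s 0)) (act N (e (s 1)) (act N (e (s 2)) (f u))).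
Proof. by rewrite linear_sum; apply: eq_bigr => s _; rewrite linearZ /= !fE. Qed.

Lemma qmodule_surj : limg f = fullv -> qmodule M -> qmodule N.
Proof.
move=> /surj_limg fS hM.
have lift (P : car N -> Prop) : (forall u, P (f u)) -> forall w, P w.
  by move=> hP w; have [u <-] := fS w.
split=> [|i|i|i|i|i|i|i j|i j|i j|i j|i|i||]; apply: lift => u; rewrite -?fE.
- by rewrite (pt_par hM).
- by rewrite (pt_parKh hM).
- by rewrite (pt_parKhi hM).
- by rewrite (pt_parE hM) linearN /= !fE.
- by rewrite (pt_parF hM) linearN /= !fE.
- by rewrite (pt_KhKhi hM).
- by rewrite (pt_KhiKh hM).
- by rewrite (pt_KhKh hM).
- by rewrite (pt_KhE hM) linearZ /= !fE.
- by rewrite (pt_KhF hM) linearZ /= !fE.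
- rewrite -linearD (pt_EF hM); case: ifP => _; last by rewrite linear0.
  by rewrite linearZ; congr (_ *: _); rewrite linearB /= !fE.
- by rewrite (pt_EE hM) linear0.
- by rewrite (pt_FF hM) linear0.
- by rewrite -serre_mor (pt_serreE hM) linear0.
- by rewrite -serre_mor (pt_serreF hM) linear0.
Qed.

End Transport.

Let eq_inj (M N N' : rep K) (f : 'Hom(car M, car N)) (g : 'Hom(car M, car N')) u v :
  (forall u, f u = 0 -> g u = 0 -> u = 0) -> f u = f v -> g u = g v -> u = v.
Proof.
move=> fg0 fe ge; apply/eqP; rewrite -subr_eq0; apply/eqP/fg0;
  by rewrite linearB /= ?fe ?ge subrr.
Qed.

(** A relation holds in M as soon as it holds after two morphisms that are jointly injective. The
    two projections give direct sums; one morphism taken twice gives submodules. *)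
Lemma qmodule_inj2 (M N N' : rep K) (f : 'Hom(car M, car N)) (g : 'Hom(car M, car N')) :
  mor f -> mor g -> (forall u, f u = 0 -> g u = 0 -> u = 0) ->
  qmodule N -> qmodule N' -> qmodule M.
Proof.
move=> fm gm fg0 hN hN'.
have fE := (mor_act fm, mor_par fm, mor_act gm, mor_par gm).
split=> [|i|i|i|i|i|i|i j|i j|i j|i j|i|i||] u; apply: (eq_inj fg0);
  rewrite ?(serre_mor fm) ?(serre_mor gm).
- by rewrite !fE (pt_par hN).
- by rewrite !fE (pt_par hN').
- by rewrite !fE (pt_parKh hN).
- by rewrite !fE (pt_parKh hN').
- by rewrite !fE (pt_parKhi hN).
- by rewrite !fE (pt_parKhi hN').
- by rewrite linearN /= !fE (pt_parE hN).
- by rewrite linearN /= !fE (pt_parE hN').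
- by rewrite linearN /= !fE (pt_parF hN).
- by rewrite linearN /= !fE (pt_parF hN').
- by rewrite !fE (pt_KhKhi hN).
- by rewrite !fE (pt_KhKhi hN').
- by rewrite !fE (pt_KhiKh hN).
- by rewrite !fE (pt_KhiKh hN').
- by rewrite !fE (pt_KhKh hN).
- by rewrite !fE (pt_KhKh hN').
- by rewrite linearZ /= !fE (pt_KhE hN).
- by rewrite linearZ /= !fE (pt_KhE hN').
- by rewrite linearZ /= !fE (pt_KhF hN).
- by rewrite linearZ /= !fE (pt_KhF hN').
- rewrite linearD /= !fE (pt_EF hN); case: ifP; rewrite ?linear0 // => _.
  by rewrite linearZ; congr (_ *: _); rewrite linearB /= !fE.
- rewrite linearD /= !fE (pt_EF hN'); case: ifP; rewrite ?linear0 // => _.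
  by rewrite linearZ; congr (_ *: _); rewrite linearB /= !fE.
- by rewrite linear0 ?fE (pt_EE hN).
- by rewrite linear0 ?fE (pt_EE hN').
- by rewrite linear0 ?fE (pt_FF hN).
- by rewrite linear0 ?fE (pt_FF hN').
- by rewrite linear0; apply: pt_serreE.
- by rewrite linear0; apply: pt_serreE.
- by rewrite linear0; apply: pt_serreF.
- by rewrite linear0; apply: pt_serreF.
Qed.

Lemma qmodule_inj (M N : rep K) (f : 'Hom(car M, car N)) :
  mor f -> lker f = 0%VS -> qmodule N -> qmodule M.
Proof. by move=> fm /inj_lker f0 hN; apply: (qmodule_inj2 fm fm) => // u /f0. Qed.

Lemma qmodule_submod M (U : {vspace car M}) :
  submodule U -> qmodule M -> qmodule (submod U).
Proof. by move=> hU; apply: qmodule_inj (mor_incl hU) (lker_incl U). Qed.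

Lemma qmodule_quomod M (U : {vspace car M}) :
  submodule U -> qmodule M -> qmodule (quomod U).
Proof. by move=> hU; apply: qmodule_surj (mor_quo hU) (limg_quo U). Qed.

Lemma qmodule_dsum (M N : rep K) : qmodule M -> qmodule N -> qmodule (M ⊕ N).
Proof.
apply: (qmodule_inj2 (@mor_prL _ M N) (@mor_prR _ M N)) => -[u1 u2].
by rewrite prLE prRE /= => -> ->.
Qed.

End QModules.

(** * The Serre element of a sum of two operators *)

Section SerreSum.
Variable C : fieldType.

Lemma sum_S3 (V : zmodType) (f : 'S_3 -> V) :
  let p := tperm (0 : 'I_3) 1 in let p' := tperm (1 : 'I_3) 2 in
  \sum_s f s = f 1%g + f p + f p' + f (p * p')%g + f (p' * p)%g + f (p * p' * p)%g.
Proof.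
move=> p p'; set l := [:: 1%g; p; p'; (p * p')%g; (p' * p)%g; (p * p' * p)%g].
have ul : uniq l.
  (* A permutation of three points is determined by its values at 0 and 1; six distinct ones exhaust
     the group. *)
  apply: (@map_uniq _ _ (fun s : 'S_3 => (val (s 0), val (s 1)))).
  by rewrite /= !permE /= !permE /= !permE.
have [_ le] : (size l = size (enum 'S_3)) * (l =i enum 'S_3).
  apply: uniq_min_size => // [s _|]; first by rewrite mem_enum.
  by rewrite -cardE card_Sn.
rewrite -big_enum (perm_big l) /=; last by rewrite perm_sym uniq_perm // enum_uniq.
by rewrite !big_cons big_nil addr0 !addrA.
Qed.

Lemma sum_S3_alt (V : lmodType C) (f : 'I_3 -> 'I_3 -> 'I_3 -> V) (n : 'I_3 -> C) :
  \sum_(s : 'S_3) ((-1) ^+ s * n (s 1)) *: f (s 0) (s 1) (s 2) =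
  n 1 *: f 0 1 2 - n 0 *: f 1 0 2 - n 2 *: f 0 2 1
  + n 2 *: f 1 2 0 + n 0 *: f 2 0 1 - n 1 *: f 2 1 0.
Proof.
rewrite sum_S3 !odd_permM !odd_tperm odd_perm1 /= !permE /= !permE /= !permE /=.
rewrite expr0 expr1 !mul1r !mulN1r !scaleNr.
by rewrite [X in X - _]addrAC.
Qed.

(* Deformed Leibniz rule: if [b j] and [a i] commute up to the scalar [c i j], the
   mixed terms of the Serre element at [a + b] cancel. *)
Lemma serre_add (V : vectType C) (a b : 'I_3 -> 'End(V))
    (c : 'I_3 -> 'I_3 -> C) (k : 'I_3 -> C) u :
  (forall i j v, b j (a i v) = c i j *: a i (b j v)) ->
  (forall i j l, i != j -> i != l -> j != l ->
     k j - k l * c j l + k i * (c i l * c j l) = 0) ->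
  (forall i j l, i != j -> i != l -> j != l ->
     k j - k i * c i j + k l * (c i j * c i l) = 0) ->
  let serre3 (X : 'I_3 -> 'End(V)) v :=
    \sum_(s : 'S_3) ((-1) ^+ s * k (s 1)) *: X (s 0) (X (s 1) (X (s 2) v)) in
  serre3 (fun i => a i + b i) u = serre3 a u + serre3 b u.
Proof.
move=> ba h1 h2; rewrite /=.
pose f3 (X Y Z : 'I_3 -> 'End(V)) i j l := X i (Y j (Z l u)).
rewrite (sum_S3_alt (f3 (fun i => a i + b i) (fun i => a i + b i) (fun i => a i + b i))).
rewrite (sum_S3_alt (f3 a a a)) (sum_S3_alt (f3 b b b)) /f3.
(* Passing to coordinates turns identities between vectors into identities between scalars, which
   [ring] can prove. *)
pose co p v : C := v2r (v : V) 0 p.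
have coordP v w : (forall p, co p v = co p w) -> v = w.
  by move=> e; apply: v2r_inj; apply/rowP.
have pD p v w : co p (v + w) = co p v + co p w by rewrite /co linearD mxE.
have pN p v : co p (- v) = - co p v by rewrite /co linearN mxE.
have pZ p k' v : co p (k' *: v) = k' * co p v by rewrite /co linearZ mxE.
have p0 p : co p 0 = 0 by rewrite /co linear0 mxE.
have lD (f : 'End(V)) v w : f (v + w) = f v + f w by exact: linearD.
have lZ (f : 'End(V)) x v : f (x *: v) = x *: f v by exact: linearZ.
have e i j l : (a i + b i) ((a j + b j) ((a l + b l) u)) =
    a i (a j (a l u)) + a i (a j (b l u)) + c l j *: a i (a l (b j u))
    + a i (b j (b l u)) + (c j i * c l i) *: a j (a l (b i u))
    + c j i *: a j (b i (b l u)) + (c l j * c l i) *: a l (b i (b j u))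
    + b i (b j (b l u)).
  rewrite !(add_lfunE, lD) !(ba, lZ) !scalerA.
  by apply: coordP => p; rewrite !(pD, pZ); ring.
apply/eqP; rewrite -subr_eq0; apply/eqP/coordP => p.
rewrite !e !(pD, pN, pZ) p0.
(* Once every [b] stands to the right of every [a], twelve mixed monomials remain, six with two
   factors [a] and six with two factors [b]. Their coefficients are instances of [h1] and [h2]
   respectively. *)
transitivity (
   (k 1 - k 2 * c 1 2 + k 0 * (c 0 2 * c 1 2)) * co p (a 0 (a 1 (b 2 u)))
   + (k 1 - k 0 * c 0 1 + k 2 * (c 0 1 * c 0 2)) * co p (a 0 (b 1 (b 2 u)))
   - (k 0 - k 2 * c 0 2 + k 1 * (c 1 2 * c 0 2)) * co p (a 1 (a 0 (b 2 u)))
   - (k 0 - k 1 * c 1 0 + k 2 * (c 1 0 * c 1 2)) * co p (a 1 (b 0 (b 2 u)))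
   - (k 2 - k 1 * c 2 1 + k 0 * (c 0 1 * c 2 1)) * co p (a 0 (a 2 (b 1 u)))
   - (k 2 - k 0 * c 0 2 + k 1 * (c 0 2 * c 0 1)) * co p (a 0 (b 2 (b 1 u)))
   + (k 2 - k 0 * c 2 0 + k 1 * (c 1 0 * c 2 0)) * co p (a 1 (a 2 (b 0 u)))
   + (k 2 - k 1 * c 1 2 + k 0 * (c 1 2 * c 1 0)) * co p (a 1 (b 2 (b 0 u)))
   + (k 0 - k 1 * c 0 1 + k 2 * (c 2 1 * c 0 1)) * co p (a 2 (a 0 (b 1 u)))
   + (k 0 - k 2 * c 2 0 + k 1 * (c 2 0 * c 2 1)) * co p (a 2 (b 0 (b 1 u)))
   - (k 1 - k 0 * c 1 0 + k 2 * (c 2 0 * c 1 0)) * co p (a 2 (a 1 (b 0 u)))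
   - (k 1 - k 2 * c 2 1 + k 0 * (c 2 1 * c 2 0)) * co p (a 2 (b 1 (b 0 u)))).
  ring.
rewrite !(h1, h2) //; ring.
Qed.

End SerreSum.

Variant I3_spec (i : 'I_3) : Prop := I3_0 of i = 0 | I3_1 of i = 1 | I3_2 of i = 2.

Lemma I3P i : I3_spec i.
Proof.
case: i => [[|[|[|]]] hi] //; [exact/I3_0/val_inj|exact/I3_1/val_inj|exact/I3_2/val_inj].
Qed.

(** * Tensor products of modules over the quantum group *)

Section QModuleTheory.
Variables (K : fieldType) (x : 'I_3 -> K) (h : K).
Hypothesis x_neq0 : forall i, x i != 0.
Local Notation bx := (bx x).
Local Notation qmodule := (qmodule x h).

Lemma bx_neq0 i j : bx i j != 0.
Proof. by rewrite /bx; case: ifP => // _; apply: oner_neq0. Qed.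

Lemma bxC i j : bx i j = bx j i.
Proof. by rewrite /bx eq_sym addrC. Qed.

Section OneModule.
Variable M : rep K.
Hypothesis hM : qmodule M.

Lemma KhiE i j u : act M (Khi i) (act M (E j) u) =
  (bx i j)^-1 *: act M (E j) (act M (Khi i) u).
Proof.
have := pt_KhE hM i j (act M (Khi i) u); rewrite (pt_KhKhi hM) => /(congr1 (act M (Khi i))).
by rewrite (pt_KhiKh hM) linearZ /= => ->; rewrite scalerA mulVf ?bx_neq0 ?scale1r.
Qed.

Lemma KhiF i j u : act M (Khi i) (act M (F j) u) =
  bx i j *: act M (F j) (act M (Khi i) u).
Proof.
have := pt_KhF hM i j (act M (Khi i) u); rewrite (pt_KhKhi hM) => /(congr1 (act M (Khi i))).
by rewrite (pt_KhiKh hM) linearZ /= => ->; rewrite scalerA divff ?bx_neq0 ?scale1r.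
Qed.

Lemma Kh_inj i : injective (act M (Kh i)).
Proof. exact: can_inj (pt_KhiKh hM i). Qed.

Lemma KhiKhC i j u :
  act M (Khi i) (act M (Kh j) u) = act M (Kh j) (act M (Khi i) u).
Proof. by apply: (@Kh_inj i); rewrite (pt_KhKh hM i j) !(pt_KhKhi hM). Qed.

Lemma KhiKhi i j u :
  act M (Khi i) (act M (Khi j) u) = act M (Khi j) (act M (Khi i) u).
Proof. by apply: (@Kh_inj j); rewrite -KhiKhC !(pt_KhKhi hM). Qed.

Lemma Khi_wt i (k : K) u : k != 0 -> act M (Kh i) u = k *: u -> act M (Khi i) u = k^-1 *: u.
Proof.
move=> k0 hu; apply: (@Kh_inj i); rewrite (pt_KhKhi hM) linearZ /= hu.
by rewrite scalerA mulVf ?scale1r.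
Qed.

End OneModule.

Hypothesis x_prod : x 0 * x 1 * x 2 = 1.

(** The vanishing sum of the alpha_i enters here: with x_l = 1 / (x_i x_j) the three terms expand to
    monomials in x_i, x_j that cancel in pairs. The first family is for the E_i, the second for the
    F_i; they are the conditions of [serre_add], the scalar being minus the square of a [bx] or of
    its inverse. *)
Lemma serre_relations :
  let k j := x j ^+ 2 - x j ^- 2 in
  (forall i j l, i != j -> i != l -> j != l ->
     k j - k l * - (bx j l) ^- 2 + k i * (- (bx i l) ^- 2 * - (bx j l) ^- 2) = 0) /\
  (forall i j l, i != j -> i != l -> j != l ->
     k j - k l * - (bx j l) ^+ 2 + k i * (- (bx i l) ^+ 2 * - (bx j l) ^+ 2) = 0).
Proof.
have x1 : x 2 = (x 0 * x 1)^-1.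
  by apply: (mulfI (mulf_neq0 (x_neq0 0) (x_neq0 1))); rewrite x_prod divff // mulf_neq0.
have third i j l : i != j -> i != l -> j != l ->
    [/\ - (j + l) = i, - (i + l) = j & x i * x j * x l = 1].
  case: (I3P i) => [->|->|->]; case: (I3P j) => [->|->|->]; case: (I3P l) => [->|->|->];
  rewrite ?eqxx //= => _ _ _; split; try exact: val_inj; rewrite -x_prod; move: (x 0) (x 1) (x 2) => a b c; ring.
split=> i j l ij il jl; have [e1 e2 e3] := third i j l ij il jl.
  rewrite /bx (negPf jl) (negPf il) e1 e2.
  have -> : x l = (x i * x j)^-1.
    by apply: (mulfI (mulf_neq0 (x_neq0 i) (x_neq0 j))); rewrite e3 divff // mulf_neq0.
  by field; rewrite !x_neq0 oner_neq0.
rewrite /bx (negPf jl) (negPf il) e1 e2.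
have -> : x l = (x i * x j)^-1.
  by apply: (mulfI (mulf_neq0 (x_neq0 i) (x_neq0 j))); rewrite e3 divff // mulf_neq0.
by field; rewrite !x_neq0 oner_neq0.
Qed.

(* [t] plays the role of [tens]: keeping it abstract makes rewriting fast. *)
Section TensorLike.
Variables (M N T : rep K) (t : car M -> car N -> car T).
Hypotheses (hM : qmodule M) (hN : qmodule N).
Hypothesis t_ext : forall f g : 'End(car T),
  (forall v w, f (t v w) = g (t v w)) -> forall u, f u = g u.
Hypothesis tDl : forall v v' w, t (v + v') w = t v w + t v' w.
Hypothesis tDr : forall v w w', t v (w + w') = t v w + t v w'.
Hypothesis tZl : forall a v w, t (a *: v) w = a *: t v w.
Hypothesis tZr : forall a v w, t v (a *: w) = a *: t v w.
Hypothesis par_t : forall v w, par T (t v w) = t (par M v) (par N w).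
Hypothesis Kh_t : forall i v w,
  act T (Kh i) (t v w) = t (act M (Kh i) v) (act N (Kh i) w).
Hypothesis Khi_t : forall i v w,
  act T (Khi i) (t v w) = t (act M (Khi i) v) (act N (Khi i) w).
Hypothesis E_t : forall i v w, act T (E i) (t v w) =
  t (act M (E i) v) (act N (Kh i) w) + t (act M (Khi i) (par M v)) (act N (E i) w).
Hypothesis F_t : forall i v w, act T (F i) (t v w) =
  t (act M (F i) v) (act N (Kh i) w) + t (act M (Khi i) (par M v)) (act N (F i) w).
Variables ea eb fa fb : 'I_3 -> 'End(car T).
Hypothesis E_ab : forall i, act T (E i) = ea i + eb i.
Hypothesis F_ab : forall i, act T (F i) = fa i + fb i.
Hypothesis ea_t : forall i v w, ea i (t v w) = t (act M (E i) v) (act N (Kh i) w).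
Hypothesis eb_t : forall i v w, eb i (t v w) = t (act M (Khi i) (par M v)) (act N (E i) w).
Hypothesis fa_t : forall i v w, fa i (t v w) = t (act M (F i) v) (act N (Kh i) w).
Hypothesis fb_t : forall i v w, fb i (t v w) = t (act M (Khi i) (par M v)) (act N (F i) w).

Let gE := (par_t, Kh_t, Khi_t, E_t, F_t).
Let tNl v w : t (- v) w = - t v w. Proof. by rewrite -scaleN1r tZl scaleN1r. Qed.
Let tNr v w : t v (- w) = - t v w. Proof. by rewrite -scaleN1r tZr scaleN1r. Qed.
Let t0l w : t 0 w = 0. Proof. by rewrite -(scale0r 0) tZl scale0r. Qed.
Let t0r v : t v 0 = 0. Proof. by rewrite -(scale0r 0) tZr scale0r. Qed.
Let lD (V W : vectType K) (f : 'Hom(V, W)) v w : f (v + w) = f v + f w.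
Proof. exact: linearD. Qed.
Let lN (V W : vectType K) (f : 'Hom(V, W)) v : f (- v) = - f v.
Proof. exact: linearN. Qed.
Let lZ (V W : vectType K) (f : 'Hom(V, W)) a v : f (a *: v) = a *: f v.
Proof. exact: linearZ. Qed.

Let t_suml (s : seq 'S_3) (c : 'S_3 -> K) (f : 'S_3 -> car M) w :
  t (\sum_(i <- s) c i *: f i) w = \sum_(i <- s) c i *: t (f i) w.
Proof. by elim/big_rec2: _ => [|i y1 y2 _ <-]; rewrite ?t0l ?tDl ?tZl. Qed.

Let t_sumr (s : seq 'S_3) (c : 'S_3 -> K) v (f : 'S_3 -> car N) :
  t v (\sum_(i <- s) c i *: f i) = \sum_(i <- s) c i *: t v (f i).
Proof. by elim/big_rec2: _ => [|i y1 y2 _ <-]; rewrite ?t0r ?tDr ?tZr. Qed.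

Let serre3 (X : 'I_3 -> 'End(car T)) u :=
  \sum_(s : 'S_3) ((-1) ^+ s * (x (s 1) ^+ 2 - x (s 1) ^- 2)) *:
    X (s 0) (X (s 1) (X (s 2) u)).

Let serre3_t (X : 'I_3 -> 'End(car T)) :
  (forall v w, serre3 X (t v w) = 0) -> forall u, serre3 X u = 0.
Proof.
move=> X0 u.
pose f := \sum_(s : 'S_3) ((-1) ^+ s * (x (s 1) ^+ 2 - x (s 1) ^- 2)) *:
    (X (s 0) \o (X (s 1) \o X (s 2)))%VF.
have fE v : f v = serre3 X v.
  by rewrite sum_lfunE; apply: eq_bigr => s _; rewrite scale_lfunE !comp_lfunE.
rewrite -fE -(zero_lfunE _ u); apply: t_ext => v w.
by rewrite fE X0 zero_lfunE.
Qed.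

Let perm3 (P : 'I_3 -> 'I_3 -> 'I_3 -> Prop) (s : 'S_3) :
  (forall i j k, P i j k -> P j i k) -> (forall i j k, P i j k -> P i k j) ->
  P 0 1 2 -> P (s 0) (s 1) (s 2).
Proof.
move=> h1 h2 h3; have n01 : s 0 != s 1 by rewrite (inj_eq perm_inj).
have n02 : s 0 != s 2 by rewrite (inj_eq perm_inj).
have n12 : s 1 != s 2 by rewrite (inj_eq perm_inj).
move: n01 n02 n12; case: (I3P (s 0)) => ->; case: (I3P (s 1)) => ->;
  case: (I3P (s 2)) => ->; rewrite ?eqxx // => _ _ _; auto.
Qed.

(** All relations are checked on pure tensors. Two of them are more than bookkeeping: the one
    between E_i and F_j, where mixed terms cancel by the sign rule, and the Serre relations, where
    [serre_add] is applied to the two terms of the coproduct. *)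
Lemma qmodule_tensor_like : qmodule T.
Proof.
split=> [|i|i|i|i|i|i|i j|i j|i j|i j|i|i||] u.
- rewrite -!comp_lfunE -[RHS](id_lfunE u); apply: t_ext => v w.
  by rewrite comp_lfunE id_lfunE !gE (pt_par hM) (pt_par hN).
- rewrite -!comp_lfunE; apply: t_ext => v w.
  by rewrite !comp_lfunE !gE (pt_parKh hM) (pt_parKh hN).
- rewrite -!comp_lfunE; apply: t_ext => v w.
  by rewrite !comp_lfunE !gE (pt_parKhi hM) (pt_parKhi hN).
- rewrite -!comp_lfunE -opp_lfunE; apply: t_ext => v w.
  rewrite opp_lfunE !comp_lfunE !gE lD !gE.
  rewrite !(pt_parE hM, pt_parE hN, pt_parKh hN, pt_parKhi hM).
  by rewrite tNl tNr opprD.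
- rewrite -!comp_lfunE -opp_lfunE; apply: t_ext => v w.
  rewrite opp_lfunE !comp_lfunE !gE lD !gE.
  rewrite !(pt_parF hM, pt_parF hN, pt_parKh hN, pt_parKhi hM).
  by rewrite tNl tNr opprD.
- rewrite -!comp_lfunE -[RHS](id_lfunE u); apply: t_ext => v w.
  by rewrite comp_lfunE id_lfunE !gE (pt_KhKhi hM) (pt_KhKhi hN).
- rewrite -!comp_lfunE -[RHS](id_lfunE u); apply: t_ext => v w.
  by rewrite comp_lfunE id_lfunE !gE (pt_KhiKh hM) (pt_KhiKh hN).
- rewrite -!comp_lfunE; apply: t_ext => v w.
  by rewrite !comp_lfunE !gE (pt_KhKh hM i j) (pt_KhKh hN i j).
- rewrite -!comp_lfunE -scale_lfunE; apply: t_ext => v w.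
  rewrite scale_lfunE !comp_lfunE !gE lD !gE (pt_KhE hM) (pt_KhE hN) tZl tZr.
  by rewrite (pt_KhKh hN i j) -(KhiKhC hM) -(pt_parKh hM) scalerDr.
- rewrite -!comp_lfunE -scale_lfunE; apply: t_ext => v w.
  rewrite scale_lfunE !comp_lfunE !gE lD !gE (pt_KhF hM) (pt_KhF hN) tZl tZr.
  by rewrite (pt_KhKh hN i j) -(KhiKhC hM) -(pt_parKh hM) scalerDr.
(* The mixed terms cancel in pairs: moving E_i or F_j past the parity produces the sign, and the
   powers of q coming from the two tensor factors compensate each other. *)
- have cross v w : act T (E i) (act T (F j) (t v w)) + act T (F j) (act T (E i) (t v w))
    = t (act M (E i) (act M (F j) v) + act M (F j) (act M (E i) v))
        (act N (Kh i) (act N (Kh j) w))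
      + t (act M (Khi i) (act M (Khi j) v))
          (act N (E i) (act N (F j) w) + act N (F j) (act N (E i) w)).
    rewrite !gE !lD !gE.
    rewrite !(pt_parE hM, pt_parF hM, pt_parKhi hM, pt_par hM, lN).
    rewrite !(pt_KhE hN, pt_KhF hN, KhiE hM, KhiF hM) !(tNl, tZl, tZr).
    rewrite (bxC j i) (KhiKhi hM j i) (pt_KhKh hN j i).
    rewrite [LHS](AC ((2*2)*(2*2)) ((1*5)*(4*8)*((2*7)*(3*6)))) /=.
    by rewrite addNr subrr !addr0 !(tDl, tDr).
  have EFt v w : act T (E i) (act T (F j) (t v w)) + act T (F j) (act T (E i) (t v w)) =
      if i == j then h^-1 *: (act T (Kh i) (act T (Kh i) (t v w))
                              - act T (Khi i) (act T (Khi i) (t v w))) else 0.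
    rewrite cross (pt_EF hM) (pt_EF hN); case: eqVneq => [->|_]; last by rewrite t0l t0r addr0.
    rewrite !gE tZl tZr -scalerDr; congr (_ *: _).
    (* Telescoping: (K - 1/K) ⊗ K + 1/K ⊗ (K - 1/K) = K ⊗ K - 1/K ⊗ 1/K. *)
    by rewrite !(tDl, tDr, tNl, tNr) addrA subrK.
  case: eqVneq EFt => [->|_] EFt.
    rewrite -!comp_lfunE -opp_lfunE -!add_lfunE -scale_lfunE; apply: t_ext => v w.
    by rewrite scale_lfunE !add_lfunE opp_lfunE !comp_lfunE.
  rewrite -!comp_lfunE -add_lfunE -(zero_lfunE _ u); apply: t_ext => v w.
  by rewrite add_lfunE zero_lfunE !comp_lfunE.
- rewrite -!comp_lfunE -(zero_lfunE _ u); apply: t_ext => v w.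
  rewrite zero_lfunE !comp_lfunE !gE !lD !gE (pt_EE hM) (pt_EE hN) t0l t0r add0r addr0.
  rewrite (pt_parE hM) (pt_KhE hN) lN (KhiE hM) /bx eqxx invr1 !scale1r.
  by rewrite tNl addNr.
- rewrite -!comp_lfunE -(zero_lfunE _ u); apply: t_ext => v w.
  rewrite zero_lfunE !comp_lfunE !gE !lD !gE (pt_FF hM) (pt_FF hN) t0l t0r add0r addr0.
  rewrite (pt_parF hM) (pt_KhF hN) lN (KhiF hM) /bx eqxx invr1 !scale1r.
  by rewrite tNl addNr.
- under eq_bigr => s _ do rewrite !E_ab.
  have ba i j v : eb j (ea i v) = - (bx i j) ^- 2 *: ea i (eb j v).
    rewrite -!comp_lfunE -scale_lfunE; apply: t_ext => v' w.
    rewrite scale_lfunE !comp_lfunE !(ea_t, eb_t) (pt_parE hM) lN (KhiE hM) (pt_KhE hN).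
    rewrite tNl !(tZl, tZr) scalerA -scaleNr (bxC j i); congr (_ *: _).
    by field; rewrite bx_neq0.
  have [h1 _] := serre_relations.
  (* As [bx] is symmetric, the second condition of [serre_add] is the first one with i and l
     exchanged. *)
  rewrite (serre_add (V := car T) u ba h1); last first.
    move=> i j l ij il jl; have [H _] := serre_relations.
    rewrite (bxC i j) (bxC i l) -[RHS](H l j i) 1?eq_sym //.
    by rewrite (mulrC (- bx l i ^- 2)).
  rewrite [X in X + _](_ : _ = 0) ?[X in _ + X](_ : _ = 0) ?addr0 //.
  + apply: (serre3_t (X := eb)) => v w.
    pose V3 := act M (Khi 0) (act M (Khi 1) (act M (Khi 2) (par M v))).
    rewrite -(t0r V3) -(pt_serreE hN w) t_sumr; apply: eq_bigr => s _.
    rewrite !eb_t !(pt_parKhi hM) !(pt_par hM); congr (_ *: t _ _).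
    by apply: (perm3 (P := fun i j k =>
         act M (Khi i) (act M (Khi j) (act M (Khi k) (par M v))) = V3)) => // i j k <-;
      [exact: KhiKhi | rewrite (KhiKhi hM k j)].
  + apply: (serre3_t (X := ea)) => v w.
    pose W3 := act N (Kh 0) (act N (Kh 1) (act N (Kh 2) w)).
    rewrite -(t0l W3) -(pt_serreE hM v) t_suml; apply: eq_bigr => s _.
    rewrite !ea_t; congr (_ *: t _ _).
    by apply: (perm3 (P := fun i j k =>
         act N (Kh i) (act N (Kh j) (act N (Kh k) w)) = W3)) => // i j k <-;
      [exact: (pt_KhKh hN) | rewrite (pt_KhKh hN k j)].
- under eq_bigr => s _ do rewrite !F_ab.
  have ba i j v : fb j (fa i v) = - (bx i j) ^+ 2 *: fa i (fb j v).
    rewrite -!comp_lfunE -scale_lfunE; apply: t_ext => v' w.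
    rewrite scale_lfunE !comp_lfunE !(fa_t, fb_t) (pt_parF hM) lN (KhiF hM) (pt_KhF hN).
    rewrite tNl !(tZl, tZr) scalerA -scaleNr (bxC j i); congr (_ *: _).
    by field; rewrite bx_neq0.
  have [_ h1] := serre_relations.
  rewrite (serre_add (V := car T) u ba h1); last first.
    move=> i j l ij il jl; have [_ H] := serre_relations.
    rewrite (bxC i j) (bxC i l) -[RHS](H l j i) 1?eq_sym //.
    by rewrite (mulrC (- bx l i ^+ 2)).
  rewrite [X in X + _](_ : _ = 0) ?[X in _ + X](_ : _ = 0) ?addr0 //.
  + apply: (serre3_t (X := fb)) => v w.
    pose V3 := act M (Khi 0) (act M (Khi 1) (act M (Khi 2) (par M v))).
    rewrite -(t0r V3) -(pt_serreF hN w) t_sumr; apply: eq_bigr => s _.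
    rewrite !fb_t !(pt_parKhi hM) !(pt_par hM); congr (_ *: t _ _).
    by apply: (perm3 (P := fun i j k =>
         act M (Khi i) (act M (Khi j) (act M (Khi k) (par M v))) = V3)) => // i j k <-;
      [exact: KhiKhi | rewrite (KhiKhi hM k j)].
  + apply: (serre3_t (X := fa)) => v w.
    pose W3 := act N (Kh 0) (act N (Kh 1) (act N (Kh 2) w)).
    rewrite -(t0l W3) -(pt_serreF hM v) t_suml; apply: eq_bigr => s _.
    rewrite !fa_t; congr (_ *: t _ _).
    by apply: (perm3 (P := fun i j k =>
         act N (Kh i) (act N (Kh j) (act N (Kh k) w)) = W3)) => // i j k <-;
      [exact: (pt_KhKh hN) | rewrite (pt_KhKh hN k j)].
Qed.

End TensorLike.

Lemma qmodule_tensor (M N : rep K) : qmodule M -> qmodule N -> qmodule (M ⊗ N).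
Proof.
move=> hM hN.
apply: (@qmodule_tensor_like M N (M ⊗ N) (@tens _ _ _)
  hM hN _ _ _ _ _ _ _ _ _ _
  (fun i => tens_lfun (act M (E i)) (act N (Kh i)))
  (fun i => tens_lfun (act M (Khi i) \o par M)%VF (act N (E i)))
  (fun i => tens_lfun (act M (F i)) (act N (Kh i)))
  (fun i => tens_lfun (act M (Khi i) \o par M)%VF (act N (F i)))) => //.
- exact: tens_lfun_ext.
- exact: tensDl.
- exact: tensDr.
- exact: tensZl.
- exact: tensZr.
- exact: (op_tensor_tens None).
- by move=> i; exact: (op_tensor_tens (Some (Kh i))).
- by move=> i; exact: (op_tensor_tens (Some (Khi i))).
- by move=> i; exact: (op_tensor_tens (Some (E i))).
- by move=> i; exact: (op_tensor_tens (Some (F i))).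
- by move=> i v w; rewrite tens_lfunE.
- by move=> i v w; rewrite tens_lfunE comp_lfunE.
- by move=> i v w; rewrite tens_lfunE.
- by move=> i v w; rewrite tens_lfunE comp_lfunE.
Qed.

End QModuleTheory.

(** * Weights and words in the generators *)

Section Weights.
Variables (K : fieldType) (x : 'I_3 -> K) (h : K).
Hypothesis x_neq0 : forall i, x i != 0.
Local Notation bx := (bx x).
Local Notation qmodule := (qmodule x h).

Definition content (w : seq 'I_3) : {ffun 'I_3 -> nat} := [ffun j => count_mem j w].

(** Weights are multiplicative: [k i] is an eigenvalue of K_i^{1/2}, and each letter j of a word in
    the F_j divides it by q^(B_ij / 2). *)
Definition lowered (k : {ffun 'I_3 -> K}) (n : {ffun 'I_3 -> nat}) : {ffun 'I_3 -> K} :=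
  [ffun i => k i / \prod_j bx i j ^+ n j].

Definition has_wt (M : rep K) (k : {ffun 'I_3 -> K}) (u : car M) : Prop :=
  forall i, act M (Kh i) u = k i *: u.

Definition Fword (M : rep K) (w : seq 'I_3) (u : car M) : car M :=
  foldr (fun i v => act M (F i) v) u w.

(** With [foldl] the first letter acts first, contrary to [Fword]. This makes [Eword w] the adjoint
    of [Fword w], up to a power of [h], for a contravariant form. *)
Definition Eword (M : rep K) (w : seq 'I_3) (u : car M) : car M :=
  foldl (fun v i => act M (E i) v) u w.

(** The multiplicative substitute for the linear independence of the simple roots. It makes every
    comparison of weights a comparison of contents. *)
Hypothesis wt_inj : forall (k : {ffun 'I_3 -> K}) (n n' : {ffun 'I_3 -> nat}), (forall i, k i != 0) ->
  lowered k n = lowered k n' -> n = n'.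

Section WeightVectors.
Variable M : rep K.
Implicit Types (k : {ffun 'I_3 -> K}) (u v : car M).

Lemma has_wt0 k : has_wt k (0 : car M).
Proof. by move=> i; rewrite linear0 scaler0. Qed.

Lemma has_wtD k u v : has_wt k u -> has_wt k v -> has_wt k (u + v).
Proof. by move=> hu hv i; rewrite linearD /= hu hv scalerDr. Qed.

Lemma has_wtZ k a u : has_wt k u -> has_wt k (a *: u).
Proof. by move=> hu i; rewrite linearZ /= hu !scalerA mulrC. Qed.

Lemma has_wt_sum k I (r : seq I) (P : pred I) (f : I -> car M) :
  (forall i, P i -> has_wt k (f i)) -> has_wt k (\sum_(i <- r | P i) f i).
Proof. by move=> hf; elim/big_ind: _ => //; [exact: has_wt0|exact: has_wtD]. Qed.

(** Induction on the number of vectors whose weight is not [k]. For one of them, of eigenvalue c for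
    some K_i^{1/2} with c different from [k i], the operator K_i^{1/2} - c kills all vectors of that
    weight and multiplies the component of weight [k] by the nonzero scalar [k i - c]. *)
Lemma wt_component (N : {vspace car M}) (l : seq ({ffun 'I_3 -> K} * car M)) :
  submodule N -> (forall p, p \in l -> has_wt p.1 p.2) ->
  \sum_(p <- l) p.2 \in N ->
  forall k, \sum_(p <- l | p.1 == k) p.2 \in N.
Proof.
move=> /submoduleP hN hl sN k.
elim: {l}(count (fun p => p.1 != k) l) {-2}l (leqnn (count (fun p => p.1 != k) l)) hl sN.
  move=> l; rewrite leqNgt -has_count => /hasPn h0 _.
  rewrite -[in X in _ -> X]big_filter (_ : [seq p <- l | p.1 == k] = l) //.
  by apply/all_filterP/allP => p /h0; rewrite negbK.
move=> n IHn l cl hl sN.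
have [l0|] := boolP (count (fun p => p.1 != k) l <= n)%N; first exact: IHn.
rewrite -ltnNge => nl; have : has (fun p => p.1 != k) l.
  by rewrite has_count (leq_ltn_trans _ nl).
case/hasP => p0 p0l p0k; have [i ki] : exists i, k i != p0.1 i.
  apply/existsP; apply: contraR p0k; rewrite negb_exists => /forallP e.
  by apply/eqP/ffunP => i; have := e i; rewrite negbK => /eqP.
set c := p0.1 i; pose l' := [seq (p.1, (p.1 i - c) *: p.2) | p : {ffun 'I_3 -> K} * car M <- l & p.1 != p0.1].
have hl' p : p \in l' -> has_wt p.1 p.2.
  by case/mapP => q; rewrite mem_filter => /andP[_ ql] -> /=; apply/has_wtZ/hl.
have := IHn l' _ hl'.
have -> : \sum_(p <- l') p.2 = act M (Kh i) (\sum_(p <- l) p.2) - c *: \sum_(p <- l) p.2.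
  rewrite /l' big_map big_filter linear_sum scaler_sumr /= -sumrB big_mkcond.
  apply: eq_big_seq => p pl; rewrite hl // -scalerBl /=.
  by case: eqP => [->|]; rewrite // subrr scale0r.
have -> : \sum_(p <- l' | p.1 == k) p.2 = (k i - c) *: \sum_(p <- l | p.1 == k) p.2.
  rewrite /l' big_map big_filter_cond scaler_sumr /=; apply: congr_big => // p.
    by case: eqP => [->|_] //=; rewrite (negPf p0k).
  by move=> /andP[_ /eqP->].
move=> H; have kc : k i - c != 0 by rewrite subr_eq0.
rewrite -[X in X \in N]scale1r -(mulVf kc) -scalerA memvZ // H //.
- rewrite /l' count_map -ltnS (leq_trans _ cl) //.
  rewrite -[X in (_ < X)%N]size_filter -(count_predC (fun p => p.1 != p0.1)) !count_filter.
  rewrite -[X in (X < _)%N]addn0 -addnS leq_add //.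
    by apply: sub_count => p /= /andP[-> ->].
  by rewrite -has_count; apply/hasP; exists p0 => //=; rewrite eqxx p0k.
- by rewrite memvB ?memvZ //; apply: (hN (Some (Kh i))).
Qed.

Lemma wt_component0 (l : seq ({ffun 'I_3 -> K} * car M)) k :
  (forall p, p \in l -> has_wt p.1 p.2) -> \sum_(p <- l) p.2 = 0 ->
  \sum_(p <- l | p.1 == k) p.2 = 0.
Proof.
move=> hl s0; apply/eqP; rewrite -memv0; apply: wt_component => //.
  exact: submodule0.
by rewrite s0 mem0v.
Qed.

Hypothesis hM : qmodule M.

Lemma Kh_neq0 i u : u != 0 -> act M (Kh i) u != 0.
Proof.
by apply: contraNneq => u0; rewrite -(pt_KhiKh hM i u) u0 linear0.
Qed.

Lemma has_wt_neq0 k u : has_wt k u -> u != 0 -> forall i, k i != 0.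
Proof.
move=> hu u0 i; have := Kh_neq0 i u0; rewrite hu.
by apply: contraNneq => ->; rewrite scale0r.
Qed.

Lemma has_wt_F k i u : has_wt k u ->
  has_wt [ffun j => k j / bx j i] (act M (F i) u).
Proof. by move=> hu j; rewrite (pt_KhF hM) hu linearZ scalerA ffunE mulrC. Qed.

Lemma has_wt_E k i u : has_wt k u ->
  has_wt [ffun j => k j * bx j i] (act M (E i) u).
Proof. by move=> hu j; rewrite (pt_KhE hM) hu linearZ scalerA ffunE mulrC. Qed.

Lemma lowered_cons k i w :
  lowered k (content (i :: w)) = [ffun j => lowered k (content w) j / bx j i].
Proof.
apply/ffunP => j; rewrite !ffunE -mulrA -invfM; congr (_ / _).
rewrite (bigD1 i) //= [in RHS](bigD1 i) //= !ffunE /= eqxx add1n exprS.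
rewrite (eq_bigr (fun l => bx j l ^+ content w l)); first by ring.
by move=> l li; rewrite !ffunE /= eq_sym (negPf li).
Qed.

Lemma lowered0 k : lowered k (content [::]) = k.
Proof.
apply/ffunP => j; rewrite !ffunE big1 ?divr1 // => i _.
by rewrite ffunE expr0.
Qed.

Lemma has_wt_Fword k w u : has_wt k u -> has_wt (lowered k (content w)) (Fword w u).
Proof.
move=> hu; elim: w => [|i w IHw]; first by rewrite lowered0.
by rewrite lowered_cons; apply: has_wt_F.
Qed.

Lemma content_nil w : content w = content [::] -> w = [::].
Proof. by case: w => // i w /ffunP/(_ i); rewrite !ffunE /= eqxx. Qed.

(** * Highest weight vectors and the submodules they generate *)

Record singular (k : {ffun 'I_3 -> K}) (e : K) (s : car M) : Prop := Singular {
  sing_neq0 : s != 0;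
  sing_par : par M s = e *: s;
  sing_E : forall i, act M (E i) s = 0;
  sing_wt : has_wt k s }.

Section Generated.
Variable s : car M.

Let in_gen u := exists l : seq (K * seq 'I_3), u = \sum_(p <- l) p.1 *: Fword p.2 s.

Let in_gen0 : in_gen 0. Proof. by exists [::]; rewrite big_nil. Qed.

Let in_genP a u v : in_gen u -> in_gen v -> in_gen (a *: u + v).
Proof.
move=> [l ->] [l' ->]; exists ([seq (a * p.1, p.2) | p <- l] ++ l').
rewrite big_cat big_map scaler_sumr; congr (_ + _); apply: eq_bigr => p _.
by rewrite scalerA.
Qed.

Definition generated : {vspace car M} :=
  projT1 (cid (vspace_of_pred in_gen0 in_genP)).

Lemma generatedP u : u \in generated <->
  exists l : seq (K * seq 'I_3), u = \sum_(p <- l) p.1 *: Fword p.2 s.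
Proof. by rewrite /generated; case: cid. Qed.

Lemma Fword_generated w : Fword w s \in generated.
Proof. by apply/generatedP; exists [:: (1, w)]; rewrite big_seq1 scale1r. Qed.

Lemma generated_self : s \in generated.
Proof. exact: (Fword_generated [::]). Qed.

Lemma generated_min (N : {vspace car M}) :
  submodule N -> s \in N -> (generated <= N)%VS.
Proof.
move=> /submoduleP hN sN; apply/subvP => u /generatedP[l ->].
rewrite big_seq; apply: memv_suml => p _; apply: memvZ.
by elim: p.2 => //= i w IHw; apply: (hN (Some (F i))).
Qed.

Lemma generated_ind (f : 'End(car M)) (N : {vspace car M}) :
  (forall w, f (Fword w s) \in N) -> forall u, u \in generated -> f u \in N.
Proof.
move=> hf u /generatedP[l ->]; rewrite linear_sum; apply: memv_suml => p _.
by rewrite linearZ; apply: memvZ; apply: hf.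
Qed.

Variables (k : {ffun 'I_3 -> K}) (e : K).
Hypothesis hs : singular k e s.

Let k0 i : k i != 0. Proof. exact: has_wt_neq0 (sing_wt hs) (sing_neq0 hs) i. Qed.

Lemma Fword_par w : par M (Fword w s) = ((-1) ^+ size w * e) *: Fword w s.
Proof.
elim: w => [|i w IHw] /=; first by rewrite expr0 mul1r (sing_par hs).
by rewrite (pt_parF hM) IHw linearZ -scaleNr exprS mulN1r mulNr.
Qed.

(** [generated] is only a span of words in the F_i. It is stable under E_i because E_i can be moved
    through a word by the relation with F_j, leaving multiples of shorter words, until it meets [s]
    and gives 0. *)
Lemma generated_submodule : submodule generated.
Proof.
have wt0 w i : lowered k (content w) i != 0.
  rewrite ffunE mulf_neq0 // invr_eq0; apply/prodf_neq0 => j _.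
  by rewrite expf_neq0 // bx_neq0.
apply/submoduleP => -[[i|i|i|i]|] /=; apply: generated_ind => w.
- by rewrite (has_wt_Fword w (sing_wt hs)); apply/memvZ/Fword_generated.
- rewrite (Khi_wt hM _ (has_wt_Fword w (sing_wt hs) i)) //.
  by apply/memvZ/Fword_generated.
- elim: w => [|j w IHw] /=; first by rewrite (sing_E hs) mem0v.
  rewrite -[act M (E i) _](addrK (act M (F j) (act M (E i) (Fword w s)))) (pt_EF hM).
  rewrite memvB //; last first.
    apply: (generated_ind (f := act M (F j))) IHw => w'.
    exact: (Fword_generated (j :: w')).
  case: ifP => _; last exact: mem0v.
  have KF := has_wt_Fword w (sing_wt hs) i.
  rewrite KF [X in X - _]linearZ /= KF (Khi_wt hM _ KF) // [X in _ - X]linearZ /=.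
  rewrite (Khi_wt hM _ KF) //; apply/memvZ/memvB; do 2!apply: memvZ; exact: Fword_generated.
- exact: (Fword_generated (i :: w)).
- by rewrite Fword_par; apply/memvZ/Fword_generated.
Qed.

Lemma generated_wt u k' : u \in generated -> has_wt k' u ->
  exists2 l : seq (K * seq 'I_3), u = \sum_(p <- l) p.1 *: Fword p.2 s &
    forall p, p \in l -> lowered k (content p.2) = k'.
Proof.
move=> /generatedP[l ul] hu.
(* With [- u] added the family sums to zero, so the part of weight [k'] vanishes: [u] is the sum of
   those words that have its weight. *)
pose l' := (k', - u) :: [seq (lowered k (content p.2), p.1 *: Fword p.2 s) | p <- l].
have hl' p : p \in l' -> has_wt p.1 p.2.
  rewrite inE => /predU1P[->|/mapP[q _ ->]] /=.
    by rewrite -scaleN1r; apply: has_wtZ.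
  exact/has_wtZ/has_wt_Fword/sing_wt/hs.
have := @wt_component0 _ k' hl'.
rewrite /l' !big_cons !big_map /= eqxx -ul addNr => /(_ erefl)/eqP.
rewrite addrC subr_eq0 => /eqP e'; exists [seq p <- l | lowered k (content p.2) == k'].
  by rewrite big_filter e'.
by move=> p; rewrite mem_filter => /andP[/eqP].
Qed.

Lemma generated_wt_neq0 u k' : u \in generated -> u != 0 -> has_wt k' u ->
  exists w, k' = lowered k (content w).
Proof.
move=> ug u0 hu; have [[|p l] ul hl] := generated_wt ug hu.
  by rewrite ul big_nil eqxx in u0.
by exists p.2; rewrite hl ?mem_head.
Qed.

(** By [wt_inj], the empty word is the only one that preserves the weight. *)
Lemma generated_top u : u \in generated -> has_wt k u -> exists a, u = a *: s.
Proof.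
move=> ug hu; have [l ul hl] := generated_wt ug hu.
exists (\sum_(p <- l) p.1); rewrite ul scaler_suml; apply: eq_big_seq => p pl.
have := hl p pl; rewrite -{2}(lowered0 k) => /(wt_inj k0)/content_nil ->.
by [].
Qed.

End Generated.
End WeightVectors.
End Weights.

(** * Irreducible highest weight modules *)

Section Irreducible.
Variables (K : fieldType) (x : 'I_3 -> K) (h : K).
Hypothesis x_neq0 : forall i, x i != 0.
Hypothesis wt_inj : forall (k : {ffun 'I_3 -> K}) (n n' : {ffun 'I_3 -> nat}),
  (forall i, k i != 0) -> lowered x k n = lowered x k n' -> n = n'.
Hypothesis two_neq0 : 2 != 0 :> K.
Local Notation qmodule := (qmodule x h).
Local Notation lowered := (lowered x).
Implicit Types (M N : rep K) (k : {ffun 'I_3 -> K}).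

Lemma lowered_lowered k w w' :
  lowered (lowered k (content w)) (content w') = lowered k (content (w' ++ w)).
Proof.
elim: w' => [|i w' IHw] /=; first by rewrite lowered0.
by rewrite !lowered_cons IHw.
Qed.

Lemma irreducible_generated M k e (s : car M) : qmodule M -> irreducible M ->
  singular k e s -> generated s = fullv.
Proof.
move=> hM [_ _ irr] hs.
have [g0|//] := irr _ (generated_submodule x_neq0 hM hs) (subvf _).
have := generated_self s; rewrite g0 memv0 => /eqP s0.
by have := sing_neq0 hs; rewrite s0 eqxx.
Qed.

Lemma hom_Fword M N (f : 'Hom(car M, car N)) w (u : car M) :
  Defs.hom f -> f (Fword w u) = Fword w (f u).
Proof. by move=> /homE fh; elim: w => //= i w IHw; rewrite fh IHw. Qed.

Lemma hom_has_wt M N (f : 'Hom(car M, car N)) k (u : car M) :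
  Defs.hom f -> has_wt k u -> has_wt k (f u).
Proof. by move=> /homE fh hu i; rewrite -fh hu linearZ. Qed.

Lemma mor_singular M N (f : 'Hom(car M, car N)) k e (s : car M) :
  mor f -> f s != 0 -> singular k e s -> singular k e (f s).
Proof.
move=> fm fs hs; split=> // [|i|].
- by rewrite -(mor_par fm) (sing_par hs) linearZ.
- by rewrite -(mor_act fm) (sing_E hs) linear0.
exact/hom_has_wt/sing_wt/hs/mor_hom.
Qed.

Lemma hom_eq_generated M N (f g : 'Hom(car M, car N)) (s : car M) :
  Defs.hom f -> Defs.hom g -> generated s = fullv -> f s = g s -> f = g.
Proof.
move=> hf hg gs fgs; apply/lfunP => u; have : u \in generated s by rewrite gs memvf.
case/generatedP => l ->; rewrite !linear_sum; apply: eq_bigr => p _.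
by rewrite !linearZ /= !hom_Fword // fgs.
Qed.

(* A vector killed by all E_i need not be homogeneous; one of its two
   homogeneous parts is nonzero. *)
Lemma homogeneous_singular M k (w : car M) : qmodule M -> w != 0 ->
  (forall i, act M (E i) w = 0) -> has_wt k w ->
  exists e, exists2 u : car M, singular k e u &
    (forall U : {vspace car M}, submodule U -> w \in U -> u \in U).
Proof.
move=> hM w0 wE wK; pose u (e : K) := w + e *: par M w.
have uE e i : act M (E i) (u e) = 0.
  rewrite /u linearD linearZ /= wE add0r.
  have := pt_parE hM i w; rewrite wE linear0 => /esym/eqP.
  by rewrite oppr_eq0 => /eqP->; rewrite scaler0.
have uK e : has_wt k (u e).
  by apply/has_wtD/has_wtZ => // i; rewrite -(pt_parKh hM) wK linearZ.
have uP e : e * e = 1 -> par M (u e) = e *: u e.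
  by move=> ee; rewrite /u linearD linearZ /= (pt_par hM) scalerDr scalerA ee scale1r addrC.
have uN e (N : {vspace car M}) : submodule N -> w \in N -> u e \in N.
  by move=> /submoduleP hN wN; apply/memvD/memvZ => //; apply: (hN None).
have [u1|u1] := eqVneq (u 1) 0; last first.
  by exists 1, (u 1); [split=> //; apply: uP; rewrite mulr1|exact: uN].
exists (- 1), (u (- 1)); last exact: uN.
split=> //; last by apply: uP; rewrite mulrNN mulr1.
apply: contraNneq w0 => uN1; have : u 1 + u (- 1) = 2 *: w.
  by rewrite /u scale1r scaleN1r addrACA subrr addr0 scaler_nat mulr2n.
by rewrite u1 uN1 addr0 => /esym/eqP; rewrite scaler_eq0 (negPf two_neq0).
Qed.

Record hw_irr k e M : Prop := HwIrr {
  hw_mod : qmodule M;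
  hw_irreducible : irreducible M;
  hw_vec : exists v : car M, singular k e v }.

(** After replacing [w] by a homogeneous vector, [v] and [w] generate each other. Each weight is
    then obtained from the other by a word, and the concatenation of the two words has empty
    content. *)
Lemma hw_irr_singular k e M k' (v w : car M) : hw_irr k e M -> singular k e v ->
  w != 0 -> (forall i, act M (E i) w = 0) -> has_wt k' w ->
  k' = k /\ exists a, w = a *: v.
Proof.
move=> [hM irr _] hv w0 wE wK.
have gv := irreducible_generated hM irr hv.
have [e' [u hu _]] := homogeneous_singular hM w0 wE wK.
have gu := irreducible_generated hM irr hu.
have vgu : v \in generated u by rewrite gu memvf.
have [w1 k1] := generated_wt_neq0 hM hu vgu (sing_neq0 hv) (sing_wt hv).
have ugv : u \in generated v by rewrite gv memvf.
have [w2 k2] := generated_wt_neq0 hM hv ugv (sing_neq0 hu) (sing_wt hu).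
have kk : k' = k.
  move: k2; rewrite {1}k1 lowered_lowered -{1}(lowered0 x k').
  move=> /(wt_inj (has_wt_neq0 hM wK w0))/esym/content_nil.
  by move: k1; case: w1 => [|? ?]; case: w2 => //; rewrite lowered0.
split=> //; apply: (generated_top wt_inj hM hv); last by rewrite -kk.
by rewrite gv memvf.
Qed.

(** In M ⊕ N the submodule U generated by s = (v, w) is the graph of an isomorphism. Both
    projections are onto because their images contain highest weight vectors, and they are injective
    on U because U meets neither M nor N. *)
Lemma hw_irr_unique k e M N : hw_irr k e M -> hw_irr k e N -> M ≅ N.
Proof.
move=> [hM irrM [v hv]] [hN irrN [w hw]].
have hD := qmodule_dsum hM hN.
pose s : car (M ⊕ N) := (v, w).
have s1 : prL M N s = v by rewrite prLE.
have s2 : prR M N s = w by rewrite prRE.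
have inj2 (u u' : car (M ⊕ N)) : prL M N u = prL M N u' -> prR M N u = prR M N u' -> u = u'.
  by case: u u' => [u1 u2] [u1' u2']; rewrite !prLE !prRE /= => -> ->.
have hs : singular k e s.
  split.
  - by apply: contraNneq (sing_neq0 hv) => s0; rewrite -s1 s0 linear0.
  - apply: inj2; rewrite linearZ /= ?(mor_par (@mor_prL _ M N)) ?(mor_par (@mor_prR _ M N)).
      by rewrite s1 (sing_par hv).
    by rewrite s2 (sing_par hw).
  - move=> i; apply: inj2; rewrite linear0 ?(mor_act (@mor_prL _ M N)) ?(mor_act (@mor_prR _ M N)).
      by rewrite s1 (sing_E hv).
    by rewrite s2 (sing_E hw).
  - move=> i; apply: inj2; rewrite linearZ /= ?(mor_act (@mor_prL _ M N)) ?(mor_act (@mor_prR _ M N)).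
      by rewrite s1 (sing_wt hv).
    by rewrite s2 (sing_wt hw).
pose U := generated s; have hU : submodule U := generated_submodule x_neq0 hD hs.
have key (A : rep K) (p : 'Hom(car (M ⊕ N), car A)) (a : car A) :
    mor p -> qmodule A -> irreducible A -> singular k e a -> p s = a ->
  (p @: U)%VS = fullv.
  move=> pm hA irrA ha psa; apply/eqP; rewrite eqEsubv subvf /=.
  rewrite -(irreducible_generated hA irrA ha); apply: generated_min.
    exact: (submodule_img pm hU).
  by rewrite -psa memv_img // generated_self.
(* If U met the summand A, it would contain all of A by irreducibility, hence its highest weight
   vector [a]. By [generated_top] this vector would be a nonzero multiple of [s], whereas [s] has a
   nonzero component in the other summand. *)
have disj (A A' : rep K) (i : 'Hom(car A, car (M ⊕ N))) (p : 'Hom(car (M ⊕ N), car A')) (a : car A) :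
    mor i -> (forall u, i u = 0 -> u = 0) -> mor p -> (forall u, p (i u) = 0) -> irreducible A -> p s != 0 ->
    singular k e a -> forall u, i u \in U -> u = 0.
  move=> im i0 pm pi0 [_ _ irrA] ps0 ha u iu.
  have hV : submodule (i @^-1: U)%VS by apply: submodule_preim.
  have := irrA _ hV (subvf _); case=> V0.
    by apply/eqP; rewrite -memv0 -V0 -memv_preim.
  have : i a \in U by rewrite memv_preim V0 memvf.
  have iak : has_wt k (i a) by exact/hom_has_wt/sing_wt/ha/mor_hom.
  move=> iaU; have [c ic] := generated_top wt_inj hD hs iaU iak.
  have : p (i a) = c *: p s by rewrite ic linearZ.
  rewrite pi0 => /esym/eqP; rewrite scaler_eq0 (negPf ps0) orbF => /eqP c0.
  by have := sing_neq0 ha; rewrite (i0 a) ?eqxx // ic c0 scale0r.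
have inR0 (u : car N) : inR M N u = 0 -> u = 0 by rewrite inRE => -[].
have inL0 (u : car M) : inL M N u = 0 -> u = 0 by rewrite inLE => -[].
have kerL u : u \in U -> prL M N u = 0 -> u = 0.
  case: u => u1 u2; rewrite prLE /= => uU u10; rewrite u10 in uU *.
  rewrite (disj N M (inR M N) (prL M N) w (@mor_inR _ M N) inR0 (@mor_prL _ M N) _ irrN _ hw u2) //.
  - by move=> u; rewrite inRE prLE.
  - by rewrite s1 (sing_neq0 hv).
  - by rewrite inRE.
have kerR u : u \in U -> prR M N u = 0 -> u = 0.
  case: u => u1 u2; rewrite prRE /= => uU u20; rewrite u20 in uU *.
  rewrite (disj M N (inL M N) (prR M N) v (@mor_inL _ M N) inL0 (@mor_prR _ M N) _ irrM _ hv u1) //.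
  - by move=> u; rewrite inLE prRE.
  - by rewrite s2 (sing_neq0 hw).
  - by rewrite inLE.
have projiso (A : rep K) (p : 'Hom(car (M ⊕ N), car A)) : mor p ->
    (p @: U)%VS = fullv -> (forall u, u \in U -> p u = 0 -> u = 0) -> submod U ≅ A.
  move=> pm pS p0; apply/isoP; exists (p \o incl U)%VF; split.
  - exact: mor_comp (mor_incl hU) pm.
  - apply/inj_lker => u; rewrite comp_lfunE inclE => /p0 u0.
    by apply: val_inj; apply: u0; apply: subvsP.
  - by rewrite limg_comp limg_incl.
apply: iso_trans (projiso N (prR M N) _ _ kerR); last 2 first.
- exact: mor_prR.
- exact: key (@mor_prR _ M N) hN irrN hw s2.
apply: iso_sym; apply: (projiso M (prL M N)) => //; first exact: mor_prL.
exact: key (@mor_prL _ M N) hM irrM hv s1.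
Qed.

Lemma hom_singular_image k e M N (f : 'Hom(car M, car N)) (v : car M) :
  Defs.hom f -> singular k e v ->
  (forall i, act N (E i) (f v) = 0) /\ has_wt k (f v).
Proof.
move=> hf hv; split=> [i|]; last exact/hom_has_wt/sing_wt/hv.
by have /homE <- := hf; rewrite (sing_E hv) linear0.
Qed.

(** Schur's lemma over any field: a homomorphism, even or not, is determined by the image of the
    highest weight vector, which is again killed by the E_i and therefore a multiple of it. *)
Lemma hom_dim_hw_self k e M N : hw_irr k e M -> hw_irr k e N -> hom_dim M N = 1%N.
Proof.
move=> hM hN; rewrite -(hom_dim_isor M (hw_irr_unique hM hN)).
have [qM irrM [v hv]] := hM; have gv := irreducible_generated qM irrM hv.
have id_hom : Defs.hom (\1%VF : 'End(car M)) by exact/mor_hom/mor1.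
apply: (hom_dim1 (g := \1%VF)) => // [id0|f hf].
  by have := sing_neq0 hv; rewrite -[v](id_lfunE v) id0 zero_lfunE eqxx.
have [f0|f0] := eqVneq (f v) 0.
  exists 0; rewrite scale0r; apply: (hom_eq_generated hf (hom0 _ _) gv).
  by rewrite f0 zero_lfunE.
have [fE fK] := hom_singular_image hf hv.
have [_ [a fa]] := hw_irr_singular hM hv f0 fE fK.
exists a; apply: (hom_eq_generated hf _ gv).
  by rewrite -[_ *: _]addr0; apply: homPL id_hom (hom0 _ _).
by rewrite scale_lfunE id_lfunE.
Qed.

Lemma hom_dim_hw_neq k e k' e' M N : k != k' -> hw_irr k e M -> hw_irr k' e' N ->
  hom_dim M N = 0%N.
Proof.
move=> kk [qM irrM [v hv]] hN; have [_ _ [v' hv']] := hN.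
apply: hom_dim0 => f hf; apply: (hom_eq_generated hf (hom0 _ _) (irreducible_generated qM irrM hv)).
rewrite zero_lfunE; apply/eqP; apply: contraNT kk => f0.
have [fE fK] := hom_singular_image hf hv.
by have [-> _] := hw_irr_singular hN hv' f0 fE fK.
Qed.

End Irreducible.

(** * Contravariant forms and orthogonals *)

Section Forms.
Variables (K : fieldType) (x : 'I_3 -> K) (h : K).
Hypotheses (x_neq0 : forall i, x i != 0) (h_neq0 : h != 0).
Hypothesis wt_inj : forall (k : {ffun 'I_3 -> K}) (n n' : {ffun 'I_3 -> nat}),
  (forall i, k i != 0) -> lowered x k n = lowered x k n' -> n = n'.
Local Notation qmodule := (qmodule x h).
Local Notation lowered := (lowered x).

(* The Shapovalov form; with the factor h = q - 1/q, its values on words in the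
   F_i are Laurent polynomials in the x_i. *)
Record contravariant (M : rep K) (b : car M -> car M -> K) : Prop := Contravariant {
  form_linear : forall a u v w, b (a *: u + v) w = a * b u w + b v w;
  form_sym : forall u v, b u v = b v u;
  form_Kh : forall i u v, b (act M (Kh i) u) v = b u (act M (Kh i) v);
  form_E : forall i u v, h * b (act M (E i) u) v = b u (act M (F i) v);
  form_par : forall u v, b (par M u) v = b u (par M v);
  form_nondeg : forall u, (forall v, b u v = 0) -> u = 0 }.

Section OneForm.
Variables (M : rep K) (b : car M -> car M -> K).
Hypotheses (hM : qmodule M) (hb : contravariant b).
Implicit Types (u v s : car M) (U N W : {vspace car M}).

Lemma form0l v : b 0 v = 0.
Proof. by have := form_linear hb (-1) 0 0 v; rewrite scaler0 addr0 mulN1r addNr. Qed.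
Lemma form0r v : b v 0 = 0. Proof. by rewrite (form_sym hb) form0l. Qed.
Lemma formDl u v (w : car M) : b (u + v) w = b u w + b v w.
Proof. by rewrite -[u]scale1r (form_linear hb) mul1r scale1r. Qed.
Lemma formDr u v (w : car M) : b w (u + v) = b w u + b w v.
Proof. by rewrite !(form_sym hb w) formDl. Qed.
Lemma formZl a u v : b (a *: u) v = a * b u v.
Proof. by rewrite -[a *: u]addr0 (form_linear hb) form0l addr0. Qed.
Lemma formZr a u v : b v (a *: u) = a * b v u.
Proof. by rewrite !(form_sym hb v) formZl. Qed.
Lemma form_suml I (r : seq I) (P : pred I) (f : I -> car M) v :
  b (\sum_(i <- r | P i) f i) v = \sum_(i <- r | P i) b (f i) v.
Proof. by elim/big_rec2: _ => [|i y1 y2 _ <-]; rewrite ?form0l ?formDl. Qed.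
Lemma form_sumr I (r : seq I) (P : pred I) (f : I -> car M) v :
  b v (\sum_(i <- r | P i) f i) = \sum_(i <- r | P i) b v (f i).
Proof. by elim/big_rec2: _ => [|i y1 y2 _ <-]; rewrite ?form0r ?formDr. Qed.

Lemma form_F i u v : b (act M (F i) u) v = h * b u (act M (E i) v).
Proof. by rewrite (form_sym hb) -(form_E hb) (form_sym hb). Qed.

Lemma form_Khi i u v : b (act M (Khi i) u) v = b u (act M (Khi i) v).
Proof. by rewrite -{1}(pt_KhKhi hM i v) -(form_Kh hb) (pt_KhKhi hM). Qed.

Lemma form_Fword w u v : b (Fword w u) v = h ^+ size w * b u (Eword w v).
Proof.
by elim: w v => [|i w IHw] v /=; rewrite ?mul1r // form_F IHw mulrA exprS.
Qed.

Lemma form_wt k k' u v : has_wt k u -> has_wt k' v -> k != k' -> b u v = 0.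
Proof.
move=> hu hv; apply: contraNeq => buv; apply/eqP/ffunP => i.
have := form_Kh hb i u v; rewrite hu hv formZl formZr => /eqP.
by rewrite -subr_eq0 -mulrBl mulf_eq0 (negPf buv) orbF subr_eq0 => /eqP.
Qed.

Let perp0 U v : v \in U -> b 0 v = 0. Proof. by rewrite form0l. Qed.

Let perpL U a u v : (forall w, w \in U -> b u w = 0) ->
  (forall w, w \in U -> b v w = 0) -> forall w, w \in U -> b (a *: u + v) w = 0.
Proof. by move=> hu hv w wU; rewrite (form_linear hb) hu // hv // mulr0 addr0. Qed.

Definition perp U : {vspace car M} :=
  projT1 (cid (vspace_of_pred (@perp0 U) (@perpL U))).

Lemma perpP U u : u \in perp U <-> forall v, v \in U -> b u v = 0.
Proof. by rewrite /perp; case: cid. Qed.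

Lemma perp_sub U W : (U <= perp W)%VS <-> forall u w, u \in U -> w \in W -> b u w = 0.
Proof.
split=> [/subvP UW u w /UW/perpP|UW]; first exact.
by apply/subvP => u uU; apply/perpP => w; apply: UW.
Qed.

Lemma perp_sub_sym U W : (U <= perp W)%VS -> (W <= perp U)%VS.
Proof.
by move=> /perp_sub UW; apply/perp_sub => w u wW uU; rewrite (form_sym hb) UW.
Qed.

Lemma perpS U W : (U <= W)%VS -> (perp W <= perp U)%VS.
Proof.
move=> /subvP UW; apply/subvP => u /perpP hu; apply/perpP => v /UW; exact: hu.
Qed.

(** The intersection contains the kernel, on U, of the map that pairs a vector with a basis of W;
    the image of this map has dimension at most that of W. *)
Lemma dim_perp_ge U W : (\dim U <= \dim W + \dim (U :&: perp W)%VS)%N.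
Proof.
pose X := vbasis W; pose phi := linfun (fun u => \row_i b u X`_i) : 'Hom(car M, 'rV[K]_(\dim W)).
have phiE u : phi u = \row_i b u X`_i.
  apply: (linfunE (f := fun u => \row_i b u X`_i)) => a v w.
  by apply/rowP => i; rewrite !mxE (form_linear hb).
rewrite -(limg_ker_dim phi U) addnC leq_add //.
  rewrite (leq_trans (dimvS (subvf _))) // dimvf dim_matrix.
  by apply: eq_leq; apply: mul1n.
apply/dimvS/subvP => u; rewrite !memv_cap memv_ker phiE => /andP[-> /eqP/rowP u0] /=.
apply/perpP => w wW; rewrite (coord_vbasis wW) form_sumr big1 // => i _.
by rewrite formZr; have := u0 i; rewrite !mxE => ->; rewrite mulr0.
Qed.

Lemma dim_perp U : (\dim U + \dim (perp U))%N = dim (car M).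
Proof.
apply/eqP; rewrite eqn_leq; apply/andP; split; last first.
  by have := dim_perp_ge fullv U; rewrite capfv dimvf.
(* A vector of U orthogonal to a complement of [perp U] is orthogonal to the whole space, as U is
   orthogonal to [perp U]. Nondegeneracy makes it zero. *)
have := dim_perp_ge U (perp U)^C; rewrite dimv_compl dimvf.
rewrite [X in _ (_ + X)%N](_ : _ = 0%N) => [dU|].
  rewrite addn0 in dU; rewrite -(leq_add2r (\dim (perp U))) in dU.
  by rewrite (leq_trans dU) // subnK // -dimvf dimvS ?subvf.
apply/eqP; rewrite dimv_eq0; apply/eqP/zerovP => u; rewrite memv_cap => /andP[uU /perpP uC].
apply: (form_nondeg hb) => v; have := memvf v; rewrite -(addv_complf (perp U)).
case/memv_addP => v1 /perpP v1U [v2 v2C ->].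
by rewrite formDr (uC v2) // addr0 (form_sym hb) v1U.
Qed.

Lemma submodule_perp U : submodule U -> submodule (perp U).
Proof.
move=> /submoduleP hU; apply/submoduleP => o u /perpP hu; apply/perpP => v vU.
case: o => [[i|i|i|i]|] /=.
- by rewrite (form_Kh hb) hu //; apply: (hU (Some (Kh i))).
- by rewrite form_Khi hu //; apply: (hU (Some (Khi i))).
- apply: (mulfI h_neq0); rewrite (form_E hb) hu ?mulr0 //.
  by apply: (hU (Some (F i))).
- by rewrite form_F hu ?mulr0 //; apply: (hU (Some (E i))).
- by rewrite (form_par hb) hu //; apply: (hU None).
Qed.

Lemma submodule_Eword U w u : submodule U -> u \in U -> Eword w u \in U.
Proof.
move=> /submoduleP hU; elim: w u => //= i w IHw u uU; apply: IHw.
exact: (hU (Some (E i))).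
Qed.

(** The F_i of a word move to the other side as E_i, which preserve the second module. What remains
    is the pairing of [s] with vectors of weights different from [k]. *)
Lemma generated_perp k e s k' e' s' : singular k e s -> singular k' e' s' ->
  (forall w, k != lowered k' (content w)) ->
  (generated s <= perp (generated s'))%VS.
Proof.
move=> hs hs' kk'; apply/perp_sub => u y /generatedP[l ->] yg.
rewrite form_suml big1 // => p _; rewrite formZl form_Fword.
have : Eword p.2 y \in generated s'.
  by apply: submodule_Eword => //; exact: (generated_submodule x_neq0 hM hs').
case/generatedP => l' ->; rewrite form_sumr big1 ?mulr0 // => q _.
by rewrite formZr (form_wt (sing_wt hs) (has_wt_Fword hM q.2 (sing_wt hs'))) // mulr0.
Qed.

Section Radical.
Variables (k : {ffun 'I_3 -> K}) (e : K) (s : car M).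
Hypothesis hs : singular k e s.

Let k0 i : k i != 0. Proof. exact: (has_wt_neq0 hM (sing_wt hs) (sing_neq0 hs)). Qed.

(* The component of highest weight of an element of a proper submodule of
   [generated s] vanishes. *)
Lemma proper_submodule_perp N : submodule N -> (N <= generated s)%VS -> s \notin N ->
  (N <= perp (generated s))%VS.
Proof.
move=> hN Ng sN; apply: perp_sub_sym; apply/perp_sub => u y /generatedP[l ->] yN.
rewrite form_suml big1 // => p _; rewrite formZl form_Fword.
set z := Eword p.2 y; have zN : z \in N by exact: submodule_Eword.
have /generatedP[l' zl'] := subvP Ng _ zN.
pose L := [seq (lowered k (content q.2), q.1 *: Fword q.2 s) | q <- l'].
have hL q : q \in L -> has_wt q.1 q.2.
  by case/mapP => q' _ ->; apply/has_wtZ/(has_wt_Fword hM)/sing_wt/hs.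
have sL : \sum_(q <- L) q.2 = z by rewrite big_map.
have topN : \sum_(q <- L | q.1 == k) q.2 \in N by apply: wt_component; rewrite ?sL.
have [a topE] : exists a, \sum_(q <- L | q.1 == k) q.2 = a *: s.
  exists (\sum_(q <- l' | lowered k (content q.2) == k) q.1).
  rewrite big_map scaler_suml; apply: eq_bigr => q /eqP.
  rewrite -{2}(lowered0 x k) => /(wt_inj k0)/content_nil -> //.
have a0 : a = 0.
  apply: contraNeq sN => a0; rewrite topE in topN.
  by rewrite -[s]scale1r -(mulVf a0) -scalerA memvZ.
rewrite -sL form_sumr (bigID (fun q => q.1 == k)) /= -form_sumr topE a0 scale0r form0r add0r.
rewrite big_seq_cond big1 ?mulr0 // => q /andP[qL qk].
by rewrite (form_wt (sing_wt hs) (hL q qL)) // eq_sym.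
Qed.

End Radical.
End OneForm.
End Forms.

Delimit Scope Z_scope with ZZ.
(** * Laurent polynomials in two variables *)

(* A computable ring: a term [(i, j, c)] stands for c x^i y^j. *)
Definition mono : Type := Z * Z.
Definition poly2 := seq (mono * Z).

Definition mono_mul (m n : mono) : mono := (m.1 + n.1, m.2 + n.2)%ZZ.
Definition mono_inv (m : mono) : mono := (- m.1, - m.2)%ZZ.

Definition mono_cmp (m n : mono) : comparison :=
  match Z.compare m.1 n.1 with Eq => Z.compare m.2 n.2 | c => c end.

(** Merges lists sorted for [mono_cmp] and drops zero coefficients, so that a difference of equal
    polynomials reduces to the empty list. [poly_eval_add] holds for arbitrary lists, so sortedness
    matters only for the success of the tests. The inner [fix] allows the recursion to descend in
    either list. *)
Fixpoint poly_add (p : poly2) : poly2 -> poly2 :=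
  fix add q :=
  match p, q with
  | [::], _ => q
  | _, [::] => p
  | (m, c) :: p', (n, d) :: q' =>
    match mono_cmp m n with
    | Lt => (m, c) :: poly_add p' q
    | Gt => (n, d) :: add q'
    | Eq => let s := (c + d)%ZZ in
      if (s =? 0)%ZZ then poly_add p' q' else (m, s) :: poly_add p' q'
    end
  end.

Definition poly_term (m : mono) (c : Z) (p : poly2) : poly2 :=
  [seq (mono_mul m t.1, (c * t.2)%ZZ) | t <- p].
Definition poly_opp : poly2 -> poly2 := poly_term (0, 0)%ZZ (-1)%ZZ.
Definition poly_mul (p q : poly2) : poly2 :=
  foldr (fun t r => poly_add (poly_term t.1 t.2 q) r) [::] p.
Definition poly_mono (m : mono) : poly2 := [:: (m, 1%ZZ)].
Definition poly_one : poly2 := poly_mono (0, 0)%ZZ.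
Definition poly_eq (p q : poly2) : bool := nilp (poly_add p (poly_opp q)).

Section Eval.
Variables (K : fieldType) (a b : K).
Hypotheses (a_neq0 : a != 0) (b_neq0 : b != 0).

Definition mono_eval (m : mono) : K := a ^ int_of_Z m.1 * b ^ int_of_Z m.2.
Definition poly_eval (p : poly2) : K :=
  \sum_(t <- p) (int_of_Z t.2)%:~R * mono_eval t.1.

Lemma mono_eval_mul m n : mono_eval (mono_mul m n) = mono_eval m * mono_eval n.
Proof.
rewrite /mono_eval /= !(rmorphD int_of_Z) /= !expfzDr //; ring.
Qed.

Lemma mono_eval0 : mono_eval (0, 0)%ZZ = 1.
Proof. by rewrite /mono_eval /= !expr0z mulr1. Qed.

Lemma mono_eval_neq0 m : mono_eval m != 0.
Proof. by rewrite mulf_neq0 // expfz_neq0. Qed.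

Lemma mono_eval_inv m : mono_eval (mono_inv m) = (mono_eval m)^-1.
Proof.
apply: (mulfI (mono_eval_neq0 m)); rewrite divff ?mono_eval_neq0 // -mono_eval_mul.
by rewrite /mono_mul /mono_inv /= !Z.add_opp_diag_r mono_eval0.
Qed.

Lemma poly_eval_cons t p :
  poly_eval (t :: p) = (int_of_Z t.2)%:~R * mono_eval t.1 + poly_eval p.
Proof. by rewrite /poly_eval big_cons. Qed.

Lemma poly_eval_nil : poly_eval [::] = 0.
Proof. by rewrite /poly_eval big_nil. Qed.

Lemma mono_cmp_eq m n : mono_cmp m n = Eq -> m = n.
Proof.
case: m n => [m1 m2] [n1 n2]; rewrite /mono_cmp /=.
by case: Z.compare_spec => // ->; case: Z.compare_spec => // ->.
Qed.

Lemma poly_eval_add p q : poly_eval (poly_add p q) = poly_eval p + poly_eval q.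
Proof.
elim: p q => [|[m c] p IHp] q; first by case: q => [|? ?]; rewrite poly_eval_nil add0r.
elim: q => [|[n d] q IHq]; first by rewrite poly_eval_nil addr0.
rewrite [poly_add _ _]/=; case E: (mono_cmp m n).
- have <- := mono_cmp_eq E; case: Z.eqb_spec => cd.
    have -> : d = (- c)%ZZ by Lia.lia.
    rewrite IHp !poly_eval_cons /= (rmorphN int_of_Z) /= mulrNz; ring.
  by rewrite !poly_eval_cons /= IHp (rmorphD int_of_Z) /= mulrzDr; ring.
- by rewrite !poly_eval_cons IHp /= poly_eval_cons addrA.
- rewrite poly_eval_cons -/(poly_add ((m, c) :: p) q) IHq !poly_eval_cons /=; ring.
Qed.

Lemma poly_eval_term m c p :
  poly_eval (poly_term m c p) = (int_of_Z c)%:~R * mono_eval m * poly_eval p.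
Proof.
elim: p => [|t p IHp]; first by rewrite poly_eval_nil mulr0.
rewrite /= !poly_eval_cons IHp /= mono_eval_mul (rmorphM int_of_Z) /= intrM; ring.
Qed.

Lemma poly_eval_opp p : poly_eval (poly_opp p) = - poly_eval p.
Proof. by rewrite poly_eval_term mono_eval0 mulr1 mulN1r. Qed.

Lemma poly_eval_mul p q : poly_eval (poly_mul p q) = poly_eval p * poly_eval q.
Proof.
elim: p => [|t p IHp]; first by rewrite poly_eval_nil mul0r.
by rewrite /= poly_eval_add IHp poly_eval_term poly_eval_cons mulrDl.
Qed.

Lemma poly_eval_mono m : poly_eval (poly_mono m) = mono_eval m.
Proof. by rewrite poly_eval_cons poly_eval_nil addr0 mul1r. Qed.

Lemma poly_eval_one : poly_eval poly_one = 1.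
Proof. by rewrite poly_eval_mono mono_eval0. Qed.

Lemma poly_eqP p q : poly_eq p q -> poly_eval p = poly_eval q.
Proof.
move=> /nilP pq; have := poly_eval_add p (poly_opp q).
by rewrite pq poly_eval_nil poly_eval_opp => /esym/eqP; rewrite subr_eq0 => /eqP.
Qed.

End Eval.

(** * Formal computations in highest weight modules *)

(* Letters are 0, 1, 2; a combination of words stands for a combination of the
   vectors [Fword w s]. *)
Definition word := seq nat.
Definition lcomb := seq (poly2 * word).

Definition letter (i : nat) : 'I_3 := inord i.

(* The exponents of q^(B_ij / 2) in x_0, x_1, with x_2 = (x_0 x_1)^-1. *)
Definition pairing (i j : nat) : mono :=
  if i == j then (0, 0)%ZZ else
  match (3 - i - j)%N with 0%N => (1, 0)%ZZ | 1%N => (0, 1)%ZZ | _ => (-1, -1)%ZZ end.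

Definition weight_mono (top : nat -> mono) (i : nat) (w : word) : mono :=
  foldr (fun j m => mono_mul (mono_inv (pairing i j)) m) (top i) w.

(** For [m] the eigenvalue of K_i^{1/2}, this is the eigenvalue of K_i - 1/K_i, that is, h times a
    q-number. *)
Definition bracket (m : mono) : poly2 :=
  let m2 := mono_mul m m in
  poly_add (poly_mono m2) (poly_opp (poly_mono (mono_inv m2))).

Fixpoint lc_add (p : poly2) (w : word) (l : lcomb) : lcomb :=
  if l is (p', w') :: l' then
    if w == w' then
      let s := poly_add p p' in if nilp s then l' else (s, w) :: l'
    else (p', w') :: lc_add p w l'
  else if nilp p then [::] else [:: (p, w)].

(* F_i F_i = 0 *)
Definition lc_cons (i : nat) (l : lcomb) : lcomb :=
  [seq (t.1, i :: t.2) | t <- l & ohead t.2 != Some i].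

Definition lc_opp (l : lcomb) : lcomb := [seq (poly_opp t.1, t.2) | t <- l].

(** Computes h E_i on a word; the factor h keeps the coefficients in the ring of Laurent
    polynomials. *)
Fixpoint E_word (top : nat -> mono) (i : nat) (w : word) : lcomb :=
  if w is j :: w' then
    let r := lc_opp (lc_cons j (E_word top i w')) in
    if i == j then lc_add (bracket (weight_mono top i w')) w' r else r
  else [::].

Definition lc_lincomb (p : poly2) (l1 l2 : lcomb) : lcomb :=
  foldr (fun t r => lc_add (poly_mul p t.1) t.2 r) l2 l1.

Definition E_lcomb (top : nat -> mono) (i : nat) (l : lcomb) : lcomb :=
  foldr (fun t r => lc_lincomb t.1 (E_word top i t.2) r) [::] l.

Definition gram_lc (top : nat -> mono) (u : word) (l : lcomb) : lcomb :=
  foldl (fun l i => E_lcomb top i l) l u.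

(** A Gram entry is meaningful only if a multiple of the highest weight vector is left; [None]
    reports any other outcome and makes the certificate fail. *)
Definition lc_scalar (l : lcomb) : option poly2 :=
  match l with [::] => Some [::] | [:: (p, [::])] => Some p | _ => None end.

Section LcombValue.
Variables (K : fieldType) (a b : K) (V : lmodType K) (phi : word -> V).
Hypotheses (a_neq0 : a != 0) (b_neq0 : b != 0).
Local Notation peval := (poly_eval a b).

Definition lc_val (l : lcomb) : V := \sum_(t <- l) peval t.1 *: phi t.2.

Lemma lc_val_cons t l : lc_val (t :: l) = peval t.1 *: phi t.2 + lc_val l.
Proof. by rewrite /lc_val big_cons. Qed.

Lemma lc_val_nil : lc_val [::] = 0. Proof. by rewrite /lc_val big_nil. Qed.

Lemma lc_val_add p w l : lc_val (lc_add p w l) = peval p *: phi w + lc_val l.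
Proof.
elim: l => [|[p' w'] l IHl] /=.
  by case: nilP => [->|_]; rewrite ?lc_val_cons !lc_val_nil ?poly_eval_nil ?scale0r ?addr0.
case: eqP => [<-|_]; last by rewrite !lc_val_cons IHl addrCA.
have : peval (poly_add p p') = peval p + peval p' by apply: poly_eval_add.
case: nilP => [->|_] E; rewrite ?lc_val_cons /= addrA -scalerDl -E.
  by rewrite poly_eval_nil scale0r add0r.
by [].
Qed.

Lemma lc_val_opp l : lc_val (lc_opp l) = - lc_val l.
Proof.
rewrite /lc_val big_map -sumrN; apply: eq_bigr => t _.
by rewrite poly_eval_opp ?scaleNr.
Qed.

Lemma lc_val_lincomb p l1 l2 :
  lc_val (lc_lincomb p l1 l2) = peval p *: lc_val l1 + lc_val l2.
Proof.
elim: l1 => [|t l1 IHl] /=; first by rewrite lc_val_nil scaler0 add0r.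
by rewrite lc_val_add IHl lc_val_cons scalerDr scalerA poly_eval_mul ?addrA.
Qed.

End LcombValue.

Section Semantics.
Variables (K : fieldType) (x : 'I_3 -> K) (h : K).
Hypothesis x_neq0 : forall i, x i != 0.
Hypothesis x_prod : x 0 * x 1 * x 2 = 1.
Hypothesis h_neq0 : h != 0.
Local Notation qmodule := (qmodule x h).
Local Notation meval := (mono_eval (x 0) (x 1)).
Local Notation peval := (poly_eval (x 0) (x 1)).

Variables (M : rep K) (hM : qmodule M).
Variables (top : nat -> mono) (k : {ffun 'I_3 -> K}) (e : K) (s : car M).
Hypothesis hs : singular k e s.
Hypothesis ktop : forall i, (i < 3)%N -> k (letter i) = meval (top i).

Definition wd (w : word) : seq 'I_3 := map letter w.
Definition lc_eval : lcomb -> car M := lc_val (x 0) (x 1) (fun w => Fword (wd w) s).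

Local Notation xx := (x_neq0 0, x_neq0 1).
Let pD p q : peval (poly_add p q) = peval p + peval q.
Proof. exact: poly_eval_add. Qed.
Let pM p q : peval (poly_mul p q) = peval p * peval q.
Proof. by apply: poly_eval_mul. Qed.
Let pN p : peval (poly_opp p) = - peval p.
Proof. by apply: poly_eval_opp. Qed.

Lemma x2E : x 2 = (x 0 * x 1)^-1.
Proof.
by apply: (mulfI (mulf_neq0 (x_neq0 0) (x_neq0 1))); rewrite x_prod divff // mulf_neq0.
Qed.

Lemma letter_pairing i j : (i < 3)%N -> (j < 3)%N ->
  bx x (letter i) (letter j) = meval (pairing i j).
Proof.
have l0 : letter 0 = 0 by apply: val_inj; rewrite /= inordK.
have l1 : letter 1 = 1 by apply: val_inj; rewrite /= inordK.
have l2 : letter 2 = 2 by apply: val_inj; rewrite /= inordK.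
have e2 : meval (-1, -1)%ZZ = x 2.
  rewrite x2E -[(-1, -1)%ZZ]/(mono_inv (1, 1)%ZZ) mono_eval_inv ?xx //.
have e0 : meval (1, 0)%ZZ = x 0 by rewrite /mono_eval /= expr0z expr1z mulr1.
have e1 : meval (0, 1)%ZZ = x 1 by rewrite /mono_eval /= expr0z expr1z mul1r.
case: i => [|[|[|]]] // _; case: j => [|[|[|]]] // _;
  rewrite /bx ?l0 ?l1 ?l2 /pairing /= ?mono_eval0 ?e0 ?e1 ?e2 //;
  congr (x _); exact: val_inj.
Qed.

Lemma has_wt_top w i : (i < 3)%N -> all (fun j => j < 3)%N w ->
  act M (Kh (letter i)) (Fword (wd w) s) =
  meval (weight_mono top i w) *: Fword (wd w) s.
Proof.
move=> i3; elim: w => [_|j w IHw /= /andP[j3 w3]].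
  by rewrite /= (sing_wt hs) ktop.
rewrite (pt_KhF hM) IHw // linearZ /= scalerA mono_eval_mul ?xx //.
by rewrite mono_eval_inv ?xx // letter_pairing.
Qed.

Lemma lc_eval_cons t l : lc_eval (t :: l) = peval t.1 *: Fword (wd t.2) s + lc_eval l.
Proof. exact: lc_val_cons. Qed.

Lemma lc_eval_nil : lc_eval [::] = 0. Proof. exact: lc_val_nil. Qed.

Lemma lc_eval_consF i l : lc_eval (lc_cons i l) = act M (F (letter i)) (lc_eval l).
Proof.
rewrite /lc_eval /lc_val big_map big_filter linear_sum big_mkcond; apply: eq_bigr => t _.
rewrite linearZ /=; case: ifP => // /negbFE/eqP.
by case: t.2 => //= j w [->]; rewrite (pt_FF hM) scaler0.
Qed.

Lemma bracket_eval m : peval (bracket m) = meval m ^+ 2 - meval m ^- 2.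
Proof.
rewrite /bracket pD pN !poly_eval_mono ?xx // mono_eval_inv ?xx //.
by rewrite mono_eval_mul ?xx // expr2.
Qed.

Lemma letter_inj i j : (i < 3)%N -> (j < 3)%N -> (letter i == letter j) = (i == j).
Proof. by move=> i3 j3; rewrite -val_eqE /= !inordK. Qed.

Lemma E_word_eval i w : (i < 3)%N -> all (fun j => j < 3)%N w ->
  h *: act M (E (letter i)) (Fword (wd w) s) = lc_eval (E_word top i w).
Proof.
move=> i3; elim: w => [_|j w IHw /= /andP[j3 w3]].
  by rewrite /= (sing_E hs) scaler0 lc_eval_nil.
rewrite -[act M (E _) _](addrK (act M (F (letter j)) (act M (E (letter i)) (Fword (wd w) s)))).
rewrite (pt_EF hM) letter_inj // scalerBr -linearZ /= IHw // -lc_eval_consF.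
have KF := has_wt_top i3 w3; set m := weight_mono top i w in KF *.
case: ifP => _; last by rewrite scaler0 [RHS]lc_val_opp ?xx // add0r.
rewrite /lc_eval lc_val_add ?xx // lc_val_opp ?xx // bracket_eval; congr (_ - _).
rewrite scalerA divff // scale1r KF linearZ /= KF.
rewrite (Khi_wt hM _ KF) ?mono_eval_neq0 ?xx // [X in _ - X]linearZ /=.
by rewrite (Khi_wt hM _ KF) ?mono_eval_neq0 ?xx // !scalerA -scalerBl expr2 -invfM.
Qed.

Definition lc_ok (l : lcomb) := all (fun t => all (fun j => j < 3)%N t.2) l.

Lemma lc_ok_add p w l : all (fun j => j < 3)%N w -> lc_ok l -> lc_ok (lc_add p w l).
Proof.
move=> w3; elim: l => [|[p' w'] l IHl] /=; first by case: ifP => //= _; rewrite w3.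
by case/andP => w'3 l3; case: ifP => _; [case: ifP => //= _; rewrite w3|rewrite /= w'3 IHl].
Qed.

Lemma lc_ok_E_word i w : (i < 3)%N -> all (fun j => j < 3)%N w -> lc_ok (E_word top i w).
Proof.
move=> i3; elim: w => //= j w IHw /andP[j3 w3].
have ok : lc_ok (lc_opp (lc_cons j (E_word top i w))).
  rewrite /lc_ok all_map all_map; apply/allP => t; rewrite mem_filter => /andP[_ tl] /=.
  by rewrite j3; apply: (allP (IHw w3)).
by case: ifP => // _; apply: lc_ok_add.
Qed.

Lemma E_lcomb_eval i l : (i < 3)%N -> lc_ok l ->
  h *: act M (E (letter i)) (lc_eval l) = lc_eval (E_lcomb top i l) /\
  lc_ok (E_lcomb top i l).
Proof.
move=> i3; elim: l => [_|[p w] l IHl /= /andP[w3 /IHl[IH ok]]] /=.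
  by rewrite lc_eval_nil linear0 scaler0.
have aux (l1 l2 : lcomb) : lc_ok l1 -> lc_ok l2 -> lc_ok (lc_lincomb p l1 l2).
  elim: l1 => [|t l1 IH1] //= /andP[t3 l13] l23; apply: lc_ok_add => //; exact: IH1.
split; last exact: aux (lc_ok_E_word i3 w3) ok.
rewrite [RHS]lc_val_lincomb ?xx // -![lc_val _ _ _ _]/(lc_eval _).
rewrite lc_eval_cons linearD linearZ /= scalerDr IH -E_word_eval //.
by rewrite !scalerA mulrC.
Qed.

Lemma gram_lc_eval u l : all (fun j => j < 3)%N u -> lc_ok l ->
  h ^+ size u *: Eword (wd u) (lc_eval l) = lc_eval (gram_lc top u l) /\
  lc_ok (gram_lc top u l).
Proof.
have EZ w a v : @Eword K M w (a *: v) = a *: Eword w v.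
  by elim: w v => //= i w IHw v; rewrite linearZ; apply: IHw.
elim: u l => [|i u IHu] l /=; first by rewrite expr0 scale1r.
move=> /andP[i3 u3] ok; have [IE okE] := E_lcomb_eval i3 ok.
have [IH okI] := IHu _ u3 okE; split=> //.
rewrite -IH -IE EZ exprSr scalerA //.
Qed.

Lemma gram_scalar_eval u l p : all (fun j => j < 3)%N u -> lc_ok l ->
  lc_scalar (gram_lc top u l) = Some p ->
  h ^+ size u *: Eword (wd u) (lc_eval l) = peval p *: s.
Proof.
move=> u3 l3; have [-> _] := gram_lc_eval u3 l3.
case: (gram_lc top u l) => [[<-]|[q [|? ?]] [|? ?]] //=.
  by rewrite lc_eval_nil poly_eval_nil scale0r.
by move=> [<-]; rewrite lc_eval_cons lc_eval_nil addr0.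
Qed.

End Semantics.

(** * Certificates for the nondegeneracy of Gram matrices *)

Definition drop_nth (T : Type) (n : nat) (l : seq T) : seq T := take n l ++ drop n.+1 l.

(* Laplace expansion; nothing is proved about it, the identity
   [adjugate G * G = d] being checked on the result. *)
Fixpoint poly_det (fuel : nat) (m : seq (seq poly2)) : poly2 :=
  if fuel is n.+1 then
    if m is r :: m' then
      foldr (fun i acc =>
          let t := poly_mul (nth [::] r i) (poly_det n [seq drop_nth i r' | r' <- m']) in
          poly_add (if odd i then poly_opp t else t) acc)
        [::] (iota 0 (size r))
    else poly_one
  else poly_one.

Definition adjugate (m : seq (seq poly2)) : seq (seq poly2) :=
  let n := size m in
  [seq [seq (let t := poly_det n [seq drop_nth i r | r <- drop_nth j m] in
             if odd (i + j) then poly_opp t else t) | j <- iota 0 n] | i <- iota 0 n].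

Definition gram_entry (top : nat -> mono) (u w : word) : option poly2 :=
  lc_scalar (gram_lc top u [:: (poly_one, w)]).

Definition opt_poly (o : option poly2) : poly2 := if o is Some p then p else [::].

(* The factors allowed in a Gram determinant; with t_i = x_i^2, they are 2, the
   values at t_i of the cyclotomic polynomials of index 1, 2, 4, and t_i + t_j,
   t_i - t_j. *)
Definition factors : seq poly2 :=
  let X (i : nat) : mono := match i with 0%N => (2, 0) | 1%N => (0, 2) | _ => (-2, -2) end%ZZ in
  [:: ((0, 0), 2)%ZZ] ::
  flatten [seq [:: poly_add (poly_mono (X i)) (poly_opp poly_one);
                   poly_add (poly_mono (X i)) poly_one;
                   poly_add (poly_mono (mono_mul (X i) (X i))) poly_one] | i <- [:: 0; 1; 2]%N] ++
  flatten [seq [:: poly_add (poly_mono (X p.1)) (poly_opp (poly_mono (X p.2)));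
                   poly_add (poly_mono (X p.1)) (poly_mono (X p.2))]
          | p <- [:: (0, 1); (0, 2); (1, 2)]%N].

Definition factored (ms : mono * bool) (fl : seq (nat * nat)) : poly2 :=
  let p := foldr (fun f acc => iter f.2 (poly_mul (nth poly_one factors f.1)) acc)
             (poly_mono ms.1) fl in
  if ms.2 then poly_opp p else p.

(* Words, unit and factors (with multiplicities) of one Gram determinant. *)
Definition class_cert : Type := seq word * (mono * bool) * seq (nat * nat).
Definition ClassCert ws ms fl : class_cert := (ws, ms, fl).
Definition cc_words (c : class_cert) := c.1.1.
Definition cc_unit (c : class_cert) := c.1.2.
Definition cc_factors (c : class_cert) := c.2.

(** A left inverse of the Gram matrix up to a nonvanishing factor is what nondegeneracy means here.
    Testing A G = d with the factored [d] verifies the adjugate and the factorisation of the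
    determinant in one step. *)
Definition check_class (top : nat -> mono) (c : class_cert) : bool :=
  let ws := cc_words c in
  let n := size ws in
  let G := [seq [seq gram_entry top u w | w <- ws] | u <- ws] in
  let G' := [seq [seq opt_poly p | p <- r] | r <- G] in
  let A := adjugate G' in
  let d := factored (cc_unit c) (cc_factors c) in
  all (fun w => all (fun j => j < 3)%N w) ws &&
  all (all isSome) G &&
  all (fun i => all (fun j =>
    poly_eq (foldr (fun l acc => poly_add (poly_mul (nth [::] (nth [::] A i) l)
                                                    (nth [::] (nth [::] G' l) j)) acc)
              [::] (iota 0 n))
            (if i == j then d else [::])) (iota 0 n)) (iota 0 n).

Definition counts (w : word) : seq nat := [seq count_mem i w | i <- [:: 0; 1; 2]%N].

Definition cert_words (cs : seq class_cert) : seq word := flatten [seq cc_words c | c <- cs].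

(** By the last clause a class consists of all the words of the certificate with given letter
    counts. The weight components of a combination of words are thus exactly its parts in the
    classes. *)
Definition check_cert (top : nat -> mono) (cs : seq class_cert) : bool :=
  all (check_class top) cs &&
  uniq (cert_words cs) &&
  all (fun c => [seq w <- cert_words cs | counts w == counts (head [::] (cc_words c))]
                == cc_words c) cs.

(** The K_i^{1/2}-eigenvalue of a vector of weight (a,b,c) is the product of the x_j^(± n_j / 2),
    where (n_0, n_1, n_2) = (a, b, c) and the sign is negative exactly for j = i; then x_2 is
    eliminated. The divisions are exact when a, b, c have the same parity, as for all the weights
    considered. *)
Definition top_mono (a b c : Z) (i : nat) : mono :=
  match i with
  | 0%N => ((- a - c) / 2, (b - c) / 2)%ZZ
  | 1%N => ((a - c) / 2, (- b - c) / 2)%ZZ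
  | _ => ((a + c) / 2, (b + c) / 2)%ZZ
  end.

(** * Soundness of the certificates *)

Section CertSoundness.
Variables (K : fieldType) (x : 'I_3 -> K) (h : K).
Hypothesis x_neq0 : forall i, x i != 0.
Hypothesis wt_inj : forall (k : {ffun 'I_3 -> K}) (n n' : {ffun 'I_3 -> nat}),
  (forall i, k i != 0) -> lowered x k n = lowered x k n' -> n = n'.
Hypothesis x_prod : x 0 * x 1 * x 2 = 1.
Hypothesis h_neq0 : h != 0.
Local Notation qmodule := (qmodule x h).
Local Notation meval := (mono_eval (x 0) (x 1)).
Local Notation peval := (poly_eval (x 0) (x 1)).
Hypothesis factors_neq0 : forall p, p \in factors -> peval p != 0.

Variables (M : rep K) (hM : qmodule M).
Variables (top : nat -> mono) (k : {ffun 'I_3 -> K}) (e : K) (s : car M).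
Hypothesis hs : singular k e s.
Hypothesis ktop : forall i, (i < 3)%N -> k (letter i) = meval (top i).
Variable N : {vspace car M}.
Hypotheses (hN : submodule N) (sN : s \notin N).

Local Notation xx := (x_neq0 0, x_neq0 1).

Lemma EwordZ w a (v : car M) : Eword w (a *: v) = a *: Eword w v.
Proof. by elim: w v => //= i w IHw v; rewrite linearZ; apply: IHw. Qed.

Lemma EwordD w (u v : car M) : Eword w (u + v) = Eword w u + Eword w v.
Proof. by elim: w u v => //= i w IHw u v; rewrite linearD; apply: IHw. Qed.

Lemma Eword_sum w I (r : seq I) (f : I -> car M) :
  Eword w (\sum_(i <- r) f i) = \sum_(i <- r) Eword w (f i).
Proof.
elim: r => [|i r IHr]; last by rewrite !big_cons EwordD IHr.
by rewrite !big_nil -{1}(scale0r (0 : car M)) EwordZ scale0r.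
Qed.

Lemma poly_eval_foldr_add I (r : seq I) (f : I -> poly2) :
  peval (foldr (fun l acc => poly_add (f l) acc) [::] r) = \sum_(l <- r) peval (f l).
Proof.
elim: r => [|l r IHr] /=; first by rewrite poly_eval_nil big_nil.
by rewrite big_cons -IHr poly_eval_add.
Qed.

Lemma factored_neq0 ms fl : peval (factored ms fl) != 0.
Proof.
have fne i : peval (nth poly_one factors i) != 0.
  have [i_lt|i_ge] := ltnP i (size factors); first exact/factors_neq0/mem_nth.
  (* An index beyond the list stands for the factor 1. *)
  by rewrite nth_default // poly_eval_one oner_neq0.
rewrite /factored; set p := foldr _ _ _.
suff p0 : peval p != 0 by case: ms.2; rewrite ?poly_eval_opp ?oppr_eq0.
rewrite {}/p; elim: fl => [|f fl IHfl] /=.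
  by rewrite poly_eval_mono ?xx // mono_eval_neq0 ?xx.
elim: f.2 => //= n IHn; by rewrite poly_eval_mul ?xx // mulf_neq0.
Qed.

(** Applying the E-word of a class to the combination gives a multiple of [s] in N, and this
    multiple is zero since [s] is not in N. So the coefficients are annihilated by the Gram matrix,
    hence, after multiplication by the adjugate, by its nonzero determinant. *)
Lemma check_class_sound c (a : nat -> K) : check_class top c ->
  \sum_(j <- iota 0 (size (cc_words c)))
    a j *: Fword (wd (nth [::] (cc_words c) j)) s \in N ->
  forall j, (j < size (cc_words c))%N -> a j = 0.
Proof.
set ws := cc_words c; set n := size ws; rewrite /check_class -/ws -/n.
set G := [seq [seq _ | w <- ws] | u <- ws]; set G' := [seq [seq opt_poly p | p <- r] | r <- G].
set A := adjugate G'; set d := factored _ _.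
case/andP=> /andP[/allP w3 /allP Gok] /allP AG sumN.
pose g l j := peval (nth [::] (nth [::] G' l) j).
have rowN l : (l < n)%N -> \sum_(j <- iota 0 n) a j * g l j = 0.
  move=> ln; set u := nth [::] ws l; have u3 := w3 u (mem_nth _ ln).
  have gE j : (j < n)%N ->
      h ^+ size u *: Eword (wd u) (Fword (wd (nth [::] ws j)) s) = g l j *: s.
    move=> jn; set w := nth [::] ws j; have wl3 := w3 w (mem_nth _ jn).
    have : isSome (gram_entry top u w).
      have := Gok (nth [::] G l); rewrite /G mem_nth ?size_map // => /(_ isT).
      rewrite (nth_map [::]) // => /allP/(_ (gram_entry top u w)).
      by apply; apply/mapP; exists w => //; apply: mem_nth.
    rewrite /g /G' (nth_map [::]) ?size_map // /G (nth_map [::]) //.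
    rewrite (nth_map None) ?size_map // (nth_map [::]) // -/u -/w.
    case E : (gram_entry top u w) => [p|] // _ /=.
    rewrite -(gram_scalar_eval x_neq0 x_prod h_neq0 hM hs ktop u3 _ E) /=; last first.
      by rewrite wl3.
    by rewrite lc_eval_cons lc_eval_nil addr0 poly_eval_one scale1r.
  apply: contraNeq sN => rl0.
  have : h ^+ size u *: Eword (wd u) (\sum_(j <- iota 0 n) a j *: Fword (wd (nth [::] ws j)) s) \in N.
    by apply/memvZ/submodule_Eword.
  rewrite Eword_sum scaler_sumr (eq_big_seq (fun j => (a j * g l j) *: s)); last first.
    move=> j; rewrite mem_iota => /andP[_ jn].
    by rewrite EwordZ scalerA [_ * a j]mulrC -!scalerA gE.
  rewrite -scaler_suml => /(memvZ (\sum_(j <- iota 0 n) a j * g l j)^-1).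
  by rewrite scalerA mulVf // scale1r.
move=> i i_n; have d0 : peval d != 0 by exact: factored_neq0.
apply: (mulIf d0); rewrite mul0r.
have e0 : \sum_(l <- iota 0 n) peval (nth [::] (nth [::] A i) l) *
    (\sum_(j <- iota 0 n) a j * g l j) = 0.
  rewrite big1_seq // => l /andP[_]; rewrite mem_iota => /andP[_ ln].
  by rewrite rowN // mulr0.
rewrite -[RHS]e0; under eq_bigr do rewrite mulr_sumr.
rewrite exchange_big /= (eq_big_seq (fun j => if i == j then a j * peval d else 0)).
  rewrite (bigD1_seq i) ?mem_iota ?iota_uniq //= eqxx big1 ?addr0 // => j.
  by rewrite eq_sym => /negPf->.
move=> j; rewrite mem_iota => /andP[_ jn].
have := AG i; rewrite mem_iota => /(_ i_n)/allP/(_ j).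
rewrite mem_iota => /(_ jn)/(poly_eqP xx.1 xx.2).
rewrite poly_eval_foldr_add => e1.
rewrite (eq_bigr (fun l => a j * (peval (poly_mul (nth [::] (nth [::] A i) l)
           (nth [::] (nth [::] G' l) j))))).
  rewrite -mulr_sumr e1; case: ifP => // _; by rewrite poly_eval_nil mulr0.
by move=> l _; rewrite poly_eval_mul ?xx // mulrCA.
Qed.

Lemma content_counts w w' : all (fun j => j < 3)%N w -> all (fun j => j < 3)%N w' ->
  content (wd w) = content (wd w') <-> counts w = counts w'.
Proof.
move=> w3 w3'.
have cnt i v : (i < 3)%N -> all (fun j => j < 3)%N v ->
    content (wd v) (letter i) = count_mem i v.
  move=> i3 v3; rewrite ffunE count_map; apply: eq_in_count => j jv /=.
  by rewrite letter_inj // (allP v3).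
split=> [/ffunP cw|cw].
  apply/eq_in_map => i; rewrite !inE => i3.
  have {}i3 : (i < 3)%N by case/or3P: i3 => /eqP->.
  by rewrite -!cnt.
apply/ffunP => i; have -> : i = letter i by apply: val_inj; rewrite /= inordK.
rewrite !cnt //; move: cw => [c0 c1 c2]; case: i => [[|[|[|]]] i3] //.
Qed.

(** N contains the weight components of the combination, and each component involves the words of a
    single class. *)
Lemma check_cert_sound cs (a : word -> K) : check_cert top cs ->
  \sum_(w <- cert_words cs) a w *: Fword (wd w) s \in N ->
  forall w, w \in cert_words cs -> a w = 0.
Proof.
rewrite /check_cert => /andP[/andP[cok0 uw] same0] sumN w.
have cok := allP cok0; have same := allP same0.
have ws3 w' : w' \in cert_words cs -> all (fun j => j < 3)%N w'.
  case/flattenP => ws /mapP[c cin ->] w'c.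
  by have /andP[/andP[/allP h3 _] _] := cok c cin; apply: h3.
move=> win; have /flattenP[_ /mapP[c cin ->] wc] := win.
have /eqP fc := same c cin.
have cntw : counts w = counts (head [::] (cc_words c)).
  by move: wc; rewrite -{1}fc mem_filter => /andP[/eqP].
pose L := [seq (lowered x k (content (wd v)), a v *: Fword (wd v) s) | v <- cert_words cs].
have := @wt_component _ _ N L hN _ _ (lowered x k (content (wd w))).
rewrite /L !big_map /= => /(_ _ sumN) H.
have {H} sN' : \sum_(v <- cert_words cs |
    lowered x k (content (wd v)) == lowered x k (content (wd w))) a v *: Fword (wd v) s \in N.
  by apply: H => p /mapP[v _ ->]; apply/has_wtZ/(has_wt_Fword hM)/sing_wt/hs.
have {sN'} sN' : \sum_(v <- cc_words c) a v *: Fword (wd v) s \in N.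
  rewrite -fc big_filter big_seq_cond.
  rewrite big_seq_cond in sN'; congr (_ \in N): sN'; apply: eq_bigl => v.
  case: (boolP (v \in cert_words cs)) => //= vin; rewrite -cntw.
  apply/eqP/eqP => [/(wt_inj (has_wt_neq0 hM (sing_wt hs) (sing_neq0 hs)))|].
    by move/content_counts; apply; apply: ws3.
  by move/content_counts => -> //; apply: ws3.
rewrite (big_nth [::]) /index_iota subn0 in sN'.
have := check_class_sound (cok c cin) sN' (j := index w (cc_words c)).
by rewrite index_mem nth_index // => ->.
Qed.

Definition word_span cs : {vspace car M} := <<[seq Fword (wd w) s | w <- cert_words cs]>>%VS.

Lemma word_spanP cs u : uniq (cert_words cs) -> u \in word_span cs ->
  exists a, u = \sum_(w <- cert_words cs) a w *: Fword (wd w) s.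
Proof.
rewrite /word_span; elim: (cert_words cs) u => [|w ws IHw] u /=.
  by rewrite span_nil memv0 => _ /eqP->; exists (fun=> 0); rewrite big_nil.
rewrite span_cons => /andP[wws uws] /memv_addP[_ /vlineP[a0 ->] [v /(IHw _ uws)[a ->] ->]].
exists (fun v => if v == w then a0 else a v); rewrite big_cons eqxx; congr (_ + _).
by apply: eq_big_seq => v' v'ws; case: eqP wws => // <-; rewrite v'ws.
Qed.

Lemma cert_uniq cs : check_cert top cs -> uniq (cert_words cs).
Proof. by rewrite /check_cert => /andP[/andP[]]. Qed.

(** Used for three kinds of N: zero gives linear independence, the orthogonal of the generated
    module gives independence modulo the radical, and an arbitrary submodule avoiding [s] gives
    irreducibility once the words span. *)
Lemma word_span_cap cs : check_cert top cs -> (word_span cs :&: N)%VS = 0%VS.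
Proof.
move=> ccs; apply: zerovP => u; rewrite memv_cap => /andP[/(word_spanP (cert_uniq ccs))[a ->] uN].
rewrite big_seq big1 // => w win.
by rewrite (check_cert_sound ccs uN) // scale0r.
Qed.

Lemma dim_word_span cs : check_cert top cs -> \dim (word_span cs) = size (cert_words cs).
Proof.
move=> ccs; set ws := cert_words cs; pose X := [seq Fword (wd w) s | w <- ws].
have uws : uniq ws := cert_uniq ccs.
suff : free (in_tuple X) by rewrite /free /= size_map => /eqP.
apply/freeP => kk sum0 i; have i_lt : (i < size ws)%N by rewrite -(size_map (fun w => Fword (wd w) s)).
pose a w := if insub (index w ws) is Some j then kk j else 0.
have aE (j : 'I_(size X)) : a (nth [::] ws j) = kk j.
  have j_lt : (j < size ws)%N by rewrite -(size_map (fun w => Fword (wd w) s)).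
  by rewrite /a index_uniq // valK.
have {sum0} sum0 : \sum_(w <- ws) a w *: Fword (wd w) s = 0.
  rewrite -[RHS]sum0 (big_nth [::]) -{1}(size_map (fun w => Fword (wd w) s)) big_mkord.
  by apply: eq_bigr => j _; rewrite aE (nth_map [::]) // -(size_map (fun w => Fword (wd w) s)).
rewrite -aE; apply: (check_cert_sound ccs); last exact: mem_nth.
by rewrite sum0 mem0v.
Qed.

Lemma word_span_generated cs : (word_span cs <= generated s)%VS.
Proof.
by apply/span_subvP => _ /mapP[w _ ->]; apply: Fword_generated.
Qed.

End CertSoundness.

(** * The product form on a tensor product *)

Section TensorForm.
Variables (K : fieldType) (x : 'I_3 -> K) (h : K).
Hypothesis x_neq0 : forall i, x i != 0.
Local Notation qmodule := (qmodule x h).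
Variables (M N : rep K) (bM : car M -> car M -> K) (bN : car N -> car N -> K).
Hypotheses (hM : qmodule M) (hN : qmodule N).
Hypotheses (hbM : contravariant h bM) (hbN : contravariant h bN).

Definition gram_mx (V : vectType K) (b : V -> V -> K) : 'M[K]_(dim V) :=
  \matrix_(i, j) b (r2v (delta_mx 0 i)) (r2v (delta_mx 0 j)).

Lemma gram_mxE (P : rep K) (b : car P -> car P -> K) u v : contravariant h b ->
  b u v = (v2r u *m gram_mx b *m (v2r v)^T) 0 0.
Proof.
move=> hb; rewrite -{1}(v2rK u) -{1}(v2rK v) {1}(row_sum_delta (v2r u)) {1}(row_sum_delta (v2r v)).
rewrite !linear_sum (form_sumr hb) mxE; apply: eq_bigr => j _.
rewrite (form_suml hb) !mxE mulr_suml; apply: eq_bigr => i _.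
by rewrite !linearZ (formZl hb) (formZr hb) !mxE; ring.
Qed.

Lemma gram_mx_unit (P : rep K) (b : car P -> car P -> K) :
  contravariant h b -> gram_mx b \in unitmx.
Proof.
move=> hb; rewrite -row_free_unit; apply: inj_row_free => u u0.
apply: (can_inj (@r2vK _ (car P))); rewrite linear0; apply: (form_nondeg hb) => v.
by rewrite (gram_mxE _ _ hb) r2vK u0 mul0mx mxE.
Qed.

(** The bilinear extension of (v ⊗ w, v' ⊗ w') -> b(v, v') b(w, w'), written for tensors that are
    represented by matrices. *)
Definition tensor_form (X Y : car (M ⊗ N)) : K :=
  \tr ((gram_mx bM)^T *m X *m gram_mx bN *m Y^T).

Lemma tensor_form_linear a X Y Z :
  tensor_form (a *: X + Y) Z = a * tensor_form X Z + tensor_form Y Z.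
Proof.
by rewrite /tensor_form mulmxDr !mulmxDl -scalemxAr -!scalemxAl linearD linearZ.
Qed.

Lemma tensor_form_tens v w v' w' :
  tensor_form (tens v w) (tens v' w') = bM v v' * bN w w'.
Proof.
rewrite /tensor_form /tens trmx_mul trmxK (gram_mxE v v' hbM) (gram_mxE w w' hbN).
set A := _ *m _ *m (v2r v')^T; set B := _ *m _ *m (v2r w')^T.
have -> : (gram_mx bM)^T *m ((v2r v)^T *m v2r w) *m gram_mx bN *m ((v2r w')^T *m v2r v') =
    ((gram_mx bM)^T *m (v2r v)^T) *m (B *m v2r v') by rewrite /B !mulmxA.
rewrite mxtrace_mulC -mulmxA (_ : v2r v' *m _ = A^T); last first.
  by rewrite /A !trmx_mul trmxK mulmxA.
by rewrite /mxtrace big_ord1 mxE big_ord1 [A^T _ _]mxE mulrC.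
Qed.

Lemma gram_mx_sym (P : rep K) (b : car P -> car P -> K) :
  contravariant h b -> (gram_mx b)^T = gram_mx b.
Proof. by move=> hb; apply/matrixP => i j; rewrite !mxE (form_sym hb). Qed.

Lemma tensor_form_sym X Y : tensor_form X Y = tensor_form Y X.
Proof.
rewrite /tensor_form -[LHS]mxtrace_tr !trmx_mul !trmxK !gram_mx_sym //.
by rewrite !mulmxA mxtrace_mulC !mulmxA.
Qed.

Lemma tensor_form_linear_r a X Y Z :
  tensor_form Z (a *: X + Y) = a * tensor_form Z X + tensor_form Z Y.
Proof. by rewrite !(tensor_form_sym Z) tensor_form_linear. Qed.

Lemma tensor_form_ext (A A' : 'End(car (M ⊗ N))) :
  (forall v w v' w', tensor_form (A (tens v w)) (tens v' w') =
                     tensor_form (tens v w) (A' (tens v' w'))) ->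
  forall X Y, tensor_form (A X) Y = tensor_form X (A' Y).
Proof.
move=> AA' X Y; apply: (tens_ext (A := K^o) (f := fun X => tensor_form (A X) Y)
   (g := fun X => tensor_form X (A' Y))) => [a X1 X2|a X1 X2|v w {X}].
- by rewrite linearP tensor_form_linear.
- by rewrite tensor_form_linear.
apply: (tens_ext (A := K^o) (f := fun Y => tensor_form (A (tens v w)) Y)
   (g := fun Y => tensor_form (tens v w) (A' Y))) => [a Y1 Y2|a Y1 Y2|v' w'].
- by rewrite tensor_form_linear_r.
- by rewrite linearP tensor_form_linear_r.
exact: AA'.
Qed.

Lemma tensor_formDl X Y Z : tensor_form (X + Y) Z = tensor_form X Z + tensor_form Y Z.
Proof. by rewrite -[X]scale1r tensor_form_linear mul1r scale1r. Qed.

Lemma tensor_formDr X Y Z : tensor_form Z (X + Y) = tensor_form Z X + tensor_form Z Y.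
Proof. by rewrite !(tensor_form_sym Z) tensor_formDl. Qed.

Lemma tensor_formZl a X Y : tensor_form (a *: X) Y = a * tensor_form X Y.
Proof.
have t0 : tensor_form 0 Y = 0.
  by have := tensor_form_linear (-1) 0 0 Y; rewrite scaler0 addr0 mulN1r addNr.
by rewrite -[a *: X]addr0 tensor_form_linear t0 addr0.
Qed.

(** The operators K_i^{±1/2} and the parity are self-adjoint and commute, so the adjoint of each
    term of the coproduct of E_i is the corresponding term for F_i, up to h and without extra
    sign. *)
Lemma contravariant_tensor : contravariant h tensor_form.
Proof.
have tE := tensor_form_tens; have tDl := tensor_formDl; have tDr := tensor_formDr.
split.
- exact: tensor_form_linear.
- exact: tensor_form_sym.
- move=> i; apply: tensor_form_ext => v w v' w'.
  rewrite !(op_tensor_tens (Some (Kh i))) /= !tE.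
  by rewrite (form_Kh hbM) (form_Kh hbN).
- move=> i X Y; rewrite -tensor_formZl -scale_lfunE.
  apply: (tensor_form_ext (A := h *: act (M ⊗ N) (E i))) => v w v' w' {X Y}.
  rewrite scale_lfunE tensor_formZl (op_tensor_tens (Some (E i))) (op_tensor_tens (Some (F i))).
  rewrite tDl tDr !tE mulrDr mulrA (form_E hbM) mulrCA (form_E hbN) (form_Kh hbN).
  by rewrite (form_Khi hM hbM) (form_par hbM) (pt_parKhi hM).
- apply: tensor_form_ext => v w v' w'; rewrite !(op_tensor_tens None) /= !tE.
  by rewrite (form_par hbM) (form_par hbN).
(* Pairing with elementary matrices yields every entry of the product of X with the two Gram
   matrices, and these are invertible. *)
move=> X X0; have GX : (gram_mx bM)^T *m X *m gram_mx bN = 0.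
  apply/matrixP => i j; rewrite [RHS]mxE; have := X0 (delta_mx i j).
  rewrite /tensor_form trmx_delta; set G := _ *m _ *m gram_mx bN => <-.
  rewrite -(mul_delta_mx (0 : 'I_1)) mulmxA mxtrace_mulC -colE -rowE.
  by rewrite /mxtrace big_ord1 !mxE.
have uM := gram_mx_unit hbM; have uN := gram_mx_unit hbN.
have := congr1 (fun A => invmx (gram_mx bM)^T *m A *m invmx (gram_mx bN)) GX.
rewrite mulmx0 mul0mx -!mulmxA mulmxV // mulmx1 mulmxA mulVmx ?mul1mx //.
by rewrite unitmx_tr.
Qed.

End TensorForm.

(** * The 17-dimensional module *)

(* Basis: 0 is the highest weight vector v, 1 + i is f_i = F_i v, 4 + k is g_k
   (of weight alpha_k), 7 + k is z_k (of weight 0), 10 + k is h_k (of weight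
   - alpha_k), 13 + k is l_k (of weight - alpha_i - alpha_j) and 16 is the lowest
   weight vector m. For distinct i, j, k, with d_i = t_i - 1 / t_i,
   F_i f_j = d_j g_k, F_k g_k = z_k, F_i z_k = d_j h_i, F_j h_i = l_k,
   F_k l_k = d_k m, and E' = (q - 1/q) E acts by E'_i f_i = - d_i v,
   E'_i g_k = f_j, E'_i z_k = - d_j g_i, E'_i h_i = z_i, E'_i l_k = - d_k h_j,
   E'_k m = l_k. *)
Definition vsym : Type := nat * nat.
Definition SP : vsym := (0, 0)%N.
Definition SK (i : nat) : vsym := (1%N, i).
Definition SKi (i : nat) : vsym := (2%N, i).
Definition SE (i : nat) : vsym := (3%N, i).
Definition SF (i : nat) : vsym := (4%N, i).

Definition x_mono (i : nat) : mono :=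
  match i with 0%N => (1, 0) | 1%N => (0, 1) | _ => (-1, -1) end%ZZ.
Definition d_poly (i : nat) : poly2 := bracket (x_mono i).
Definition third (i j : nat) : nat := (3 - i - j)%N.

(** Only the weight and the parity of a basis vector are read off this word; the three vectors z_k
    share one word. *)
Definition basis_word (n : nat) : word :=
  if (n == 0)%N then [::] else
  if (n < 4)%N then [:: n - 1]%N else
  if (n < 7)%N then [seq i <- [:: 0; 1; 2] | i != n - 4]%N else
  if (n < 10)%N then [:: 0; 1; 2]%N else
  if (n < 13)%N then [:: 0; 1; 2; n - 10]%N else
  if (n < 16)%N then [:: 0, 1, 2 & [seq i <- [:: 0; 1; 2] | i != n - 13]]%N else
  [:: 0; 1; 2; 0; 1; 2]%N.

Definition wt_mono (i n : nat) : mono :=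
  weight_mono (top_mono 1 1 1) i (basis_word n).

Definition F_table (i n : nat) : lcomb :=
  if (n == 0)%N then [:: (poly_one, [:: 1 + i])]%N else
  if (n < 4)%N then let j := (n - 1)%N in
    if i == j then [::] else [:: (d_poly j, [:: 4 + third i j])]%N else
  if (n < 7)%N then if i == (n - 4)%N then [:: (poly_one, [:: 7 + i])]%N else [::] else
  if (n < 10)%N then let k := (n - 7)%N in
    if i == k then [::] else [:: (d_poly (third i k), [:: 10 + i])]%N else
  if (n < 13)%N then let a := (n - 10)%N in
    if i == a then [::] else [:: (poly_one, [:: 13 + third i a])]%N else
  if (n < 16)%N then let k := (n - 13)%N in
    if i == k then [:: (d_poly k, [:: 16])]%N else [::] else
  [::].

Definition E_table (i n : nat) : lcomb :=
  if (n == 0)%N then [::] else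
  if (n < 4)%N then let j := (n - 1)%N in
    if i == j then [:: (poly_opp (d_poly i), [:: 0])]%N else [::] else
  if (n < 7)%N then let k := (n - 4)%N in
    if i == k then [::] else [:: (poly_one, [:: 1 + third i k])]%N else
  if (n < 10)%N then let k := (n - 7)%N in
    if i == k then [::] else [:: (poly_opp (d_poly (third i k)), [:: 4 + i])]%N else
  if (n < 13)%N then if i == (n - 10)%N then [:: (poly_one, [:: 7 + i])]%N else [::] else
  if (n < 16)%N then let k := (n - 13)%N in
    if i == k then [::] else [:: (poly_opp (d_poly k), [:: 10 + third i k])]%N else
  [:: (poly_one, [:: 13 + i])]%N.

(** The highest weight vector is odd, hence the sign -1 for words of even length. *)
Definition par_table (n : nat) : lcomb :=
  [:: (if odd (size (basis_word n)) then poly_one else poly_opp poly_one, [:: n])].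

(** The default 17 is one past the last basis vector, and the tables send it to zero. *)
Definition index (w : word) : nat := head 17 w.

Definition table (g : vsym) (w : word) : lcomb :=
  let n := index w in
  if (n < 17)%N then
    match g.1 with
    | 0%N => par_table n
    | 1%N => [:: (poly_mono (wt_mono g.2 n), [:: n])]
    | 2%N => [:: (poly_mono (mono_inv (wt_mono g.2 n)), [:: n])]
    | 3%N => E_table g.2 n
    | _ => F_table g.2 n
    end
  else [::].

Definition lc_apply (T : word -> lcomb) (l : lcomb) : lcomb :=
  foldr (fun t r => lc_lincomb t.1 (T t.2) r) [::] l.

(* Relations: sums of scalar multiples of words in the operators. *)
Definition relation := seq (poly2 * seq vsym).

Definition relation_at (r : relation) (n : nat) : lcomb :=
  foldr (fun t acc => lc_lincomb t.1
     (foldr (fun g l => lc_apply (table g) l) [:: (poly_one, [:: n])] t.2) acc) [::] r.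

Definition check_relation (r : relation) : bool :=
  all (fun n => nilp (relation_at r n)) (iota 0 17).

Definition neg1 : poly2 := poly_opp poly_one.

(** The six terms are in the order of [sum_S3_alt]. *)
Definition rel_serre (X : nat -> vsym) : relation :=
  [:: (d_poly 1, [:: X 0; X 1; X 2]); (poly_opp (d_poly 0), [:: X 1; X 0; X 2]);
      (poly_opp (d_poly 2), [:: X 0; X 2; X 1]); (d_poly 2, [:: X 1; X 2; X 0]);
      (d_poly 0, [:: X 2; X 0; X 1]); (poly_opp (d_poly 1), [:: X 2; X 1; X 0])]%N.

Definition rels1 (i : nat) : seq relation :=
  [:: [:: (poly_one, [:: SP; SK i]); (neg1, [:: SK i; SP])];
      [:: (poly_one, [:: SP; SKi i]); (neg1, [:: SKi i; SP])];
      [:: (poly_one, [:: SP; SE i]); (poly_one, [:: SE i; SP])];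
      [:: (poly_one, [:: SP; SF i]); (poly_one, [:: SF i; SP])];
      [:: (poly_one, [:: SK i; SKi i]); (neg1, [::])];
      [:: (poly_one, [:: SKi i; SK i]); (neg1, [::])];
      [:: (poly_one, [:: SE i; SE i])];
      [:: (poly_one, [:: SF i; SF i])]].

(** [SE] stands for h E, so the last relation has K_i - 1/K_i on the right, without denominator. *)
Definition rels2 (i j : nat) : seq relation :=
  [:: [:: (poly_one, [:: SK i; SK j]); (neg1, [:: SK j; SK i])];
      [:: (poly_one, [:: SK i; SE j]);
          (poly_opp (poly_mono (pairing i j)), [:: SE j; SK i])];
      [:: (poly_one, [:: SK i; SF j]);
          (poly_opp (poly_mono (mono_inv (pairing i j))), [:: SF j; SK i])];
      [:: (poly_one, [:: SE i; SF j]), (poly_one, [:: SF j; SE i]) &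
          if i == j then [:: (neg1, [:: SK i; SK i]); (poly_one, [:: SKi i; SKi i])]
          else [::]]].

Definition I3 : seq nat := [:: 0; 1; 2]%N.

Definition all_relations : seq relation :=
  [:: [:: (poly_one, [:: SP; SP]); (neg1, [::])]; rel_serre SE; rel_serre SF] ++
  flatten [seq rels1 i | i <- I3] ++ flatten [seq rels2 i j | i <- I3, j <- I3].

Lemma check_all_relations : all check_relation all_relations.
Proof. by vm_compute. Qed.

(* The contravariant form, and a multiple of the inverse of its matrix. *)
Definition d3_poly : poly2 := poly_mul (d_poly 0) (poly_mul (d_poly 1) (d_poly 2)).
Definition scale_poly : poly2 := poly_mul [:: ((0, 0), 2)%ZZ] d3_poly.

(** On the span of z_0, z_1, z_2 the diagonal is zero and z_i, z_j pair to d_k with k the third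
    index. The determinant of this block is 2 d_0 d_1 d_2, the polynomial [scale_poly]; its adjugate
    has entries d_i d_j off the diagonal and - d_i^2 on it, as used in [inv_table]. *)
Definition form_table (w : word) : lcomb :=
  let n := index w in
  if (n == 0)%N then [:: (poly_one, [:: 0])]%N else
  if (n < 4)%N then [:: (poly_opp (d_poly (n - 1)), [:: n])] else
  if (n < 7)%N then [:: (neg1, [:: n])] else
  if (n < 10)%N then
    [seq (d_poly (third j (n - 7)), [:: 7 + j])%N | j <- I3 & j != (n - 7)%N] else
  if (n < 13)%N then [:: (poly_one, [:: n])] else
  if (n < 16)%N then [:: (poly_opp (d_poly (n - 13)), [:: n])] else
  if (n < 17)%N then [:: (neg1, [:: n])] else [::].

(* 2 d_0 d_1 d_2 / d_i *)
Definition scale_div (i : nat) : poly2 :=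
  foldr (fun j p => if i == j then p else poly_mul (d_poly j) p) [:: ((0, 0), 2)%ZZ] I3.

Definition inv_table (w : word) : lcomb :=
  let n := index w in
  let z := (n - 7)%N in
  if (n == 0)%N then [:: (scale_poly, [:: 0])]%N else
  if (n < 4)%N then [:: (poly_opp (scale_div (n - 1)), [:: n])] else
  if (n < 7)%N then [:: (poly_opp scale_poly, [:: n])] else
  if (n < 10)%N then
    [seq (let p := poly_mul (d_poly z) (d_poly j) in
          if j == z then poly_opp p else p, [:: 7 + j]%N) | j <- I3] else
  if (n < 13)%N then [:: (scale_poly, [:: n])] else
  if (n < 16)%N then [:: (poly_opp (scale_div (n - 13)), [:: n])] else
  if (n < 17)%N then [:: (poly_opp scale_poly, [:: n])] else [::].

Definition coef (n : nat) (l : lcomb) : poly2 :=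
  if (n < 17)%N then foldr (fun t p => if index t.2 == n then poly_add t.1 p else p) [::] l
  else [::].

Definition check_adjoint (g g' : vsym) : bool :=
  all (fun n => all (fun m =>
      poly_eq (coef m (lc_apply form_table (table g [:: n])))
              (coef n (lc_apply form_table (table g' [:: m])))) (iota 0 17)) (iota 0 17).

Definition check_form : bool :=
  [&& all (fun n => all (fun m =>
        poly_eq (coef m (form_table [:: n])) (coef n (form_table [:: m]))) (iota 0 17)) (iota 0 17),
      all (fun n => nilp (lc_lincomb neg1 (lc_apply form_table (inv_table [:: n]))
                            [:: (scale_poly, [:: n])])) (iota 0 17),
      check_adjoint SP SP,
      all (fun i => check_adjoint (SK i) (SK i)) I3 &
      all (fun i => check_adjoint (SE i) (SF i)) I3].

Lemma check_form_ok : check_form.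
Proof. by vm_compute. Qed.

(** * Vectors of the tensor square *)

(* The word [:: n; m] stands for the tensor product of the basis vectors n, m. *)
Definition lc_pair (l1 l2 : lcomb) : lcomb :=
  [seq (poly_mul t1.1 t2.1, [:: index t1.2; index t2.2]) | t1 <- l1, t2 <- l2].

Definition table2 (X : nat -> vsym) (i : nat) (w : word) : lcomb :=
  let n := index w in let m := index (behead w) in
  lc_pair (table (X i) [:: n]) (table (SK i) [:: m]) ++
  lc_pair (lc_apply (table (SKi i)) (table SP [:: n])) (table (X i) [:: m]).

Definition form2 (l l' : lcomb) : poly2 :=
  foldr (fun t r => foldr (fun t' r' =>
    poly_add (poly_mul (poly_mul t.1 t'.1)
      (poly_mul (coef (index t'.2) (form_table t.2))
                (coef (index (behead t'.2)) (form_table (behead t.2))))) r') r l') [::] l.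

Definition top2 : lcomb := [:: (poly_one, [:: 0; 0]%N)].

(** Since F_i (v ⊗ v) = x_i^-1 f_i ⊗ v - x_i v ⊗ f_i, this vector spans its orthogonal in the plane
    of f_i ⊗ v and v ⊗ f_i. By contravariance it is killed by E_i. *)
Definition sing3 (i : nat) : lcomb :=
  [:: (poly_mono (x_mono i), [:: 1 + i; 0]%N);
      (poly_mono (mono_inv (x_mono i)), [:: 0; 1 + i]%N)].

Definition sing0 : lcomb :=
  [:: (scale_poly, [:: 0; 16]%N)] ++
  [seq (poly_opp (scale_div i), [:: 1 + i; 13 + i]%N) | i <- I3] ++
  [seq (poly_opp scale_poly, [:: 4 + i; 10 + i]%N) | i <- I3] ++
  flatten [seq [seq (t.1, 7 + i :: t.2)%N | t <- inv_table [:: 7 + i]%N] | i <- I3] ++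
  [seq (scale_poly, [:: 10 + i; 4 + i]%N) | i <- I3] ++
  [seq (poly_opp (scale_div i), [:: 13 + i; 1 + i]%N) | i <- I3] ++
  [:: (poly_opp scale_poly, [:: 16; 0]%N)].

(** A solution of E_i z = 0 among the words with letters 0, 1, 2 applied to v ⊗ v. Of the six
    orders, 2 1 0 is eliminated by the Serre relation. Four of the other five words have a
    nondegenerate Gram matrix in [cert_222]; the dimension left over is that of z. *)
Definition sing1_coefs : seq (poly2 * word) := [:: (factored ((-2, -10)%ZZ, false) [:: (4, 2); (5, 2); (6, 1)]%N, [:: 0; 1; 2]%N);
      (factored ((0, -2)%ZZ, false) [:: (7, 1); (8, 1); (9, 1); (10, 1); (11, 1)]%N, [:: 0; 2; 1]%N);
      (factored ((-4, -4)%ZZ, false) [:: (1, 1); (2, 1); (6, 1); (12, 1); (13, 1)]%N, [:: 1; 0; 2]%N);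
      (factored ((0, -2)%ZZ, true) [:: (1, 1); (2, 1); (6, 1); (7, 1); (8, 1); (9, 1)]%N, [:: 1; 2; 0]%N);
      (factored ((0, 0)%ZZ, false) [:: (1, 1); (2, 1); (7, 1); (8, 1); (9, 1)]%N, [:: 2; 0; 1]%N)].

Definition sing1 : lcomb :=
  foldr (fun t r => lc_lincomb t.1 (foldr (fun i l => lc_apply (table2 SF i) l) top2 t.2) r)
    [::] sing1_coefs.

Definition killed (X : nat -> vsym) (l : lcomb) : bool :=
  all (fun i => nilp (lc_apply (table2 X i) l)) I3.

Definition poly_factored (p : poly2) (c : (mono * bool) * seq (nat * nat)) : bool :=
  poly_eq p (factored c.1 c.2).

Lemma check_tensor_square :
  [&& killed SE top2, all (fun i => killed SE (sing3 i)) I3,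
      killed SE sing0, killed SF sing0 & killed SE sing1].
Proof. by vm_compute. Qed.

Definition scale_cert : (mono * bool) * seq (nat * nat) :=
  ((0, 0)%ZZ, false, [:: (0, 1); (1, 1); (2, 1); (4, 1); (5, 1); (7, 1); (8, 1)]%N).
Definition norm3_cert (i : nat) : (mono * bool) * seq (nat * nat) :=
  match i with
  | 0%N => ((-4, 0)%ZZ, true, [:: (1, 1); (2, 1); (3, 1)]%N)
  | 1%N => ((0, -4)%ZZ, true, [:: (4, 1); (5, 1); (6, 1)]%N)
  | _ => ((4, 4)%ZZ, true, [:: (7, 1); (8, 1); (9, 1)]%N)
  end.
(** As z is isotropic, its norm cannot show that it is nonzero; its pairing with v ⊗ z_0 does. *)
Definition sing1_cert : (mono * bool) * seq (nat * nat) :=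
  ((-4, -4)%ZZ, false, [:: (0, 1); (1, 2); (2, 2); (4, 1); (5, 1); (7, 1); (8, 1)]%N).

Lemma check_norms :
  [&& poly_factored scale_poly scale_cert,
      all (fun i => poly_factored (form2 (sing3 i) (sing3 i)) (norm3_cert i)) I3,
      poly_eq (form2 sing0 sing0) (poly_mul scale_poly scale_poly) &
      poly_factored (form2 sing1 [:: (poly_one, [:: 0; 7]%N)]) sing1_cert].
Proof. by vm_compute. Qed.

(** * Interpretation of the tables over a field *)

Section Soundness.
Variables (K : fieldType) (x : 'I_3 -> K) (h : K).
Hypothesis x_neq0 : forall i, x i != 0.
Hypothesis x_prod : x 0 * x 1 * x 2 = 1.
Hypothesis h_neq0 : h != 0.
Local Notation qmodule := (qmodule x h).
Local Notation meval := (mono_eval (x 0) (x 1)).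
Local Notation peval := (poly_eval (x 0) (x 1)).
Hypothesis factors_neq0 : forall p, p \in factors -> peval p != 0.
Local Notation xx := (x_neq0 0, x_neq0 1).
Local Notation lc_val := (lc_val (x 0) (x 1)).

Let pM p q : peval (poly_mul p q) = peval p * peval q.
Proof. by apply: poly_eval_mul. Qed.
Let pN p : peval (poly_opp p) = - peval p.
Proof. by apply: poly_eval_opp. Qed.
Let p1 : peval poly_one = 1. Proof. exact: poly_eval_one. Qed.

Section Apply.
Variables (V : lmodType K) (phi : word -> V).

Lemma lc_val_applyl (f : V -> V) (T : word -> lcomb) l : linear f ->
  (forall w, f (phi w) = lc_val phi (T w)) -> f (lc_val phi l) = lc_val phi (lc_apply T l).
Proof.
move=> lf fT; pose g : {linear V -> V} := HB.pack f (GRing.isLinear.Build _ _ _ _ _ lf).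
elim: l => [|t l IHl] /=; first by rewrite lc_val_nil -[f 0]/(g 0) linear0.
rewrite lc_val_lincomb ?xx // -IHl -fT lc_val_cons -[f _]/(g _) linearP.
by [].
Qed.

End Apply.

Definition e17 (n : nat) : 'rV[K]_17 := delta_mx 0 (inord n).
Definition phi (w : word) : 'rV[K]_17 := if (index w < 17)%N then e17 (index w) else 0.

Definition vop (g : vsym) : 'End('rV[K]_17) :=
  linfun (fun u : 'rV[K]_17 => \sum_(n < 17) u 0 n *: lc_val phi (table g [:: n : nat])).

Lemma vop_phi g w : vop g (phi w) = lc_val phi (table g w).
Proof.
rewrite /vop linfunE => [|a u v]; last first.
  rewrite scaler_sumr -big_split; apply: eq_bigr => n _ /=.
  by rewrite !mxE scalerDl scalerA.
rewrite /phi; case: ifP => w17; last first.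
  rewrite /table w17 lc_val_nil big1 // => n _; by rewrite mxE scale0r.
rewrite (bigD1 (inord (index w))) //= big1 => [|n nw].
  by rewrite mxE !eqxx scale1r addr0 inordK.
by rewrite mxE eqxx (negPf nw) scale0r.
Qed.

Lemma row_basis (W : vectType K) (f g : 'Hom('rV[K]_17, W)) :
  (forall n, (n < 17)%N -> f (phi [:: n]) = g (phi [:: n])) -> f =1 g.
Proof.
move=> fg u; rewrite (row_sum_delta u) !linear_sum; apply: eq_bigr => n _.
rewrite !linearZ /=; congr (_ *: _).
by have := fg n (ltn_ord n); rewrite /phi /= ltn_ord /e17 inord_val.
Qed.

Definition V17 : rep K := @Rep K 'rV[K]_17 (vop SP) (fun g =>
  match g with
  | Kh i => vop (SK i) | Khi i => vop (SKi i)
  | E i => h^-1 *: vop (SE i) | F i => vop (SF i)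
  end).

Lemma relation_sound r u : check_relation r ->
  \sum_(t <- r) peval t.1 *: foldr (fun g v => vop g v) u t.2 = 0.
Proof.
move=> /allP r0.
pose f := \sum_(t <- r) peval t.1 *: foldr (fun g f => (vop g \o f)%VF) \1%VF t.2.
have fE v : f v = \sum_(t <- r) peval t.1 *: foldr (fun g v => vop g v) v t.2.
  rewrite sum_lfunE; apply: eq_bigr => t _; rewrite scale_lfunE; congr (_ *: _).
  by elim: t.2 => [|g l IHl] /=; rewrite ?id_lfunE // comp_lfunE IHl.
rewrite -fE -(zero_lfunE _ u); apply: row_basis => n n17.
rewrite zero_lfunE fE; have : n \in iota 0 17 by rewrite mem_iota.
move/r0/nilP; rewrite /relation_at => e0.
suff -> : \sum_(t <- r) peval t.1 *: foldr (fun g v => vop g v) (phi [:: n]) t.2 =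
    lc_val phi (foldr (fun t acc => lc_lincomb t.1
     (foldr (fun g l => lc_apply (table g) l) [:: (poly_one, [:: n])] t.2) acc) [::] r).
  by rewrite e0 lc_val_nil.
elim: {f fE e0 r0} r => [|t r IHr] /=; first by rewrite big_nil lc_val_nil.
rewrite big_cons lc_val_lincomb ?xx // IHr; congr (_ *: _ + _).
elim: t.2 => [|g l IHl] /=; first by rewrite lc_val_cons lc_val_nil p1 scale1r addr0.
rewrite IHl; apply: lc_val_applyl => [a v w|w]; first by rewrite linearP.
exact: vop_phi.
Qed.

Lemma rel_in r u : r \in all_relations ->
  \sum_(t <- r) peval t.1 *: foldr (fun g v => vop g v) u t.2 = 0.
Proof. by move=> /(allP check_all_relations)/relation_sound. Qed.

Lemma mem_I3 (i : 'I_3) : (i : nat) \in I3.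
Proof. by case: i => [[|[|[|]]]]. Qed.

Lemma rel_in1 (i : 'I_3) n u : (n < 8)%N ->
  \sum_(t <- nth [::] (rels1 i) n) peval t.1 *: foldr (fun g v => vop g v) u t.2 = 0.
Proof.
move=> n8; apply: rel_in; rewrite mem_cat; apply/orP; right; rewrite mem_cat; apply/orP; left.
apply/flattenP; exists (rels1 i); first by apply/map_f/mem_I3.
exact: mem_nth.
Qed.

Lemma rel_in2 (i j : 'I_3) n u : (n < 4)%N ->
  \sum_(t <- nth [::] (rels2 i j) n) peval t.1 *: foldr (fun g v => vop g v) u t.2 = 0.
Proof.
move=> n4; apply: rel_in; rewrite mem_cat; apply/orP; right; rewrite mem_cat; apply/orP; right.
apply/flattenP; exists (rels2 i j); last exact: mem_nth.
by apply/allpairsP; exists (i : nat, j : nat); split=> //=; apply: mem_I3.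
Qed.

Lemma bx_pairing (i j : 'I_3) : bx x i j = meval (pairing i j).
Proof.
by rewrite -letter_pairing // /letter !inord_val.
Qed.

Lemma d_polyE (i : 'I_3) : peval (d_poly i) = x i ^+ 2 - x i ^- 2.
Proof.
rewrite /d_poly bracket_eval //; suff -> : meval (x_mono i) = x i by [].
rewrite (_ : x i = bx x (i + 1) (i + 2)); last first.
  by rewrite /bx; case: (I3P i) => ->; rewrite //=; congr (x _); apply: val_inj.
by rewrite bx_pairing; case: (I3P i) => ->.
Qed.

Let two_terms (p q : poly2) l1 l2 (u : 'rV[K]_17) :
  \sum_(t <- [:: (p, l1); (q, l2)]) peval t.1 *: foldr (fun g v => vop g v) u t.2 =
  peval p *: foldr (fun g v => vop g v) u l1 + peval q *: foldr (fun g v => vop g v) u l2.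
Proof. by rewrite !big_cons big_nil addr0. Qed.

Lemma scaled_triple (V : vectType K) (a : K) (f g k : 'End(V)) u :
  (a *: f) ((a *: g) ((a *: k) u)) = (a * (a * a)) *: f (g (k u)).
Proof.
have lZ (f' : 'End(V)) b v : f' (b *: v) = b *: f' v by exact: linearZ.
by rewrite !scale_lfunE !lZ !scalerA mulrA.
Qed.

Lemma serre_V17 (X : nat -> vsym) u : rel_serre X \in all_relations ->
  \sum_(s : 'S_3) ((-1) ^+ s * (x (s 1) ^+ 2 - x (s 1) ^- 2)) *:
     vop (X (s 0)) (vop (X (s 1)) (vop (X (s 2)) u)) = 0.
Proof.
have o0 : nat_of_ord (0 : 'I_3) = 0%N by [].
have o1 : nat_of_ord (1 : 'I_3) = 1%N by [].
have o2 : nat_of_ord (2 : 'I_3) = 2%N by [].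
have := (d_polyE 0, d_polyE 1, d_polyE 2); rewrite o0 o1 o2 => dE.
have six (c1 c2 c3 c4 c5 c6 : poly2) l1 l2 l3 l4 l5 l6 :
    \sum_(t <- [:: (c1, l1); (c2, l2); (c3, l3); (c4, l4); (c5, l5); (c6, l6)])
      peval t.1 *: foldr (fun g v => vop g v) u t.2 =
    peval c1 *: foldr (fun g v => vop g v) u l1 + peval c2 *: foldr (fun g v => vop g v) u l2
    + peval c3 *: foldr (fun g v => vop g v) u l3 + peval c4 *: foldr (fun g v => vop g v) u l4
    + peval c5 *: foldr (fun g v => vop g v) u l5 + peval c6 *: foldr (fun g v => vop g v) u l6.
  by rewrite !big_cons big_nil addr0 !addrA.
move=> /(rel_in u); rewrite six !pN !dE !scaleNr => e.
rewrite (sum_S3_alt (fun i j k : 'I_3 => vop (X i) (vop (X j) (vop (X k) u)))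
  (fun i => x i ^+ 2 - x i ^- 2)) o0 o1 o2.
exact: e.
Qed.

Lemma qmodule_V17 : qmodule V17.
Proof.
have r1 := rel_in1; have r2 := rel_in2.
have eqB (V : zmodType) (a b : V) : a - b = 0 -> a = b by move=> /eqP; rewrite subr_eq0 => /eqP.
split=> [|i|i|i|i|i|i|i j|i j|i j|i j|i|i||] u; rewrite /= ?scale_lfunE.
- have := @rel_in [:: (poly_one, [:: SP; SP]); (neg1, [::])] u.
  rewrite mem_head => /(_ isT); rewrite two_terms pN p1 scale1r scaleN1r; exact: eqB.
- have := r1 i 0%N u isT; rewrite two_terms pN p1 scale1r scaleN1r; exact: eqB.
- have := r1 i 1%N u isT; rewrite two_terms pN p1 scale1r scaleN1r; exact: eqB.
- have := r1 i 2%N u isT; rewrite two_terms p1 !scale1r => /eqP; rewrite addr_eq0 => /eqP /= e.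
  by rewrite linearZ /= e scalerN.
- have := r1 i 3%N u isT; rewrite two_terms p1 !scale1r => /eqP; rewrite addr_eq0 => /eqP. exact.
- have := r1 i 4%N u isT; rewrite two_terms pN p1 scale1r scaleN1r; exact: eqB.
- have := r1 i 5%N u isT; rewrite two_terms pN p1 scale1r scaleN1r; exact: eqB.
- have := r2 i j 0%N u isT; rewrite two_terms pN p1 scale1r scaleN1r; exact: eqB.
- have := r2 i j 1%N u isT; rewrite two_terms pN p1 scale1r scaleNr => /eqB /= e.
  by rewrite linearZ /= e poly_eval_mono ?xx // -bx_pairing !scalerA mulrC.
- have := r2 i j 2%N u isT; rewrite two_terms pN p1 scale1r scaleNr => /eqB /= e.
  by rewrite e poly_eval_mono ?xx // mono_eval_inv ?xx // -bx_pairing.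
- have := r2 i j 3%N u isT; rewrite [nth _ _ _]/= -val_eqE /=.
  case: ifP => _; rewrite !big_cons big_nil /= ?pN !p1 ?scaleN1r !scale1r addr0 => e.
    rewrite linearZ /= -scalerDr; congr (_ *: _); apply/eqP.
    by rewrite -subr_eq0 opprB [X in _ + X]addrC -addrA e eqxx.
  by rewrite linearZ /= -scalerDr e scaler0.
- have := r1 i 6%N u isT; rewrite big_seq1 p1 scale1r /= => e.
  by rewrite linearZ /= e !scaler0.
- have := r1 i 7%N u isT; rewrite big_seq1 p1 scale1r /=. exact.
- rewrite (eq_bigr (fun s : 'S_3 => (h^-1 * (h^-1 * h^-1)) *:
      (((-1) ^+ s * (x (s 1) ^+ 2 - x (s 1) ^- 2)) *:
       vop (SE (s 0)) (vop (SE (s 1)) (vop (SE (s 2)) u))))); last first.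
    by move=> s _; rewrite scaled_triple !scalerA; congr (_ *: _); apply: mulrC.
  rewrite -scaler_sumr (serre_V17 (X := SE)) ?scaler0 //.
- exact: (serre_V17 (X := SF)).
Qed.

(** * Its contravariant form *)

(** Such a table depends on the first letter alone and vanishes outside the basis, so it represents
    a linear map with matrix [table_mx T]. *)
Definition indexed (T : word -> lcomb) :=
  forall w, T w = if (index w < 17)%N then T [:: index w] else [::].

Lemma indexed_form_table : indexed form_table.
Proof.
move=> w; case: ltnP => // w17; rewrite /form_table.
by rewrite -(subnKC w17).
Qed.

Definition table_mx (T : word -> lcomb) : 'M[K]_17 :=
  \matrix_(n, m) peval (coef m (T [:: n : nat])).

Lemma lc_val_coef l (m : 'I_17) : lc_val phi l 0 m = peval (coef m l).
Proof.
rewrite /coef ltn_ord; elim: l => [|t l IHl] /=.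
  by rewrite lc_val_nil poly_eval_nil mxE.
rewrite lc_val_cons !mxE IHl /phi; case: ifP => t17; last first.
  rewrite mxE mulr0 add0r; case: eqP => // tm; by rewrite tm ltn_ord in t17.
rewrite mxE eqxx /= -val_eqE /= inordK // eq_sym.
case: ifP => _; last by rewrite mulr0 add0r.
by rewrite mulr1 poly_eval_add ?xx.
Qed.

Lemma row_table_mx T n : row n (table_mx T) = lc_val phi (T [:: n : nat]).
Proof. by apply/rowP => m; rewrite !mxE lc_val_coef. Qed.

Lemma phi_mul T w : indexed T -> phi w *m table_mx T = lc_val phi (T w).
Proof.
move=> ->; rewrite /phi; case: ifP => w17; last by rewrite mul0mx lc_val_nil.
by rewrite /e17 -rowE row_table_mx inordK.
Qed.

Lemma lc_val_mul T l : indexed T ->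
  lc_val phi l *m table_mx T = lc_val phi (lc_apply T l).
Proof.
move=> iT; apply: (lc_val_applyl (f := fun u => u *m table_mx T)) => [a u v|w].
  by rewrite mulmxDl scalemxAl.
exact: phi_mul.
Qed.

Lemma table_mx_mul S T : indexed T ->
  table_mx S *m table_mx T = table_mx (fun w => lc_apply T (S w)).
Proof.
move=> iT; apply/row_matrixP => n; rewrite row_mul !row_table_mx.
exact: lc_val_mul.
Qed.

Lemma vop_mx g u : vop g u = u *m table_mx (table g).
Proof.
rewrite /vop linfunE => [|a v w]; last first.
  rewrite scaler_sumr -big_split; apply: eq_bigr => n _ /=.
  by rewrite !mxE scalerDl scalerA.
by rewrite mulmx_sum_row; apply: eq_bigr => n _; rewrite row_table_mx.
Qed.

Definition form17 (u v : 'rV[K]_17) : K := (u *m table_mx form_table *m v^T) 0 0.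

Let ltn_iota (n : 'I_17) : (n : nat) \in iota 0 17. Proof. by rewrite mem_iota ltn_ord. Qed.

Lemma table_mx_form_sym : (table_mx form_table)^T = table_mx form_table.
Proof.
have /and5P[/allP fs _ _ _ _] := check_form_ok.
apply/matrixP => n m; rewrite !mxE; apply: poly_eqP => //.
by have /allP := fs m (ltn_iota m); apply; apply: ltn_iota.
Qed.

Lemma adjoint_form17 g g' u v : check_adjoint g g' ->
  form17 (vop g u) v = form17 u (vop g' v).
Proof.
move=> /allP gg'; rewrite /form17 !vop_mx trmx_mul !mulmxA -[u *m _ *m _]mulmxA.
rewrite -[in RHS]table_mx_form_sym -[_ *m _ *m (table_mx (table g'))^T]mulmxA -trmx_mul.
rewrite !table_mx_mul; try exact: indexed_form_table.
congr ((_ *m _ *m _) _ _); apply/matrixP => n m; rewrite !mxE.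
apply: poly_eqP => //; have /allP := gg' n (ltn_iota n); apply; exact: ltn_iota.
Qed.

Lemma poly_factored_neq0 p c : poly_factored p c -> peval p != 0.
Proof. by move=> /poly_eqP ->; rewrite ?xx // factored_neq0. Qed.

Lemma contravariant_form17 : @contravariant K h V17 form17.
Proof.
have /and5P[_ /allP fi fP /allP fK /allP fE] := check_form_ok.
have fsym u v : form17 u v = form17 v u.
  rewrite /form17 -[in LHS](trmxK (u *m _ *m _)) [in LHS]mxE !trmx_mul trmxK.
  by rewrite table_mx_form_sym mulmxA.
have flin a u v w : form17 (a *: u + v) w = a * form17 u w + form17 v w.
  by rewrite /form17 !mulmxDl -!scalemxAl !mxE.
split=> //.
- move=> i u v; apply: adjoint_form17; exact/fK/mem_I3.
- move=> i u v; rewrite /= scale_lfunE -[_ *: _]addr0 flin.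
  have -> : form17 0 v = 0 by rewrite /form17 !mul0mx mxE.
  rewrite addr0 mulrA divff // mul1r; apply: adjoint_form17; exact/fE/mem_I3.
- by move=> u v; apply: adjoint_form17.
move=> u u0; have uG : u *m table_mx form_table = 0.
  apply/rowP => j; rewrite [RHS]mxE -(u0 (delta_mx 0 j)) /form17.
  by rewrite trmx_delta -colE [RHS]mxE.
have /and4P[/poly_factored_neq0 s0 _ _ _] := check_norms.
suff Gu : table_mx form_table \in unitmx by rewrite -(mulmxK Gu u) uG mul0mx.
(* The matrix of the form is inverted explicitly; [check_form] has verified that [inv_table] is its
   inverse up to [scale_poly]. *)
have : (peval scale_poly)^-1 *: table_mx inv_table *m table_mx form_table = 1%:M.
  rewrite -scalemxAl table_mx_mul; last exact: indexed_form_table.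
  apply/row_matrixP => n; rewrite linearZ /= row_table_mx row1.
  have /nilP e0 := fi n (ltn_iota n).
  have := congr1 (lc_val phi) e0.
  rewrite lc_val_lincomb ?xx // lc_val_cons !lc_val_nil addr0 pN p1 scaleN1r.
  move=> /eqP; rewrite addrC subr_eq0 => /eqP <-; rewrite scalerA mulVf ?scale1r.
    by rewrite /phi /= ltn_ord /e17 inord_val.
  exact: s0.
by case/mulmx1_unit.
Qed.
End Soundness.

(** * Modules with a chain of three nonzero submodules *)

Section Irreducible.
Variables (K : fieldType) (M N : rep K) (f : 'Hom(car M, car N)).
Hypothesis fm : mor f.

Lemma irreducible_inj : lker f = 0%VS -> irreducible_sub (limg f) -> irreducible M.
Proof.
move=> f0 [_ fne0 irr]; have inj U : \dim (f @: U) = \dim U.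
  by apply: limg_dim_eq; rewrite f0 capv0.
split=> [||U hU _]; first exact: submodulef.
  by move=> M0; apply: fne0; rewrite M0 limg0.
have [fU|fU] := irr _ (submodule_img fm hU) (limgS f (subvf U)).
  by left; apply/eqP; rewrite -dimv_eq0 -(inj U) fU dimv0.
by right; apply/eqP; rewrite eqEdim subvf -(inj U) fU inj /=.
Qed.

Lemma irreducible_surj : limg f = fullv -> lker f <> fullv ->
  (forall U, submodule U -> (lker f <= U)%VS -> U = lker f \/ U = fullv) ->
  irreducible N.
Proof.
move=> ff fnf irr; split=> [||U hU _]; first exact: submodulef.
  move=> N0; apply: fnf; apply: fullvP => u; rewrite memv_ker.
  by have := memvf (f u); rewrite N0 memv0.
have UE : (f @: (f @^-1: U) = U)%VS by rewrite lpreimK // ff subvf.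
have kU : (lker f <= f @^-1: U)%VS.
  by apply/subvP => u; rewrite memv_ker -memv_preim => /eqP ->; apply: mem0v.
have [e|e] := irr _ (submodule_preim fm hU) kU; [left|right]; rewrite -UE e //.
by apply/zerovP => u /memv_imgP[v]; rewrite memv_ker => /eqP v0 ->.
Qed.

End Irreducible.

Section Chain.
Variables (K : fieldType) (M : rep K) (Z X : {vspace car M}).
Hypotheses (hZ : submodule Z) (hX : submodule X).
Hypotheses (Z_neq0 : Z <> 0%VS) (ZX : (Z <= X)%VS) (X_neqZ : X <> Z) (X_neqf : X <> fullv).
Hypothesis chain : forall N, submodule N -> [\/ N = 0%VS, N = Z, N = X | N = fullv].

Let X_neq0 : X <> 0%VS.
Proof. by move=> X0; move: ZX; rewrite X0 subv0 => /eqP. Qed.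

Let full_neqZ : (fullv : {vspace car M}) <> Z.
Proof. by move=> fZ; apply: X_neqf; apply/eqP; rewrite eqEsubv subvf fZ. Qed.

Lemma chain_irreducible_bottom : irreducible_sub Z.
Proof.
split=> // U hU UZ; have [->|->|UX|Uf] := chain hU; [by left|by right| |].
  by case: X_neqZ; apply/eqP; rewrite eqEsubv ZX -UX UZ.
by case: full_neqZ; apply/eqP; rewrite eqEsubv subvf -Uf UZ.
Qed.

Lemma chain_socle : is_socle Z.
Proof.
split=> [U [hU U0 irr]|]; last first.
  exists [:: Z]; split=> [U|]; last by rewrite big_seq1.
  by rewrite inE => /eqP ->; apply: chain_irreducible_bottom.
have [e|->|UX|Uf] := chain hU; [by case: U0|by rewrite ?subvv| |].
  by have ZU : (Z <= U)%VS by [rewrite UX]; case: (irr Z hZ ZU) => [/Z_neq0|<-].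
by have ZU : (Z <= U)%VS by [rewrite Uf subvf]; case: (irr Z hZ ZU) => [/Z_neq0|<-].
Qed.

(** Every nonzero submodule contains Z, so two of them never meet in zero. *)
Lemma chain_indecomposable : indecomposable M.
Proof.
split=> [f0|U1 U2 h1 h2 _ U12].
  by apply: X_neqf; apply/eqP; rewrite eqEsubv subvf f0 sub0v.
have ge U : submodule U -> U = 0%VS \/ (Z <= U)%VS.
  by move=> hU; case: (chain hU) => ->; [left|right|right|right]; rewrite ?subvv ?subvf.
have [|ZU1] := ge U1 h1; first by left.
have [|ZU2] := ge U2 h2; first by right.
by case: Z_neq0; apply/eqP; rewrite -subv0 -U12 subv_cap ZU1.
Qed.

Definition chain_mid : {vspace car (quomod Z)} := (quo Z @: X)%VS.

Lemma submodule_chain_mid : submodule chain_mid.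
Proof. exact: submodule_img (mor_quo hZ) hX. Qed.

Let quoK (U : {vspace car (quomod Z)}) : (quo Z @: (quo Z @^-1: U) = U)%VS.
Proof. by rewrite lpreimK // limg_quo subvf. Qed.

Let quo0 u : (quo Z u == 0) = (u \in Z).
Proof. by rewrite -memv_ker lker_quo. Qed.

Let quo_eq0 : (quo Z @: Z = 0)%VS.
Proof. by apply/zerovP => u /memv_imgP[v]; rewrite -quo0 => /eqP v0 ->. Qed.

Lemma mem_chain_mid u : (quo Z u \in chain_mid) = (u \in X).
Proof.
apply/idP/idP => [/memv_imgP[v vX uv]|]; last exact: memv_img.
have : u - v \in Z by rewrite -quo0 linearB /= uv subrr.
by move/(subvP ZX)/(memvD vX); rewrite addrC subrK.
Qed.

Let preim_ge (U : {vspace car (quomod Z)}) : (Z <= quo Z @^-1: U)%VS.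
Proof. by apply/subvP => u; rewrite -quo0 -memv_preim => /eqP ->; apply: mem0v. Qed.

Let quo_submodules (U : {vspace car (quomod Z)}) : submodule U ->
  [\/ U = 0%VS, U = chain_mid | U = fullv].
Proof.
move=> hU; have [p|p|p|p] := chain (submodule_preim (mor_quo hZ) hU).
- by case: Z_neq0; apply/eqP; rewrite -subv0 -p preim_ge.
- by constructor 1; rewrite -(quoK U) p quo_eq0.
- by constructor 2; rewrite -(quoK U) p.
- by constructor 3; rewrite -(quoK U) p limg_quo.
Qed.

Let mid_neq0 : chain_mid <> 0%VS.
Proof.
move=> m0; apply: X_neqZ; apply/eqP; rewrite eqEsubv ZX andbT.
by apply/subvP => u; rewrite -mem_chain_mid m0 memv0 quo0.
Qed.

Let mid_neqf : chain_mid <> fullv.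
Proof. by move=> mf; apply: X_neqf; apply: fullvP => u; rewrite -mem_chain_mid mf memvf. Qed.

Lemma chain_irreducible_mid : irreducible_sub chain_mid.
Proof.
split=> // [|U hU Um]; first exact: submodule_chain_mid.
have [->|->|Uf] := quo_submodules hU; [by left|by right|].
by case: mid_neqf; apply/eqP; rewrite eqEsubv subvf -Uf Um.
Qed.

Lemma chain_socle_quo : is_socle chain_mid.
Proof.
split=> [U [hU U0 irr]|]; last first.
  exists [:: chain_mid]; split=> [U|]; last by rewrite big_seq1.
  by rewrite inE => /eqP ->; apply: chain_irreducible_mid.
have [e|->|Uf] := quo_submodules hU; [by case: U0|by rewrite ?subvv|].
have mU : (chain_mid <= U)%VS by rewrite Uf subvf.
by case: (irr _ submodule_chain_mid mU) => [/mid_neq0|<-].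
Qed.

Definition chain_top : 'Hom(car M, car (quomod chain_mid)) := (quo chain_mid \o quo Z)%VF.

Lemma mor_chain_top : mor chain_top.
Proof. exact: mor_comp (mor_quo hZ) (mor_quo submodule_chain_mid). Qed.

Lemma lker_chain_top : lker chain_top = X.
Proof.
apply/vspaceP => u; rewrite memv_ker comp_lfunE -memv_ker lker_quo.
exact: mem_chain_mid.
Qed.

Lemma limg_chain_top : limg chain_top = fullv.
Proof. by rewrite limg_comp !limg_quo. Qed.

Lemma chain_irreducible_top : irreducible (quomod chain_mid).
Proof.
apply: (irreducible_surj mor_chain_top limg_chain_top); rewrite lker_chain_top //.
move=> U hU XU; have [U0|UZ|->|->] := chain hU; [| |by left|by right].
  by case: X_neq0; apply/eqP; rewrite -subv0 -U0.
by case: X_neqZ; apply/eqP; rewrite eqEsubv ZX -UZ XU.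
Qed.

End Chain.

(** * The structure of the tensor square *)

Section Structure.
Variables (K : fieldType) (x : 'I_3 -> K) (h : K).
Hypothesis x_neq0 : forall i, x i != 0.
Hypothesis wt_inj : forall (k : {ffun 'I_3 -> K}) (n n' : {ffun 'I_3 -> nat}),
  (forall i, k i != 0) -> lowered x k n = lowered x k n' -> n = n'.
Hypothesis x_prod : x 0 * x 1 * x 2 = 1.
Hypothesis h_neq0 : h != 0.
Hypothesis two_neq0 : (2 : K) != 0.
Local Notation qmodule := (qmodule x h).
Local Notation lowered := (lowered x).
Local Notation meval := (mono_eval (x 0) (x 1)).
Local Notation peval := (poly_eval (x 0) (x 1)).
Hypothesis factors_neq0 : forall p, p \in factors -> peval p != 0.

(* The indices 0, ..., 4 stand for (2,2,2), (3,1,1), (1,3,1), (1,1,3) and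
   (0,0,0); z is the highest weight vector of weight (1,1,1). *)
Definition square_words : seq (seq 'I_3) :=
  [:: [::]; [:: 0]; [:: 1]; [:: 2%R]; [:: 0; 1; 2%R; 0; 1; 2%R]].
Definition square_word (l : 'I_5) : seq 'I_3 := nth [::] square_words l.
Definition z_word : seq 'I_3 := [:: 0; 1; 2%R].
Definition square_dims : seq nat := [:: 110; 48; 48; 48; 1]%N.

Variables (T : rep K) (b : car T -> car T -> K).
Hypotheses (hT : qmodule T) (hb : contravariant h b) (dimT : dim (car T) = 289%N).
Hypothesis graded : forall u : car T, exists2 L : seq ({ffun 'I_3 -> K} * car T),
  (forall p, p \in L -> has_wt p.1 p.2) & \sum_(p <- L) p.2 = u.
Variables (k0 : {ffun 'I_3 -> K}) (s : 'I_5 -> car T) (e : 'I_5 -> K) (z : car T) (ez : K).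
Local Notation k l := (lowered k0 (content (square_word l))).
Local Notation kz := (lowered k0 (content z_word)).
Hypothesis k0_neq0 : forall i, k0 i != 0.
Hypothesis hs : forall l, singular (k l) (e l) (s l).
Hypothesis hz : singular kz ez z.
Hypothesis norm_neq0 : forall l, b (s l) (s l) != 0.
Hypothesis z_gen : z \in generated (s 0).
Variables (top : 'I_5 -> nat -> mono) (cert : 'I_5 -> seq class_cert).
Variables (topz : nat -> mono) (certz : seq class_cert).
Hypothesis ktop : forall l i, (i < 3)%N -> k l (letter i) = meval (top l i).
Hypothesis kztop : forall i, (i < 3)%N -> kz (letter i) = meval (topz i).
Hypothesis cert_ok : forall l, check_cert (top l) (cert l).
Hypothesis certz_ok : check_cert topz certz.
Hypothesis cert_size : forall l, size (cert_words (cert l)) = nth 0%N square_dims l.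
Hypothesis certz_size : size (cert_words certz) = 17%N.

Local Notation gX l := (generated (s l)).
Local Notation Z := (generated z).
Local Notation W l := (word_span (s l) (cert l)).
Hypothesis z_words : forall l w, l != 0 -> content (w ++ square_word l) = content z_word ->
  Fword w (s l) \in W l.

Local Notation perp := (perp hb).

Let hX l : submodule (gX l). Proof. exact (generated_submodule x_neq0 hT (hs l)). Qed.
Let hZ : submodule Z. Proof. exact (generated_submodule x_neq0 hT hz). Qed.
Let hP U : submodule U -> submodule (perp U). Proof. exact: (submodule_perp h_neq0 hT hb). Qed.

Lemma weights_differ w1 w2 w i : (count_mem i w1 < count_mem i w2)%N ->
  lowered k0 (content w1) != lowered (lowered k0 (content w2)) (content w).
Proof.
move=> lt; rewrite lowered_lowered; apply/eqP => /(wt_inj k0_neq0)/ffunP/(_ i).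
by rewrite !ffunE count_cat => ww; move: lt; rewrite ww ltnNge leq_addl.
Qed.

Let subv_bigsum (I : eqType) (r : seq I) (U : I -> {vspace car T}) V :
  (forall i, i \in r -> (U i <= V)%VS) -> (\sum_(i <- r) U i <= V)%VS.
Proof.
move=> UV; rewrite big_seq; elim/big_ind: _ => // [|U1 U2 h1 h2]; first exact: sub0v.
by rewrite subv_add h1.
Qed.

Let perpC (U V : {vspace car T}) : (U <= perp V)%VS -> (V <= perp U)%VS.
Proof. exact: perp_sub_sym. Qed.

(** Some letter occurs more often in one of the two words than in the other. Hence the weight of one
    vector does not occur in the module generated by the other one, and [generated_perp] applies. *)
Lemma orthogonal l m : l != m -> (gX l <= perp (gX m))%VS.
Proof.
wlog [i lt] : l m / exists i, (count_mem i (square_word l) < count_mem i (square_word m))%N.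
  move=> H lm; have : (exists i, (count_mem i (square_word l) < count_mem i (square_word m))%N) \/
      (exists i, (count_mem i (square_word m) < count_mem i (square_word l))%N).
    move: l m lm {H} => [[|[|[|[|[|]]]]] // il] [[|[|[|[|[|]]]]] // im] // _;
      by [left; exists 0|left; exists 1|left; exists 2|right; exists 0|right; exists 1|right; exists 2].
  case=> hlt; first exact: H.
  by apply: perpC; apply: H; rewrite // eq_sym.
move=> _; apply: (generated_perp x_neq0 hT hb (hs l) (hs m)) => w.
exact: weights_differ lt.
Qed.

Lemma z_sub : (Z <= gX 0%R)%VS.
Proof. exact: generated_min. Qed.

(** For l = 0 the weight of [s 0] lies above all the weights of Z. So Z is in the radical of [gX 0],
    and in particular it is isotropic. *)
Lemma z_orthogonal l : (Z <= perp (gX l))%VS.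
Proof.
have [->|l0] := eqVneq l 0; last first.
  by apply: subv_trans z_sub (orthogonal _); rewrite eq_sym.
apply: perpC; apply: (generated_perp x_neq0 hT hb (hs 0) hz) => w.
by apply: (@weights_differ _ _ _ 0).
Qed.

Lemma s_notin_perp l : s l \notin perp (gX l).
Proof. by apply/negP => /perpP/(_ _ (generated_self _))/eqP; apply/negP. Qed.

Lemma word_span_sub l : (W l <= gX l)%VS.
Proof. exact: word_span_generated. Qed.

Lemma word_span_perp l : (W l :&: perp (gX l))%VS = 0%VS.
Proof.
exact: (word_span_cap x_neq0 wt_inj x_prod h_neq0 factors_neq0 hT (hs l) (ktop l)
  (hP (hX l)) (s_notin_perp l) (cert_ok l)).
Qed.

Lemma word_span_dim l : \dim (W l) = nth 0%N square_dims l.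
Proof.
rewrite -cert_size; apply: (dim_word_span x_neq0 wt_inj x_prod h_neq0 factors_neq0 hT (hs l)
  (ktop l) (hP (hX l)) (s_notin_perp l) (cert_ok l)).
Qed.

Lemma z_notin0 : z \notin (0%VS : {vspace car T}).
Proof. by rewrite memv0 (sing_neq0 hz). Qed.

Lemma z_dim_ge : (17 <= \dim Z)%N.
Proof.
rewrite -certz_size -(dim_word_span x_neq0 wt_inj x_prod h_neq0 factors_neq0 hT hz kztop
  (submodule0 T) z_notin0 certz_ok).
exact/dimvS/word_span_generated.
Qed.

(** The sum is direct: [W l] meets the orthogonal of [gX l] trivially, and that orthogonal contains
    Z and all the other summands. *)
Lemma dim_words_add (r : seq 'I_5) : uniq r ->
  \dim (\sum_(l <- r) W l + Z) = (\sum_(l <- r) nth 0 square_dims l + \dim Z)%N.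
Proof.
elim: r => [|l r IHr] /=; first by rewrite !big_nil add0v.
case/andP => lr ur; rewrite !big_cons -addvA dimv_disjoint_sum ?IHr // ?word_span_dim ?addnA //.
apply/eqP; rewrite -subv0 -[X in (_ <= X)%VS](word_span_perp l) capvS ?subvv //.
rewrite subv_add z_orthogonal andbT; apply: subv_bigsum => m mr.
apply: subv_trans (word_span_sub m) (orthogonal _).
by apply: contraNneq lr => <-.
Qed.

Let sumW : {vspace car T} := (\sum_(l <- index_enum 'I_5) W l + Z)%VS.

Let dim_sumW : \dim sumW = (255 + \dim Z)%N.
Proof.
rewrite dim_words_add ?index_enum_uniq //; congr addn.
by rewrite !big_ord_recl big_ord0.
Qed.

Let sumW_perp : (sumW <= perp Z)%VS.
Proof.
rewrite subv_add (perpC (subv_trans z_sub (perpC (z_orthogonal 0)))) andbT.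
apply: subv_bigsum => l _; apply: subv_trans (word_span_sub l) (perpC (z_orthogonal l)).
Qed.

(* The words and Z span 255 + dim Z dimensions, all of them orthogonal to Z. *)
Lemma dim_z : \dim Z = 17%N.
Proof.
have := dimvS sumW_perp; have := dim_perp hb Z; have := z_dim_ge.
rewrite dimT dim_sumW; lia.
Qed.

(** Equality of dimensions: 255 + 17 = 289 - 17. *)
Lemma sumW_eq : sumW = perp Z.
Proof.
apply/eqP; rewrite eqEdim sumW_perp dim_sumW dim_z.
have := dim_perp hb Z; rewrite dimT dim_z; lia.
Qed.

(** As Z has dimension 17, the words of the certificate span it; a submodule without z meets their
    span in zero. *)
Lemma irreducible_z : irreducible_sub Z.
Proof.
split=> // [Z0|U hU UZ]; first by have := dim_z; rewrite Z0 dimv0.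
have [zU|zU] := boolP (z \in U).
  by right; apply/eqP; rewrite eqEsubv UZ (generated_min hU zU).
left; have WZ : word_span z certz = Z.
  apply/eqP; rewrite eqEdim word_span_generated dim_z -certz_size /=.
  by rewrite (dim_word_span x_neq0 wt_inj x_prod h_neq0 factors_neq0 hT hz kztop hU zU certz_ok).
have := word_span_cap x_neq0 wt_inj x_prod h_neq0 factors_neq0 hT hz kztop hU zU certz_ok.
by rewrite WZ (capv_idPr UZ).
Qed.

Lemma component_perp (P : pred 'I_5) (u : car T) (us : 'I_5 -> car T) y m : P m ->
  (forall l, P l -> us l \in gX l) -> y \in perp (gX m) ->
  \sum_(l | P l) us l + y \in perp (gX m) -> us m \in perp (gX m).
Proof.
move=> Pm usX yP; rewrite (bigD1 m) //= -addrA => /(memvB) H.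
have := H (\sum_(l | P l && (l != m)) us l + y); rewrite addrK; apply.
apply: memvD yP; apply: memv_suml => l /andP[Pl lm].
exact: (subvP (orthogonal lm) _ (usX l Pl)).
Qed.

Lemma mem_perp_z u : u \in perp Z ->
  exists2 ws : 'I_5 -> car T, forall l, ws l \in W l & exists2 y, y \in Z & u = \sum_l ws l + y.
Proof.
rewrite -sumW_eq => /memv_addP[w0 /memv_sumP[ws wsW ->] [y yZ ->]].
by exists ws => [l|]; [exact: wsW|exists y].
Qed.

Let wsX l u : u \in W l -> u \in gX l. Proof. exact: (subvP (word_span_sub l)). Qed.

Lemma generated_decomp l u : u \in gX l ->
  exists2 w, w \in W l & exists2 y, y \in Z & u = w + y.
Proof.
move=> uX; have uZ : u \in perp Z.
  exact: (subvP (perpC (z_orthogonal l)) _ uX).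
have [ws wsW [y yZ uE]] := mem_perp_z uZ; exists (ws l) => //; exists y => //.
rewrite uE; congr (_ + _); rewrite (bigD1 l) //= big1 ?addr0 // => m ml.
apply/eqP; rewrite -memv0 -(word_span_perp m) memv_cap wsW /=.
apply: (@component_perp xpredT u ws y m) => // [l' _||].
- exact: wsX.
- exact: (subvP (z_orthogonal m)).
by rewrite -uE (subvP _ _ uX) // orthogonal // eq_sym.
Qed.

(** Otherwise [z_words] would put z in [W l], whereas z is orthogonal to [gX l] and [W l] meets that
    orthogonal trivially. *)
Lemma z_notin l : l != 0 -> z \notin gX l.
Proof.
move=> l0; apply/negP => zX; have := sing_neq0 hz; rewrite -memv0 -(word_span_perp l).
rewrite memv_cap (subvP (z_orthogonal l) _ (generated_self z)) andbT => /negP; apply.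
have [r -> hr] := generated_wt hT (hs l) zX (sing_wt hz).
rewrite big_seq; apply: memv_suml => p pr; apply/memvZ/z_words => //.
by apply: (wt_inj k0_neq0); rewrite -lowered_lowered hr.
Qed.

Lemma sub_z U : submodule U -> z \notin U -> (U :&: Z)%VS = 0%VS.
Proof.
move=> hU zU; have [_ _ irr] := irreducible_z.
have [//|e1] := irr _ (submoduleI hU hZ) (capvSr U Z).
by case/negP: zU; apply: (subvP (capvSl U Z)); rewrite e1 generated_self.
Qed.

Lemma generated_words l : l != 0 -> gX l = W l.
Proof.
move=> l0; apply/eqP; rewrite eqEsubv word_span_sub andbT; apply/subvP => u uX.
have [w wW [y yZ uE]] := generated_decomp uX.
suff y0 : y = 0 by rewrite uE y0 addr0.
apply/eqP; rewrite -memv0 -(sub_z (hX l) (z_notin l0)) memv_cap yZ andbT.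
by have -> : y = u - w by [rewrite uE addrC addKr]; rewrite memvB // wsX.
Qed.

Lemma generated_perp0 l : l != 0 -> (gX l :&: perp (gX l))%VS = 0%VS.
Proof. by move=> l0; rewrite {1}generated_words // word_span_perp. Qed.

Lemma dim_generated l : l != 0 -> \dim (gX l) = nth 0%N square_dims l.
Proof. by move=> l0; rewrite generated_words // word_span_dim. Qed.

Lemma irreducible_square l : l != 0 -> irreducible_sub (gX l).
Proof.
move=> l0; split=> // [X0|U hU UX].
  by have := sing_neq0 (hs l); rewrite -memv0 -X0 generated_self.
have [sU|sU] := boolP (s l \in U); [right|left].
  by apply/eqP; rewrite eqEsubv UX (generated_min hU sU).
have := word_span_cap x_neq0 wt_inj x_prod h_neq0 factors_neq0 hT (hs l) (ktop l) hU sU (cert_ok l).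
by rewrite -generated_words // (capv_idPr UX).
Qed.

Lemma radical : (gX 0%R :&: perp (gX 0%R))%VS = Z.
Proof.
apply/eqP; rewrite eqEsubv subv_cap z_sub z_orthogonal !andbT; apply/subvP => u.
rewrite memv_cap => /andP[/generated_decomp[w wW [y yZ ->]] uP].
suff -> : w = 0 by rewrite add0r.
apply/eqP; rewrite -memv0 -(word_span_perp 0) memv_cap wW.
rewrite -[w](addrK y) memvB // (subvP (z_orthogonal 0)) //.
Qed.

Lemma dim_generated0 : \dim (gX 0%R) = 127%N.
Proof.
have -> : gX 0%R = (W 0%R + Z)%VS.
  apply/eqP; rewrite eqEsubv subv_add word_span_sub z_sub !andbT.
  by apply/subvP => u /generated_decomp[w wW [y yZ ->]]; rewrite memv_add.
have := @dim_words_add [:: 0] isT; rewrite !big_seq1 => ->.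
by rewrite dim_z.
Qed.

Definition square_ss : {vspace car T} := (\sum_(l < 5 | l != 0%R) gX l)%VS.
Local Notation S := square_ss.
Definition square_core : {vspace car T} := perp S.
Local Notation C := square_core.

Lemma submodule_ss : submodule S.
Proof.
rewrite /S; elim/big_ind: _ => [|U V|l _]; [exact: submodule0|exact: submoduleD|exact: hX].
Qed.

Lemma submodule_core : submodule C. Proof. exact/hP/submodule_ss. Qed.

Lemma core_sub : (gX 0%R <= C)%VS.
Proof. by apply: perpC; apply/subv_sumP => l l0; apply: orthogonal. Qed.

Lemma ss_core : (S :&: C)%VS = 0%VS.
Proof.
apply: zerovP => u; rewrite memv_cap => /andP[/memv_sumP[us usX uE] uC].
rewrite uE big1 // => m m0; apply/eqP; rewrite -memv0 -(generated_perp0 m0) memv_cap usX //=.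
apply: (@component_perp (fun l => l != 0) u us 0 m) => //; first exact: mem0v.
rewrite addr0 -uE (subvP _ _ uC) //; apply: perpS; exact: sumv_sup (subvv _).
Qed.

(** This is 289 - (48 + 48 + 48 + 1). *)
Lemma dim_core : \dim C = 144%N.
Proof.
have SE : S = (\sum_(l <- [seq l <- index_enum 'I_5 | l != 0%R]) W l)%VS.
  by rewrite /S big_filter; apply: eq_bigr => l; apply: generated_words.
have := @dim_words_add [seq l <- index_enum 'I_5 | l != 0].
rewrite filter_uniq ?index_enum_uniq // => /(_ isT); rewrite -SE dimv_disjoint_sum; last first.
  apply/eqP; rewrite -subv0 -ss_core capvS ?subvv //.
  exact: subv_trans z_sub core_sub.
move/addIn; rewrite big_filter big_mkcond /= !big_ord_recl big_ord0 /= => dS.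
by have := dim_perp hb S; rewrite dimT dS => /(canRL (addKn _)).
Qed.

Lemma ss_core_full : (S + C)%VS = fullv.
Proof.
apply/eqP; rewrite eqEdim subvf dimv_disjoint_sum ?ss_core //.
by rewrite dimvf -(dim_perp hb S); exact: leqnn.
Qed.

(** A vector orthogonal to Z is a sum of components in the [W l] and Z by [sumW_eq]. If it is also
    in C, its components with l different from 0 add up to an element of S and of C, which is
    zero. *)
Lemma perp_z_core : (perp Z :&: C)%VS = gX 0%R.
Proof.
apply/eqP; rewrite eqEsubv subv_cap core_sub (perpC (z_orthogonal 0)) !andbT.
apply/subvP => u; rewrite memv_cap => /andP[/mem_perp_z[ws wsW [y yZ uE]] uC].
have w0y : ws 0 + y \in gX 0%R by apply: memvD; [exact: wsX|exact: (subvP z_sub)].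
suff w0 : \sum_(l < 5 | l != 0) ws l = 0 by rewrite uE (bigD1 0) //= w0 addr0.
apply/eqP; rewrite -memv0 -ss_core memv_cap; apply/andP; split.
  by apply/memv_sumP; exists ws => // l _; apply: wsX.
have -> : \sum_(l < 5 | l != 0) ws l = u - (ws 0 + y).
  by apply: (canRL (addrK _)); rewrite uE [in RHS](bigD1 0) //= addrA [_ + ws 0]addrC.
by rewrite memvB // (subvP core_sub).
Qed.

Local Notation killed u := (forall i, act _ (E i) u = 0).

Lemma z_word_neq0 : k0 != kz.
Proof.
have := @weights_differ [::] z_word [::] 0 isT.
by rewrite !lowered_lowered !cat0s lowered0.
Qed.

(** By contravariance, a vector killed by the E_i is orthogonal to the image of every F_i, so only
    its pairing with [s'] itself matters. *)
Lemma killed_perp k' e' s' k1 (u : car T) : singular k' e' s' -> killed u -> has_wt k1 u ->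
  k1 != k' \/ b u s' = 0 -> u \in perp (generated s').
Proof.
move=> hs' uE uK k1k'; apply/perpP => v /generatedP[r ->].
rewrite (form_sumr hb) big1 // => -[a w] _ /=; rewrite (formZr hb).
case: w => [|i w] /=; last by rewrite (form_sym hb) (form_F hb) uE (form0r hb) !mulr0.
by case: k1k' => [kk|->]; rewrite ?mulr0 // (form_wt hb uK (sing_wt hs')) // mulr0.
Qed.

(** Such a vector is orthogonal to [gX 0], hence to Z, hence lies in [gX 0] by [perp_z_core]; there
    it belongs to the radical, which is Z. *)
Lemma killed_core k1 (u : car T) : u \in C -> killed u -> has_wt k1 u ->
  k1 != k0 \/ b u (s 0) = 0 -> u \in Z.
Proof.
move=> uC uE uK kk; have k00 : k 0 = k0 by rewrite lowered0.
have uP : u \in perp (gX 0%R) by apply: (killed_perp (hs 0) uE uK); rewrite k00.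
rewrite -radical memv_cap uP andbT -perp_z_core memv_cap uC andbT.
exact: (subvP (perpS hb z_sub)).
Qed.

Lemma mem_submod (U : {vspace car T}) (hU : submodule U) u : u \in U ->
  exists v : car (submod U), incl U v = u.
Proof. by rewrite -{1}(limg_incl U) => /memv_imgP[v _ ->]; exists v. Qed.

Lemma singular_inj (M N : rep K) (f : 'Hom(car M, car N)) k1 e1 u :
  mor f -> lker f = 0%VS -> singular k1 e1 (f u) -> singular k1 e1 u.
Proof.
move=> fm /inj_lker f0 [fu0 fuP fuE fuK].
have inj v w : f v = f w -> v = w.
  by move=> e1'; apply/eqP; rewrite -subr_eq0; apply/eqP/f0; rewrite linearB /= e1' subrr.
split.
- by apply: contraNneq fu0 => ->; rewrite linear0.
- by apply: inj; rewrite (mor_par fm) fuP linearZ.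
- by move=> i; apply: inj; rewrite (mor_act fm) fuE linear0.
by move=> i; apply: inj; rewrite (mor_act fm) fuK linearZ.
Qed.

Lemma hw_irr_submod k1 e1 s1 (U : {vspace car T}) : irreducible_sub U -> s1 \in U ->
  singular k1 e1 s1 -> hw_irr x h k1 e1 (submod U).
Proof.
move=> hU sU hs1; have [hU' _ _] := hU; split; first exact: qmodule_submod.
  by apply: (irreducible_inj (mor_incl hU') (lker_incl U)); rewrite limg_incl.
have [v vs] := mem_submod hU' sU; exists v.
by apply: (singular_inj (mor_incl hU') (lker_incl U)); rewrite vs.
Qed.

Lemma hw_irr_z : hw_irr x h kz ez (submod Z).
Proof. exact: hw_irr_submod irreducible_z (generated_self z) hz. Qed.

Lemma hw_irr_square l : l != 0 -> hw_irr x h (k l) (e l) (submod (gX l)).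
Proof.
by move=> l0; apply: hw_irr_submod (irreducible_square l0) (generated_self _) (hs l).
Qed.

Lemma z_killed k1 (u : car T) : u \in Z -> u != 0 -> killed u -> has_wt k1 u -> k1 = kz.
Proof.
move=> uZ u0 uE uK; have [v vu] := mem_submod hZ uZ; have [_ _ [w hw]] := hw_irr_z.
have inj : forall y, incl Z y = 0 -> y = 0 by apply/inj_lker/lker_incl.
have m := mor_incl hZ.
have [|||-> _ //] := @hw_irr_singular _ x h x_neq0 wt_inj two_neq0 _ _ _ k1 w v hw_irr_z hw.
- by apply: contraNneq u0 => v0; rewrite -vu v0 linear0.
- by move=> i; apply: inj; rewrite (mor_act m) vu uE.
by move=> i; apply/eqP; rewrite -subr_eq0; apply/eqP/inj; rewrite linearB /= (mor_act m) linearZ /= vu uK subrr.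
Qed.

Lemma killed_core_z (u : car T) : u \in C -> killed u -> has_wt kz u -> exists a, u = a *: z.
Proof.
move=> uC uE uK; apply: (generated_top wt_inj hT hz) => //.
by apply: killed_core uK _ => //; left; rewrite eq_sym z_word_neq0.
Qed.

Lemma killed_core_s (u : car T) : u \in C -> killed u -> has_wt k0 u -> exists a, u = a *: s 0.
Proof.
(* The coefficient of the orthogonal projection to [s 0]; the difference is then in Z, where [k0] is
   not a weight of vectors killed by the E_i. *)
move=> uC uE uK; exists (b u (s 0) / b (s 0) (s 0)); set a := _ / _.
have s0C : s 0 \in C by apply: (subvP core_sub); exact: generated_self.
have sK : has_wt k0 (s 0) by have := sing_wt (hs 0); rewrite lowered0.
set u' := u - a *: s 0.
have uE' : killed u' by move=> i; rewrite linearB linearZ /= uE (sing_E (hs 0)) scaler0 subrr.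
have uK' : has_wt k0 u' by rewrite /u' -scaleNr; apply/has_wtD/has_wtZ.
have uZ : u' \in Z.
  apply: (killed_core _ uE' uK'); first by rewrite memvB ?memvZ.
  right; rewrite (formDl hb) -scaleNr (formZl hb) mulNr mulfVK ?subrr //.
apply/eqP; rewrite -subr_eq0 -/u'; apply: contraT => u'0.
by have /eqP := z_killed uZ u'0 uE' uK'; rewrite (negPf z_word_neq0).
Qed.

Lemma killed_core_neq k1 (u : car T) : u \in C -> killed u -> has_wt k1 u ->
  k1 != k0 -> k1 != kz -> u = 0.
Proof.
move=> uC uE uK kk kk'; apply/eqP; apply: contraNT kk' => u0; apply/eqP.
by apply: (z_killed _ u0 uE uK); apply: killed_core uK _ => //; left.
Qed.

Lemma z_weight_lowered i w : lowered kz (content (i :: w)) != kz.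
Proof.
apply/eqP; rewrite -[X in _ = X](lowered0 x) => e1; suff : i :: w = [::] by [].
by apply: content_nil; apply: (wt_inj _ e1); exact: (has_wt_neq0 hT (sing_wt hz) (sing_neq0 hz)).
Qed.

(** Pairing E_i t with a word applied to z amounts to pairing t with a longer word, and the weights
    differ. *)
Lemma raised_perp t i : has_wt kz t -> act T (E i) t \in perp Z.
Proof.
move=> tK; apply/perpP => v /generatedP[r ->]; rewrite (form_sumr hb) big1 // => p _.
rewrite (formZr hb) (_ : b _ _ = 0) ?mulr0 //; apply: (mulfI h_neq0); rewrite mulr0.
rewrite (form_E hb) -[act T (F i) _]/(Fword (i :: p.2) z).
apply: (form_wt hb tK (has_wt_Fword hT (i :: p.2) (sing_wt hz))).
by rewrite eq_sym z_weight_lowered.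
Qed.

(** The weight of E_i t is above the highest weight of Z. *)
Lemma raised_z t i : has_wt kz t -> act T (E i) t \in Z -> act T (E i) t = 0.
Proof.
move=> tK tZ; apply/eqP; apply: contraT => t0.
have [w] := generated_wt_neq0 hT hz tZ t0 (has_wt_E hT i tK).
move=> e1; case/eqP: (z_weight_lowered i w); rewrite lowered_cons -e1.
by apply/ffunP => j; rewrite [LHS]ffunE ffunE mulfK ?bx_neq0.
Qed.

(** If N were orthogonal to z, it would be orthogonal to Z, the orthogonal of N being a submodule.
    Only the component of weight [kz] of a vector contributes to its pairing with z. *)
Lemma z_vector N : submodule N -> ~~ (N <= perp Z)%VS ->
  exists t, [/\ t \in N, has_wt kz t & b t z != 0].
Proof.
move=> hN NZ; have [u uN uz] : exists2 u, u \in N & b z u != 0.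
  apply: contrapT => H; case/negP: NZ; apply/perpC/generated_min; first exact: hP.
  apply/perpP => v vN; apply/eqP; apply: contraT => bz; case: H; by exists v.
have [L hL Lu] := graded u; exists (\sum_(p <- L | p.1 == kz) p.2); split.
- by apply: (wt_component hN) => //; rewrite Lu.
- by rewrite big_seq_cond; apply: has_wt_sum => p /andP[pL /eqP <-]; apply: hL.
move: uz; rewrite (form_sym hb) -Lu !(form_suml hb) (bigID (fun p => p.1 == kz)) /=.
by rewrite [X in _ + X]big1_seq ?addr0 // => p /andP[kk pL]; apply: (form_wt hb (hL p pL) (sing_wt hz)).
Qed.

(* Otherwise N contains t of weight (1,1,1) with b t z != 0; as E_i t has to
   vanish, t is orthogonal to F_i T, hence to z. *)
Lemma core_sub_no_top N : submodule N -> (N <= C)%VS -> s 0 \notin N -> (N <= Z)%VS.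
Proof.
move=> hN NC sN; have NXZ : (N :&: gX 0%R <= Z)%VS.
  rewrite -radical subv_cap capvSr /=.
  apply: (proper_submodule_perp wt_inj hT hb (hs 0) (submoduleI hN (hX 0)) (capvSr _ _)).
  by rewrite memv_cap negb_and sN.
have [NZ|NZ] := boolP (N <= perp Z)%VS.
  by rewrite (subv_trans _ NXZ) // subv_cap subvv -perp_z_core subv_cap NZ.
have [t [tN tK /negP[]]] := z_vector hN NZ.
have tE : killed t.
  move=> i; apply: (raised_z tK); apply: (subvP NXZ).
  have EN : act T (E i) t \in N by have /submoduleP/(_ (Some (E i))) := hN; apply.
  by rewrite memv_cap EN -perp_z_core memv_cap raised_perp //= (subvP NC).
have tZ : t \in Z.
  by apply: (killed_core (subvP NC _ tN) tE tK); left; rewrite eq_sym z_word_neq0.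
by have /perpP -> := subvP (z_orthogonal 0) _ tZ; rewrite ?z_gen.
Qed.

(** Duality with [core_sub_no_top]: the orthogonal of N in C does not contain [s 0], which has
    nonzero norm, so it is contained in Z. If it is Z, then N is orthogonal to Z; if it is zero, N
    is C by dimensions. *)
Lemma core_sub_top N : submodule N -> (N <= C)%VS -> s 0 \in N -> N = gX 0%R \/ N = C.
Proof.
move=> hN NC sN; have XN : (gX 0%R <= N)%VS by exact: generated_min.
have [NZ|NZ] := boolP (N <= perp Z)%VS.
  by left; apply/eqP; rewrite eqEsubv XN -perp_z_core subv_cap NZ NC.
right; have hM := submoduleI (hP hN) submodule_core.
have sM : s 0 \notin (perp N :&: C)%VS.
  by rewrite memv_cap; apply: contra (norm_neq0 0) => /andP[/perpP -> //].
have [_ _ irr] := irreducible_z.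
have [M0|MZ] := irr _ hM (core_sub_no_top hM (capvSr _ _) sM).
  apply/eqP; rewrite eqEdim NC; have := dim_perp_ge hb C N.
  by rewrite capvC M0 dimv0 addn0.
by case/negP: NZ; apply: perpC; rewrite -MZ capvSl.
Qed.

Lemma core_top : exists t, [/\ t \in C, has_wt kz t, t \notin gX 0%R,
  par T t = ez *: t & forall i, act T (E i) t \in gX 0%R].
Proof.
have CZ : ~~ (C <= perp Z)%VS.
  apply/negP => CZ; have := dim_generated0.
  by rewrite -perp_z_core (capv_idPr CZ) dim_core.
have [t [tC tK tz]] := z_vector submodule_core CZ.
have ee : ez * ez = 1.
  have := pt_par hT z; rewrite (sing_par hz) linearZ /= (sing_par hz) scalerA => /eqP.
  rewrite -subr_eq0 -[X in _ - X]scale1r -scalerBl scaler_eq0 (negPf (sing_neq0 hz)) orbF.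
  by rewrite subr_eq0 => /eqP.
(* The projection of t to the parity of z makes it homogeneous; its pairing with z is twice that of
   t. *)
have tK' : has_wt kz (t + ez *: par T t).
  apply: has_wtD => //; apply: has_wtZ => i.
  by rewrite -(pt_parKh hT) tK linearZ.
exists (t + ez *: par T t); split=> //.
- apply: memvD => //; apply: memvZ.
  by have /submoduleP/(_ None) := submodule_core; apply.
- rewrite -perp_z_core memv_cap negb_and; apply/orP; left.
  apply/negP => /perpP/(_ _ (generated_self z))/eqP.
  rewrite (formDl hb) (formZl hb) (form_par hb) (sing_par hz) (formZr hb) mulrA ee mul1r.
  by rewrite -mulr2n -mulr_natl mulf_eq0 (negPf two_neq0) (negPf tz).
- by rewrite linearD linearZ /= (pt_par hT) scalerDr scalerA ee scale1r addrC.
move=> i; rewrite -perp_z_core memv_cap raised_perp //=.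
have /submoduleP/(_ (Some (E i))) := submodule_core; apply.
apply: memvD => //; apply: memvZ.
by have /submoduleP/(_ None) := submodule_core; apply.
Qed.

Definition core_mod : rep K := submod C.
Local Notation Wa := core_mod.
Local Notation iota := (incl C).
Definition core_Z : {vspace car Wa} := (iota @^-1: Z)%VS.
Definition core_X : {vspace car Wa} := (iota @^-1: gX 0%R)%VS.

Let mi : mor iota. Proof. exact: mor_incl submodule_core. Qed.
Let i_inj u : iota u = 0 -> u = 0. Proof. by move: u; apply/inj_lker/lker_incl. Qed.
Let i_inj2 u v : iota u = iota v -> u = v.
Proof. by move=> uv; apply/eqP; rewrite -subr_eq0; apply/eqP/i_inj; rewrite linearB /= uv subrr. Qed.
Let i_core u : iota u \in C. Proof. by have := memv_img iota (memvf u); rewrite limg_incl. Qed.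
Let i_surj u : u \in C -> exists v, iota v = u. Proof. exact: mem_submod submodule_core u. Qed.
Let ZC : (Z <= C)%VS. Proof. exact: subv_trans z_sub core_sub. Qed.
Let iZ : (iota @: core_Z = Z)%VS. Proof. by rewrite lpreimK // limg_incl ZC. Qed.
Let iX : (iota @: core_X = gX 0%R)%VS. Proof. by rewrite lpreimK // limg_incl core_sub. Qed.
Let mem_Z u : (u \in core_Z) = (iota u \in Z). Proof. by rewrite memv_preim. Qed.
Let mem_X u : (u \in core_X) = (iota u \in gX 0%R). Proof. by rewrite memv_preim. Qed.
Let i_img (U V : {vspace car Wa}) : (iota @: U = iota @: V)%VS -> U = V.
Proof.
move=> UV; apply/vspaceP => u; have mem (Y : {vspace car Wa}) : (u \in Y) = (iota u \in iota @: Y)%VS.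
  by apply/idP/idP => [/(memv_img _)|/memv_imgP[v vY /i_inj2->]].
by rewrite !mem UV.
Qed.

Lemma qmodule_core : qmodule Wa. Proof. exact: qmodule_submod submodule_core hT. Qed.
Lemma submodule_core_Z : submodule core_Z. Proof. exact: submodule_preim mi hZ. Qed.
Lemma submodule_core_X : submodule core_X. Proof. exact: submodule_preim mi (hX 0). Qed.

Lemma core_Z_neq0 : core_Z <> 0%VS.
Proof. by move=> Z0; have := dim_z; rewrite -iZ Z0 limg0 dimv0. Qed.

Lemma core_ZX : (core_Z <= core_X)%VS.
Proof. by apply/subvP => u; rewrite mem_Z mem_X; apply/subvP/z_sub. Qed.

Lemma core_X_neqZ : core_X <> core_Z.
Proof. by move=> e1; have := dim_generated0; rewrite -iX e1 iZ dim_z. Qed.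

Lemma core_X_neqf : core_X <> fullv.
Proof. by move=> e1; have := dim_generated0; rewrite -iX e1 limg_incl dim_core. Qed.

Lemma core_chain N : submodule N -> [\/ N = 0%VS, N = core_Z, N = core_X | N = fullv].
Proof.
move=> hN; have hN' := submodule_img mi hN.
have NC : (iota @: N <= C)%VS by have := limgS iota (subvf N); rewrite limg_incl.
have [sN|sN] := boolP (s 0 \in (iota @: N)%VS).
  have [e1|e1] := core_sub_top hN' NC sN; [constructor 3|constructor 4]; apply: i_img.
    by rewrite e1 iX.
  by rewrite e1 limg_incl.
have [_ _ irr] := irreducible_z.
have [e1|e1] := irr _ hN' (core_sub_no_top hN' NC sN); [constructor 1|constructor 2]; apply: i_img.
  by rewrite e1 limg0.
by rewrite e1 iZ.
Qed.

Local Notation mid := (chain_mid core_Z core_X).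
Local Notation topm := (chain_top core_Z core_X).

Lemma hw_irr_core_bottom : hw_irr x h kz ez (submod core_Z).
Proof.
have [v vz] := i_surj (subvP ZC _ (generated_self z)).
have vZ : v \in core_Z by rewrite mem_Z vz generated_self.
have hv : singular kz ez v.
  by apply: (singular_inj mi (lker_incl C)); rewrite vz.
have irr := chain_irreducible_bottom submodule_core_Z core_Z_neq0 core_ZX core_X_neqZ core_X_neqf core_chain.
split; first exact: qmodule_submod submodule_core_Z qmodule_core.
  apply: (irreducible_inj (mor_incl submodule_core_Z) (lker_incl core_Z)).
  by rewrite limg_incl.
have : v \in limg (incl core_Z) by rewrite limg_incl.
case/memv_imgP => w _ vw; exists w.
by apply: (singular_inj (mor_incl submodule_core_Z) (lker_incl core_Z)); rewrite -vw.
Qed.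

Lemma hw_irr_core_mid : hw_irr x h k0 (e 0) (submod mid).
Proof.
have hm := submodule_chain_mid submodule_core_Z submodule_core_X.
have [v vs] := i_surj (subvP core_sub _ (generated_self (s 0))).
have hv : singular k0 (e 0) v.
  by apply: (singular_inj mi (lker_incl C)); rewrite vs; have := hs 0; rewrite lowered0.
have vX : v \in core_X by rewrite mem_X vs generated_self.
have vZ : v \notin core_Z.
  rewrite mem_Z vs; apply: contra (s_notin_perp 0) => sZ.
  exact: (subvP (z_orthogonal 0)).
have hq := qmodule_quomod submodule_core_Z qmodule_core.
have irr := chain_irreducible_mid submodule_core_Z submodule_core_X core_Z_neq0 core_ZX core_X_neqZ core_X_neqf core_chain.
split; first exact: qmodule_submod hm hq.
  by apply: (irreducible_inj (mor_incl hm) (lker_incl mid)); rewrite limg_incl.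
have : quo core_Z v \in limg (incl mid).
  by rewrite limg_incl mem_chain_mid // core_ZX.
case/memv_imgP => w _ vw; exists w.
apply: (singular_inj (mor_incl hm) (lker_incl mid)); rewrite -vw.
apply: (mor_singular (mor_quo submodule_core_Z)) hv.
by rewrite -memv_ker lker_quo.
Qed.

Let mt : mor topm := mor_chain_top submodule_core_Z submodule_core_X.
Let kt : lker topm = core_X := lker_chain_top core_ZX.

Lemma hw_irr_core_top : hw_irr x h kz ez (quomod mid) /\
  exists t, [/\ singular kz ez (topm t), has_wt kz t & forall i, act Wa (E i) t \in core_X].
Proof.
have [t0 [tC tK tX tP tE]] := core_top; have [t tt] := i_surj tC.
have tK' : has_wt kz t by move=> i; apply: i_inj2; rewrite (mor_act mi) linearZ /= tt tK.
have tE' i : act Wa (E i) t \in core_X by rewrite mem_X (mor_act mi) tt.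
have tS : singular kz ez (topm t).
  split.
  - by rewrite -memv_ker kt mem_X tt.
  - rewrite -(mor_par mt) (_ : par Wa t = ez *: t) ?linearZ //.
    by apply: i_inj2; rewrite (mor_par mi) linearZ /= tt tP.
  - by move=> i; rewrite -(mor_act mt); apply/eqP; rewrite -memv_ker kt.
  by move=> i; rewrite -(mor_act mt) tK' linearZ.
split; last by exists t.
split; last by exists (topm t).
  have hm := submodule_chain_mid submodule_core_Z submodule_core_X.
  exact: qmodule_quomod hm (qmodule_quomod submodule_core_Z qmodule_core).
exact: chain_irreducible_top submodule_core_Z submodule_core_X core_Z_neq0 core_ZX core_X_neqZ core_X_neqf core_chain.
Qed.

Let z_ex : exists zc : car Wa, [/\ iota zc = z, singular kz ez zc & zc \in core_Z].
Proof.
have [v vz] := i_surj (subvP ZC _ (generated_self z)); exists v; split=> //.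
  by apply: (singular_inj mi (lker_incl C)); rewrite vz.
by rewrite mem_Z vz generated_self.
Qed.

Let s_ex : exists sc : car Wa, [/\ iota sc = s 0, singular k0 (e 0) sc & sc \in core_X].
Proof.
have [v vs] := i_surj (subvP core_sub _ (generated_self (s 0))); exists v; split=> //.
  by apply: (singular_inj mi (lker_incl C)); rewrite vs; have := hs 0; rewrite lowered0.
by rewrite mem_X vs generated_self.
Qed.

Let killed_i (u : car Wa) : killed u -> killed (iota u).
Proof. by move=> uE i; rewrite -(mor_act mi) uE linear0. Qed.

Let wt_i k1 (u : car Wa) : has_wt k1 u -> has_wt k1 (iota u).
Proof. by move=> uK i; rewrite -(mor_act mi) uK linearZ. Qed.

Lemma core_hom_X (N : rep K) (f : 'Hom(car Wa, car N)) sc : Defs.hom f -> iota sc = s 0 ->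
  f sc = 0 -> forall u, u \in core_X -> f u = 0.
Proof.
move=> hf sE f0 u; rewrite mem_X => /generatedP[l].
have -> : \sum_(p <- l) p.1 *: Fword p.2 (s 0) = iota (\sum_(p <- l) p.1 *: Fword p.2 sc).
  rewrite linear_sum; apply: eq_bigr => p _.
  by rewrite linearZ /= (hom_Fword _ _ (mor_hom mi)) sE.
move/i_inj2 ->; rewrite linear_sum big1 // => p _.
rewrite linearZ /= (hom_Fword _ _ hf) f0; suff -> : Fword p.2 (0 : car N) = 0 by rewrite scaler0.
by elim: p.2 => //= i w ->; rewrite linear0.
Qed.

(** Modulo X the module is irreducible, hence generated by the image of t. *)
Lemma core_hom_eq (N : rep K) (f g : 'Hom(car Wa, car N)) t :
  singular kz ez (topm t) -> Defs.hom f -> Defs.hom g ->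
  (forall u, u \in core_X -> f u = 0) -> (forall u, u \in core_X -> g u = 0) ->
  f t = g t -> f = g.
Proof.
move=> ht hf hg f0 g0 fgt; have [[hq irr _] _] := hw_irr_core_top.
apply/lfunP => u; have := memvf (topm u); rewrite -(irreducible_generated x_neq0 hq irr ht).
case/generatedP => l uE; pose v := \sum_(p <- l) p.1 *: Fword p.2 t.
have uv : u - v \in core_X.
  rewrite -kt memv_ker linearB /= uE /v linear_sum subr_eq0; apply/eqP/eq_bigr => p _.
  by rewrite linearZ /= (hom_Fword _ _ (mor_hom mt)).
have uE' (k : 'Hom(car Wa, car N)) : k u = k (u - v) + k v by rewrite -linearD subrK.
rewrite !uE' (f0 _ uv) (g0 _ uv) !add0r /v !linear_sum; apply: eq_bigr => p _.
by rewrite !linearZ /= (hom_Fword _ _ hf) (hom_Fword _ _ hg) fgt.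
Qed.

Let multiple_z (L : rep K) (f : 'Hom(car L, car Wa)) u zc : iota zc = z ->
  (forall i, act Wa (E i) (f u) = 0) -> has_wt kz (f u) -> exists a, f u = a *: zc.
Proof.
move=> zcE fE fK; have [a fa] := killed_core_z (i_core _) (killed_i fE) (wt_i fK).
by exists a; apply: i_inj2; rewrite fa linearZ /= zcE.
Qed.

Lemma hom_dim_to_core k1 e1 L : hw_irr x h k1 e1 L -> k1 != k0 -> k1 != kz ->
  hom_dim L Wa = 0%N.
Proof.
move=> [hq irr [v hv]] kk kk'; have gv := irreducible_generated x_neq0 hq irr hv.
apply: hom_dim0 => f hf; apply: (hom_eq_generated hf (hom0 _ _) gv); rewrite zero_lfunE.
have [fE fK] := hom_singular_image hf hv; apply: i_inj.
exact: (killed_core_neq (i_core _) (killed_i fE) (wt_i fK)).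
Qed.

Lemma hom_dim_to_core_z L : hw_irr x h kz ez L -> hom_dim L Wa = 1%N.
Proof.
move=> hL; have [hq irr [v hv]] := hL; have gv := irreducible_generated x_neq0 hq irr hv.
have [zc [zcE hzc zcZ]] := z_ex.
have multiple f : Defs.hom f -> exists a, f v = a *: zc.
  by move=> hf; have [fE fK] := hom_singular_image hf hv; apply: multiple_z.
have /isoP[g [gm g0 gf]] : L ≅ submod core_Z.
  exact: (hw_irr_unique x_neq0 wt_inj hL hw_irr_core_bottom).
pose g' := (incl core_Z \o g)%VF; have hg' : Defs.hom g'.
  exact/mor_hom/(mor_comp gm)/(mor_incl submodule_core_Z).
have g'v : g' v != 0.
  rewrite comp_lfunE; apply: contraNneq (sing_neq0 hv).
  have /inj_lker i0 := lker_incl core_Z; have /inj_lker g0' := g0.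
  by move=> e1; apply/eqP/g0'/i0.
have [c gc] := multiple _ hg'.
have c0 : c != 0 by apply: contraNneq g'v => c0; rewrite gc c0 scale0r.
apply: (hom_dim1 (g := g')) => // [e0|f hf]; first by rewrite e0 zero_lfunE eqxx in g'v.
have [a fa] := multiple _ hf; exists (a / c).
apply: (hom_eq_generated hf _ gv); first by rewrite -[_ *: _]addr0; apply: homPL (hom0 _ _).
by rewrite scale_lfunE gc fa scalerA divfK.
Qed.

(** The image of [s 0] is killed by the E_i and has weight [k0], which is not the highest weight of
    L, so it vanishes; X is generated by [s 0]. *)
Lemma hom_from_core_X k1 e1 L (f : 'Hom(car Wa, car L)) : hw_irr x h k1 e1 L -> k1 != k0 ->
  Defs.hom f -> forall u, u \in core_X -> f u = 0.
Proof.
move=> hL kk hf; have [sc [scE hsc _]] := s_ex; apply: (core_hom_X hf scE).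
have [fE fK] := hom_singular_image hf hsc; have [_ _ [v hv]] := hL.
apply/eqP; apply: contraNT kk => fs0; apply/eqP.
by have [] := hw_irr_singular x_neq0 wt_inj two_neq0 hL hv fs0 fE fK.
Qed.

Lemma hom_dim_from_core k1 e1 L : hw_irr x h k1 e1 L -> k1 != k0 -> k1 != kz ->
  hom_dim Wa L = 0%N.
Proof.
move=> hL kk kk'; have [_ [t [ht tK tE]]] := hw_irr_core_top; have [_ _ [v hv]] := hL.
apply: hom_dim0 => f hf; have fX := hom_from_core_X hL kk hf.
apply: (core_hom_eq ht hf (hom0 _ _) fX) => [u _|]; first by rewrite zero_lfunE.
rewrite zero_lfunE; apply/eqP; apply: contraNT kk' => ft0; apply/eqP.
have fE i : act L (E i) (f t) = 0 by have /homE <- := hf; apply: fX.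
by have [] := hw_irr_singular x_neq0 wt_inj two_neq0 hL hv ft0 fE (hom_has_wt hf tK).
Qed.

Lemma core_top_hom L : hw_irr x h kz ez L -> exists2 g : 'Hom(car Wa, car L),
  mor g & limg g = fullv /\ forall u, u \in core_X -> g u = 0.
Proof.
move=> hL; have [htop _] := hw_irr_core_top.
have /isoP[g [gm g0 gf]] := hw_irr_unique x_neq0 wt_inj htop hL.
exists (g \o topm)%VF; first exact: mor_comp mt gm.
split; first by rewrite limg_comp limg_chain_top.
move=> u uX; have : u \in lker topm by rewrite kt.
by rewrite memv_ker comp_lfunE => /eqP ->; rewrite linear0.
Qed.

Lemma hom_dim_from_core_z L : hw_irr x h kz ez L -> hom_dim Wa L = 1%N.
Proof.
move=> hL; have [_ [t [ht tK tE]]] := hw_irr_core_top; have [_ irr [v hv]] := hL.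
have kk : kz != k0 by rewrite eq_sym z_word_neq0.
have [g /mor_hom hg [gf gX]] := core_top_hom hL.
have multiple f : Defs.hom f -> exists a, f t = a *: v.
  move=> hf; have fX := hom_from_core_X hL kk hf.
  have fE i : act L (E i) (f t) = 0 by have /homE <- := hf; apply: fX.
  have [ft0|ft0] := eqVneq (f t) 0; first by exists 0; rewrite scale0r.
  by have [] := hw_irr_singular x_neq0 wt_inj two_neq0 hL hv ft0 fE (hom_has_wt hf tK).
have g0 : g <> 0.
  move=> g0; have [_ + _] := irr; apply; rewrite -gf g0.
  by apply/zerovP => u /memv_imgP[w _ ->]; rewrite zero_lfunE.
have [c gc] := multiple _ hg.
have c0 : c != 0.
  apply/eqP => c0; apply: g0; apply: (core_hom_eq ht hg (hom0 _ _) gX) => [u _|].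
    by rewrite zero_lfunE.
  by rewrite gc c0 scale0r zero_lfunE.
apply: (hom_dim1 (g := g)) => // f hf; have [a fa] := multiple _ hf; exists (a / c).
apply: (core_hom_eq ht hf _ (hom_from_core_X hL kk hf)).
- by rewrite -[_ *: _]addr0; apply: homPL (hom0 _ _).
- by move=> u uX; rewrite scale_lfunE gX ?scaler0.
by rewrite scale_lfunE gc fa scalerA divfK.
Qed.

(** A basis is the identity together with the nilpotent map from W_a onto its top factor, identified
    with the socle Z. Any f multiplies [s 0] by a scalar a; then f - a kills X, and it sends t to a
    multiple of z. *)
Lemma hom_dim_core : hom_dim Wa Wa = 2%N.
Proof.
have [_ [t [ht tK tE]]] := hw_irr_core_top.
have [zc [zcE hzc zcZ]] := z_ex; have [sc [scE hsc scX]] := s_ex.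
have [g1 g1m [g1f g1X]] := core_top_hom hw_irr_core_bottom.
pose g := (incl core_Z \o g1)%VF : 'End(car Wa).
have hg : Defs.hom g by exact/mor_hom/(mor_comp g1m)/(mor_incl submodule_core_Z).
have gX u : u \in core_X -> g u = 0 by move=> uX; rewrite comp_lfunE g1X ?linear0.
have multiple (f : 'End(car Wa)) : Defs.hom f -> (forall u, u \in core_X -> f u = 0) ->
    exists a, f t = a *: zc.
  move=> hf fX; apply: multiple_z => // [i|]; last exact: hom_has_wt tK.
  by have /homE <- := hf; apply: fX.
have g0 : g <> 0.
  move=> g0; apply: core_Z_neq0; rewrite -(limg_incl core_Z) -g1f -limg_comp -/g g0.
  by apply/zerovP => u /memv_imgP[w _ ->]; rewrite zero_lfunE.
have [c gc] := multiple _ hg gX.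
have c0 : c != 0.
  apply/eqP => c0; apply: g0; apply: (core_hom_eq ht hg (hom0 _ _) gX) => [u _|].
    by rewrite zero_lfunE.
  by rewrite gc c0 scale0r zero_lfunE.
have hid : Defs.hom (\1%VF : 'End(car Wa)) by exact/mor_hom/mor1.
have id0 : (\1%VF : 'End(car Wa)) <> 0.
  move=> id0; have := sing_neq0 hsc.
  by rewrite -[sc]id_lfunE id0 zero_lfunE eqxx.
apply: (hom_dim2 (g := \1%VF) (h := g)) => // [a ga|f hf].
  have := gX _ scX; rewrite ga scale_lfunE id_lfunE => /eqP.
  rewrite scaler_eq0 (negPf (sing_neq0 hsc)) orbF => /eqP a0.
  by apply: g0; rewrite ga a0 scale0r.
have [a fa] : exists a, f sc = a *: sc.
  have [fE fK] := hom_singular_image hf hsc.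
  have [a fa] := killed_core_s (i_core _) (killed_i fE) (wt_i fK).
  by exists a; apply: i_inj2; rewrite fa linearZ /= scE.
have hf' : Defs.hom (f - a *: \1%VF).
  by rewrite addrC -scaleNr; apply: homPL.
have fX : forall u, u \in core_X -> (f - a *: \1%VF) u = 0.
  apply: (core_hom_X hf' scE); rewrite add_lfunE opp_lfunE scale_lfunE id_lfunE fa.
  exact: subrr.
have [d fd] := multiple _ hf' fX; exists a, (d / c).
apply/eqP; rewrite addrC -subr_eq; apply/eqP.
apply: (core_hom_eq ht hf' _ fX) => [|u uX|].
- by rewrite -[_ *: _]addr0; apply: homPL (hom0 _ _).
- by rewrite scale_lfunE gX ?scaler0.
by rewrite fd scale_lfunE gc scalerA divfK.
Qed.

Record core_structure (L1 L2 M : rep K) : Prop := CoreStructure {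
  cs_mod : qmodule M;
  cs_indec : indecomposable M;
  cs_dim : dim (car M) = 144%N;
  cs_dim1 : dim (car L1) = 17%N;
  cs_dim2 : dim (car L2) = 110%N;
  cs_series : composition_series [:: L1; L2; L1] M;
  cs_socle : exists S : {vspace car M}, [/\ is_socle S, submod S ≅ L1 &
    exists S' : {vspace car (quomod S)}, is_socle S' /\ submod S' ≅ L2];
  cs_End : hom_dim M M = 2%N;
  cs_to : hom_dim L1 M = 1%N;
  cs_from : hom_dim M L1 = 1%N }.

Lemma core_structureP L1 L2 : hw_irr x h kz ez L1 -> hw_irr x h k0 (e 0) L2 ->
  core_structure L1 L2 Wa.
Proof.
move=> h1 h2; have [hq _] := hw_irr_core_top; have unique := hw_irr_unique x_neq0 wt_inj.
have iso1 : submod core_Z ≅ L1 by exact: unique hw_irr_core_bottom h1.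
have iso2 : submod mid ≅ L2 by exact: unique hw_irr_core_mid h2.
have iso3 : quomod mid ≅ L1 by exact: unique hq h1.
have dimi U : \dim (iota @: U) = \dim U by apply: limg_dim_eq; rewrite lker_incl capv0.
have dimZ : \dim core_Z = 17%N by rewrite -dimi iZ dim_z.
have dimX : \dim core_X = 127%N by rewrite -dimi iX dim_generated0.
have hm := submodule_chain_mid submodule_core_Z submodule_core_X.
split.
- exact: qmodule_core.
- exact: (chain_indecomposable core_Z_neq0 core_ZX core_X_neqf core_chain).
- by rewrite dim_submod dim_core.
- by rewrite -(iso_dim iso1) dim_submod dimZ.
- rewrite -(iso_dim iso2) dim_submod /chain_mid.
  have := limg_ker_dim (quo core_Z) core_X; rewrite lker_quo (capv_idPr core_ZX) dimZ dimX.
  by move/(canRL (addKn _)).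
- split; first exact: hw_irreducible h1.
  exists core_Z; split=> //; first exact: submodule_core_Z.
  split; first exact: hw_irreducible h2.
  exists mid; split=> //; split; first exact: hw_irreducible h1.
  (* The top factor is all that is left, so the submodule is the full space and the next quotient
     has dimension 0. *)
  exists fullv; split; first exact: submodulef.
    apply: iso_trans iso3; apply: iso_submod (submodulef _); first exact: mor1.
      by apply/inj_lker => u; rewrite id_lfunE.
    by rewrite lim1g.
  have := @dim_submod _ (quomod mid) (fullv^C)%VS.
  by rewrite dimv_compl dimvf subnn -dimvf.
- exists core_Z; split=> //; first exact: (chain_socle submodule_core_Z core_Z_neq0 core_ZX core_X_neqZ core_X_neqf core_chain).
  exists mid; split=> //.
  exact: (chain_socle_quo submodule_core_Z submodule_core_X core_Z_neq0 core_ZX core_X_neqZ core_X_neqf core_chain).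
- exact: hom_dim_core.
- exact: hom_dim_to_core_z h1.
exact: hom_dim_from_core_z h1.
Qed.

Lemma square_generated (L : 'I_5 -> rep K) : (forall l, l != 0 -> hw_irr x h (k l) (e l) (L l)) ->
  exists2 f : forall l, 'Hom(car (L l), car T), forall l, l != 0 -> mor (f l) &
    (C + \sum_(l < 5 | l != 0%R) limg (f l))%VS = fullv.
Proof.
move=> hL; have H l : exists f : 'Hom(car (L l), car T), l != 0 -> mor f /\ limg f = gX l.
  have [->|l0] := eqVneq l 0; first by exists 0 => /eqP[].
  have /isoP[f [fm f0 ff]] := hw_irr_unique x_neq0 wt_inj (hL l l0) (hw_irr_square l0).
  exists (incl (gX l) \o f)%VF => _; split; last by rewrite limg_comp ff limg_incl.
  exact: mor_comp fm (mor_incl (hX l)).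
exists (fun l => projT1 (cid (H l))) => [l l0|]; first by case: cid => f /= /(_ l0)[].
rewrite addvC -ss_core_full; congr (_ + _)%VS; apply: eq_bigr => l l0.
by case: cid => f /= /(_ l0)[].
Qed.

Lemma square_weight_inj l m : l != m -> k l != k m.
Proof.
move=> lm; apply: contra_neq lm => /(wt_inj k0_neq0).
by case: l m => [[|[|[|[|[|]]]]] // ?] [[|[|[|[|[|]]]]] // ?] /ffunP cc; do ?exact: val_inj;
  have := (cc 0, cc 1, cc 2); rewrite !ffunE /= => -[[]].
Qed.

Lemma square_weight_z l : k l != kz.
Proof.
apply/eqP => /(wt_inj k0_neq0).
by case: l => [[|[|[|[|[|]]]]] // ?] /ffunP cc; have := (cc 0, cc 1, cc 2); rewrite !ffunE /= => -[[]].
Qed.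

Let k00 : k 0 = k0. Proof. exact: lowered0. Qed.

(** This is the source of the existence statement: every L is a subquotient of the tensor square. *)
Lemma square_irreducibles : (exists L, hw_irr x h kz ez L) /\
  forall l, exists L, hw_irr x h (k l) (e l) L.
Proof.
split=> [|l]; first by exists (submod Z); apply: hw_irr_z.
have [->|l0] := eqVneq l 0; last by exists (submod (gX l)); apply: hw_irr_square.
by exists (submod mid); rewrite k00; apply: hw_irr_core_mid.
Qed.

Lemma square_decomposition Lz (L : 'I_5 -> rep K) : hw_irr x h kz ez Lz ->
  (forall l, hw_irr x h (k l) (e l) (L l)) ->
  exists M, [/\ core_structure Lz (L 0) M,
    forall l, l != 0 -> [/\ hom_dim M (L l) = 0%N, hom_dim (L l) M = 0%N &
                           dim (car (L l)) = nth 0%N square_dims l] &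
    exists f0 : 'Hom(car M, car T), mor f0 /\
      exists2 f : forall l, 'Hom(car (L l), car T), forall l, l != 0 -> mor (f l) &
        (limg f0 + \sum_(l < 5 | l != 0%R) limg (f l))%VS = fullv].
Proof.
move=> hz' hL; exists Wa; split.
- by apply: core_structureP => //; rewrite -k00.
- move=> l l0; have kk : k l != k0 by rewrite -[X in _ != X]k00 square_weight_inj.
  have kk' := square_weight_z l; split.
  + exact: hom_dim_from_core (hL l) kk kk'.
  + exact: hom_dim_to_core (hL l) kk kk'.
  by rewrite (iso_dim (hw_irr_unique x_neq0 wt_inj (hL l) (hw_irr_square l0))) dim_submod dim_generated.
exists iota; split; first exact: mi.
have [f fm ff] := square_generated (fun l _ => hL l).
by exists f => //; rewrite limg_incl.
Qed.

End Structure.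

(** Each class gives words of one weight whose Gram determinant does not vanish, as many as the
    multiplicity of this weight in the irreducible module. In the factorisation, position 0 is 2;
    positions 1 to 3, 4 to 6, 7 to 9 are t_i - 1, t_i + 1, t_i^2 + 1 for i = 0, 1, 2; from 10 on
    come t_i - t_j, t_i + t_j for the pairs 01, 02, 12. A Boolean [true] is a minus sign. *)
Definition cert_111 : seq class_cert :=
  [:: ClassCert [:: [::]]
    ((0, 0)%ZZ, false) [::];
  ClassCert [:: [:: 2]]
    ((2, 2)%ZZ, true) [:: (7, 1); (8, 1)];
  ClassCert [:: [:: 1]]
    ((0, -2)%ZZ, true) [:: (4, 1); (5, 1)];
  ClassCert [:: [:: 0]]
    ((-2, 0)%ZZ, true) [:: (1, 1); (2, 1)];
  ClassCert [:: [:: 1; 2]]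
    ((4, 4)%ZZ, true) [:: (7, 2); (8, 2)];
  ClassCert [:: [:: 0; 2]]
    ((4, 4)%ZZ, true) [:: (7, 2); (8, 2)];
  ClassCert [:: [:: 0; 1]]
    ((0, -4)%ZZ, true) [:: (4, 2); (5, 2)];
  ClassCert [:: [:: 0; 1; 2]; [:: 1; 0; 2]; [:: 2; 0; 1]]
    ((8, 4)%ZZ, false) [:: (0, 1); (1, 1); (2, 1); (4, 3); (5, 3); (7, 5); (8, 5)];
  ClassCert [:: [:: 2; 0; 1; 2]]
    ((4, 0)%ZZ, false) [:: (4, 2); (5, 2); (7, 2); (8, 2)];
  ClassCert [:: [:: 1; 0; 1; 2]]
    ((8, 8)%ZZ, false) [:: (7, 4); (8, 4)];
  ClassCert [:: [:: 0; 1; 0; 2]]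
    ((8, 8)%ZZ, false) [:: (7, 4); (8, 4)];
  ClassCert [:: [:: 1; 2; 0; 1; 2]]
    ((2, 0)%ZZ, true) [:: (1, 1); (2, 1); (4, 2); (5, 2); (7, 2); (8, 2)];
  ClassCert [:: [:: 0; 2; 0; 1; 2]]
    ((4, -2)%ZZ, true) [:: (4, 3); (5, 3); (7, 2); (8, 2)];
  ClassCert [:: [:: 0; 1; 0; 1; 2]]
    ((10, 10)%ZZ, true) [:: (7, 5); (8, 5)];
  ClassCert [:: [:: 0; 1; 2; 0; 1; 2]]
    ((0, 0)%ZZ, true) [:: (1, 2); (2, 2); (4, 2); (5, 2); (7, 2); (8, 2)]]%N.

Definition cert_311 : seq class_cert :=
  [:: ClassCert [:: [::]]
    ((0, 0)%ZZ, false) [::];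
  ClassCert [:: [:: 2]]
    ((0, 2)%ZZ, false) [:: (12, 1); (13, 1)];
  ClassCert [:: [:: 1]]
    ((-2, -2)%ZZ, false) [:: (10, 1); (11, 1)];
  ClassCert [:: [:: 0]]
    ((-4, 0)%ZZ, true) [:: (1, 1); (2, 1); (3, 1)];
  ClassCert [:: [:: 1; 2]; [:: 2; 1]]
    ((-8, 0)%ZZ, true) [:: (1, 2); (2, 2); (3, 1); (10, 1); (11, 1); (12, 1); (13, 1)];
  ClassCert [:: [:: 0; 2]]
    ((0, 4)%ZZ, true) [:: (12, 2); (13, 2)];
  ClassCert [:: [:: 0; 1]]
    ((-4, -4)%ZZ, true) [:: (10, 2); (11, 2)];
  ClassCert [:: [:: 2; 1; 2]]
    ((-6, 2)%ZZ, true) [:: (1, 2); (2, 2); (3, 1); (12, 1); (13, 1)];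
  ClassCert [:: [:: 1; 2; 1]]
    ((-8, -2)%ZZ, true) [:: (1, 2); (2, 2); (3, 1); (10, 1); (11, 1)];
  ClassCert [:: [:: 0; 1; 2]; [:: 0; 2; 1]; [:: 1; 0; 2]]
    ((-6, 8)%ZZ, false) [:: (1, 3); (2, 3); (3, 1); (7, 2); (8, 2); (10, 1); (11, 1); (12, 3); (13, 3)];
  ClassCert [:: [:: 1; 2; 1; 2]; [:: 2; 1; 2; 1]]
    ((-20, 0)%ZZ, true) [:: (1, 6); (2, 6); (3, 3); (10, 1); (11, 1); (12, 1); (13, 1)];
  ClassCert [:: [:: 0; 2; 1; 2]; [:: 2; 0; 1; 2]]
    ((-8, 0)%ZZ, true) [:: (1, 2); (2, 2); (3, 1); (4, 2); (5, 2); (10, 1); (11, 1); (12, 3); (13, 3)];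
  ClassCert [:: [:: 0; 1; 2; 1]; [:: 1; 0; 1; 2]]
    ((-4, 0)%ZZ, true) [:: (1, 2); (2, 2); (3, 1); (4, 2); (5, 2); (7, 2); (8, 2); (10, 1); (11, 1); (12, 1); (13, 1)];
  ClassCert [:: [:: 0; 1; 0; 2]]
    ((4, 8)%ZZ, false) [:: (7, 2); (8, 2); (12, 2); (13, 2)];
  ClassCert [:: [:: 2; 1; 2; 1; 2]]
    ((-12, 2)%ZZ, false) [:: (1, 4); (2, 4); (3, 2); (12, 1); (13, 1)];
  ClassCert [:: [:: 1; 2; 1; 2; 1]]
    ((-14, -2)%ZZ, false) [:: (1, 4); (2, 4); (3, 2); (10, 1); (11, 1)];
  ClassCert [:: [:: 0; 1; 2; 1; 2]; [:: 0; 2; 1; 2; 1]; [:: 1; 0; 2; 1; 2]; [:: 2; 0; 1; 2; 1]]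
    ((-36, 0)%ZZ, false) [:: (1, 12); (2, 12); (3, 6); (4, 2); (5, 2); (7, 2); (8, 2); (10, 2); (11, 2); (12, 2); (13, 2)];
  ClassCert [:: [:: 0; 2; 0; 1; 2]]
    ((-2, -2)%ZZ, false) [:: (4, 2); (5, 2); (10, 1); (11, 1); (12, 2); (13, 2)];
  ClassCert [:: [:: 0; 1; 0; 1; 2]]
    ((4, 2)%ZZ, false) [:: (4, 2); (5, 2); (7, 2); (8, 2); (12, 1); (13, 1)];
  ClassCert [:: [:: 1; 2; 1; 2; 1; 2]]
    ((-12, 4)%ZZ, true) [:: (1, 4); (2, 4); (3, 2); (12, 2); (13, 2)];
  ClassCert [:: [:: 0; 2; 1; 2; 1; 2]; [:: 2; 0; 1; 2; 1; 2]]
    ((-20, 0)%ZZ, true) [:: (1, 6); (2, 6); (3, 3); (4, 2); (5, 2); (10, 1); (11, 1); (12, 3); (13, 3)];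
  ClassCert [:: [:: 0; 1; 2; 1; 2; 1]; [:: 1; 0; 1; 2; 1; 2]]
    ((-12, 8)%ZZ, true) [:: (1, 6); (2, 6); (3, 3); (7, 4); (8, 4); (10, 1); (11, 1); (12, 1); (13, 1)];
  ClassCert [:: [:: 0; 1; 0; 2; 1; 2]; [:: 0; 2; 0; 1; 2; 1]]
    ((-16, 0)%ZZ, true) [:: (1, 6); (2, 6); (3, 3); (4, 2); (5, 2); (7, 2); (8, 2); (10, 1); (11, 1); (12, 1); (13, 1)];
  ClassCert [:: [:: 0; 1; 2; 1; 2; 1; 2]; [:: 1; 0; 2; 1; 2; 1; 2]; [:: 1; 2; 0; 1; 2; 1; 2]]
    ((-30, 8)%ZZ, false) [:: (1, 11); (2, 11); (3, 5); (4, 2); (5, 2); (7, 2); (8, 2); (10, 1); (11, 1); (12, 5); (13, 5)];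
  ClassCert [:: [:: 0; 2; 0; 1; 2; 1; 2]]
    ((-8, -2)%ZZ, true) [:: (1, 2); (2, 2); (3, 1); (4, 2); (5, 2); (10, 1); (11, 1); (12, 2); (13, 2)];
  ClassCert [:: [:: 0; 1; 0; 1; 2; 1; 2]]
    ((2, 10)%ZZ, true) [:: (1, 2); (2, 2); (3, 1); (7, 4); (8, 4); (12, 1); (13, 1)];
  ClassCert [:: [:: 2; 0; 1; 2; 1; 2; 1; 2]]
    ((-12, 0)%ZZ, false) [:: (1, 4); (2, 4); (3, 2); (4, 2); (5, 2); (12, 2); (13, 2)];
  ClassCert [:: [:: 1; 0; 1; 2; 1; 2; 1; 2]]
    ((-8, 8)%ZZ, false) [:: (1, 4); (2, 4); (3, 2); (7, 2); (8, 2); (12, 2); (13, 2)];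
  ClassCert [:: [:: 0; 1; 0; 2; 1; 2; 1; 2]; [:: 0; 1; 2; 0; 1; 2; 1; 2]]
    ((-20, 4)%ZZ, true) [:: (1, 8); (2, 8); (3, 3); (4, 2); (5, 2); (7, 2); (8, 2); (10, 1); (11, 1); (12, 3); (13, 3)];
  ClassCert [:: [:: 1; 2; 0; 1; 2; 1; 2; 1; 2]]
    ((-16, 0)%ZZ, true) [:: (1, 5); (2, 5); (3, 3); (4, 2); (5, 2); (12, 2); (13, 2)];
  ClassCert [:: [:: 0; 2; 0; 1; 2; 1; 2; 1; 2]]
    ((-14, -2)%ZZ, false) [:: (1, 4); (2, 4); (3, 2); (4, 2); (5, 2); (10, 1); (11, 1); (12, 2); (13, 2)];
  ClassCert [:: [:: 0; 1; 0; 1; 2; 1; 2; 1; 2]]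
    ((-8, 10)%ZZ, false) [:: (1, 4); (2, 4); (3, 2); (7, 2); (8, 2); (12, 3); (13, 3)];
  ClassCert [:: [:: 0; 1; 2; 0; 1; 2; 1; 2; 1; 2]]
    ((-20, 0)%ZZ, true) [:: (1, 6); (2, 6); (3, 4); (4, 2); (5, 2); (12, 2); (13, 2)]]%N.

(** The words of [cert_311] with the letters 0 and 1 exchanged. *)
Definition cert_131 : seq class_cert :=
  [:: ClassCert [:: [::]]
    ((0, 0)%ZZ, false) [::];
  ClassCert [:: [:: 2]]
    ((2, 0)%ZZ, false) [:: (14, 1); (15, 1)];
  ClassCert [:: [:: 0]]
    ((-2, -2)%ZZ, true) [:: (10, 1); (11, 1)];
  ClassCert [:: [:: 1]]
    ((0, -4)%ZZ, true) [:: (4, 1); (5, 1); (6, 1)];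
  ClassCert [:: [:: 0; 2]; [:: 2; 0]]
    ((0, -8)%ZZ, false) [:: (4, 2); (5, 2); (6, 1); (10, 1); (11, 1); (14, 1); (15, 1)];
  ClassCert [:: [:: 1; 2]]
    ((4, 0)%ZZ, true) [:: (14, 2); (15, 2)];
  ClassCert [:: [:: 1; 0]]
    ((-4, -4)%ZZ, true) [:: (10, 2); (11, 2)];
  ClassCert [:: [:: 2; 0; 2]]
    ((2, -6)%ZZ, true) [:: (4, 2); (5, 2); (6, 1); (14, 1); (15, 1)];
  ClassCert [:: [:: 0; 2; 0]]
    ((-2, -8)%ZZ, false) [:: (4, 2); (5, 2); (6, 1); (10, 1); (11, 1)];
  ClassCert [:: [:: 1; 0; 2]; [:: 1; 2; 0]; [:: 0; 1; 2]]
    ((8, -6)%ZZ, true) [:: (4, 3); (5, 3); (6, 1); (7, 2); (8, 2); (10, 1); (11, 1); (14, 3); (15, 3)];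
  ClassCert [:: [:: 0; 2; 0; 2]; [:: 2; 0; 2; 0]]
    ((0, -20)%ZZ, false) [:: (4, 6); (5, 6); (6, 3); (10, 1); (11, 1); (14, 1); (15, 1)];
  ClassCert [:: [:: 1; 2; 0; 2]; [:: 2; 1; 0; 2]]
    ((0, -8)%ZZ, false) [:: (1, 2); (2, 2); (4, 2); (5, 2); (6, 1); (10, 1); (11, 1); (14, 3); (15, 3)];
  ClassCert [:: [:: 1; 0; 2; 0]; [:: 0; 1; 0; 2]]
    ((0, -4)%ZZ, false) [:: (1, 2); (2, 2); (4, 2); (5, 2); (6, 1); (7, 2); (8, 2); (10, 1); (11, 1); (14, 1); (15, 1)];
  ClassCert [:: [:: 1; 0; 1; 2]]
    ((8, 4)%ZZ, false) [:: (7, 2); (8, 2); (14, 2); (15, 2)];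
  ClassCert [:: [:: 2; 0; 2; 0; 2]]
    ((2, -12)%ZZ, false) [:: (4, 4); (5, 4); (6, 2); (14, 1); (15, 1)];
  ClassCert [:: [:: 0; 2; 0; 2; 0]]
    ((-2, -14)%ZZ, true) [:: (4, 4); (5, 4); (6, 2); (10, 1); (11, 1)];
  ClassCert [:: [:: 1; 0; 2; 0; 2]; [:: 1; 2; 0; 2; 0]; [:: 0; 1; 2; 0; 2]; [:: 2; 1; 0; 2; 0]]
    ((0, -36)%ZZ, false) [:: (1, 2); (2, 2); (4, 12); (5, 12); (6, 6); (7, 2); (8, 2); (10, 2); (11, 2); (14, 2); (15, 2)];
  ClassCert [:: [:: 1; 2; 1; 0; 2]]
    ((-2, -2)%ZZ, true) [:: (1, 2); (2, 2); (10, 1); (11, 1); (14, 2); (15, 2)];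
  ClassCert [:: [:: 1; 0; 1; 0; 2]]
    ((2, 4)%ZZ, false) [:: (1, 2); (2, 2); (7, 2); (8, 2); (14, 1); (15, 1)];
  ClassCert [:: [:: 0; 2; 0; 2; 0; 2]]
    ((4, -12)%ZZ, true) [:: (4, 4); (5, 4); (6, 2); (14, 2); (15, 2)];
  ClassCert [:: [:: 1; 2; 0; 2; 0; 2]; [:: 2; 1; 0; 2; 0; 2]]
    ((0, -20)%ZZ, false) [:: (1, 2); (2, 2); (4, 6); (5, 6); (6, 3); (10, 1); (11, 1); (14, 3); (15, 3)];
  ClassCert [:: [:: 1; 0; 2; 0; 2; 0]; [:: 0; 1; 0; 2; 0; 2]]
    ((8, -12)%ZZ, false) [:: (4, 6); (5, 6); (6, 3); (7, 4); (8, 4); (10, 1); (11, 1); (14, 1); (15, 1)];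
  ClassCert [:: [:: 1; 0; 1; 2; 0; 2]; [:: 1; 2; 1; 0; 2; 0]]
    ((0, -16)%ZZ, false) [:: (1, 2); (2, 2); (4, 6); (5, 6); (6, 3); (7, 2); (8, 2); (10, 1); (11, 1); (14, 1); (15, 1)];
  ClassCert [:: [:: 1; 0; 2; 0; 2; 0; 2]; [:: 0; 1; 2; 0; 2; 0; 2]; [:: 0; 2; 1; 0; 2; 0; 2]]
    ((8, -30)%ZZ, true) [:: (1, 2); (2, 2); (4, 11); (5, 11); (6, 5); (7, 2); (8, 2); (10, 1); (11, 1); (14, 5); (15, 5)];
  ClassCert [:: [:: 1; 2; 1; 0; 2; 0; 2]]
    ((-2, -8)%ZZ, false) [:: (1, 2); (2, 2); (4, 2); (5, 2); (6, 1); (10, 1); (11, 1); (14, 2); (15, 2)];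
  ClassCert [:: [:: 1; 0; 1; 0; 2; 0; 2]]
    ((10, 2)%ZZ, true) [:: (4, 2); (5, 2); (6, 1); (7, 4); (8, 4); (14, 1); (15, 1)];
  ClassCert [:: [:: 2; 1; 0; 2; 0; 2; 0; 2]]
    ((0, -12)%ZZ, false) [:: (1, 2); (2, 2); (4, 4); (5, 4); (6, 2); (14, 2); (15, 2)];
  ClassCert [:: [:: 0; 1; 0; 2; 0; 2; 0; 2]]
    ((8, -8)%ZZ, false) [:: (4, 4); (5, 4); (6, 2); (7, 2); (8, 2); (14, 2); (15, 2)];
  ClassCert [:: [:: 1; 0; 1; 2; 0; 2; 0; 2]; [:: 1; 0; 2; 1; 0; 2; 0; 2]]
    ((4, -20)%ZZ, false) [:: (1, 2); (2, 2); (4, 8); (5, 8); (6, 3); (7, 2); (8, 2); (10, 1); (11, 1); (14, 3); (15, 3)];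
  ClassCert [:: [:: 0; 2; 1; 0; 2; 0; 2; 0; 2]]
    ((0, -16)%ZZ, true) [:: (1, 2); (2, 2); (4, 5); (5, 5); (6, 3); (14, 2); (15, 2)];
  ClassCert [:: [:: 1; 2; 1; 0; 2; 0; 2; 0; 2]]
    ((-2, -14)%ZZ, true) [:: (1, 2); (2, 2); (4, 4); (5, 4); (6, 2); (10, 1); (11, 1); (14, 2); (15, 2)];
  ClassCert [:: [:: 1; 0; 1; 0; 2; 0; 2; 0; 2]]
    ((10, -8)%ZZ, false) [:: (4, 4); (5, 4); (6, 2); (7, 2); (8, 2); (14, 3); (15, 3)];
  ClassCert [:: [:: 1; 0; 2; 1; 0; 2; 0; 2; 0; 2]]
    ((0, -20)%ZZ, true) [:: (1, 2); (2, 2); (4, 6); (5, 6); (6, 4); (14, 2); (15, 2)]]%N.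

(** The words of [cert_311] with the letters 0 and 2 exchanged. *)
Definition cert_113 : seq class_cert :=
  [:: ClassCert [:: [::]]
    ((0, 0)%ZZ, false) [::];
  ClassCert [:: [:: 0]]
    ((0, 2)%ZZ, true) [:: (12, 1); (13, 1)];
  ClassCert [:: [:: 1]]
    ((2, 0)%ZZ, true) [:: (14, 1); (15, 1)];
  ClassCert [:: [:: 2]]
    ((4, 4)%ZZ, true) [:: (7, 1); (8, 1); (9, 1)];
  ClassCert [:: [:: 1; 0]; [:: 0; 1]]
    ((8, 8)%ZZ, true) [:: (7, 2); (8, 2); (9, 1); (12, 1); (13, 1); (14, 1); (15, 1)];
  ClassCert [:: [:: 2; 0]]
    ((0, 4)%ZZ, true) [:: (12, 2); (13, 2)];
  ClassCert [:: [:: 2; 1]]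
    ((4, 0)%ZZ, true) [:: (14, 2); (15, 2)];
  ClassCert [:: [:: 0; 1; 0]]
    ((6, 8)%ZZ, false) [:: (7, 2); (8, 2); (9, 1); (12, 1); (13, 1)];
  ClassCert [:: [:: 1; 0; 1]]
    ((8, 6)%ZZ, false) [:: (7, 2); (8, 2); (9, 1); (14, 1); (15, 1)];
  ClassCert [:: [:: 2; 1; 0]; [:: 2; 0; 1]; [:: 1; 2; 0]]
    ((6, 14)%ZZ, false) [:: (1, 2); (2, 2); (7, 3); (8, 3); (9, 1); (12, 3); (13, 3); (14, 1); (15, 1)];
  ClassCert [:: [:: 1; 0; 1; 0]; [:: 0; 1; 0; 1]]
    ((20, 20)%ZZ, true) [:: (7, 6); (8, 6); (9, 3); (12, 1); (13, 1); (14, 1); (15, 1)];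
  ClassCert [:: [:: 2; 0; 1; 0]; [:: 0; 2; 1; 0]]
    ((8, 8)%ZZ, true) [:: (4, 2); (5, 2); (7, 2); (8, 2); (9, 1); (12, 3); (13, 3); (14, 1); (15, 1)];
  ClassCert [:: [:: 2; 1; 0; 1]; [:: 1; 2; 1; 0]]
    ((4, 4)%ZZ, true) [:: (1, 2); (2, 2); (4, 2); (5, 2); (7, 2); (8, 2); (9, 1); (12, 1); (13, 1); (14, 1); (15, 1)];
  ClassCert [:: [:: 2; 1; 2; 0]]
    ((-4, 4)%ZZ, false) [:: (1, 2); (2, 2); (12, 2); (13, 2)];
  ClassCert [:: [:: 0; 1; 0; 1; 0]]
    ((12, 14)%ZZ, true) [:: (7, 4); (8, 4); (9, 2); (12, 1); (13, 1)];
  ClassCert [:: [:: 1; 0; 1; 0; 1]]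
    ((14, 12)%ZZ, true) [:: (7, 4); (8, 4); (9, 2); (14, 1); (15, 1)];
  ClassCert [:: [:: 2; 1; 0; 1; 0]; [:: 2; 0; 1; 0; 1]; [:: 1; 2; 0; 1; 0]; [:: 0; 2; 1; 0; 1]]
    ((36, 36)%ZZ, false) [:: (1, 2); (2, 2); (4, 2); (5, 2); (7, 12); (8, 12); (9, 6); (12, 2); (13, 2); (14, 2); (15, 2)];
  ClassCert [:: [:: 2; 0; 2; 1; 0]]
    ((2, 0)%ZZ, true) [:: (4, 2); (5, 2); (12, 2); (13, 2); (14, 1); (15, 1)];
  ClassCert [:: [:: 2; 1; 2; 1; 0]]
    ((-4, -2)%ZZ, true) [:: (1, 2); (2, 2); (4, 2); (5, 2); (12, 1); (13, 1)];
  ClassCert [:: [:: 1; 0; 1; 0; 1; 0]]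
    ((12, 16)%ZZ, true) [:: (7, 4); (8, 4); (9, 2); (12, 2); (13, 2)];
  ClassCert [:: [:: 2; 0; 1; 0; 1; 0]; [:: 0; 2; 1; 0; 1; 0]]
    ((20, 20)%ZZ, true) [:: (4, 2); (5, 2); (7, 6); (8, 6); (9, 3); (12, 3); (13, 3); (14, 1); (15, 1)];
  ClassCert [:: [:: 2; 1; 0; 1; 0; 1]; [:: 1; 2; 1; 0; 1; 0]]
    ((12, 20)%ZZ, true) [:: (1, 4); (2, 4); (7, 6); (8, 6); (9, 3); (12, 1); (13, 1); (14, 1); (15, 1)];
  ClassCert [:: [:: 2; 1; 2; 0; 1; 0]; [:: 2; 0; 2; 1; 0; 1]]
    ((16, 16)%ZZ, true) [:: (1, 2); (2, 2); (4, 2); (5, 2); (7, 6); (8, 6); (9, 3); (12, 1); (13, 1); (14, 1); (15, 1)];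
  ClassCert [:: [:: 2; 1; 0; 1; 0; 1; 0]; [:: 1; 2; 0; 1; 0; 1; 0]; [:: 1; 0; 2; 1; 0; 1; 0]]
    ((30, 38)%ZZ, false) [:: (1, 2); (2, 2); (4, 2); (5, 2); (7, 11); (8, 11); (9, 5); (12, 5); (13, 5); (14, 1); (15, 1)];
  ClassCert [:: [:: 2; 0; 2; 1; 0; 1; 0]]
    ((8, 6)%ZZ, false) [:: (4, 2); (5, 2); (7, 2); (8, 2); (9, 1); (12, 2); (13, 2); (14, 1); (15, 1)];
  ClassCert [:: [:: 2; 1; 2; 1; 0; 1; 0]]
    ((-2, 8)%ZZ, false) [:: (1, 4); (2, 4); (7, 2); (8, 2); (9, 1); (12, 1); (13, 1)];
  ClassCert [:: [:: 0; 2; 1; 0; 1; 0; 1; 0]]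
    ((12, 12)%ZZ, false) [:: (4, 2); (5, 2); (7, 4); (8, 4); (9, 2); (12, 2); (13, 2)];
  ClassCert [:: [:: 1; 2; 1; 0; 1; 0; 1; 0]]
    ((8, 16)%ZZ, false) [:: (1, 2); (2, 2); (7, 4); (8, 4); (9, 2); (12, 2); (13, 2)];
  ClassCert [:: [:: 2; 1; 2; 0; 1; 0; 1; 0]; [:: 2; 1; 0; 2; 1; 0; 1; 0]]
    ((20, 24)%ZZ, true) [:: (1, 2); (2, 2); (4, 2); (5, 2); (7, 8); (8, 8); (9, 3); (12, 3); (13, 3); (14, 1); (15, 1)];
  ClassCert [:: [:: 1; 0; 2; 1; 0; 1; 0; 1; 0]]
    ((16, 16)%ZZ, true) [:: (4, 2); (5, 2); (7, 5); (8, 5); (9, 3); (12, 2); (13, 2)];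
  ClassCert [:: [:: 2; 0; 2; 1; 0; 1; 0; 1; 0]]
    ((14, 12)%ZZ, true) [:: (4, 2); (5, 2); (7, 4); (8, 4); (9, 2); (12, 2); (13, 2); (14, 1); (15, 1)];
  ClassCert [:: [:: 2; 1; 2; 1; 0; 1; 0; 1; 0]]
    ((8, 18)%ZZ, true) [:: (1, 2); (2, 2); (7, 4); (8, 4); (9, 2); (12, 3); (13, 3)];
  ClassCert [:: [:: 2; 1; 0; 2; 1; 0; 1; 0; 1; 0]]
    ((20, 20)%ZZ, true) [:: (4, 2); (5, 2); (7, 6); (8, 6); (9, 4); (12, 2); (13, 2)]]%N.

Definition cert_222 : seq class_cert :=
  [:: ClassCert [:: [::]]
    ((0, 0)%ZZ, false) [::];
  ClassCert [:: [:: 2]]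
    ((4, 4)%ZZ, true) [:: (7, 1); (8, 1); (9, 1)];
  ClassCert [:: [:: 1]]
    ((0, -4)%ZZ, true) [:: (4, 1); (5, 1); (6, 1)];
  ClassCert [:: [:: 0]]
    ((-4, 0)%ZZ, true) [:: (1, 1); (2, 1); (3, 1)];
  ClassCert [:: [:: 1; 2]; [:: 2; 1]]
    ((0, 0)%ZZ, true) [:: (1, 2); (2, 2); (4, 1); (5, 1); (6, 1); (7, 1); (8, 1); (9, 1)];
  ClassCert [:: [:: 0; 2]; [:: 2; 0]]
    ((0, 0)%ZZ, true) [:: (1, 1); (2, 1); (3, 1); (4, 2); (5, 2); (7, 1); (8, 1); (9, 1)];
  ClassCert [:: [:: 0; 1]; [:: 1; 0]]
    ((0, 0)%ZZ, true) [:: (1, 1); (2, 1); (3, 1); (4, 1); (5, 1); (6, 1); (7, 2); (8, 2)];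
  ClassCert [:: [:: 2; 1; 2]]
    ((0, 4)%ZZ, false) [:: (1, 2); (2, 2); (7, 1); (8, 1); (9, 1)];
  ClassCert [:: [:: 1; 2; 1]]
    ((-4, -4)%ZZ, false) [:: (1, 2); (2, 2); (4, 1); (5, 1); (6, 1)];
  ClassCert [:: [:: 2; 0; 2]]
    ((4, 0)%ZZ, false) [:: (4, 2); (5, 2); (7, 1); (8, 1); (9, 1)];
  ClassCert [:: [:: 0; 1; 2]; [:: 0; 2; 1]; [:: 1; 0; 2]; [:: 1; 2; 0]]
    ((4, 4)%ZZ, true) [:: (1, 4); (2, 4); (3, 1); (4, 4); (5, 4); (6, 1); (7, 4); (8, 4); (9, 3)];
  ClassCert [:: [:: 1; 0; 1]]
    ((4, 0)%ZZ, false) [:: (4, 1); (5, 1); (6, 1); (7, 2); (8, 2)];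
  ClassCert [:: [:: 0; 2; 0]]
    ((-4, -4)%ZZ, false) [:: (1, 1); (2, 1); (3, 1); (4, 2); (5, 2)];
  ClassCert [:: [:: 0; 1; 0]]
    ((0, 4)%ZZ, false) [:: (1, 1); (2, 1); (3, 1); (7, 2); (8, 2)];
  ClassCert [:: [:: 1; 2; 1; 2]]
    ((4, 8)%ZZ, false) [:: (1, 2); (2, 2); (7, 2); (8, 2); (9, 2)];
  ClassCert [:: [:: 0; 2; 1; 2]; [:: 1; 2; 0; 2]; [:: 2; 0; 1; 2]]
    ((10, 6)%ZZ, false) [:: (1, 3); (2, 3); (4, 5); (5, 5); (7, 4); (8, 4); (9, 4)];
  ClassCert [:: [:: 0; 1; 2; 1]; [:: 1; 0; 1; 2]; [:: 1; 0; 2; 1]]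
    ((4, 6)%ZZ, false) [:: (1, 5); (2, 5); (4, 2); (5, 2); (6, 2); (7, 5); (8, 5); (9, 2)];
  ClassCert [:: [:: 0; 2; 0; 2]]
    ((8, 4)%ZZ, false) [:: (4, 2); (5, 2); (7, 2); (8, 2); (9, 2)];
  ClassCert [:: [:: 0; 1; 0; 2]; [:: 0; 1; 2; 0]; [:: 1; 0; 2; 0]]
    ((6, 4)%ZZ, false) [:: (1, 2); (2, 2); (3, 2); (4, 5); (5, 5); (7, 5); (8, 5); (9, 2)];
  ClassCert [:: [:: 0; 1; 0; 1]]
    ((4, -4)%ZZ, false) [:: (4, 2); (5, 2); (6, 2); (7, 2); (8, 2)];
  ClassCert [:: [:: 2; 0; 2; 1; 2]]
    ((0, 0)%ZZ, true) [:: (1, 2); (2, 2); (4, 2); (5, 2); (7, 1); (8, 1); (9, 1)];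
  ClassCert [:: [:: 0; 1; 2; 1; 2]; [:: 1; 0; 2; 1; 2]; [:: 1; 2; 0; 1; 2]; [:: 2; 0; 1; 2; 1]]
    ((4, 8)%ZZ, true) [:: (1, 8); (2, 8); (3, 1); (4, 6); (5, 6); (6, 1); (7, 6); (8, 6); (9, 5)];
  ClassCert [:: [:: 1; 0; 1; 2; 1]]
    ((0, 0)%ZZ, true) [:: (1, 2); (2, 2); (4, 1); (5, 1); (6, 1); (7, 2); (8, 2)];
  ClassCert [:: [:: 0; 1; 2; 0; 2]; [:: 0; 2; 0; 1; 2]; [:: 1; 0; 2; 0; 2]; [:: 2; 0; 1; 2; 0]]
    ((16, -4)%ZZ, true) [:: (1, 2); (2, 2); (3, 1); (4, 12); (5, 12); (6, 1); (7, 6); (8, 6); (9, 5)];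
  ClassCert [:: [:: 0; 1; 0; 1; 2]; [:: 0; 1; 0; 2; 1]; [:: 1; 0; 1; 0; 2]; [:: 1; 0; 1; 2; 0]]
    ((24, 24)%ZZ, true) [:: (1, 4); (2, 4); (3, 1); (4, 4); (5, 4); (6, 1); (7, 12); (8, 12); (9, 5)];
  ClassCert [:: [:: 0; 1; 0; 2; 0]]
    ((0, 0)%ZZ, true) [:: (1, 1); (2, 1); (3, 1); (4, 2); (5, 2); (7, 2); (8, 2)];
  ClassCert [:: [:: 1; 2; 0; 2; 1; 2]; [:: 2; 0; 1; 2; 1; 2]]
    ((0, 4)%ZZ, true) [:: (1, 5); (2, 5); (3, 1); (4, 4); (5, 4); (7, 3); (8, 3); (9, 3)];
  ClassCert [:: [:: 1; 0; 1; 2; 1; 2]; [:: 1; 2; 0; 1; 2; 1]]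
    ((0, 4)%ZZ, true) [:: (1, 5); (2, 5); (3, 1); (4, 3); (5, 3); (6, 1); (7, 4); (8, 4); (9, 2)];
  ClassCert [:: [:: 0; 2; 0; 2; 1; 2]; [:: 2; 0; 1; 2; 0; 2]]
    ((8, -4)%ZZ, true) [:: (1, 2); (2, 2); (4, 7); (5, 7); (6, 1); (7, 3); (8, 3); (9, 3)];
  ClassCert [:: [:: 0; 1; 0; 2; 1; 2]; [:: 0; 1; 2; 0; 1; 2]; [:: 1; 0; 1; 2; 0; 2]; [:: 1; 0; 2; 0; 1; 2]]
    ((32, 24)%ZZ, true) [:: (1, 4); (2, 4); (4, 8); (5, 8); (7, 12); (8, 12); (9, 8)];
  ClassCert [:: [:: 0; 1; 0; 1; 2; 1]; [:: 1; 0; 1; 0; 1; 2]]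
    ((20, 16)%ZZ, true) [:: (1, 2); (2, 2); (4, 1); (5, 1); (6, 1); (7, 7); (8, 7); (9, 3); (14, 2); (15, 2)];
  ClassCert [:: [:: 0; 1; 0; 2; 0; 2]; [:: 0; 2; 0; 1; 2; 0]]
    ((8, -4)%ZZ, true) [:: (1, 1); (2, 1); (3, 1); (4, 7); (5, 7); (6, 1); (7, 4); (8, 4); (9, 2)];
  ClassCert [:: [:: 0; 1; 0; 1; 0; 2]; [:: 0; 1; 0; 1; 2; 0]]
    ((16, 12)%ZZ, true) [:: (1, 1); (2, 1); (3, 1); (4, 4); (5, 4); (7, 7); (8, 7); (9, 3)];
  ClassCert [:: [:: 1; 2; 0; 1; 2; 1; 2]]
    ((0, 4)%ZZ, false) [:: (1, 3); (2, 3); (3, 1); (4, 2); (5, 2); (7, 2); (8, 2); (9, 2)];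
  ClassCert [:: [:: 0; 1; 2; 0; 2; 1; 2]; [:: 0; 2; 0; 1; 2; 1; 2]; [:: 1; 0; 2; 0; 2; 1; 2]; [:: 1; 2; 0; 1; 2; 0; 2]]
    ((12, 4)%ZZ, true) [:: (1, 8); (2, 8); (3, 1); (4, 12); (5, 12); (6, 1); (7, 8); (8, 8); (9, 7)];
  ClassCert [:: [:: 0; 1; 0; 1; 2; 1; 2]; [:: 0; 1; 2; 0; 1; 2; 1]; [:: 1; 0; 1; 0; 2; 1; 2]; [:: 1; 0; 1; 2; 0; 1; 2]]
    ((24, 28)%ZZ, true) [:: (1, 8); (2, 8); (3, 1); (4, 6); (5, 6); (6, 1); (7, 14); (8, 14); (9, 7)];
  ClassCert [:: [:: 0; 2; 0; 1; 2; 0; 2]]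
    ((8, -4)%ZZ, false) [:: (4, 5); (5, 5); (6, 1); (7, 2); (8, 2); (9, 2)];
  ClassCert [:: [:: 0; 1; 0; 1; 2; 0; 2]; [:: 0; 1; 0; 2; 0; 1; 2]; [:: 1; 0; 1; 0; 2; 0; 2]; [:: 1; 0; 2; 0; 1; 2; 0]]
    ((36, 16)%ZZ, true) [:: (1, 2); (2, 2); (3, 1); (4, 12); (5, 12); (6, 1); (7, 14); (8, 14); (9, 7)];
  ClassCert [:: [:: 0; 1; 0; 1; 0; 1; 2]]
    ((20, 16)%ZZ, false) [:: (7, 5); (8, 5); (9, 3); (14, 2); (15, 2)];
  ClassCert [:: [:: 2; 0; 1; 2; 0; 2; 1; 2]]
    ((4, 0)%ZZ, false) [:: (1, 2); (2, 2); (4, 4); (5, 4); (7, 2); (8, 2); (9, 2)];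
  ClassCert [:: [:: 0; 1; 2; 0; 1; 2; 1; 2]; [:: 1; 0; 1; 2; 0; 2; 1; 2]; [:: 1; 0; 2; 0; 1; 2; 1; 2]]
    ((10, 16)%ZZ, false) [:: (1, 8); (2, 8); (3, 2); (4, 7); (5, 7); (7, 9); (8, 9); (9, 6)];
  ClassCert [:: [:: 1; 0; 1; 0; 1; 2; 1; 2]]
    ((16, 20)%ZZ, false) [:: (1, 2); (2, 2); (7, 6); (8, 6); (9, 4)];
  ClassCert [:: [:: 0; 1; 0; 2; 0; 2; 1; 2]; [:: 0; 1; 2; 0; 1; 2; 0; 2]; [:: 1; 0; 2; 0; 1; 2; 0; 2]]
    ((24, 2)%ZZ, false) [:: (1, 3); (2, 3); (4, 12); (5, 12); (6, 2); (7, 9); (8, 9); (9, 6)];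
  ClassCert [:: [:: 0; 1; 0; 1; 0; 2; 1; 2]; [:: 0; 1; 0; 1; 2; 0; 1; 2]; [:: 1; 0; 1; 0; 1; 2; 0; 2]]
    ((42, 38)%ZZ, false) [:: (1, 3); (2, 3); (4, 5); (5, 5); (7, 16); (8, 16); (9, 8)];
  ClassCert [:: [:: 0; 1; 0; 1; 0; 2; 0; 2]]
    ((20, 16)%ZZ, false) [:: (4, 2); (5, 2); (7, 6); (8, 6); (9, 4)];
  ClassCert [:: [:: 1; 2; 0; 1; 2; 0; 2; 1; 2]]
    ((0, 0)%ZZ, true) [:: (1, 3); (2, 3); (3, 1); (4, 4); (5, 4); (7, 2); (8, 2); (9, 2)];
  ClassCert [:: [:: 1; 0; 1; 2; 0; 1; 2; 1; 2]]
    ((4, 8)%ZZ, true) [:: (1, 3); (2, 3); (3, 1); (4, 2); (5, 2); (7, 4); (8, 4); (9, 2)];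
  ClassCert [:: [:: 0; 2; 0; 1; 2; 0; 2; 1; 2]]
    ((4, -4)%ZZ, true) [:: (1, 2); (2, 2); (4, 5); (5, 5); (6, 1); (7, 2); (8, 2); (9, 2)];
  ClassCert [:: [:: 0; 1; 0; 1; 2; 0; 2; 1; 2]; [:: 0; 1; 0; 2; 0; 1; 2; 1; 2]; [:: 1; 0; 1; 0; 2; 0; 2; 1; 2]; [:: 1; 0; 1; 2; 0; 1; 2; 0; 2]]
    ((32, 24)%ZZ, true) [:: (1, 8); (2, 8); (3, 1); (4, 12); (5, 12); (6, 1); (7, 16); (8, 16); (9, 9)];
  ClassCert [:: [:: 0; 1; 0; 1; 0; 1; 2; 1; 2]]
    ((20, 24)%ZZ, true) [:: (1, 2); (2, 2); (7, 7); (8, 7); (9, 5)];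
  ClassCert [:: [:: 0; 1; 0; 2; 0; 1; 2; 0; 2]]
    ((12, 0)%ZZ, true) [:: (4, 5); (5, 5); (6, 1); (7, 4); (8, 4); (9, 2)];
  ClassCert [:: [:: 0; 1; 0; 1; 0; 1; 2; 0; 2]]
    ((20, 16)%ZZ, true) [:: (4, 2); (5, 2); (7, 7); (8, 7); (9, 3)];
  ClassCert [:: [:: 0; 1; 2; 0; 1; 2; 0; 2; 1; 2]; [:: 1; 0; 2; 0; 1; 2; 0; 2; 1; 2]]
    ((8, 0)%ZZ, true) [:: (1, 5); (2, 5); (3, 1); (4, 9); (5, 9); (6, 1); (7, 6); (8, 6); (9, 4)];
  ClassCert [:: [:: 0; 1; 0; 1; 2; 0; 1; 2; 1; 2]; [:: 1; 0; 1; 0; 1; 2; 0; 2; 1; 2]]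
    ((16, 24)%ZZ, true) [:: (1, 5); (2, 5); (3, 1); (4, 4); (5, 4); (7, 9); (8, 9); (9, 5); (12, 2); (13, 2)];
  ClassCert [:: [:: 0; 1; 0; 1; 0; 2; 0; 2; 1; 2]; [:: 0; 1; 0; 1; 2; 0; 1; 2; 0; 2]]
    ((20, 12)%ZZ, true) [:: (1, 4); (2, 4); (4, 7); (5, 7); (6, 1); (7, 9); (8, 9); (9, 5)];
  ClassCert [:: [:: 1; 0; 1; 2; 0; 1; 2; 0; 2; 1; 2]]
    ((4, 4)%ZZ, false) [:: (1, 3); (2, 3); (3, 1); (4, 4); (5, 4); (7, 4); (8, 4); (9, 2)];
  ClassCert [:: [:: 0; 1; 0; 2; 0; 1; 2; 0; 2; 1; 2]]
    ((8, 0)%ZZ, false) [:: (1, 2); (2, 2); (4, 5); (5, 5); (6, 1); (7, 4); (8, 4); (9, 2)];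
  ClassCert [:: [:: 0; 1; 0; 1; 0; 1; 2; 0; 2; 1; 2]]
    ((12, 16)%ZZ, false) [:: (1, 2); (2, 2); (4, 2); (5, 2); (7, 5); (8, 5); (9, 3); (12, 2); (13, 2)];
  ClassCert [:: [:: 0; 1; 0; 1; 2; 0; 1; 2; 0; 2; 1; 2]]
    ((0, 4)%ZZ, false) [:: (1, 4); (2, 4); (3, 2); (4, 4); (5, 4); (7, 4); (8, 4); (9, 2)]]%N.

Definition cert_000 : seq class_cert := [:: ClassCert [:: [::]] ((0, 0)%ZZ, false) [::]]%N.

Lemma check_cert_111 : check_cert (top_mono 1 1 1) cert_111. Proof. by vm_compute. Qed.
Lemma check_cert_311 : check_cert (top_mono 3 1 1) cert_311. Proof. by vm_compute. Qed.
Lemma check_cert_131 : check_cert (top_mono 1 3 1) cert_131. Proof. by vm_compute. Qed.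
Lemma check_cert_113 : check_cert (top_mono 1 1 3) cert_113. Proof. by vm_compute. Qed.
Lemma check_cert_222 : check_cert (top_mono 2 2 2) cert_222. Proof. by vm_compute. Qed.
Lemma check_cert_000 : check_cert (top_mono 0 0 0) cert_000. Proof. by vm_compute. Qed.

(** Here and in the next three definitions, the default value of [nth] is the entry for the last
    index, the weight (0,0,0). *)
Definition square_top (l : 'I_5) : nat -> mono :=
  nth (top_mono 0 0 0) [:: top_mono 2 2 2; top_mono 3 1 1; top_mono 1 3 1; top_mono 1 1 3] l.
Definition square_cert (l : 'I_5) : seq class_cert :=
  nth cert_000 [:: cert_222; cert_311; cert_131; cert_113] l.
Definition square_sing (l : 'I_5) : lcomb :=
  nth sing0 [:: top2; sing3 0; sing3 1; sing3 2] l.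
Definition square_odd (l : 'I_5) : bool := nth false [:: false; true; true; true] l.

Definition check_weight (l : lcomb) (top : nat -> mono) (o : bool) : bool :=
  all (fun t => [&& (index t.2 < 17)%N, (index (behead t.2) < 17)%N,
    odd (size (basis_word (index t.2)) + size (basis_word (index (behead t.2)))) == o &
    all (fun i => mono_mul (wt_mono i (index t.2)) (wt_mono i (index (behead t.2))) == top i) I3]) l.

Lemma check_weights :
  all (fun p => check_weight p.1.1 p.1.2 p.2)
    [:: (top2, top_mono 2 2 2, false); (sing3 0, top_mono 3 1 1, true);
        (sing3 1, top_mono 1 3 1, true); (sing3 2, top_mono 1 1 3, true);
        (sing0, top_mono 0 0 0, false); (sing1, top_mono 1 1 1, true)].
Proof. by vm_compute. Qed.

Lemma check_top_norm : poly_eq (form2 top2 top2) poly_one.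
Proof. by vm_compute. Qed.

(** * The tensor square of the 17-dimensional module *)

Section TensorSquare.
Variables (K : fieldType) (x : 'I_3 -> K) (h : K).
Hypothesis x_neq0 : forall i, x i != 0.
Hypothesis x_prod : x 0 * x 1 * x 2 = 1.
Hypothesis h_neq0 : h != 0.
Local Notation qmodule := (qmodule x h).
Local Notation meval := (mono_eval (x 0) (x 1)).
Local Notation peval := (poly_eval (x 0) (x 1)).
Hypothesis factors_neq0 : forall p, p \in factors -> peval p != 0.
Local Notation xx := (x_neq0 0, x_neq0 1).
Local Notation lc_val := (lc_val (x 0) (x 1)).
Local Notation phi := (phi K).
Local Notation vop := (vop x).
Local Notation V17 := (V17 x h).
Local Notation form17 := (form17 x).

Definition top_weight (top : nat -> mono) : {ffun 'I_3 -> K} := [ffun i : 'I_3 => meval (top i)].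

Lemma lowered_top top w : all (fun j => j < 3)%N w ->
  lowered x (top_weight top) (content (wd w)) = top_weight (fun i => weight_mono top i w).
Proof.
elim: w => [|j w IHw] /=; first by rewrite lowered0.
case/andP => j3 w3; rewrite lowered_cons IHw //; apply/ffunP => i; rewrite !ffunE.
rewrite /= mono_eval_mul ?xx // mono_eval_inv ?xx // mulrC; congr (_^-1 * _).
by rewrite -letter_pairing // /letter inord_val.
Qed.

Lemma top_weight_neq0 top i : top_weight top i != 0.
Proof. by rewrite ffunE mono_eval_neq0 ?xx. Qed.

Lemma eq_top_weight top top' : all (fun i => top i == top' i) I3 ->
  top_weight top = top_weight top'.
Proof. by move=> /allP H; apply/ffunP => i; rewrite !ffunE (eqP (H _ (mem_I3 i))). Qed.

Lemma phi_index w : phi [:: index w] = phi w. Proof. by []. Qed.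

Lemma vop_K i w : (index w < 17)%N -> vop (SK i) (phi w) = meval (wt_mono i (index w)) *: phi w.
Proof.
move=> w17; rewrite vop_phi // /table w17 lc_val_cons lc_val_nil addr0 /= poly_eval_mono ?xx //.
Qed.

Lemma vop_P w : (index w < 17)%N ->
  vop SP (phi w) = (-1) ^+ (size (basis_word (index w))).+1 *: phi w.
Proof.
move=> w17; rewrite vop_phi // /table w17 /= /par_table lc_val_cons lc_val_nil addr0 /= phi_index.
have eN : peval (poly_opp poly_one) = -1 by rewrite poly_eval_opp ?xx // poly_eval_one.
congr (_ *: _); rewrite -signr_odd oddS; case: odd; last by rewrite expr1; exact: eN.
by rewrite poly_eval_one expr0.
Qed.

Definition square : rep K := V17 ⊗ V17.
Local Notation T := square.
Definition phi2 (w : word) : car T := tens (phi w : car V17) (phi (behead w) : car V17).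

Lemma dim_V17 : dim (car V17) = 17%N. Proof. by rewrite dim_matrix; apply: mul1n. Qed.

Lemma dim_square : dim (car T) = 289%N.
Proof. by rewrite dim_matrix dim_V17. Qed.

Lemma qmodule_square : qmodule T.
Proof. by apply: qmodule_tensor => //; exact: qmodule_V17. Qed.

Definition square_form : car T -> car T -> K := @tensor_form K V17 V17 form17 form17.

Lemma contravariant_square : contravariant h square_form.
Proof.
have hV := qmodule_V17 h x_neq0 x_prod.
have hF := contravariant_form17 x_neq0 h_neq0 factors_neq0.
exact: (contravariant_tensor hV hF hF).
Qed.

Lemma lc_val_pair l1 l2 : lc_val phi2 (lc_pair l1 l2) =
  tens (lc_val phi l1 : car V17) (lc_val phi l2 : car V17).
Proof.
rewrite {1}/lc_val /lc_pair big_allpairs_dep /lc_val tens_suml; apply: eq_bigr => t _.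
rewrite tens_sumr; apply: eq_bigr => t' _.
by rewrite /phi2 /= !phi_index tensZl tensZr scalerA poly_eval_mul ?xx.
Qed.

Lemma lc_val_cat (V : lmodType K) (f : word -> V) l1 l2 :
  lc_val f (l1 ++ l2) = lc_val f l1 + lc_val f l2.
Proof. exact: big_cat. Qed.

Lemma table2_value X i w : lc_val phi2 (table2 X i w) =
  tens (vop (X i) (phi w) : car V17) (vop (SK i) (phi (behead w)) : car V17) +
  tens (vop (SKi i) (vop SP (phi w)) : car V17) (vop (X i) (phi (behead w)) : car V17).
Proof.
rewrite /table2 lc_val_cat !lc_val_pair -!vop_phi // !phi_index; congr (_ + tens _ _).
rewrite -(lc_val_applyl x_neq0 (f := vop (SKi i))) => [||w'].
- by rewrite -vop_phi.
- by move=> a u v; rewrite linearP.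
exact: vop_phi.
Qed.

Lemma square_E (i : 'I_3) w : h *: act T (E i) (phi2 w) = lc_val phi2 (table2 SE i w).
Proof.
rewrite table2_value (op_tensor_tens (Some (E i))) /= !scale_lfunE tensZl tensZr.
by rewrite -scalerDr scalerA divff // scale1r.
Qed.

Lemma square_F (i : 'I_3) w : act T (F i) (phi2 w) = lc_val phi2 (table2 SF i w).
Proof. by rewrite table2_value (op_tensor_tens (Some (F i))). Qed.

Lemma square_F_comb (i : 'I_3) l :
  act T (F i) (lc_val phi2 l) = lc_val phi2 (lc_apply (table2 SF i) l).
Proof.
apply: (lc_val_applyl x_neq0) => [a u v|w]; first by rewrite linearP.
exact: square_F.
Qed.

Lemma killed_sound l (i : 'I_3) : killed SE l -> act T (E i) (lc_val phi2 l) = 0.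
Proof.
move=> /allP/(_ _ (mem_I3 i))/nilP l0.
have : h *: act T (E i) (lc_val phi2 l) = 0.
  rewrite (lc_val_applyl x_neq0 (f := fun u => h *: act T (E i) u) (T := table2 SE i)) => [||w].
  - by rewrite l0 lc_val_nil.
  - by move=> a u v; rewrite linearP scalerDr !scalerA mulrC.
  exact: square_E.
by move/eqP; rewrite scaler_eq0 (negPf h_neq0) => /eqP.
Qed.

Lemma form17_phi w w' : form17 (phi w) (phi w') = peval (coef (index w') (form_table w)).
Proof.
rewrite /form17 phi_mul //; last exact: indexed_form_table.
rewrite {2}/phi; case: ifP => w17; last by rewrite trmx0 mulmx0 mxE /coef w17 poly_eval_nil.
rewrite /e17 trmx_delta -colE [LHS]mxE lc_val_coef // inordK //.
Qed.

Lemma form2_sound l l' : square_form (lc_val phi2 l) (lc_val phi2 l') = peval (form2 l l').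
Proof.
have hF := contravariant_form17 x_neq0 h_neq0 factors_neq0.
have hb := contravariant_square.
have lcE r : lc_val phi2 r = \sum_(t <- r) peval t.1 *: phi2 t.2 by [].
rewrite (lcE l) (form_suml hb) /form2.
elim: l => [|t l IHl] /=; first by rewrite big_nil poly_eval_nil.
rewrite big_cons {}IHl (formZl hb); set r := foldr _ [::] l; clearbody r.
rewrite (lcE l') (form_sumr hb).
elim: l' => [|t' l' IHl'] /=; first by rewrite big_nil mulr0 add0r.
rewrite big_cons mulrDr -addrA IHl' (formZr hb) poly_eval_add ?xx // !poly_eval_mul ?xx //.
congr (_ + _); rewrite /square_form /phi2 (tensor_form_tens hF hF) !form17_phi.
by rewrite mulrA.
Qed.

Lemma phi2_weight i w : (index w < 17)%N -> (index (behead w) < 17)%N ->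
  act T (Kh i) (phi2 w) =
  meval (mono_mul (wt_mono i (index w)) (wt_mono i (index (behead w)))) *: phi2 w.
Proof.
move=> w1 w2; rewrite (op_tensor_tens (Some (Kh i))) /= !vop_K // tensZl tensZr scalerA.
by rewrite mono_eval_mul ?xx.
Qed.

Lemma phi2_par w : (index w < 17)%N -> (index (behead w) < 17)%N ->
  par T (phi2 w) = (-1) ^+ (size (basis_word (index w)) + size (basis_word (index (behead w))))
    *: phi2 w.
Proof.
move=> w1 w2; rewrite (op_tensor_tens None) /= !vop_P // tensZl tensZr scalerA.
by rewrite -exprD addSn addnS !exprS !mulN1r opprK.
Qed.

Lemma lc_val_eigen (V : vectType K) (psi : word -> V) (f : 'End(V)) c l :
  (forall t, t \in l -> f (psi t.2) = c *: psi t.2) -> f (lc_val psi l) = c *: lc_val psi l.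
Proof.
move=> fc; rewrite /lc_val linear_sum scaler_sumr; apply: eq_big_seq => t tl.
by rewrite linearZ /= fc // !scalerA mulrC.
Qed.

Lemma comb_singular l top o : check_weight l top o -> killed SE l -> lc_val phi2 l != 0 ->
  singular (top_weight top) ((-1) ^+ o) (lc_val phi2 l).
Proof.
move=> /allP lw lE l0; split=> // [|i|i].
- apply: lc_val_eigen => t /lw/and4P[w1 w2 /eqP <- _].
  by rewrite phi2_par // signr_odd.
- exact: killed_sound.
apply: lc_val_eigen => t /lw/and4P[w1 w2 _ /allP ti].
by rewrite phi2_weight // (eqP (ti _ (mem_I3 i))) ffunE.
Qed.

Let weights_sum (u : car T) := exists2 L : seq ({ffun 'I_3 -> K} * car T),
  (forall p, p \in L -> has_wt p.1 p.2) & \sum_(p <- L) p.2 = u.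

Lemma graded_square u : weights_sum u.
Proof.
have ws0 : weights_sum 0 by exists [::]; rewrite ?big_nil.
have wsP a u1 u2 : weights_sum u1 -> weights_sum u2 -> weights_sum (a *: u1 + u2).
  move=> [L1 h1 <-] [L2 h2 <-]; exists ([seq (p.1, a *: p.2) | p <- L1] ++ L2) => [p|].
    rewrite mem_cat => /orP[/mapP[q qL ->]|/h2//]; apply: has_wtZ; exact: h1.
  by rewrite big_cat big_map scaler_sumr.
have [U UE] := vspace_of_pred ws0 wsP; apply/UE.
suff -> : U = fullv by exact: memvf.
apply: tens_full => v w; rewrite (row_sum_delta (v : 'rV[K]_17)) (row_sum_delta (w : 'rV[K]_17)).
rewrite tens_suml; apply: memv_suml => n _; rewrite tens_sumr; apply: memv_suml => m _.
rewrite tensZl tensZr; do 2!apply: memvZ; apply/UE.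
have -> : tens (delta_mx 0 n : car V17) (delta_mx 0 m : car V17) = phi2 [:: n : nat; m : nat].
  by rewrite /phi2 /phi /= !ltn_ord /e17 !inord_val.
exists [:: (top_weight (fun i => mono_mul (wt_mono i n) (wt_mono i m)), phi2 [:: n : nat; m : nat])].
  move=> p; rewrite inE => /eqP -> i /=.
  by rewrite ffunE phi2_weight ?ltn_ord.
by rewrite big_seq1.
Qed.

Definition square_vec (l : 'I_5) : car T := lc_val phi2 (square_sing l).
Definition square_z : car T := lc_val phi2 sing1.
Local Notation k0 := (top_weight (top_mono 2 2 2)).

Lemma square_norm l : square_form (square_vec l) (square_vec l) != 0.
Proof.
have /and4P[s0 /allP n3 n0 _] := check_norms.
have fn p c : poly_factored p c -> peval p != 0 by exact: poly_factored_neq0.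
rewrite form2_sound; pose P u := peval (form2 u u) != 0.
have P2 : P top2.
  by rewrite /P (poly_eqP xx.1 xx.2 check_top_norm) poly_eval_one oner_neq0.
have P3 i : i \in I3 -> P (sing3 i) by move=> i3; apply: fn (n3 i i3).
have P0 : P sing0.
  rewrite /P (poly_eqP xx.1 xx.2 n0) (poly_eval_mul xx.1 xx.2).
  have sc := fn _ _ s0; exact (mulf_neq0 sc sc).
suff : P (square_sing l) by apply.
case: l => [[|[|[|[|[|m]]]]] l5].
- exact P2.
- exact (P3 0%N isT).
- exact (P3 1%N isT).
- exact (P3 2%N isT).
- exact P0.
by [].
Qed.

Lemma square_z_neq0 : square_z != 0.
Proof.
have /and4P[_ _ _ n1] := check_norms; have := poly_factored_neq0 x_neq0 factors_neq0 n1.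
rewrite -form2_sound; apply: contraNneq; rewrite /square_z => ->.
by rewrite (form0l contravariant_square).
Qed.

Lemma singular_square l :
  singular (top_weight (square_top l)) ((-1) ^+ square_odd l) (square_vec l).
Proof.
have l0 : square_vec l != 0.
  by apply: contraNneq (square_norm l) => ->; rewrite (form0l contravariant_square).
have /and5P[E2 /allP E3 E0 _ _] := check_tensor_square.
have /andP[w2 /andP[w30 /andP[w31 /andP[w32 /andP[w0 _]]]]] := check_weights.
case: l l0 => [[|[|[|[|[|m]]]]] l5] l0.
- exact: comb_singular w2 E2 l0.
- exact: comb_singular w30 (E3 0%N isT) l0.
- exact: comb_singular w31 (E3 1%N isT) l0.
- exact: comb_singular w32 (E3 2%N isT) l0.
- exact: comb_singular w0 E0 l0.
by [].
Qed.

Lemma singular_square_z : singular (top_weight (top_mono 1 1 1)) (-1) square_z.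
Proof.
have /and5P[_ _ _ _ E1] := check_tensor_square.
have /and5P[_ _ _ _ /and3P[_ w1 _]] := check_weights.
by have := comb_singular w1 E1 square_z_neq0; rewrite expr1.
Qed.

Lemma square_z_gen : square_z \in generated (square_vec 0).
Proof.
have FW w : all (fun j => j < 3)%N w ->
    lc_val phi2 (foldr (fun i l => lc_apply (table2 SF i) l) top2 w) = Fword (wd w) (square_vec 0).
  elim: w => //= i w IHw /andP[i3 w3]; rewrite -IHw //.
  have -> : table2 SF i = table2 SF (letter i) by rewrite /letter inordK.
  by rewrite -square_F_comb.
have : all (fun t => all (fun j => j < 3)%N t.2) sing1_coefs by [].
rewrite /square_z /sing1; elim: sing1_coefs => [|t r IHr] /=.
  by rewrite lc_val_nil mem0v.
case/andP => t3 /IHr hr; rewrite lc_val_lincomb ?xx // FW //.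
by apply: memvD hr; apply/memvZ/Fword_generated.
Qed.

Definition nat_word (l : 'I_5) : word := nth [::] [:: [::]; [:: 0]; [:: 1]; [:: 2]; [:: 0; 1; 2; 0; 1; 2]]%N l.

Let letter_val (i : 'I_3) : letter i = i. Proof. exact: inord_val. Qed.

Lemma square_word_nat l : square_word l = wd (nat_word l).
Proof.
have l0 : 0 = letter 0 :> 'I_3 by rewrite -(letter_val 0).
have l1 : 1 = letter 1 :> 'I_3 by rewrite -(letter_val 1).
have l2 : 2 = letter 2 :> 'I_3 by rewrite -(letter_val 2).
rewrite /square_word /square_words l2 l1 l0.
by case: l => [[|[|[|[|[|]]]]] l5].
Qed.

Lemma z_word_nat : z_word = wd [:: 0; 1; 2]%N.
Proof.
have l0 : 0 = letter 0 :> 'I_3 by rewrite -(letter_val 0).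
have l1 : 1 = letter 1 :> 'I_3 by rewrite -(letter_val 1).
have l2 : 2 = letter 2 :> 'I_3 by rewrite -(letter_val 2).
by rewrite /z_word l2 l1 l0.
Qed.

Lemma square_weight l : lowered x k0 (content (square_word l)) = top_weight (square_top l).
Proof.
rewrite square_word_nat lowered_top; last by case: l => [[|[|[|[|[|]]]]] l5].
by apply: eq_top_weight; case: l => [[|[|[|[|[|]]]]] l5].
Qed.

Lemma square_z_weight : lowered x k0 (content z_word) = top_weight (top_mono 1 1 1).
Proof. by rewrite z_word_nat lowered_top //; apply: eq_top_weight. Qed.

Lemma sum_content w : (\sum_i content w i)%N = size w.
Proof.
elim: w => [|j w IHw] /=; first by rewrite big1 // => i _; rewrite ffunE.
rewrite -IHw (bigD1 j) //= [in RHS](bigD1 j) //= !ffunE /= eqxx add1n addSn; congr (_ + _).+1.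
by apply: eq_bigr => i /negPf ij; rewrite !ffunE /= eq_sym ij.
Qed.

Lemma check_z_words : all (fun l => all (fun a => all (fun b =>
    (counts [:: a; b; l] == [:: 1; 1; 1]) ==>
    ([:: a; b] \in cert_words (nth cert_000 [:: cert_311; cert_131; cert_113] l)))%N I3) I3) I3.
Proof. by vm_compute. Qed.

(** The lengths add up to 3, so the weight (0,0,0), reached by six letters, is excluded, and
    otherwise w has two letters. The finitely many such words are found in the certificates by
    [check_z_words]. *)
Lemma square_z_words l w : l != 0 ->
  content (w ++ square_word l) = content z_word ->
  Fword w (square_vec l) \in word_span (square_vec l) (square_cert l).
Proof.
move=> l0 cw; have sw : size (w ++ square_word l) = 3%N by rewrite -sum_content cw sum_content.
have [a [b wE]] : exists a b, w = [:: a; b] /\ (l < 4)%N.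
  have /andP[l4 /eqP] : (l < 4)%N && (size w == 2)%N.
    move: sw; rewrite size_cat; case: l l0 {cw} => [[|[|[|[|[|]]]]] //= l5] _; lia.
  by case: w {sw cw} => [|a [|b [|? ?]]] // _; exists a, b.
case: wE => wE l4; rewrite wE in cw *.
have {cw} /content_counts cw : content (wd ([:: a : nat; b : nat] ++ nat_word l)) = content (wd [:: 0; 1; 2]%N).
  have wd_cat u v : wd (u ++ v) = wd u ++ wd v by exact: map_cat.
  by rewrite wd_cat -square_word_nat -z_word_nat -cw /= !letter_val.
have -> : [:: a; b] = wd [:: a : nat; b : nat] by rewrite /= !letter_val.
have l3 : (l : nat).-1 \in I3 by case: l l0 l4 {sw cw} => [[|[|[|[|[|]]]]] //= l5].
have nl : nat_word l = [:: (l : nat).-1] by case: l l0 l4 {sw cw l3} => [[|[|[|[|[|]]]]] //= l5].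
have cl : square_cert l = nth cert_000 [:: cert_311; cert_131; cert_113] (l : nat).-1.
  by case: l l0 l4 {sw cw l3 nl} => [[|[|[|[|[|]]]]] //= l5].
apply/memv_span/(map_f (fun w => Fword (wd w) _)); rewrite cl.
have /allP/(_ _ l3)/allP/(_ _ (mem_I3 a))/allP/(_ _ (mem_I3 b))/implyP := check_z_words; apply.
rewrite nl in cw; rewrite -[[:: 1; 1; 1]%N]/(counts [:: 0; 1; 2]%N) -cw //=.
by rewrite !ltn_ord; move: l3; rewrite !inE => /or3P[]/eqP->.
Qed.

End TensorSquare.

(** * The decomposition over a field with generic parameters *)

Section Generic.
Variables (K : fieldType) (x : 'I_3 -> K) (h : K).
Hypothesis x_neq0 : forall i, x i != 0.
Hypothesis wt_inj : forall (k : {ffun 'I_3 -> K}) (n n' : {ffun 'I_3 -> nat}),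
  (forall i, k i != 0) -> lowered x k n = lowered x k n' -> n = n'.
Hypothesis x_prod : x 0 * x 1 * x 2 = 1.
Hypothesis h_neq0 : h != 0.
Hypothesis two_neq0 : (2 : K) != 0.
Local Notation qmodule := (qmodule x h).
Local Notation meval := (mono_eval (x 0) (x 1)).
Local Notation peval := (poly_eval (x 0) (x 1)).
Hypothesis factors_neq0 : forall p, p \in factors -> peval p != 0.
Local Notation kt top := (top_weight x top).
Local Notation V17 := (V17 x h).
Local Notation T := (square x h).
Local Notation kl l := (kt (square_top l)).
Local Notation el l := ((-1) ^+ square_odd l).
Local Notation k1 := (kt (top_mono 1 1 1)).

Let letter_val (i : 'I_3) : letter i = i. Proof. exact: inord_val. Qed.

(** The 17 words of the certificate span the whole space, so a submodule without v meets everything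
    in zero. *)
Lemma hw_irr_V17 : hw_irr x h k1 (-1) V17.
Proof.
have hV := qmodule_V17 h x_neq0 x_prod.
pose v : car V17 := phi K [:: 0%N].
have hv : singular k1 (-1) v.
  split=> [|||i].
  - apply/eqP => /rowP/(_ (inord 0)); rewrite /v /phi /= /e17 !mxE !eqxx => /eqP.
    by rewrite oner_eq0.
  - by rewrite /= vop_P // expr1.
  - move=> i; rewrite /= scale_lfunE vop_phi // /table /=.
    by rewrite lc_val_nil scaler0.
  by rewrite /= vop_K // ffunE.
have ktop i : (i < 3)%N -> k1 (letter i) = meval (top_mono 1 1 1 i).
  by move=> i3; rewrite ffunE /letter inordK.
have dimW N : submodule N -> v \notin N -> \dim (word_span v cert_111) = 17%N /\
    (word_span v cert_111 :&: N)%VS = 0%VS.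
  move=> hN vN; split.
    exact (dim_word_span x_neq0 wt_inj x_prod h_neq0 factors_neq0 hV hv ktop hN vN check_cert_111).
  exact (word_span_cap x_neq0 wt_inj x_prod h_neq0 factors_neq0 hV hv ktop hN vN check_cert_111).
have v0 : v \notin (0%VS : {vspace car V17}) by rewrite memv0 (sing_neq0 hv).
have [dimf _] := dimW _ (submodule0 V17) v0.
have Wf : word_span v cert_111 = fullv.
  by apply/eqP; rewrite eqEdim subvf dimvf dim_V17 dimf.
split=> //; last by exists v.
split=> [||N hN _]; first exact: submodulef.
  by move=> f0; have := memvf v; rewrite f0 memv0 (negPf (sing_neq0 hv)).
have [vN|vN] := boolP (v \in N); [right|left].
  apply/eqP; rewrite eqEsubv subvf -Wf; apply: subv_trans (word_span_generated v cert_111) _.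
  exact: generated_min.
by have [_] := dimW N hN vN; rewrite Wf capfv.
Qed.

Let ktop l i : (i < 3)%N -> kl l (letter i) = meval (square_top l i).
Proof. by move=> i3; rewrite ffunE /letter inordK. Qed.

Let cert_ok l : check_cert (square_top l) (square_cert l).
Proof.
case: l => [[|[|[|[|[|m]]]]] l5].
- exact check_cert_222.
- exact check_cert_311.
- exact check_cert_131.
- exact check_cert_113.
- exact check_cert_000.
by [].
Qed.

Let cert_size l : size (cert_words (square_cert l)) = nth 0%N square_dims l.
Proof. by case: l => [[|[|[|[|[|m]]]]] l5]. Qed.

Let certz_size : size (cert_words cert_111) = 17%N. Proof. by []. Qed.

Let hs l : singular (lowered x (kt (top_mono 2 2 2)) (content (square_word l))) (el l)
  (square_vec x h l).
Proof. rewrite square_weight //; exact: singular_square. Qed.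

Let hz : singular (lowered x (kt (top_mono 2 2 2)) (content z_word)) (-1) (square_z x h).
Proof. rewrite square_z_weight //; exact: singular_square_z. Qed.

Let wtE l : lowered x (kt (top_mono 2 2 2)) (content (square_word l)) = kl l.
Proof. exact: square_weight. Qed.
Let wtzE : lowered x (kt (top_mono 2 2 2)) (content z_word) = k1.
Proof. exact: square_z_weight. Qed.

Let ktop' l i : (i < 3)%N ->
  lowered x (kt (top_mono 2 2 2)) (content (square_word l)) (letter i) = meval (square_top l i).
Proof. by rewrite wtE; apply: ktop. Qed.
Let kztop' i : (i < 3)%N ->
  lowered x (kt (top_mono 2 2 2)) (content z_word) (letter i) = meval (top_mono 1 1 1 i).
Proof. by rewrite wtzE => i3; rewrite ffunE /letter inordK. Qed.

Let k0_neq0 i : kt (top_mono 2 2 2) i != 0. Proof. exact: top_weight_neq0. Qed.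

Lemma tensor_irreducibles : (exists L, hw_irr x h k1 (-1) L) /\
  forall l, exists L, hw_irr x h (kl l) (el l) L.
Proof.
have [H1 H2] := square_irreducibles x_neq0 wt_inj x_prod h_neq0 two_neq0 factors_neq0
  (qmodule_square h x_neq0 x_prod) (contravariant_square x_neq0 x_prod h_neq0 factors_neq0)
  (dim_square x h) (graded_square x_neq0) k0_neq0 hs hz
  (square_norm x_neq0 x_prod h_neq0 factors_neq0) (square_z_gen h x_neq0)
  ktop' kztop' cert_ok check_cert_111 cert_size certz_size (square_z_words x h_neq0).
by rewrite wtzE in H1; split=> // l; have := H2 l; rewrite wtE.
Qed.
Lemma tensor_decomposition Lz (L : 'I_5 -> rep K) : hw_irr x h k1 (-1) Lz ->
  (forall l, hw_irr x h (kl l) (el l) (L l)) ->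
  exists M, [/\ core_structure x h Lz (L 0) M,
    forall l, l != 0 -> [/\ hom_dim M (L l) = 0%N, hom_dim (L l) M = 0%N &
                           dim (car (L l)) = nth 0%N square_dims l] &
    exists f0 : 'Hom(car M, car T), mor f0 /\
      exists2 f : forall l, 'Hom(car (L l), car T), forall l, l != 0 -> mor (f l) &
        (limg f0 + \sum_(l < 5 | l != 0%R) limg (f l))%VS = fullv].
Proof.
move=> hLz hL.
have := square_decomposition x_neq0 wt_inj x_prod h_neq0 two_neq0 factors_neq0
  (qmodule_square h x_neq0 x_prod) (contravariant_square x_neq0 x_prod h_neq0 factors_neq0)
  (dim_square x h) (graded_square x_neq0) k0_neq0 hs hz
  (square_norm x_neq0 x_prod h_neq0 factors_neq0) (square_z_gen h x_neq0)
  ktop' kztop' cert_ok check_cert_111 cert_size certz_size (square_z_words x h_neq0) (Lz := Lz) (L := L).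
by rewrite wtzE; apply=> // l; rewrite wtE.
Qed.

Lemma tensor_weight_inj l m : l != m -> kl l != kl m.
Proof. by rewrite -!wtE; apply: square_weight_inj. Qed.

Lemma tensor_weight_z l : kl l != k1.
Proof. by rewrite -wtE -wtzE; apply: square_weight_z. Qed.

Section TrivialFactor.
Variables (M N : rep K) (g : 'Hom(car M, car N)) (w : car N).
Hypotheses (gm : mor g) (wP : par N w = w).
Hypotheses (wK : forall i, act N (Kh i) w = w) (wKi : forall i, act N (Khi i) w = w).
Hypotheses (wE : forall i, act N (E i) w = 0) (wF : forall i, act N (F i) w = 0).

Definition tens_right : 'Hom(car M, car (N ⊗ N)) := linfun (fun u => tens (g u) w).
Definition tens_left : 'Hom(car M, car (N ⊗ N)) := linfun (fun u => tens w (g u)).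

Lemma tens_rightE u : tens_right u = tens (g u) w.
Proof. by rewrite /tens_right linfunE // => a v v'; rewrite linearP tensDl tensZl. Qed.

Lemma tens_leftE u : tens_left u = tens w (g u).
Proof. by rewrite /tens_left linfunE // => a v v'; rewrite linearP tensDr tensZr. Qed.

Lemma mor_tens_right : mor tens_right.
Proof.
move=> o u; rewrite !tens_rightE op_tensor_tens gm.
by case: o => [[i|i|i|i]|] /=; rewrite ?wP ?wK ?wKi ?wE ?wF ?tens0r ?addr0.
Qed.

(** The sign rule has no effect because w is even. *)
Lemma mor_tens_left : mor tens_left.
Proof.
move=> o u; rewrite !tens_leftE op_tensor_tens gm.
by case: o => [[i|i|i|i]|] /=; rewrite ?wP ?wK ?wKi ?wE ?wF ?tens0l ?add0r.
Qed.

End TrivialFactor.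

Lemma trivial_vector L : hw_irr x h (kt (top_mono 0 0 0)) 1 L -> dim (car L) = 1%N ->
  exists w : car L, [/\ <[w]>%VS = fullv, par L w = w,
    forall i, act L (Kh i) w = w /\ act L (Khi i) w = w &
    forall i, act L (E i) w = 0 /\ act L (F i) w = 0].
Proof.
move=> [hq _ [w hw]] d1; have w0 := sing_neq0 hw; exists w.
have wf : <[w]>%VS = fullv by apply/eqP; rewrite eqEdim subvf dimvf d1 dim_vline w0.
have wK i : act L (Kh i) w = w.
  rewrite (sing_wt hw) ffunE (_ : top_mono 0 0 0 i = (0, 0)%ZZ) ?mono_eval0 ?scale1r //.
  by case: i => [[|[|[|]]]].
split=> // [|i|i]; first by rewrite (sing_par hw) scale1r.
  by split=> //; rewrite -{1}(wK i) (pt_KhiKh hq).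
split; first exact: (sing_E hw).
have : act L (F i) w \in <[w]>%VS by rewrite wf memvf.
(* The line of w is stable under F_i, and F_i^2 = 0 forces the eigenvalue to be 0. *)
case/vlineP => c Fw; have := pt_FF hq i w; rewrite Fw linearZ /= Fw scalerA => /eqP.
by rewrite scaler_eq0 (negPf w0) orbF mulf_eq0 orbb => /eqP->; rewrite scale0r.
Qed.

(** The square of L1 ⊕ L0 splits into L1 ⊗ L1, decomposed above, two copies of L1 obtained by
    tensoring with the invariant vector w' on either side, and the line of w' ⊗ w'. The second copy
    of L0 is the invariant inside L1 ⊗ L1. *)
Lemma tensor_square_product L1 (L : 'I_5 -> rep K) : hw_irr x h k1 (-1) L1 ->
    (forall l, hw_irr x h (kl l) (el l) (L l)) ->
  let l1 := @Ordinal 5 1 isT in let l2 := @Ordinal 5 2 isT in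
  let l3 := @Ordinal 5 3 isT in let l4 := @Ordinal 5 4 isT in
  let P := (L1 ⊕ L l4) ⊗ (L1 ⊕ L l4) in
  (forall l, l != 0 -> dim (car (L l)) = nth 0%N square_dims l) /\
  exists M, [/\ core_structure x h L1 (L 0) M,
    P ≅ M ⊕ L l1 ⊕ L l2 ⊕ L l3 ⊕ (L1 ⊕ L1) ⊕ (L l4 ⊕ L l4) & hom_dim P P = 17%N].
Proof.
move=> hL1 hL l1 l2 l3 l4 P.
have [M [hM hML [f0 [f0m [f fm ff]]]]] := tensor_decomposition hL1 hL.
have d l : l != 0 -> dim (car (L l)) = nth 0%N square_dims l by case/hML.
split=> //; exists M.
have d1 : dim (car L1) = 17%N := cs_dim1 hM; have dM : dim (car M) = 144%N := cs_dim hM.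
pose Q := M ⊕ L l1 ⊕ L l2 ⊕ L l3 ⊕ (L1 ⊕ L1) ⊕ (L l4 ⊕ L l4).
have hL4 : hw_irr x h (kt (top_mono 0 0 0)) 1 (L l4) by exact: hL l4.
have [w [wf wP wK wE]] := trivial_vector hL4 (d l4 isT).
pose R := L1 ⊕ L l4; pose w' : car R := inR L1 (L l4) w.
have mR : mor (inR L1 (L l4)) by exact: mor_inR.
have mL : mor (inL L1 (L l4)) by exact: mor_inL.
have aR g : act R g w' = inR L1 (L l4) (act (L l4) g w) by rewrite (mor_act mR).
have wP' : par R w' = w' by rewrite /w' -(mor_par mR) wP.
have wK' i : act R (Kh i) w' = w' by rewrite aR (wK i).1.
have wKi' i : act R (Khi i) w' = w' by rewrite aR (wK i).2.
have wE' i : act R (E i) w' = 0 by rewrite aR (wE i).1 linear0.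
have wF' i : act R (F i) w' = 0 by rewrite aR (wE i).2 linear0.
have /isoP[g [gm g0 gf]] := hw_irr_unique x_neq0 wt_inj hw_irr_V17 hL1.
pose gL := (inL L1 (L l4) \o g)%VF.
have gLm : mor gL := mor_comp gm mL.
pose Phi : 'Hom(car T, car P) := tens_hom gL gL.
have Phim : mor Phi by exact: (mor_tens_hom gLm gLm).
pose J1 := tens_right (inL L1 (L l4)) w'; pose J2 := tens_left (inL L1 (L l4)) w'.
pose J3 := tens_right (inR L1 (L l4)) w'.
have J1m : mor J1 := mor_tens_right mL wP' wK' wKi' wE' wF'.
have J2m : mor J2 := mor_tens_left mL wP' wK' wKi' wE' wF'.
have J3m : mor J3 := mor_tens_right mR wP' wK' wKi' wE' wF'.
pose G : 'Hom(car Q, car P) := copair (copair (copair (copair (copair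
  (Phi \o f0)%VF (Phi \o f l1)%VF) (Phi \o f l2)%VF) (Phi \o f l3)%VF) (copair J1 J2))
  (copair (Phi \o f l4)%VF J3).
have Gm : mor G.
  do !apply: mor_copair => //; apply: mor_comp Phim => //; exact: fm.
have GU : limg G = fullv.
  have [U UE] : exists U, U = limg G by exists (limg G).
  have : (limg G <= U)%VS by rewrite UE.
  move=> le; rewrite -UE; move: le; rewrite /G !limg_copair !subv_add.
  case/andP => /andP[/andP[/andP[/andP[U0 U1] U2] U3] /andP[UJ1 UJ2]] /andP[U4 UJ3].
  have UPhi t : Phi t \in U.
    have pre (A : vectType K) (k : 'Hom(A, car T)) : (limg (Phi \o k) <= U)%VS ->
        (limg k <= Phi @^-1: U)%VS.
      move=> kG; apply/subvP => u /memv_imgP[u' _ ->]; rewrite -memv_preim.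
      by apply: (subvP kG); rewrite -comp_lfunE memv_img ?memvf.
    rewrite memv_preim; apply: subvP (memvf t); rewrite -ff subv_add pre //=.
    apply/subv_sumP => l l0; apply: pre.
    have [->|->|->|->] // : [\/ l = l1, l = l2, l = l3 | l = l4].
    move: l l0 => [[|[|[|[|[|n]]]]] l5] // _;
      by [constructor 1; apply: val_inj|constructor 2; apply: val_inj
         |constructor 3; apply: val_inj|constructor 4; apply: val_inj].
  have wline (u : car (L l4)) : exists c, u = c *: w by apply/vlineP; rewrite wf memvf.
  have splitR (a : car R) : exists a1 c, a = inL L1 (L l4) a1 + c *: w'.
    case: a => a1 a2; have [c ->] := wline a2; exists a1, c.
    rewrite /w' inLE inRE; congr pair; rewrite /= ?scaler0 ?addr0 ?add0r //.
  have gS (a : car L1) : exists a', g a' = a by apply/surj_limg: a.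
  suff mem (a b : car R) : (tens a b : car P) \in U by exact: tens_full mem.
  have [a1 [c ->]] := splitR a; have [b1 [c' ->]] := splitR b.
  rewrite !tensDl !tensDr !tensZl !tensZr; do 2?apply: memvD; do ?apply: memvZ.
  - have [a' <-] := gS a1; have [b' <-] := gS b1.
    by have := UPhi (tens (a' : car V17) (b' : car V17)); rewrite /Phi tens_homE !comp_lfunE.
  - by apply: (subvP UJ1); rewrite -(tens_rightE (inL L1 (L l4))) memv_img ?memvf.
  - by apply: (subvP UJ2); rewrite -(tens_leftE (inL L1 (L l4))) memv_img ?memvf.
  - by apply: (subvP UJ3); rewrite /w' -(tens_rightE (inR L1 (L l4))) memv_img ?memvf.
have iso_P : P ≅ Q.
  (* Both sides have dimension 144 + 3 * 48 + 2 * 17 + 2 = 18 * 18. *)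
  apply/iso_sym/(mor_surj_iso Gm GU); rewrite /Q /P !dim_dsum dim_matrix !dim_dsum.
  by rewrite d1 dM !d.
split=> //; rewrite (hom_dim_isol _ iso_P) (hom_dim_isor _ iso_P).
have self l : hom_dim (L l) (L l) = 1%N by exact: hom_dim_hw_self (hL l) (hL l).
have neq l m : l != m -> hom_dim (L l) (L m) = 0%N.
  by move=> lm; exact: hom_dim_hw_neq (tensor_weight_inj lm) (hL l) (hL m).
have to1 l : hom_dim (L l) L1 = 0%N by exact: hom_dim_hw_neq (tensor_weight_z l) (hL l) hL1.
have from1 l : hom_dim L1 (L l) = 0%N.
  by apply: hom_dim_hw_neq hL1 (hL l) => //; rewrite eq_sym tensor_weight_z.
have self1 : hom_dim L1 L1 = 1%N by exact (@hom_dim_hw_self _ _ _ x_neq0 wt_inj two_neq0 _ _ _ _ hL1 hL1).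
have fM l : l != 0 -> hom_dim M (L l) = 0%N by case/hML.
have tM l : l != 0 -> hom_dim (L l) M = 0%N by case/hML.
(* Contributions to 17: 2 from M, 2 + 2 from the maps between M and the two copies of L1 in both
   directions, 4 from each pair of equal summands, and 3 from the summands of dimension 48. *)
rewrite /Q !hom_dim_dsuml !hom_dim_dsumr !(cs_End hM, cs_to hM, cs_from hM, self, to1, from1, self1).
by rewrite !fM // !tM // !neq.
Qed.
End Generic.

(** * The quantum group *)

Section Bridge.
Variables (R : realType) (alpha : 'I_3 -> R[i]) (q logq : R[i]).
Hypothesis alpha_sum : \sum_i alpha i = 0.
Hypothesis q_neq0 : q != 0.
Hypothesis q_not_root : forall n : nat, (0 < n)%N -> q ^+ n != 1.
Hypothesis logqE : cexp logq = q.
Hypothesis qalpha_not_root : forall (i : 'I_3) (n : nat), (0 < n)%N ->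
  qpow logq (alpha i) ^+ n != 1.
Hypothesis qalpha_distinct : forall i j : 'I_3, i != j ->
  qpow logq (2 * (alpha i - alpha j)) != 1.
Local Notation qpow := (qpow logq).

Lemma cexpD (a b : R[i]) : cexp (a + b) = cexp a * cexp b.
Proof.
case: a b => [a1 a2] [b1 b2]; rewrite /cexp /= expRD cosD sinD.
by apply/eqP; rewrite eq_complex /=; apply/andP; split; apply/eqP; ring.
Qed.

Lemma cexp0 : cexp (0 : R[i]) = 1.
Proof.
rewrite /cexp /= expR0 cos0 sin0.
by apply/eqP; rewrite eq_complex /=; apply/andP; split; apply/eqP; ring.
Qed.

Lemma qpowD a b : qpow (a + b) = qpow a * qpow b.
Proof. by rewrite /Defs.qpow mulrDl cexpD. Qed.

Lemma qpow0 : qpow 0 = 1. Proof. by rewrite /Defs.qpow mul0r cexp0. Qed.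

Lemma qpow_neq0 a : qpow a != 0.
Proof.
have : qpow a * qpow (- a) != 0 by rewrite -qpowD subrr qpow0 oner_neq0.
by rewrite mulf_eq0 negb_or => /andP[].
Qed.

Lemma qpowN a : qpow (- a) = (qpow a)^-1.
Proof. by apply: (mulfI (qpow_neq0 a)); rewrite -qpowD subrr qpow0 divff ?qpow_neq0. Qed.

Lemma qpowMn a n : qpow (n%:R * a) = qpow a ^+ n.
Proof.
elim: n => [|n IHn]; first by rewrite mul0r qpow0.
by rewrite exprS -IHn -qpowD -addn1 natrD mulrDl mul1r addrC.
Qed.

Lemma qpowMz a (m : int) : qpow (m%:~R * a) = qpow a ^ m.
Proof.
case: m => n; first exact: qpowMn.
by rewrite NegzE mulrNz mulNr qpowN qpowMn.
Qed.

Definition xq (i : 'I_3) : R[i] := qpow (alpha i / 2).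
Definition hq : R[i] := qpow 1 - qpow (- 1).
Local Notation meval := (mono_eval (xq 0) (xq 1)).
Local Notation peval := (poly_eval (xq 0) (xq 1)).

Lemma two_neq0 : (2 : R[i]) != 0. Proof. by rewrite pnatr_eq0. Qed.

Lemma xq_neq0 i : xq i != 0. Proof. exact: qpow_neq0. Qed.

Lemma alpha2E : alpha 2 = - alpha 0 - alpha 1.
Proof.
have := alpha_sum; rewrite !big_ord_recl big_ord0 addr0.
have -> : lift ord0 ord0 = 1 :> 'I_3 by apply: val_inj.
have -> : lift ord0 (lift ord0 ord0) = 2 :> 'I_3 by apply: val_inj.
by move=> e; apply/eqP; rewrite -subr_eq0 -e; apply/eqP; ring.
Qed.

Lemma xq_prod : xq 0 * xq 1 * xq 2 = 1.
Proof. by rewrite -!qpowD alpha2E -[RHS]qpow0; congr qpow; field. Qed.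

Lemma qpow1 : qpow 1 = q. Proof. by rewrite /Defs.qpow mul1r logqE. Qed.

Lemma hq_neq0 : hq != 0.
Proof.
rewrite /hq qpowN qpow1 subr_eq0; apply: contra (q_not_root (n := 2) isT) => /eqP e.
by rewrite expr2 {2}e divff.
Qed.

Lemma xq2 i : xq i ^+ 2 = qpow (alpha i).
Proof. by rewrite -qpowMn; congr qpow; field. Qed.

(** If x_i^n = 1 then also q^(n alpha_i) = x_i^(2 n) = 1. *)
Lemma xq_not_root i (m : int) : xq i ^ m = 1 -> m = 0.
Proof.
have pos n : xq i ^+ n = 1 -> n = 0%N.
  move=> e; apply/eqP; case: n e => // n e.
  by have := qalpha_not_root i (n := n.+1) isT; rewrite -xq2 -exprM mulnC exprM e expr1n eqxx.
case: m => n; first by move/pos->.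
by move=> /(congr1 GRing.inv); rewrite -[xq i ^ _]/((xq i ^+ n.+1)^-1) invrK invr1 => /pos.
Qed.

Lemma bx_third (x : 'I_3 -> R[i]) :
  [/\ bx x 0 1 = x 2, bx x 0 2 = x 1 & bx x 1 2 = x 0].
Proof. by split; rewrite /bx /=; congr x; apply: val_inj. Qed.

Lemma prod3 (f : 'I_3 -> R[i]) : \prod_j f j = f 0 * f 1 * f 2.
Proof.
rewrite !big_ord_recl big_ord0 mulr1 mulrA.
by congr (_ * f _ * f _); apply: val_inj.
Qed.

(** No x_i is a root of unity, but the x_i may be multiplicatively dependent. With m the difference
    of the contents, x_2^m_1 x_1^m_2 = x_2^m_0 x_0^m_2 = x_1^m_0 x_0^m_1 = 1. Raised to the powers
    m_0, m_1, m_2, these equations say that A = x_2^(m_0 m_1), B = x_1^(m_0 m_2), C = x_0^(m_1 m_2)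
    have pairwise products 1. So their squares are 1, all products m_i m_j vanish, and the original
    equations then give m = 0. *)
Lemma xq_wt_inj (k : {ffun 'I_3 -> R[i]}) (n n' : {ffun 'I_3 -> nat}) :
  (forall i, k i != 0) -> lowered xq k n = lowered xq k n' -> n = n'.
Proof.
move=> k0 /ffunP nn'; pose m i : int := (n i)%:Z - (n' i)%:Z.
have mE i j : xq i ^ m j = xq i ^+ n j / xq i ^+ n' j.
  by rewrite /m expfzDr ?xq_neq0 // -invr_expz.
have [b01 b02 b12] := bx_third xq.
have b10 : bx xq 1 0 = xq 2 by rewrite bxC.
have b20 : bx xq 2 0 = xq 1 by rewrite bxC.
have b21 : bx xq 2 1 = xq 0 by rewrite bxC.
have bii i : bx xq i i = 1 by rewrite /bx eqxx.
have prodE i : \prod_j bx xq i j ^+ n j = \prod_j bx xq i j ^+ n' j.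
  by have := nn' i; rewrite !ffunE => /(mulfI (k0 i)) /invr_inj.
have pair i j i' j' : xq i ^+ n j * xq i' ^+ n j' = xq i ^+ n' j * xq i' ^+ n' j' ->
    xq i ^ m j * xq i' ^ m j' = 1.
  by move=> e; rewrite !mE mulf_div e divff // mulf_neq0 // expf_neq0 ?xq_neq0.
have e0 : xq 2 ^ m 1 * xq 1 ^ m 2 = 1.
  by apply: pair; have := prodE 0; rewrite !prod3 b01 b02 bii !expr1n !mul1r.
have e1 : xq 2 ^ m 0 * xq 0 ^ m 2 = 1.
  by apply: pair; have := prodE 1; rewrite !prod3 b10 b12 bii !expr1n !mulr1.
have e2 : xq 1 ^ m 0 * xq 0 ^ m 1 = 1.
  by apply: pair; have := prodE 2; rewrite !prod3 b20 b21 bii !expr1n !mulr1.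
have pw i j i' j' l : xq i ^ m j * xq i' ^ m j' = 1 ->
    xq i ^ (m j * m l) * xq i' ^ (m j' * m l) = 1.
  by move=> e; rewrite -!exprz_exp -expfzMl e exp1rz.
have p0 := pw _ _ _ _ 0 e0; have p1 := pw _ _ _ _ 1 e1; have p2 := pw _ _ _ _ 2 e2.
rewrite [m 1 * m 0]mulrC [m 2 * m 0]mulrC in p0; rewrite [m 2 * m 1]mulrC in p1.
have sq1 (A B C : R[i]) : A * B = 1 -> A * C = 1 -> B * C = 1 -> A ^+ 2 = 1.
  move=> ab ac bc; have -> : A ^+ 2 = (A * B) * (A * C) / (B * C).
    have b0 : B != 0 by apply: contraTneq (oner_neq0 R[i]) => B0; rewrite -ab B0 mulr0 eqxx.
    have c0 : C != 0 by apply: contraTneq (oner_neq0 R[i]) => C0; rewrite -ac C0 mulr0 eqxx.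
    by field; rewrite b0 c0.
  by rewrite ab ac bc mulr1 divr1.
have root0 i (u : int) : (xq i ^ u) ^+ 2 = 1 -> u = 0.
  rewrite -[_ ^+ 2]/(_ ^ 2%:Z) exprz_exp => /xq_not_root/eqP.
  by rewrite mulf_eq0 orbF => /eqP.
have C1 (A B : R[i]) : A * B = 1 -> B * A = 1 by rewrite mulrC.
have m01 : m 0 * m 1 = 0 by apply: (root0 2); exact: sq1 p0 p1 p2.
have m02 : m 0 * m 2 = 0 by apply: (root0 1); exact: sq1 (C1 _ _ p0) p2 p1.
have m12 : m 1 * m 2 = 0 by apply: (root0 0); exact: sq1 (C1 _ _ p1) (C1 _ _ p2) p0.
have mz i : m i = 0.
  have m_0 : m 0 = 0.
    case/eqP: m01; rewrite mulf_eq0 => /orP[/eqP//|/eqP m1].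
    case/eqP: m02; rewrite mulf_eq0 => /orP[/eqP//|/eqP m2].
    by move: e1; rewrite m2 expr0z mulr1 => /xq_not_root.
  have m_1 : m 1 = 0 by move: e2; rewrite m_0 expr0z mul1r => /xq_not_root.
  have m_2 : m 2 = 0 by move: e1; rewrite m_0 expr0z mul1r => /xq_not_root.
  by case: (I3P i) => ->.
apply/ffunP => i; apply/eqP; have /eqP := mz i.
by rewrite /m subr_eq0.
Qed.

(** The factors t_i - 1, t_i + 1, t_i^2 + 1 vanish only at roots of unity of order 1, 2, 4, and t_i
    - t_j, t_i + t_j only if t_i^2 = t_j^2, which [qalpha_distinct] excludes. *)
Lemma xq_factors_neq0 p : p \in factors -> peval p != 0.
Proof.
pose t i : R[i] := qpow (alpha i).
have x0 := xq_neq0 0; have x1 := xq_neq0 1.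
have root i n : (0 < n)%N -> t i ^+ n != 1 by exact: qalpha_not_root.
have X0 : meval (2, 0)%ZZ = t 0 by rewrite /t -xq2 /mono_eval /= expr0z mulr1.
have X1 : meval (0, 2)%ZZ = t 1 by rewrite /t -xq2 /mono_eval /= expr0z mul1r.
have X2 : meval (-2, -2)%ZZ = t 2.
  rewrite -[(-2, -2)%ZZ]/(mono_inv (mono_mul (2, 0) (0, 2))%ZZ) mono_eval_inv // mono_eval_mul //.
  by rewrite X0 X1 /t alpha2E -qpowD -qpowN; congr qpow; ring.
have pD p1 p2 : peval (poly_add p1 p2) = peval p1 + peval p2 by exact: poly_eval_add.
have pN p1 : peval (poly_opp p1) = - peval p1 by exact: poly_eval_opp.
have pm m : peval (poly_mono m) = meval m by exact: poly_eval_mono.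
have mm m m' : meval (mono_mul m m') = meval m * meval m' by exact: mono_eval_mul.
have p1 : peval poly_one = 1 by exact: poly_eval_one.
have sub1 i : t i - 1 != 0 by rewrite subr_eq0; exact: (root i 1%N isT).
have add1 i : t i + 1 != 0.
  rewrite addr_eq0; apply: contra (root i 2%N isT) => /eqP ->; by rewrite sqrrN expr1n.
have sq1 i : t i * t i + 1 != 0.
  rewrite addr_eq0; rewrite -expr2; apply: contra (root i 4%N isT) => /eqP e.
  by rewrite -[4%N]/(2 * 2)%N exprM e sqrrN expr1n.
have tt i j : i != j -> t i ^+ 2 != t j ^+ 2.
  move=> ij; apply: contra (qalpha_distinct ij) => /eqP e.
  by rewrite mulrBr qpowD qpowN !qpowMn -/(t i) -/(t j) e divff // expf_neq0 // qpow_neq0.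
have subt i j : i != j -> t i - t j != 0.
  by move=> ij; rewrite subr_eq0; apply: contra (tt i j ij) => /eqP->.
have addt i j : i != j -> t i + t j != 0.
  by move=> ij; rewrite addr_eq0; apply: contra (tt i j ij) => /eqP->; rewrite sqrrN.
have -> : factors = [::
  [:: ((0, 0), 2)%ZZ];
  poly_add (poly_mono (2, 0)%ZZ) (poly_opp poly_one);
  poly_add (poly_mono (2, 0)%ZZ) poly_one;
  poly_add (poly_mono (mono_mul (2, 0)%ZZ (2, 0)%ZZ)) poly_one;
  poly_add (poly_mono (0, 2)%ZZ) (poly_opp poly_one);
  poly_add (poly_mono (0, 2)%ZZ) poly_one;
  poly_add (poly_mono (mono_mul (0, 2)%ZZ (0, 2)%ZZ)) poly_one;
  poly_add (poly_mono (-2, -2)%ZZ) (poly_opp poly_one);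
  poly_add (poly_mono (-2, -2)%ZZ) poly_one;
  poly_add (poly_mono (mono_mul (-2, -2)%ZZ (-2, -2)%ZZ)) poly_one;
  poly_add (poly_mono (2, 0)%ZZ) (poly_opp (poly_mono (0, 2)%ZZ));
  poly_add (poly_mono (2, 0)%ZZ) (poly_mono (0, 2)%ZZ);
  poly_add (poly_mono (2, 0)%ZZ) (poly_opp (poly_mono (-2, -2)%ZZ));
  poly_add (poly_mono (2, 0)%ZZ) (poly_mono (-2, -2)%ZZ);
  poly_add (poly_mono (0, 2)%ZZ) (poly_opp (poly_mono (-2, -2)%ZZ));
  poly_add (poly_mono (0, 2)%ZZ) (poly_mono (-2, -2)%ZZ)] by [].
rewrite inE => /orP[/eqP -> | ].
  rewrite /poly_eval big_seq1 /mono_eval /= !expr0z !mulr1; exact: two_neq0.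
do 14?[rewrite inE => /orP[/eqP -> | ]; first by
  rewrite !pD ?pN ?p1 ?pm ?mm ?X0 ?X1 ?X2 ?sub1 ?add1 ?sq1 ?subt ?addt].
by rewrite inE => /eqP ->; rewrite !pD !pm ?X0 ?X1 ?X2 addt.
Qed.

Lemma xq_bx i j : qpow (B alpha i j / 2) = bx xq i j.
Proof. by rewrite /B /bx; case: eqP => _ //; rewrite mul0r qpow0. Qed.

Lemma qnumE i : qnum logq (alpha i) = hq^-1 * (xq i ^+ 2 - xq i ^- 2).
Proof. by rewrite /qnum xq2 qpowN mulrC. Qed.

Lemma serreE (V : vectType R[i]) (X : 'I_3 -> 'End(V)) u : serre alpha logq X u =
  hq^-1 *: \sum_(s : 'S_3) ((-1) ^+ s * (xq (s 1) ^+ 2 - xq (s 1) ^- 2)) *: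
    X (s 0) (X (s 1) (X (s 2) u)).
Proof.
rewrite /serre sum_lfunE scaler_sumr; apply: eq_bigr => s _.
by rewrite scale_lfunE !comp_lfunE qnumE scalerA mulrCA.
Qed.

Lemma is_moduleP M : is_module alpha logq M <-> qmodule xq hq M.
Proof.
(* Translates K E K^-1 = c E into K E = c E K, the form used in [qmodule]. *)
have cancelKh (f g k l : 'End(car M)) c : (k \o l)%VF = \1%VF -> (l \o k)%VF = \1%VF ->
    (k \o f \o l)%VF = c *: f <-> (forall u, k (f u) = c *: f (k u)).
  move=> kl lk; split=> [e u|e].
    have := congr1 (fun a : 'End(car M) => a (k u)) e; rewrite scale_lfunE !comp_lfunE.
    by rewrite -[l (k u)]comp_lfunE lk id_lfunE.
  apply/lfunP => u; rewrite !comp_lfunE e scale_lfunE -[k (l u)]comp_lfunE kl id_lfunE //.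
split=> [[pp pK pKi pE pF KKi KiK KK KE KF EF EE FF sE sF]|
         [pp pK pKi pE pF KKi KiK KK KE KF EF EE FF sE sF]].
  have at2 (f g k l : 'End(car M)) : (f \o g = k \o l)%VF -> forall u, f (g u) = k (l u).
    by move=> e u; rewrite -!comp_lfunE e.
  split.
  - by move=> u; rewrite -comp_lfunE pp id_lfunE.
  - by move=> i; apply: at2.
  - by move=> i; apply: at2.
  - by move=> i u; rewrite -comp_lfunE pE opp_lfunE comp_lfunE.
  - by move=> i u; rewrite -comp_lfunE pF opp_lfunE comp_lfunE.
  - by move=> i u; rewrite -comp_lfunE KKi id_lfunE.
  - by move=> i u; rewrite -comp_lfunE KiK id_lfunE.
  - by move=> i j; apply: at2.
  - move=> i j; have /cancelKh := KE i j; rewrite xq_bx; apply=> //; exact: (act M (E i)).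
  - move=> i j; have /cancelKh := KF i j; rewrite qpowN xq_bx; apply=> //; exact: (act M (E i)).
  - move=> i j u; have := congr1 (fun a : 'End(car M) => a u) (EF i j).
    rewrite add_lfunE !comp_lfunE => ->; case: eqP => _; last by rewrite zero_lfunE.
    by rewrite scale_lfunE add_lfunE opp_lfunE !comp_lfunE.
  - by move=> i u; rewrite -comp_lfunE EE zero_lfunE.
  - by move=> i u; rewrite -comp_lfunE FF zero_lfunE.
  - move=> u; have := congr1 (fun a : 'End(car M) => a u) sE; rewrite serreE zero_lfunE => /eqP.
    by rewrite scaler_eq0 invr_eq0 (negPf hq_neq0) => /eqP.
  move=> u; have := congr1 (fun a : 'End(car M) => a u) sF; rewrite serreE zero_lfunE => /eqP.
  by rewrite scaler_eq0 invr_eq0 (negPf hq_neq0) => /eqP.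
have KKi' i : (act M (Kh i) \o act M (Khi i) = \1)%VF.
  by apply/lfunP => u; rewrite comp_lfunE id_lfunE KKi.
have KiK' i : (act M (Khi i) \o act M (Kh i) = \1)%VF.
  by apply/lfunP => u; rewrite comp_lfunE id_lfunE KiK.
split=> //.
- by apply/lfunP => u; rewrite comp_lfunE id_lfunE pp.
- by move=> i; apply/lfunP => u; rewrite !comp_lfunE pK.
- by move=> i; apply/lfunP => u; rewrite !comp_lfunE pKi.
- by move=> i; apply/lfunP => u; rewrite opp_lfunE !comp_lfunE pE.
- by move=> i; apply/lfunP => u; rewrite opp_lfunE !comp_lfunE pF.
- by move=> i j; apply/lfunP => u; rewrite !comp_lfunE KK.
- by move=> i j; rewrite xq_bx; apply/cancelKh => //; exact: (act M (E i)).
- by move=> i j; rewrite qpowN xq_bx; apply/cancelKh => //; exact: (act M (E i)).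
- move=> i j; apply/lfunP => u; rewrite add_lfunE !comp_lfunE EF.
  case: eqP => _; last by rewrite zero_lfunE.
  by rewrite scale_lfunE add_lfunE opp_lfunE !comp_lfunE.
- by move=> i; apply/lfunP => u; rewrite comp_lfunE EE zero_lfunE.
- by move=> i; apply/lfunP => u; rewrite comp_lfunE FF zero_lfunE.
- by apply/lfunP => u; rewrite serreE sE scaler0 zero_lfunE.
by apply/lfunP => u; rewrite serreE sF scaler0 zero_lfunE.
Qed.

(* The exponents of x_0 and x_1 in q^(weight a b c i / 2). *)
Lemma weight_top a b c (top : nat -> mono) :
  [/\ int_of_Z (top 0%N).1 * 2 = - a%:Z - c%:Z, int_of_Z (top 0%N).2 * 2 = b%:Z - c%:Z &
      int_of_Z (top 1%N).1 * 2 = a%:Z - c%:Z] ->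
  [/\ int_of_Z (top 1%N).2 * 2 = - b%:Z - c%:Z, int_of_Z (top 2%N).1 * 2 = a%:Z + c%:Z &
      int_of_Z (top 2%N).2 * 2 = b%:Z + c%:Z] ->
  forall i, qpow (weight alpha a b c i / 2) = meval (top i).
Proof.
move=> [e1 e2 e3] [e4 e5 e6] i; rewrite /mono_eval -!qpowMz -qpowD; congr qpow.
have cast (u : int) (v w : int) : u * 2 = v -> v = w -> u%:~R = w%:~R / 2 :> R[i].
  by move=> <- <-; rewrite intrM mulfK // two_neq0.
rewrite /weight /omega.
have o0 : nat_of_ord (0 : 'I_3) = 0%N by [].
have o1 : nat_of_ord (1 : 'I_3) = 1%N by [].
have o2 : nat_of_ord (2 : 'I_3) = 2%N by [].
case: (I3P i) => ->; rewrite ?o0 ?o1 ?o2 /= alpha2E;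
  rewrite ?(cast _ _ _ e1 erefl) ?(cast _ _ _ e2 erefl) ?(cast _ _ _ e3 erefl);
  rewrite ?(cast _ _ _ e4 erefl) ?(cast _ _ _ e5 erefl) ?(cast _ _ _ e6 erefl);
  rewrite ?rmorphB ?rmorphD ?rmorphN /= -!pmulrn; by field.
Qed.

Lemma is_LP a b c (top : nat -> mono) e M : (-1) ^+ (a + b + c) = e ->
  (forall i, qpow (weight alpha a b c i / 2) = meval (top i)) ->
  is_L alpha logq a b c M <-> hw_irr xq hq (top_weight xq top) e M.
Proof.
move=> <- wt; split=> [[/is_moduleP hM irr [v [v0 vP vE vK]]]|[/is_moduleP hM irr [v [v0 vP vE vK]]]].
  by split=> //; exists v; split=> // i; rewrite vK ffunE wt.
by split=> //; exists v; split=> // i; rewrite vK ffunE wt.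
Qed.

Lemma is_L_z M : is_L alpha logq 1 1 1 M <->
  hw_irr xq hq (top_weight xq (top_mono 1 1 1)) (-1) M.
Proof.
apply: is_LP; first by rewrite -signr_odd.
by apply: weight_top; split.
Qed.

Definition square_label (l : 'I_5) : nat * nat * nat :=
  nth (0, 0, 0)%N [:: (2, 2, 2); (3, 1, 1); (1, 3, 1); (1, 1, 3)]%N l.

Lemma is_L_square l M :
  is_L alpha logq (square_label l).1.1 (square_label l).1.2 (square_label l).2 M <->
  hw_irr xq hq (top_weight xq (square_top l)) ((-1) ^+ square_odd l) M.
Proof.
apply: is_LP; first by rewrite -signr_odd; case: l => [[|[|[|[|[|]]]]] l5].
by apply: weight_top; case: l => [[|[|[|[|[|]]]]] l5]; split.
Qed.

Lemma is_L_exists a b c :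
  (a, b, c) \in [:: (1, 1, 1); (0, 0, 0); (3, 1, 1); (1, 3, 1); (1, 1, 3); (2, 2, 2)]%N ->
  exists L : rep R[i], is_L alpha logq a b c L.
Proof.
have [[L1 hL1] hL] := tensor_irreducibles xq_neq0 xq_wt_inj xq_prod hq_neq0 two_neq0 xq_factors_neq0.
have ex n (n5 : (n < 5)%N) : exists L, is_L alpha logq (square_label (Ordinal n5)).1.1
    (square_label (Ordinal n5)).1.2 (square_label (Ordinal n5)).2 L.
  by have [L /is_L_square hLn] := hL (Ordinal n5); exists L.
rewrite !inE => /orP[/eqP[-> -> ->]|]; first by exists L1; apply/is_L_z.
move=> /orP[/eqP[-> -> ->]|]; first exact: (ex 4 isT).
move=> /orP[/eqP[-> -> ->]|]; first exact: (ex 1%N isT).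
move=> /orP[/eqP[-> -> ->]|]; first exact: (ex 2%N isT).
move=> /orP[/eqP[-> -> ->]|/eqP[-> -> ->]]; first exact: (ex 3%N isT).
exact: (ex 0%N isT).
Qed.

Lemma square_structure (L111 L000 L311 L131 L113 L222 : rep R[i]) :
  is_L alpha logq 1 1 1 L111 -> is_L alpha logq 0 0 0 L000 ->
  is_L alpha logq 3 1 1 L311 -> is_L alpha logq 1 3 1 L131 ->
  is_L alpha logq 1 1 3 L113 -> is_L alpha logq 2 2 2 L222 ->
  let P := (L111 ⊕ L000) ⊗ (L111 ⊕ L000) in
  [/\ dim (car L000) = 1%N, dim (car L311) = 48%N, dim (car L131) = 48%N,
      dim (car L113) = 48%N &
      exists M, [/\ core_structure xq hq L111 L222 M,
        P ≅ M ⊕ L311 ⊕ L131 ⊕ L113 ⊕ (L111 ⊕ L111) ⊕ (L000 ⊕ L000) & hom_dim P P = 17%N]].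
Proof.
move=> /is_L_z h111 h000 h311 h131 h113 h222 P.
pose L (l : 'I_5) := nth L000 [:: L222; L311; L131; L113] l.
have hL l : hw_irr xq hq (top_weight xq (square_top l)) ((-1) ^+ square_odd l) (L l).
  by apply/is_L_square; case: l => [[|[|[|[|[|]]]]] l5].
have [dL HM] := tensor_square_product xq_neq0 xq_wt_inj xq_prod hq_neq0 two_neq0
  xq_factors_neq0 h111 hL.
split; [exact: (dL (@Ordinal 5 4 isT) isT)|exact: (dL (@Ordinal 5 1 isT) isT)|
  exact: (dL (@Ordinal 5 2 isT) isT)|exact: (dL (@Ordinal 5 3 isT) isT)|exact: HM].
Qed.

End Bridge.

(* The last two hypotheses are genericity conditions. The first one excludes
   the roots of unity for q^alpha_i as for q (it is automatic when alpha_i is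
   rational), so that a highest weight determines an irreducible module. The
   second one holds if dim L_(3,1,1) = dim L_(1,3,1) = dim L_(1,1,3) = 48: for
   instance, L_(3,1,1) is smaller when alpha_1 = alpha_2. *)
Theorem theorem5p3 (R : realType) (alpha : 'I_3 -> R[i]) (q logq : R[i])
    (alpha_neq0 : forall i, alpha i != 0)
    (alpha_neqN1 : forall i, alpha i != -1)
    (alpha_sum : \sum_i alpha i = 0)
    (q_neq0 : q != 0)
    (q_not_root : forall n : nat, (0 < n)%N -> q ^+ n != 1)
    (logqE : cexp logq = q)
    (qalpha_not_root : forall (i : 'I_3) (n : nat), (0 < n)%N ->
       qpow logq (alpha i) ^+ n != 1)
    (qalpha_distinct : forall i j : 'I_3, i != j ->
       qpow logq (2 * (alpha i - alpha j)) != 1) :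
  (forall a b c : nat,
     (a, b, c) \in [:: (1, 1, 1); (0, 0, 0); (3, 1, 1); (1, 3, 1); (1, 1, 3);
                       (2, 2, 2)]%N ->
     exists L : rep R[i], is_L alpha logq a b c L)
  /\
  forall L111 L000 L311 L131 L113 L222 Lt : rep R[i],
    is_L alpha logq 1 1 1 L111 ->
    is_L alpha logq 0 0 0 L000 ->
    is_L alpha logq 3 1 1 L311 ->
    is_L alpha logq 1 3 1 L131 ->
    is_L alpha logq 1 1 3 L113 ->
    is_L alpha logq 2 2 2 L222 ->
    (* the restriction of the module over the quantum affine superalgebra *)
    is_module alpha logq Lt -> Lt ≅ L111 ⊕ L000 ->
    [/\ [/\ rep_dim L111 = 17%N, rep_dim L000 = 1%N & rep_dim L222 = 110%N],
        [/\ rep_dim L311 = 48%N, rep_dim L131 = 48%N & rep_dim L113 = 48%N],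
        Lt ⊗ Lt ≅ (L111 ⊕ L000) ⊗ (L111 ⊕ L000),
        exists Wa : rep R[i],
          [/\ (L111 ⊕ L000) ⊗ (L111 ⊕ L000)
                ≅ Wa ⊕ L311 ⊕ L131 ⊕ L113
                     ⊕ (L111 ⊕ L111) ⊕ (L000 ⊕ L000),
              is_module alpha logq Wa /\ indecomposable Wa,
              rep_dim Wa = (17 + 110 + 17)%N /\ rep_dim Wa = 144%N,
              composition_series [:: L111; L222; L111] Wa &
              exists S : {vspace car Wa},
                [/\ is_socle S, submod S ≅ L111 &
                    exists S' : {vspace car (quomod S)},
                      is_socle S' /\ submod S' ≅ L222]] &
        dim_End (Lt ⊗ Lt) (4 + 2 ^ 2 + 2 ^ 2 + 3 + 2)
        /\ (4 + 2 ^ 2 + 2 ^ 2 + 3 + 2)%N = 17%N].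
Proof.
split.
  move=> a b c abc; exact (is_L_exists alpha_sum q_neq0 q_not_root logqE qalpha_not_root qalpha_distinct abc).
move=> L111 L000 L311 L131 L113 L222 Lt h111 h000 h311 h131 h113 h222 hLt isoLt.
have [d000 d311 d131 d113 [M [hM isoP homP]]] := square_structure alpha_sum q_neq0 q_not_root
  logqE qalpha_not_root qalpha_distinct h111 h000 h311 h131 h113 h222.
have dE (N : rep R[i]) n : dim (car N) = n -> rep_dim N = n by rewrite /rep_dim dimvf.
have isoT : Lt ⊗ Lt ≅ (L111 ⊕ L000) ⊗ (L111 ⊕ L000) by exact: iso_tensor.
split.
- by split; apply: dE => //; [exact: cs_dim1 hM|exact: cs_dim2 hM].
- by split; apply: dE.
- exact: isoT.
- exists M; split=> //.
  + by split; [apply/(is_moduleP alpha q_neq0 q_not_root logqE)/(cs_mod hM)|exact: cs_indec hM].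
  + by split; apply: dE; exact: cs_dim hM.
  + exact: cs_series hM.
  exact: cs_socle hM.
split=> //; apply/dim_EndP.
by rewrite (hom_dim_isol _ isoT) (hom_dim_isor _ isoT) homP.
Qed.
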